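(* Let $u_0\in W^{1,\infty}_{\rm loc}(\mathbb{R})$ and $u_1\in L^\infty_{\rm loc}(\mathbb{R})$. Assume that $u_0\ge 0$ and that $u_1\ge 0$ a.e. in $\{u_0=0\}$. Then there exists a unique solution $u\in L^\infty_{{\rm loc},t}((0,\infty);W^{1,\infty}_{{\rm loc},x}(\mathbb{R}))\cap W^{1,\infty}_{{\rm loc},t}((0,\infty);L^\infty_{{\rm loc},x}(\mathbb{R}))$ to $$\min\{\square u,u\}=0 \ \text{ in } \mathbb{R}\times[0,\infty),\qquad u(\cdot,0)=u_0 \ \text{ in }\mathbb{R},\qquad u_t(\cdot,0)=u_1\ \text{ a.e. in }\mathbb{R},$$ such that, in the sense of distributions, $$\frac{d}{dx}(-2u_xu_t)+\frac{d}{dt}(u_x^2+u_t^2)=0\quad\text{in }\mathbb{R}\times(0,\infty).$$ Moreover, if $u_0\in W^{1,\infty}(\mathbb{R})$ and $u_1\in L^\infty(\mathbb{R})$, then for a.e. $t\ge 0$ $$\|u_x(\cdot,t)-u_t(\cdot,t)\|_{L^\infty(\mathbb{R})}=\|u_x(\cdot,0)-u_t(\cdot,0)\|_{L^\infty(\mathbb{R})},$$ $$\|u_x(\cdot,t)+u_t(\cdot,t)\|_{L^\infty(\mathbb{R})}=\|u_x(\cdot,0)+u_t(\cdot,0)\|_{L^\infty(\mathbb{R})}.$$ In particular, for a.e. $t\ge 0$, $$\frac{1}{\sqrt2}\|\nabla_{x,t}u(\cdot,0)\|_{L^\infty(\mathbb{R})}\le\|\nabla_{x,t}u(\cdot,t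)\|_{L^\infty(\mathbb{R})}\le\sqrt2\,\|\nabla_{x,t}u(\cdot,0)\|_{L^\infty(\mathbb{R})}.$$
   Context: $\square u:=u_{tt}-u_{xx}$. The equation $\min\{\square u,u\}=0$ means: $u\ge 0$, $\square u\ge 0$ in the sense of distributions (so $\square u$ is a nonnegative measure), and $\square u=0$ in the open set $\{u>0\}$. The condition $u\in L^\infty_{{\rm loc},t}((0,\infty);W^{1,\infty}_{{\rm loc},x}(\mathbb{R}))\cap W^{1,\infty}_{{\rm loc},t}((0,\infty);L^\infty_{{\rm loc},x}(\mathbb{R}))$ means that for every compact $K\subset\mathbb{R}$ and every $T>0$ there is a constant $C(T,K)<\infty$ such that $\|u(\cdot,t)\|_{L^\infty(K)}+\|u_x(\cdot,t)\|_{L^\infty(K)}+\|u_t(\cdot,t)\|_{L^\infty(K)}\le C(T,K)$ for a.e. $t\in(0,T)$. At $t=0$ the derivatives are those of the initial data: $u_x(\cdot,0)=u_0'$, $u_t(\cdot,0)=u_1$. $\nabla_{x,t}u=(u_x,u_t)$, measured with the Euclidean norm. *)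

(* Defs.v *)
From HB Require Import structures.
From mathcomp Require Import all_boot all_order all_algebra.
From mathcomp Require Import all_classical all_reals all_analysis.

Set Implicit Arguments.
Unset Strict Implicit.
Unset Printing Implicit Defensive.

Import Order.TTheory GRing.Theory Num.Theory.
Import numFieldNormedType.Exports.

Local Open Scope classical_set_scope.
Local Open Scope ring_scope.

(* The point (x, t) is the pair p = (x, t): p.1 is space and p.2 is time. *)

Section Definitions.
Context {R : realType}.

Notation mu := (@lebesgue_measure R).
Notation mu2 := (@lebesgue_measure R \x @lebesgue_measure R)%E.

Definition Loo_norm (f : R -> R) : \bar R := 'N[mu]_(+oo%E)[EFin \o f]%E.

Definition Loo (f : R -> R) : Prop := f \in Lfun mu +oo%E.

Definition Loo_loc (f : R -> R) : Prop :=
  forall K : set R, compact K -> Loo (f \_ K).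

Definition test_fun1 (phi : R -> R) : Prop :=
  (forall (n : nat) (x : R), derivable (phi^`(n))%classic x 1) /\
  exists2 K : set R, compact K & forall x, ~ K x -> phi x = 0.

Definition weak_derivative (f g : R -> R) : Prop :=
  [/\ locally_integrable setT f, locally_integrable setT g &
    forall phi, test_fun1 phi ->
      \int[mu]_x (f x * (phi^`())%classic x) = - \int[mu]_x (g x * phi x)].

Definition W1oo (f : R -> R) : Prop :=
  Loo f /\ exists2 g, weak_derivative f g & Loo g.

(* A class of W^{1,oo}_loc is represented by its unique continuous
   representative, so that its pointwise values are meaningful. *)
Definition W1oo_loc (f : R -> R) : Prop :=
  [/\ continuous f, Loo_loc f & exists2 g, weak_derivative f g & Loo_loc g].

Definition half_plane : set (R * R) := [set p | 0 < p.2].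

Definition ex : R * R := (1, 0).
Definition et : R * R := (0, 1).

(* iterated partial derivatives: true stands for d/dt, false for d/dx *)
Definition partials (s : seq bool) (phi : R * R -> R) : R * R -> R :=
  foldr (fun (b : bool) (f : R * R -> R) => 'D_(if b then et else ex) f) phi s.

Definition test_fun (Omega : set (R * R)) (phi : R * R -> R) : Prop :=
  (forall (s : seq bool) (p : R * R), differentiable (partials s phi) p) /\
  exists K : set (R * R),
    [/\ compact K, K `<=` Omega & forall p, ~ K p -> phi p = 0].

Definition box (phi : R * R -> R) (p : R * R) : R :=
  'D_et ('D_et phi) p - 'D_ex ('D_ex phi) p.

Definition L1_loc_half (f : R * R -> R) : Prop :=
  measurable_fun half_plane f /\
  forall K : set (R * R), compact K -> K `<=` half_plane ->
    (\int[mu2]_(p in K) `|f p|%:E < +oo)%E.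

(* g is the distributional derivative of f in the direction v, in the open
   upper half-plane *)
Definition weak_partial (v : R * R) (f g : R * R -> R) : Prop :=
  [/\ L1_loc_half f, L1_loc_half g &
    forall phi, test_fun half_plane phi ->
      \int[mu2]_(p in half_plane) (f p * 'D_v phi p) =
      - \int[mu2]_(p in half_plane) (g p * phi p)].

Definition weak_gradient (u ux ut : R * R -> R) : Prop :=
  weak_partial ex u ux /\ weak_partial et u ut.

(* L^oo_loc,t W^{1,oo}_loc,x and W^{1,oo}_loc,t L^oo_loc,x; as for W1oo_loc,
   u is the representative that is continuous up to t = 0. Its values for
   t < 0 are irrelevant. *)
Definition energy_space (u : R * R -> R) : Prop :=
  {within [set p : R * R | 0 <= p.2], continuous u} /\
  exists ux ut : R * R -> R,
    weak_gradient u ux ut /\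
    forall (K : set R) (T : R), compact K -> 0 < T ->
      exists C : R, {ae mu, forall t : R, 0 < t < T ->
        (Loo_norm ((fun x => u (x, t)) \_ K) +
         Loo_norm ((fun x => ux (x, t)) \_ K) +
         Loo_norm ((fun x => ut (x, t)) \_ K) <= C%:E)%E}.

(* min {box u, u} = 0; the first argument of box is the test function since
   box is formally self-adjoint *)
Definition obstacle_equation (u : R * R -> R) : Prop :=
  [/\ forall p : R * R, 0 <= p.2 -> 0 <= u p,
      forall phi, test_fun half_plane phi -> (forall p, 0 <= phi p) ->
        0 <= \int[mu2]_(p in half_plane) (u p * box phi p) &
      forall phi, test_fun (half_plane `&` [set p | 0 < u p]) phi ->
        \int[mu2]_(p in half_plane) (u p * box phi p) = 0].

(* The initial velocity is the one-sided classical derivative in time. *)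
Definition initial_conditions (u0 u1 : R -> R) (u : R * R -> R) : Prop :=
  (forall x, u (x, 0) = u0 x) /\
  {ae mu, forall x : R,
    (u (x, h) - u (x, 0)) / h @[h --> 0^'+] --> u1 x}.

(* d/dx (-2 u_x u_t) + d/dt (u_x^2 + u_t^2) = 0 as a distribution *)
Definition energy_conservation (u : R * R -> R) : Prop :=
  forall ux ut, weak_gradient u ux ut ->
  forall phi, test_fun half_plane phi ->
    \int[mu2]_(p in half_plane)
      (- ((- 2 * ux p * ut p) * 'D_ex phi p) -
       (ux p ^+ 2 + ut p ^+ 2) * 'D_et phi p) = 0.

Definition conservative_solution (u0 u1 : R -> R) (u : R * R -> R) : Prop :=
  [/\ energy_space u, obstacle_equation u, initial_conditions u0 u1 u &
      energy_conservation u].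

End Definitions.

(* Main.v *)
(* In the characteristic coordinates a = x - t, b = x + t a solution becomes a
   locally Lipschitz function V a b, its initial position is g x - f x and the
   free wave with the same data is g a - f b.  That box u is a nonnegative
   measure carried by {u = 0} becomes an inequality between the values of V at
   the corners of a rectangle, with equality if V > 0 on the rectangle, and the
   energy law becomes the additivity of [ene V a b], the integral of the squared
   slopes of V along the two characteristics from the diagonal to (a, b).

   Existence.  Let M a b be the largest profit of a trader who may repeatedly
   buy one unit at price g and sell it at price f during [a, b].  Then
   V a b = g a - f b + 2 * M a b is a solution: exchanging the tails of two
   schedules gives the rectangle inequality, and the slope of V in a is g' or
   - g', that in b is f' or - f', according to whether the optimal trader acts
   at once.  So u_x - u_t and u_x + u_t are, up to sign, transported along
   characteristics, whence the energy law and the equalities of norms.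

   Uniqueness.  Outside the domain of influence of the set where the free wave
   is negative, the obstacle condition bounds the squared slopes of V on one
   side by those of the data; the energies being equal, so are the slopes, and V
   is the free wave.  On the boundary of that domain two solutions carry the
   same momentum and the same energy.  Where u > 0 their difference is locally
   constant along the boundary; where u = 0 the signs of the outgoing slopes are
   known and, as in an elastic collision, both conservation laws together admit
   only one reflection.

   The two formulations are exchanged by testing with products of one-variable
   mollifiers in characteristic coordinates. *)
Require Import Defs.
From HB Require Import structures.
From mathcomp Require Import all_boot all_order all_algebra.
From mathcomp Require Import all_classical all_reals all_analysis.
From mathcomp Require Import measurable_realfun.
From mathcomp Require Import lra ring.

Set Implicit Arguments.
Unset Strict Implicit.
Unset Printing Implicit Defensive.

Import Order.TTheory GRing.Theory Num.Theory.
Import numFieldNormedType.Exports.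

Local Open Scope classical_set_scope.
Local Open Scope ring_scope.

(** * Locally Lipschitz functions *)

(* [lra] inspects every hypothesis, and those which are quantified or mention
   derivatives are expensive to inspect. *)
Ltac linarith := first
  [ repeat match goal with x := _ |- _ => clearbody x end;
    repeat match goal with
      | H : forall x, @?P x |- _ => lazymatch type of H with
        | forall x, is_true (_ <= _) => fail | _ => clear H end
      | H : derivable _ _ _ |- _ => clear H
      | H : ?A |- _ => lazymatch A with
        | is_true (_ <= _) => idtac | is_true (_ < _) => idtac | _ = _ => idtac end;
        lazymatch A with context [@derive1] => clear H end
      end;
    lra
  | lra ].

Section LipschitzFunctions.
Context {R : realType}.
Notation mu := (@lebesgue_measure R).

(** The obstacle is low regularity: slopes exist only almost everywhere, and the curves that matter
    may run along characteristics. Derivatives are therefore read through [dq], a total measurable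
    function, and each rigidity statement is reduced to a Lipschitz function of one variable whose
    derivative vanishes almost everywhere.

    The initial velocity enters only through [geo_init]: the excess over the free wave at the apex
    of the characteristic triangle over [x - h, x + h] is o(h) for almost every x. As the excess is
    superadditive, it is then nonnegative and monotone, and every additive function of intervals
    that it dominates vanishes; this identifies the energy of a solution with that of its data.

    Along the boundary of the domain of influence, a null set of bad slopes may be met on a
    parameter set of positive measure, but there the corresponding characteristic coordinate has
    derivative zero ([loclip_comp_null]), so no information is lost.

    The condition on u1 where u0 = 0 becomes g' <= 0 at points with g = f; it makes trading near
    such points negligible to first order. *)

Definition loclip (f : R -> R) := forall N : R,
  exists2 L : R, 0 <= L &
    forall x y : R, `|x| <= N -> `|y| <= N -> `|f x - f y| <= L * `|x - y|.

Lemma ae_imp (P Q : R -> Prop) : (forall x, P x -> Q x) ->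
  {ae mu, forall x, P x} -> {ae mu, forall x, Q x}.
Proof.
move=> PQ [A [mA A0 PA]]; exists A; split => //.
by apply: subset_trans PA; apply: subsetC => x; exact: PQ.
Qed.

Lemma ae_and (P Q : R -> Prop) : {ae mu, forall x, P x} ->
  {ae mu, forall x, Q x} -> {ae mu, forall x, P x /\ Q x}.
Proof.
move=> hP hQ; have := negligibleU hP hQ; apply: negligibleS => x /=.
by move=> /not_andP.
Qed.

Lemma ae_forall_nat (P : nat -> R -> Prop) : (forall n, {ae mu, forall x, P n x}) ->
  {ae mu, forall x, forall n, P n x}.
Proof.
move=> hP; have := negligible_bigcup hP; apply: negligibleS => x /= /existsNP[n hn].
by exists n.
Qed.

(** Lebesgue measure is an infimum over countable covers by half-open intervals, so a bound on such
    intervals passes to null sets. This one principle yields the absolute continuity of Stieltjes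
    measures, the invariance of null sets under reflection, and [loclip_comp_null]. *)
Lemma null_of_itv_le (nu : {measure set (measurableTypeR R) -> \bar R}) (C : R) :
  0 <= C ->
  (forall a b, a <= b -> (nu `]a, b]%classic <= (C * (b - a))%:E)%E) ->
  forall N, measurable N -> mu N = 0%E -> nu N = 0%E.
Proof.
move=> C0 nuC N mN N0; apply/eqP; rewrite eq_le measure_ge0 andbT.
apply/lee_addgt0Pr => e e0; rewrite add0e.
have d0 : 0 < e / (C + 1) by rewrite divr_gt0// ltr_wpDl.
have : (mu N < (e / (C + 1))%:E)%E by rewrite N0 lte_fin.
move=> /ereal_inf_lt[z [/= F [mF NF] <-] zlt].
have nuF k : (nu (F k) <= C%:E * wlength idfun (F k))%E.
  have /ocitvP[->|[[a b] /= ab ->]] := (mF k).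
    by rewrite measure0 wlength0 mule0.
  rewrite wlength_itv/= lte_fin ab -EFinD -EFinM; exact/nuC/ltW.
have mF' k : measurable (F k : set (measurableTypeR R)).
  by apply: sub_sigma_algebra; exact: mF.
apply: (@le_trans _ _ (\sum_(0 <= k <oo) nu (F k))%E).
  by apply: measure_sigma_subadditive => //; case: mF.
apply: (@le_trans _ _ (\sum_(0 <= k <oo) (C%:E * wlength idfun (F k)))%E).
  by apply: lee_nneseries => k _ //; exact: nuF.
rewrite nneseriesZl//.
apply: (@le_trans _ _ (C%:E * (e / (C + 1))%:E)%E).
  by apply: lee_wpmul2l; [rewrite lee_fin|exact: ltW].
rewrite -EFinM lee_fin mulrCA ger_pMr// ler_pdivrMr ?ltr_wpDl// mul1r.
by rewrite lerDl.
Qed.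

(** Adding L * x makes F nondecreasing. The Lebesgue-Stieltjes measure it then generates is
    absolutely continuous because F is Lipschitz, and k is its Radon-Nikodym density minus L. *)
Lemma glip_density (F : R -> R) (L N : R) : 0 <= L -> 0 <= N ->
  (forall x y : R, `|F x - F y| <= L * `|x - y|) ->
  exists2 k : R -> R, mu.-integrable `[- N, N] (EFin \o k) &
    forall a b : R, - N <= a -> a <= b -> b <= N ->
      F b - F a = \int[mu]_(t in `[a, b]) k t.
Proof.
move=> L0 N0 FL.
pose psi x := F x + L * x.
have ndpsi : {homo psi : x y / x <= y}.
  move=> x y xy; rewrite /psi -subr_ge0.
  have := FL x y; rewrite (ler0_norm (x := x - y)) ?subr_le0// => h.
  have := le_trans (ler_norm _) h; linarith.
have cF : continuous F.
  move=> x; apply/cvgrPdist_le => /= e e0.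
  have L1 : 0 < L + 1 by rewrite ltr_wpDl.
  near=> t.
  apply: (le_trans (FL x t)).
  apply: (@le_trans _ _ ((L + 1) * `|x - t|)).
    by rewrite ler_wpM2r// lerDl.
  rewrite -ler_pdivlMl//; near: t.
  apply: cvgr_dist_le; first exact: cvg_id.
  by rewrite mulr_gt0// invr_gt0.
have cpsi : continuous psi.
  move=> x; apply: cvgD; [exact: cF|apply: cvgM; [exact: cvg_cst|exact: cvg_id]].
pose Cu := isCumulative.Build R _ R psi ndpsi (right_continuousW cpsi).
pose psiC : cumulative R R := HB.pack psi Cu.
pose ls : {measure set (measurableTypeR R) -> \bar R} :=
  lebesgue_stieltjes_measure psiC.
have lsE a b : a <= b -> ls `]a, b]%classic = (psi b - psi a)%:E.
  move=> ab; rewrite /ls /= /lebesgue_stieltjes_measure /measure_extension.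
  transitivity (wlength psiC `]a, b]%classic).
    by apply: measurable_mu_extE; exact: is_ocitv.
  by rewrite wlength_itv_bnd.
have mD : measurable (`]- N, N]%classic : set (measurableTypeR R)).
  by apply: sub_sigma_algebra; exact: is_ocitv.
have NN : - N <= N by rewrite (le_trans _ N0)// oppr_le0.
have Dfin : (ls `](- N)%R, N]%classic < +oo)%E by rewrite lsE// ltry.
pose nu : {finite_measure set (measurableTypeR R) -> \bar R} := mfrestr mD Dfin.
have psiL a b : a <= b -> psi b - psi a <= (L + L) * (b - a).
  move=> ab; have := le_trans (ler_norm _) (FL b a).
  by rewrite ger0_norm ?subr_ge0// /psi; linarith.
have numu : nu `<< mu.
  apply/null_content_dominatesP => N' mN' N'0.
  have L2 : 0 <= L + L by rewrite addr_ge0.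
  apply: (@null_of_itv_le nu (L + L) L2) => // a b ab.
  apply: (@le_trans _ _ (ls `]a, b]%classic)).
    rewrite /nu /= /mfrestr /mrestr; apply: le_measure; rewrite ?inE//.
    by apply: measurableI => //; apply: sub_sigma_algebra; exact: is_ocitv.
  by rewrite lsE// lee_fin psiL.
pose h := Radon_Nikodym_SigmaFinite.f nu mu.
have hint := Radon_Nikodym_SigmaFinite.f_integrable numu.
have hE := Radon_Nikodym_SigmaFinite.f_integral numu.
have hfin := Radon_Nikodym_SigmaFinite.f_fin_num numu.
have mI : measurable (`[- N, N]%classic : set (measurableTypeR R)).
  exact: measurable_itv.
have fkE : EFin \o (fine \o h) = h.
  by apply/funext => x /=; rewrite fineK ?hfin.
have cint a b : mu.-integrable `[a, b] (EFin \o cst L).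
  apply: continuous_compact_integrable; first exact: segment_compact.
  by apply: continuous_subspaceT => x; exact: cvg_cst.
have hintS a b : mu.-integrable `[a, b] h.
  exact: integrableS hint.
exists (fun x => fine (h x) - L).
  rewrite (_ : EFin \o _ = (h \- (EFin \o cst L))%E).
    by apply: integrableB.
  by apply/funext => x /=; rewrite EFinB fineK.
move=> a b Na ab bN.
have ih : mu.-integrable `[a, b] (EFin \o (fun x => fine (h x))).
  by move: (hintS a b); rewrite -{1}fkE.
rewrite RintegralB//.
rewrite Rintegral_cst//= lebesgue_measure_itv/=.
have -> : \int[mu]_(x in `[a, b]) fine (h x) = psi b - psi a.
  rewrite /Rintegral; under eq_integral do rewrite fineK//.
  rewrite -integral_itv_obnd_cbnd; last first.
    exact: measurable_funS (measurable_int _ hint).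
  rewrite -hE//= /mfrestr /mrestr.
  rewrite (_ : _ `&` _ = `]a, b]%classic) ?lsE//.
  apply/seteqP; split => [x []//|x /= xab]; split => //.
  by move: xab; rewrite /= !in_itv/= => /andP[ax xb]; apply/andP; split; linarith.
rewrite lte_fin; case: ltP => [ab'|ba] /=; first by rewrite /psi; linarith.
have -> : a = b by apply/eqP; rewrite eq_le ab.
by rewrite /psi; linarith.
Unshelve. all: by end_near. Qed.

(** A limit superior along 1 / n.+1 needs no choice of representative: for locally Lipschitz f it is
    measurable, locally bounded and meaningful at every point, and it is the derivative wherever
    that exists. *)
Definition dq (f : R -> R) (x : R) : R :=
  limn_sup (fun n => n.+1%:R * (f (x + n.+1%:R^-1) - f x)).

Lemma cvg_dq f x l : (fun n => n.+1%:R * (f (x + n.+1%:R^-1) - f x)) @ \oo --> l ->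
  dq f x = l.
Proof. by move=> fl; apply/cvg_lim => //; exact: cvg_sups. Qed.

Lemma derive_dq (f : R -> R) (x : R) : derivable f x 1 -> dq f x = f^`()%classic x.
Proof.
move=> df; apply: cvg_dq.
have dcv : (fun n => n.+1%:R^-1 : R) @ \oo --> 0^'.
  move=> A [e /= e0 eA].
  have := near_infty_natSinv_lt (PosNum e0); apply: filterS => n /= ne.
  by apply: eA => //=; rewrite ?invr_neq0// sub0r normrN ger0_norm.
rewrite derive1E (_ : (fun n => _) =
    (fun h : R => h^-1 *: ((f \o shift x) (h *: 1) - f x)) \o
     (fun n : nat => n.+1%:R^-1)); first exact: cvg_comp dcv df.
by rewrite funeqE => n /=; rewrite invrK /GRing.scale/= mulr1 (addrC x).
Qed.

Lemma loclip_continuous f : loclip f -> continuous f.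
Proof.
move=> lf x; have [L L0 fL] := lf (`|x| + 1).
apply/cvgrPdist_le => /= e e0.
have L1 : 0 < L + 1 by rewrite ltr_wpDl.
near=> t.
apply: (le_trans (fL x t _ _)).
- by rewrite lerDl.
- have : `|x - t| <= 1 by near: t; apply: cvgr_dist_le; [exact: cvg_id|].
  by move: (ler_distD x t 0); rewrite !subr0 distrC; linarith.
apply: (@le_trans _ _ ((L + 1) * `|x - t|)); first by rewrite ler_wpM2r// lerDl.
rewrite -ler_pdivlMl//; near: t.
apply: cvgr_dist_le; first exact: cvg_id.
by rewrite mulr_gt0// invr_gt0.
Unshelve. all: by end_near. Qed.

(** Precomposing with the projection onto [- N, N] turns the local Lipschitz constant into a global
    one, as [glip_density] requires. *)
Lemma loclip_clamp (f : R -> R) (N : R) : loclip f -> 0 <= N -> exists2 L : R, 0 <= L &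
  forall x y : R, `|f (Num.max (- N) (Num.min x N)) - f (Num.max (- N) (Num.min y N))|
    <= L * `|x - y|.
Proof.
move=> lf N0; have [L L0 fL] := lf N; exists L => // x y.
have cl (z : R) : `|Num.max (- N) (Num.min z N)| <= N.
  by rewrite ler_norml le_max lexx/= ge_max ge_min lexx orbT andbT; linarith.
apply: (le_trans (fL _ _ (cl x) (cl y))); rewrite ler_wpM2l//.
have := ler_norm (x - y); have := ler_norm (y - x); rewrite (distrC y x).
rewrite ler_norml /Num.max /Num.min => h1 h2.
case: (ltP x N) => ?; case: (ltP y N) => ?; case: ltP => ?; case: ltP => ?.
all: linarith.
Qed.

Lemma loclip_density (f : R -> R) (N : R) : loclip f -> 0 <= N ->
  exists2 k : R -> R, mu.-integrable `[- N, N] (EFin \o k) &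
    forall a b : R, - N <= a -> a <= b -> b <= N ->
      f b - f a = \int[mu]_(t in `[a, b]) k t.
Proof.
move=> lf N0; have [L L0 fL] := loclip_clamp lf N0.
have [k ik kE] := glip_density L0 N0 fL.
exists k => // a b Na ab bN; rewrite -kE//.
by rewrite !max_r ?min_l//; linarith.
Qed.

Lemma density_derivable (f k : R -> R) (N x : R) :
  mu.-integrable `[- N, N] (EFin \o k) ->
  (forall a b : R, - N <= a -> a <= b -> b <= N ->
      f b - f a = \int[mu]_(t in `[a, b]) k t) ->
  - N < x -> x < N -> lebesgue_pt (k \_ `[- N, N]) x ->
  derivable f x 1 /\ f^`()%classic x = k x.
Proof.
move=> ik kE Nx xN; set k0 : R -> R := k \_ _ => k0x.
have ik0 : mu.-integrable `[- N, N] (EFin \o k0).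
  move: ik; rewrite integrable_mkcond//= restrict_EFin => ik'.
  exact: (integrableS measurableT _ _ ik').
have Nbx : ((BLeft (- N)%R : itv_bound R) < (BRight x : itv_bound R))%E by rewrite lte_fin.
have kx : k0 x = k x by rewrite /k0 patchE mem_set//= in_itv/= (ltW Nx) (ltW xN).
have [] := @FTC1_lebesgue_pt R k0 (BLeft (- N)) x N xN ik0 Nbx k0x.
rewrite kx; set F : R -> R := (fun y => _) => dF dFE.
pose c : R -> R := cst (f (- N)).
have dc : derivable c x 1 by exact: derivable_cst.
have nF : {near x, F + c =1 f}.
  near=> y.
  have /andP[Ny1 Ny2] : - N <= y <= N.
    by apply/andP; split; near: y; [exact: lt_le_nbhsr|exact: lt_le_nbhsl].
  rewrite /c /F fctE /cst.
  transitivity (\int[mu]_(t in `[- N, y]) k t + f (- N)); last first.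
    by rewrite -kE//; ring.
  congr (_ + _); apply: eq_Rintegral => z; rewrite inE /= in_itv/= => /andP[z1 z2].
  by rewrite /k0 patchE mem_set//= in_itv/= z1 (le_trans z2).
split.
  exact: (near_eq_derivable nF (@derivableD _ _ _ F c x 1 dF dc)).
rewrite derive1E -(near_eq_derive _ nF) ?oner_eq0//.
by rewrite (@deriveD _ _ _ F c x 1 dF dc) derive_cst addr0 -derive1E.
Unshelve. all: by end_near. Qed.

Lemma loclip_derivable_itv (f : R -> R) (N : R) : loclip f -> 0 < N ->
  {ae mu, forall x, - N < x < N -> derivable f x 1}.
Proof.
move=> lf N0; have [k ik kE] := loclip_density lf (ltW N0).
have lk0 : locally_integrable setT (k \_ `[- N, N]) by apply: integrable_locally.
have := lebesgue_differentiation lk0.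
apply: ae_imp => x k0x /andP[Nx xN].
by have [] := density_derivable ik kE Nx xN k0x.
Qed.

Lemma loclip_derivable f : loclip f -> {ae mu, forall x : R, derivable f x 1}.
Proof.
move=> lf.
have h n : {ae mu, forall x : R, - n.+1%:R < x < n.+1%:R -> derivable f x 1}.
  exact: loclip_derivable_itv.
apply: ae_imp (ae_forall_nat h) => x /(_ (Num.bound x)); apply.
rewrite -ltr_norml (lt_le_trans (unstable.ltr_norm_bound x))// ler_nat.
exact: leqnSn.
Qed.

Lemma measurable_dq (f : R -> R) : loclip f -> measurable_fun setT (dq f).
Proof.
move=> lf.
have bd (t : R) : exists C : R, forall n, `|n.+1%:R * (f (t + n.+1%:R^-1) - f t)| <= C.
  have [L L0 fL] := lf (`|t| + 1); exists L => n.
  rewrite normrM ger0_norm// -ler_pdivlMl// mulrC.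
  apply: le_trans (fL _ _ _ _) _.
  - rewrite (le_trans (ler_normD _ _))// lerD2l ger0_norm// invf_le1//.
    by rewrite ler1n.
  - by rewrite lerDl.
  - by rewrite addrAC subrr add0r ger0_norm.
apply: measurable_fun_limn_sup => [t _|t _|n].
- by have [C hC] := bd t; exists C => _ [n _ <-]; exact: le_trans (ler_norm _) (hC n).
- have [C hC] := bd t; exists (- C) => _ [n _ <-].
  by have := hC n; rewrite ler_norml => /andP[].
- apply: measurable_funM => //; apply: measurable_funB; last first.
    exact: continuous_measurable_fun (loclip_continuous lf).
  apply: continuous_measurable_fun => x; apply: continuous_comp.
    by apply: cvgD; [exact: cvg_id|exact: cvg_cst].
  exact: (loclip_continuous lf).
Qed.

Lemma dq_le (f : R -> R) (t L : R) :
  (forall n, `|n.+1%:R * (f (t + n.+1%:R^-1) - f t)| <= L) -> `|dq f t| <= L.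
Proof.
move=> hL; set u := (fun n => n.+1%:R * (f (t + n.+1%:R^-1) - f t)) in hL *.
have ub : has_ubound (range u).
  by exists L => _ [n _ <-]; exact: le_trans (ler_norm _) (hL n).
have lb : has_lbound (range u).
  by exists (- L) => _ [n _ <-]; have := hL n; rewrite ler_norml => /andP[].
rewrite /dq -/u; have /cvg_lim := cvg_sups_inf ub lb.
move=> /(_ (@Rhausdorff _)); rewrite -[lim _]/(limn_sup u) => ->.
have sL n : - L <= sups u n <= L.
  apply/andP; split.
    apply: (@le_trans _ _ (u n)).
      by have := hL n; rewrite ler_norml => /andP[].
    by apply: ub_le_sup; [exact: has_ubound_sdrop|exists n => /=].
  apply: ge_sup; first by exists (u n), n => /=.
  by move=> _ [m _ <-]; exact: le_trans (ler_norm _) (hL m).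
rewrite ler_norml; apply/andP; split.
  apply: lb_le_inf; first by exists (sups u 0%N), 0%N.
  by move=> _ [m _ <-]; case/andP: (sL m).
apply: (@le_trans _ _ (sups u 0%N)); last by case/andP: (sL 0%N).
apply: ge_inf; last by exists 0%N.
by exists (- L) => _ [m _ <-]; case/andP: (sL m).
Qed.

Lemma loclip_dq_le (f : R -> R) (L N t : R) :
  (forall x y : R, `|x| <= N + 1 -> `|y| <= N + 1 -> `|f x - f y| <= L * `|x - y|) ->
  `|t| <= N -> `|dq f t| <= L.
Proof.
move=> fL tN; apply: dq_le => n.
rewrite normrM ger0_norm// -ler_pdivlMl// mulrC.
apply: le_trans (fL _ _ _ _) _.
- rewrite (le_trans (ler_normD _ _))// lerD//.
  by rewrite ger0_norm// invf_le1// ler1n.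
- by rewrite (le_trans tN)// lerDl.
- by rewrite addrAC subrr add0r ger0_norm.
Qed.

(** By Lebesgue differentiation the density of f coincides almost everywhere with [dq f]. *)
Lemma loclip_FTC (f : R -> R) (a b : R) : loclip f -> a <= b ->
  \int[mu]_(t in `[a, b]) dq f t = f b - f a.
Proof.
move=> lf ab.
pose N : R := Num.max `|a| `|b| + 1.
have aN : `|a| < N by rewrite ltr_pwDr// le_max lexx.
have bN : `|b| < N by rewrite ltr_pwDr// le_max lexx orbT.
have N0 : 0 < N by rewrite (le_lt_trans _ aN).
have [k ik kE] := loclip_density lf (ltW N0).
move: aN bN; rewrite !ltr_norml => /andP[Na aN] /andP[Nb bN].
rewrite kE; [|exact: ltW|by []|exact: ltW].
have dk : {ae mu, forall x : R, `[a, b]%classic x -> (dq f x)%:E = (k x)%:E}.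
  have lk0 : locally_integrable setT (k \_ `[- N, N]) by apply: integrable_locally.
  have := ae_and (lebesgue_differentiation lk0) (loclip_derivable lf).
  apply: ae_imp => x [k0x dfx] /=; rewrite in_itv/= => /andP[ax xb].
  have Nx : - N < x by linarith.
  have xN : x < N by linarith.
  have [_ dfE] := density_derivable ik kE Nx xN k0x.
  by rewrite derive_dq// dfE.
rewrite /Rintegral; congr fine; apply: ae_eq_integral => //.
- by apply/measurable_EFinP; apply: measurable_funTS; exact: measurable_dq.
- have /integrableP[+ _] := ik; apply: measurable_funS => // x /=.
  by rewrite !in_itv/= => /andP[? ?]; apply/andP; split; linarith.
Unshelve. all: by end_near. Qed.

Lemma loclip_integrable_dq (f : R -> R) (a b : R) : loclip f ->
  mu.-integrable `[a, b] (EFin \o dq f).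
Proof.
move=> lf.
pose N : R := Num.max `|a| `|b|.
have [L L0 fL] := lf (N + 1).
apply: measurable_bounded_integrable => //.
- by apply: compact_finite_measure; exact: segment_compact.
- by apply: measurable_funTS; exact: measurable_dq.
- exists L; split; first exact: num_real.
  move=> M LM t /=; rewrite in_itv/= => /andP[at_ tb].
  apply: (le_trans _ (ltW LM)); apply: (loclip_dq_le fL).
  rewrite ler_norml /N le_max lerNl le_max.
  by have := ler_norm b; have := ler_norm (- a); rewrite normrN; linarith.
Qed.

Lemma ae_mem_itv (P : R -> Prop) (a b : R) :
  {ae mu, forall x, a < x < b -> P x} ->
  {ae mu, forall x, `[a, b]%classic x -> P x}.
Proof.
move=> h.
have : {ae mu, forall x, x <> a /\ x <> b}.
  exists [set a; b]; split.
  - by apply: measurableU.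
  - apply: countable_lebesgue_measure0; apply: finite_set_countable.
    by rewrite finite_setU; split; exact: finite_set1.
  - by move=> x /= /not_andP[] /contrapT ->; [left|right].
move=> /(ae_and h); apply: ae_imp => x [hx [xa xb]] /=.
rewrite in_itv/= => /andP[ax xb']; apply: hx.
rewrite !lt_neqAle ax xb'/= !andbT; apply/andP; split; apply/eqP => // E.
by apply: xa.
Qed.

(** The sign is asked only at points of differentiability, which is where it can be computed; these
    are almost all points, so it determines the integral of [dq f]. *)
Lemma loclip_ndecr (f : R -> R) (a b : R) : loclip f -> a <= b ->
  {ae mu, forall x, a < x < b -> derivable f x 1 -> 0 <= f^`()%classic x} ->
  f a <= f b.
Proof.
move=> lf ab h; rewrite -subr_ge0 -(loclip_FTC lf ab).
rewrite /Rintegral fine_ge0//.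
have dq0 : {ae mu, forall x, `[a, b]%classic x -> 0 <= dq f x}.
  apply: ae_mem_itv; move: (ae_and h (loclip_derivable lf)).
  by apply: ae_imp => x [h1 h2] xab; rewrite derive_dq//; exact: h1.
have -> : (\int[mu]_(x in `[a, b]) (dq f x)%:E =
    \int[mu]_(x in `[a, b]) `|dq f x|%:E)%E; last first.
  by apply: integral_ge0 => x _; rewrite lee_fin.
apply: ae_eq_integral => //.
- by have /integrableP[] := loclip_integrable_dq a b lf.
- apply/measurable_EFinP; apply: measurableT_comp => //.
  by apply: measurable_funTS; exact: measurable_dq.
- by apply: ae_imp dq0 => x h' xab; rewrite ger0_norm ?h'.
Qed.

Lemma loclipN (f : R -> R) : loclip f -> loclip (fun x => - f x).
Proof.
move=> lf N; have [L L0 fL] := lf N; exists L => // x y xN yN.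
by rewrite -opprD normrN fL.
Qed.

Lemma loclipD (f g : R -> R) : loclip f -> loclip g -> loclip (fun x => f x + g x).
Proof.
move=> lf lg N; have [L L0 fL] := lf N; have [K K0 gK] := lg N.
exists (L + K) => [|x y xN yN]; first exact: addr_ge0.
rewrite opprD addrACA mulrDl (le_trans (ler_normD _ _))// lerD//.
  exact: fL.
exact: gK.
Qed.

Lemma loclip_eq (f : R -> R) (a b : R) : loclip f -> a <= b ->
  {ae mu, forall x, a < x < b -> derivable f x 1 -> f^`()%classic x = 0} ->
  f a = f b.
Proof.
move=> lf ab h; apply/eqP; rewrite eq_le; apply/andP; split.
  by apply: loclip_ndecr => //; apply: ae_imp h => x h1 h2 h3; rewrite h1.
rewrite -lerN2; apply: (loclip_ndecr (loclipN lf) ab).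
apply: ae_imp h => x h1 h2 h3.
have dfx : derivable f x 1.
  by rewrite (_ : f = - (fun x => - f x)); [exact: derivableN|apply/funext => y /=; rewrite opprK].
by rewrite (_ : (fun x => _) = - f)// derive1N// h1 ?oppr0.
Qed.

End LipschitzFunctions.

(** * Quotients, integrals of squared slopes and null sets on the line *)

Section OneDimensionalTools.
Context {R : realType}.
Notation mu := (@lebesgue_measure R).

Lemma cvg_natSinv : (fun n => n.+1%:R^-1 : R) @ \oo --> 0^'.
Proof.
move=> A [e /= e0 eA].
have := near_infty_natSinv_lt (PosNum e0); apply: filterS => n /= ne.
by apply: eA => //=; rewrite ?invr_neq0// sub0r normrN ger0_norm.
Qed.

Lemma derive_seqr (f : R -> R) (x : R) : derivable f x 1 ->
  (fun n => n.+1%:R * (f (x + n.+1%:R^-1) - f x)) @ \oo --> f^`()%classic x.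
Proof.
move=> df; rewrite derive1E (_ : (fun n => _) =
    (fun h : R => h^-1 *: ((f \o shift x) (h *: 1) - f x)) \o
     (fun n : nat => n.+1%:R^-1)); first exact: cvg_comp cvg_natSinv df.
by rewrite funeqE => n /=; rewrite invrK /GRing.scale/= mulr1 (addrC x).
Qed.

Lemma derive_seql (f : R -> R) (x : R) : derivable f x 1 ->
  (fun n => n.+1%:R * (f x - f (x - n.+1%:R^-1))) @ \oo --> f^`()%classic x.
Proof.
move=> df; have cN : (fun n => - n.+1%:R^-1 : R) @ \oo --> 0^'.
  move=> A [e /= e0 eA].
  have := near_infty_natSinv_lt (PosNum e0); apply: filterS => n /= ne.
  by apply: eA => //=; rewrite ?oppr_eq0 ?invr_neq0// sub0r !normrN ger0_norm.
rewrite derive1E (_ : (fun n => _) =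
    (fun h : R => h^-1 *: ((f \o shift x) (h *: 1) - f x)) \o
     (fun n : nat => - n.+1%:R^-1)); first exact: cvg_comp cN df.
rewrite funeqE => n /=; rewrite invrN invrK /GRing.scale/= mulr1 (addrC _ x).
by rewrite mulNr -mulrN opprB.
Qed.

Lemma seq_ge0 (u : nat -> R) (l d : R) : u @ \oo --> l -> 0 < d ->
  (forall n, n.+1%:R^-1 < d -> 0 <= u n) -> 0 <= l.
Proof.
move=> ul d0 h; apply: (cvgr_to_ge ul).
by have := near_infty_natSinv_lt (PosNum d0); apply: filterS => n /= /h.
Qed.

(** Increments on one side suffice once the derivative is known to exist. Often no more is
    available, as for the outgoing slopes at a contact point. *)
Lemma derive_ge0_r (f : R -> R) (x d : R) : derivable f x 1 -> 0 < d ->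
  (forall h, 0 < h -> h < d -> f x <= f (x + h)) -> 0 <= f^`()%classic x.
Proof.
move=> df d0 hf; apply: (seq_ge0 (derive_seqr df) d0) => n nd.
by rewrite mulr_ge0// subr_ge0 hf.
Qed.

Lemma derive_ge0_l (f : R -> R) (x d : R) : derivable f x 1 -> 0 < d ->
  (forall h, 0 < h -> h < d -> f (x - h) <= f x) -> 0 <= f^`()%classic x.
Proof.
move=> df d0 hf; apply: (seq_ge0 (derive_seql df) d0) => n nd.
by rewrite mulr_ge0// subr_ge0 hf.
Qed.

Lemma derive_le0_r (f : R -> R) (x d : R) : derivable f x 1 -> 0 < d ->
  (forall h, 0 < h -> h < d -> f (x + h) <= f x) -> f^`()%classic x <= 0.
Proof.
move=> df d0 hf; rewrite -oppr_ge0; apply: (seq_ge0 (cvgN (derive_seqr df)) d0) => n nd.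
by rewrite oppr_ge0 mulr_ge0_le0// subr_le0 hf.
Qed.

Lemma derive_le0_l (f : R -> R) (x d : R) : derivable f x 1 -> 0 < d ->
  (forall h, 0 < h -> h < d -> f x <= f (x - h)) -> f^`()%classic x <= 0.
Proof.
move=> df d0 hf; rewrite -oppr_ge0; apply: (seq_ge0 (cvgN (derive_seql df)) d0) => n nd.
by rewrite oppr_ge0 mulr_ge0_le0// subr_le0 hf.
Qed.

Lemma derive1_sub (f g : R -> R) (x : R) : derivable f x 1 -> derivable g x 1 ->
  derivable (fun y => f y - g y) x 1 /\
  (fun y => f y - g y)^`()%classic x = f^`()%classic x - g^`()%classic x.
Proof.
move=> df dg.
have dN : derivable (- g) x 1 by exact: derivableN.
have -> : (fun y => f y - g y) = f + - g by [].
split.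
  exact: (@derivableD _ _ _ f (- g) x 1 df dN).
by rewrite !derive1E (@deriveD _ _ _ f (- g) x 1 df dN) (@deriveN _ _ _ g x 1 dg).
Qed.

Lemma ae_opp (P : R -> Prop) : {ae mu, forall x, P x} -> {ae mu, forall x, P (- x)}.
Proof.
move=> [A [mA A0 PA]].
have mopp : measurable_fun setT (-%R : R -> R).
  by apply: continuous_measurable_fun => x; exact: continuousN.
have mopp' : measurable_fun (setT : set (measurableTypeR R))
  (-%R : measurableTypeR R -> measurableTypeR R) := mopp.
pose nu0 : {measure set (measurableTypeR R) -> \bar R} :=
  pushforward mu (-%R : measurableTypeR R -> measurableTypeR R).
pose nu : {measure set (measurableTypeR R) -> \bar R} := nu0 mopp'.
have nuI a b : a <= b -> (nu `]a, b]%classic <= (1 * (b - a))%:E)%E.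
  move=> ab; rewrite /nu/= /pushforward.
  rewrite (_ : _ @^-1` _ = `[- b, - a[%classic); last first.
    by apply/seteqP; split => x /=; rewrite !in_itv/= => /andP[h1 h2]; apply/andP; linarith.
  rewrite /= lebesgue_measure_itv/=; case: ifP => _; last by rewrite lee_fin; linarith.
  by rewrite -EFinD lee_fin; linarith.
have nuA : nu A = 0%E by apply: (null_of_itv_le _ nuI).
exists (-%R @^-1` A); split.
- by rewrite -[X in measurable X]setTI; exact: mopp.
- exact: nuA.
- by move=> x /= hx; apply: PA => /= h; apply: hx.
Qed.

Lemma ndecr_dq_ge0 (A : R -> R) (x : R) : loclip A -> {homo A : x y / x <= y} ->
  0 <= dq A x.
Proof.
move=> lA ndA; set u := fun n => n.+1%:R * (A (x + n.+1%:R^-1) - A x).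
have u0 n : 0 <= u n by rewrite mulr_ge0// subr_ge0 ndA// lerDl.
have [L L0 AL] := lA (`|x| + 1).
have uL n : `|u n| <= L.
  rewrite normrM ger0_norm// -ler_pdivlMl// mulrC.
  apply: le_trans (AL _ _ _ _) _.
  - rewrite (le_trans (ler_normD _ _))// lerD2l ger0_norm// invf_le1//.
    by rewrite ler1n.
  - by rewrite lerDl.
  - by rewrite addrAC subrr add0r ger0_norm.
have ub : has_ubound (range u).
  by exists L => _ [n _ <-]; exact: le_trans (ler_norm _) (uL n).
have lb : has_lbound (range u) by exists 0 => _ [n _ <-].
rewrite /dq -/u; have /cvg_lim := cvg_sups_inf ub lb.
move=> /(_ (@Rhausdorff _)); rewrite -[lim _]/(limn_sup u) => ->.
apply: lb_le_inf; first by exists (sups u 0%N), 0%N.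
move=> _ [m _ <-]; apply: (@le_trans _ _ (u m)) => //.
by apply: ub_le_sup; [exact: has_ubound_sdrop|exists m => /=].
Qed.

Lemma normr_le_max (a b x : R) : a <= x -> x <= b -> `|x| <= Num.max `|a| `|b|.
Proof.
move=> ax xb; rewrite ler_norml le_max lerNl le_max.
by have := ler_norm b; have := ler_norm (- a); rewrite normrN; linarith.
Qed.

Lemma dq_bounded (f : R -> R) (a b : R) : loclip f ->
  exists2 L : R, 0 <= L & forall x, a <= x <= b -> `|dq f x| <= L.
Proof.
move=> lf; pose N : R := Num.max `|a| `|b|.
have [L L0 fL] := lf (N + 1); exists L => // x /andP[ax xb].
apply: (loclip_dq_le fL); rewrite ler_norml /N le_max lerNl le_max.
by have := ler_norm b; have := ler_norm (- a); rewrite normrN; linarith.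
Qed.

Lemma bounded_integrable_itv (f : R -> R) (a b C : R) : measurable_fun setT f ->
  (forall x, a <= x <= b -> `|f x| <= C) -> mu.-integrable `[a, b] (EFin \o f).
Proof.
move=> mf fC; apply: measurable_bounded_integrable => //.
- by apply: compact_finite_measure; exact: segment_compact.
- exact: measurable_funTS.
- exists C; split; first exact: num_real.
  move=> M CM t /=; rewrite in_itv/= => tab.
  exact: le_trans (fC _ tab) (ltW CM).
Qed.

Definition int2 (f : R -> R) (a b : R) : R := \int[mu]_(s in `[a, b]) (dq f s ^+ 2).

Lemma measurable_dq2 (f : R -> R) : loclip f ->
  measurable_fun setT (fun s => dq f s ^+ 2).
Proof. by move=> lf; apply: measurable_funX; exact: measurable_dq. Qed.

Lemma integrable_dq2 (f : R -> R) (a b : R) : loclip f ->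
  mu.-integrable `[a, b] (EFin \o (fun s => dq f s ^+ 2)).
Proof.
move=> lf; have [L L0 fL] := dq_bounded a b lf.
apply: (@bounded_integrable_itv _ _ _ (L ^+ 2)); first exact: measurable_dq2.
by move=> x xab; rewrite normrX lerXn2r ?nnegrE// fL.
Qed.

Lemma Rintegral_cat (f : R -> R) (a c b : R) : a <= c -> c <= b ->
  mu.-integrable `[a, b] (EFin \o f) ->
  \int[mu]_(s in `[a, b]) f s =
  \int[mu]_(s in `[a, c]) f s + \int[mu]_(s in `[c, b]) f s.
Proof.
move=> ac cb fi.
have := @Rintegral_itvB R f (BLeft a) (BRight b) c fi.
rewrite !bnd_simp => /(_ ac cb) h.
have fi' : mu.-integrable `]c, b] (EFin \o f).
  apply: integrableS fi => //; apply: subset_itvr; rewrite bnd_simp.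
  exact: ac.
rewrite -(Rintegral_itv_obnd_cbnd fi') -h; ring.
Qed.

Lemma int2_cat (f : R -> R) (a c b : R) : loclip f -> a <= c -> c <= b ->
  int2 f a b = int2 f a c + int2 f c b.
Proof. by move=> lf ac cb; apply: Rintegral_cat => //; exact: integrable_dq2. Qed.

Lemma ae_eq_Rintegral (f g : R -> R) (a b : R) : measurable_fun setT f -> measurable_fun setT g ->
  {ae mu, forall x, a < x < b -> f x = g x} ->
  \int[mu]_(s in `[a, b]) f s = \int[mu]_(s in `[a, b]) g s.
Proof.
move=> mf mg h; rewrite /Rintegral; congr fine; apply: ae_eq_integral => //.
- by apply/measurable_EFinP; exact: measurable_funTS.
- by apply/measurable_EFinP; exact: measurable_funTS.
- by have := ae_mem_itv h; apply: ae_imp => x /[apply] ->.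
Qed.

Lemma derive1_eq_near (f g : R -> R) (x c : R) : derivable g x 1 ->
  (\forall y \near x, f y = g y + c) -> derivable f x 1 /\ f^`()%classic x = g^`()%classic x.
Proof.
move=> dg h.
have dc : derivable (cst c : R -> R) x 1 by exact: derivable_cst.
have nF : {near x, g + cst c =1 f} by near=> y; rewrite fctE /cst; apply/esym; near: y.
split; first exact: (near_eq_derivable nF (@derivableD _ _ _ g (cst c) x 1 dg dc)).
rewrite derive1E -(near_eq_derive _ nF) ?oner_eq0//.
by rewrite (@deriveD _ _ _ g (cst c) x 1 dg dc) derive_cst addr0 -derive1E.
Unshelve. all: by end_near. Qed.

Lemma near_itv (a b x : R) : a < x -> x < b -> \forall y \near x, a < y < b.
Proof.
move=> ax xb; near=> y; apply/andP; split; near: y.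
  exact: lt_nbhsr.
exact: lt_nbhsl.
Unshelve. all: by end_near. Qed.

Lemma int2_eq (f g : R -> R) (a b : R) : loclip f -> loclip g ->
  (forall s t, a < s < b -> a < t < b -> f s - g s = f t - g t) ->
  int2 f a b = int2 g a b.
Proof.
move=> lf lg h; apply: ae_eq_Rintegral; [exact: measurable_dq2..|].
have := ae_and (loclip_derivable lf) (loclip_derivable lg).
apply: ae_imp => x [dfx dgx] xab; rewrite !derive_dq//; congr (_ ^+ 2).
have [ax xb] := andP xab.
have [] := @derive1_eq_near f g x (f x - g x) dgx _ => //.
near=> y; have yab : a < y < b by near: y; exact: near_itv.
by have := h y x yab xab; linarith.
Unshelve. all: by end_near. Qed.

Lemma Rintegral_ge0_eq0 (f : R -> R) (a b : R) : measurable_fun setT f ->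
  mu.-integrable `[a, b] (EFin \o f) ->
  {ae mu, forall x, a < x < b -> 0 <= f x} ->
  \int[mu]_(s in `[a, b]) f s <= 0 -> {ae mu, forall x, a < x < b -> f x = 0}.
Proof.
move=> mf fi f0 If.
have f0' := ae_mem_itv f0.
have E : (\int[mu]_(x in `[a, b]) `|(f x)%:E| = \int[mu]_(x in `[a, b]) (f x)%:E)%E.
  apply: ae_eq_integral => //.
  - apply: measurableT_comp => //; apply/measurable_EFinP; exact: measurable_funTS.
  - by apply/measurable_EFinP; exact: measurable_funTS.
  - by apply: ae_imp f0' => x /[apply] fx; rewrite /= ger0_norm.
have I0 : (\int[mu]_(x in `[a, b]) `|(f x)%:E| = 0)%E.
  apply/eqP; rewrite eq_le integral_ge0// andbT E.
  by rewrite -(@fineK _ (\int[mu]_(x in _) _)%E) ?lee_fin//; exact: integrable_fin_num.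
have mfi : measurable_fun `[a, b] (EFin \o f).
  by apply/measurable_EFinP; exact: measurable_funTS.
have [h _] := ae_eq_integral_abs mu (measurable_itv `[a, b]) mfi.
apply: ae_imp (h I0) => x hx /andP[ax xb].
by apply: EFin_inj; apply: hx; rewrite /= in_itv/= !ltW.
Qed.

Lemma ae_le_Rintegral (f g : R -> R) (a b C : R) :
  measurable_fun setT f -> measurable_fun setT g ->
  (forall x, a <= x <= b -> `|f x| <= C /\ `|g x| <= C) ->
  {ae mu, forall x, a < x < b -> f x <= g x} ->
  \int[mu]_(s in `[a, b]) f s <= \int[mu]_(s in `[a, b]) g s.
Proof.
move=> mf mg fgC fg.
have mm : measurable_fun setT (fun x => Num.max (f x) (g x)).
  exact: measurable_maxr.
rewrite -(@ae_eq_Rintegral (fun x => Num.max (f x) (g x)) g)//; last first.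
  by apply: ae_imp fg => x /[apply]; exact: max_r.
apply: le_Rintegral => //.
- by apply: (@bounded_integrable_itv f a b C mf) => x /fgC[].
- apply: (bounded_integrable_itv (C := C) mm) => x /fgC[fC gC].
  by rewrite /Num.max; case: ifP.
- by move=> x _; rewrite le_max lexx.
Qed.

(** The difference of squares factors as (f' - g') (f' + g'). The second factor is at most 2 C; the
    first has the constant sign e because f - g is monotone, so the integral of its absolute value
    is an increment of f - g. *)
Lemma int2_diff_le (f g : R -> R) (a b e C : R) : loclip f -> loclip g -> a <= b ->
  (e = 1 \/ e = -1) ->
  (forall s t, a <= s -> s <= t -> t <= b -> 0 <= e * ((f t - g t) - (f s - g s))) ->
  (forall x, a <= x <= b -> `|dq f x| <= C /\ `|dq g x| <= C) ->
  `|int2 f a b - int2 g a b| <= 2 * C * (e * ((f b - g b) - (f a - g a))).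
Proof.
move=> lf lg ab e1 mono bd.
have C0 : 0 <= C.
  by have [|+ _] := bd a; [rewrite lexx|apply: le_trans].
have ee : e * e = 1 by case: e1 => ->; rewrite ?mul1r// mulrNN mulr1.
have Efg : {ae mu, forall x, a < x < b -> `|dq f x ^+ 2 - dq g x ^+ 2| <=
    2 * C * (e * (dq f x - dq g x))}.
  have := ae_and (loclip_derivable lf) (loclip_derivable lg).
  apply: ae_imp => x [dfx dgx] /andP[ax xb].
  have [ds dsE] := derive1_sub dfx dgx.
  have s0 : 0 <= e * (dq f x - dq g x).
    rewrite !derive_dq// -dsE; case: e1 mono => -> mono.
      rewrite mul1r; apply: (derive_ge0_r (d := b - x) ds) => [|h h0 hd]; first linarith.
      have := mono x (x + h); rewrite mul1r subr_ge0; apply; linarith.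
    rewrite mulN1r oppr_ge0; apply: (derive_le0_r (d := b - x) ds) => [|h h0 hd]; first linarith.
    have := mono x (x + h); rewrite mulN1r oppr_ge0 subr_le0; apply; linarith.
  have [|fC gC] := bd x; first by rewrite !ltW.
  rewrite subr_sqr normrM mulrC.
  have -> : `|dq f x - dq g x| = e * (dq f x - dq g x).
    have E1 : `|e| = 1 by case: e1 => ->; rewrite ?normr1 ?normrN1.
    by rewrite -[LHS]mul1r -E1 -normrM ger0_norm.
  rewrite ler_wpM2r// (le_trans (ler_normD _ _))// mulr_natl mulr2n; exact: lerD.
have mf := measurable_dq lf; have mg := measurable_dq lg.
have fi := integrable_dq2 a b lf; have gi := integrable_dq2 a b lg.
have fi1 := loclip_integrable_dq a b lf; have gi1 := loclip_integrable_dq a b lg.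
have md1 : measurable_fun setT (fun x => dq f x - dq g x) by exact: measurable_funB.
have md2 : measurable_fun setT (fun x => dq f x ^+ 2 - dq g x ^+ 2).
  by apply: measurable_funB; exact: measurable_dq2.
have bd1 x : a <= x <= b -> `|dq f x - dq g x| <= 2 * C.
  move=> /bd[fC gC]; rewrite (le_trans (ler_normB _ _))// mulr_natl mulr2n.
  exact: lerD.
have i1 : mu.-integrable `[a, b] (EFin \o (fun x => dq f x - dq g x)).
  exact: bounded_integrable_itv bd1.
have E1 : `|e| = 1 by case: e1 => ->; rewrite ?normr1 ?normrN1.
have i2 : mu.-integrable `[a, b] (EFin \o (fun x => e * (dq f x - dq g x))).
  apply: (@bounded_integrable_itv _ _ _ (2 * C)); first exact: measurable_funM.
  by move=> x /bd1; rewrite normrM E1 mul1r.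
have bd2 x : a <= x <= b -> `|dq f x ^+ 2 - dq g x ^+ 2| <= 2 * C * (2 * C).
  move=> xab; rewrite subr_sqr normrM ler_pM// ?bd1//.
  have [fC gC] := bd _ xab; rewrite (le_trans (ler_normD _ _))// mulr_natl mulr2n.
  exact: lerD.
rewrite /int2 -RintegralB//.
apply: (@le_trans _ _ (\int[mu]_(x in `[a, b]) `|dq f x ^+ 2 - dq g x ^+ 2|)).
  by apply: le_normr_Rintegral => //; exact: bounded_integrable_itv bd2.
apply: (@le_trans _ _ (\int[mu]_(x in `[a, b]) (2 * C * (e * (dq f x - dq g x))))).
  apply: (@ae_le_Rintegral _ _ _ _ (2 * C * (2 * C))) => //.
  - exact: measurableT_comp.
  - by apply: measurable_funM => //; exact: measurable_funM.
  move=> x xab; rewrite normr_id; split; first exact: bd2.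
  rewrite normrM ger0_norm ?mulr_ge0// ler_wpM2l ?mulr_ge0//.
  by rewrite normrM E1 mul1r bd1.
rewrite !RintegralZl// RintegralB// !loclip_FTC// le_eqVlt; apply/orP; left; apply/eqP.
by congr (_ * (_ * _)); ring.
Qed.

Lemma loclip_primitive (f : R -> R) (a b C : R) : measurable_fun setT f ->
  a <= b -> (forall x, a <= x <= b -> `|f x| <= C) ->
  exists F : R -> R, [/\ loclip F,
    (forall s t, a <= s -> s <= t -> t <= b -> F t - F s = \int[mu]_(x in `[s, t]) f x) &
    {ae mu, forall x, a < x < b -> derivable F x 1 /\ F^`()%classic x = f x}].
Proof.
move=> mf ab fC.
have C0 : 0 <= C by apply: le_trans (fC a _) => //; rewrite lexx.
pose f0 : R -> R := f \_ `[a, b].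
have fi : mu.-integrable `[a, b] (EFin \o f) by exact: bounded_integrable_itv fC.
have f0i : mu.-integrable setT (EFin \o f0).
  by move: fi; rewrite integrable_mkcond//= restrict_EFin.
have f0C x : `|f0 x| <= C.
  rewrite /f0 patchE; case: ifPn => [|_]; last by rewrite normr0.
  by rewrite inE /= in_itv/=; exact: fC.
pose F x := \int[mu]_(t in `]-oo, x]) f0 t.
have FE x y : x <= y -> F y - F x = \int[mu]_(t in `]x, y]) f0 t.
  move=> xy; apply: Rintegral_itvB; rewrite ?bnd_simp//.
  exact: integrableS f0i.
exists F; split.
- have FL x y : x <= y -> `|F y - F x| <= C * (y - x).
    move=> xy; rewrite (FE _ _ xy).
    have i0 : mu.-integrable `]x, y] (EFin \o f0) by exact: integrableS f0i.
    apply: le_trans (le_normr_Rintegral _ i0) _ => //.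
    apply: (@le_trans _ _ (\int[mu]_(t in `]x, y]) C)).
      apply: le_Rintegral => //.
      + by apply: integrable_norm.
      + apply: measurable_bounded_integrable => //.
          by rewrite /= lebesgue_measure_itv/=; case: ifP; rewrite ltry.
        by exists C; split; [exact: num_real|move=> M CM t _; rewrite (le_trans _ (ltW CM))// ger0_norm].
    rewrite Rintegral_cst//= lebesgue_measure_itv/= lte_fin; case: ltP => xy' /=.
      by rewrite ler_wpM2l//.
    by rewrite mulr0 mulr_ge0// subr_ge0.
  move=> N; exists C => // x y _ _.
  have [xy|yx] := orP (le_total x y).
    by rewrite distrC [X in _ <= _ * X]distrC (ger0_norm (x := y - x)) ?subr_ge0// FL.
  by rewrite (ger0_norm (x := x - y)) ?subr_ge0// FL.
- move=> s t as_ st tb; rewrite FE// Rintegral_itv_obnd_cbnd; last exact: integrableS f0i.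
  apply: eq_Rintegral => x; rewrite inE /= in_itv/= => /andP[sx xt].
  by rewrite /f0 patchE mem_set//= in_itv/= (le_trans as_)//= (le_trans xt).
- have := @FTC1Ny R f0.
  have lf0 : locally_integrable setT f0 by apply: integrable_locally.
  have i0 y : mu.-integrable `]-oo, y] (EFin \o f0) by exact: integrableS f0i.
  move=> /(_ i0 lf0); apply: ae_imp => x [dF dFE] /andP[ax xb]; split => //.
  by rewrite [LHS]dFE /f0 patchE mem_set//= in_itv/= !ltW.
Qed.

(** The measure with density [dq A], pushed forward by the nondecreasing map A, is bounded by
    Lebesgue measure; hence the preimage of a null set carries no mass of A'. A chain rule along A
    may thus ignore exceptional slopes: where A meets them on a set of positive measure, it stands
    still. *)
Lemma loclip_comp_null (A : R -> R) (P : R -> Prop) : loclip A ->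
  {homo A : x y / x <= y} -> {ae mu, forall x, P x} ->
  {ae mu, forall x, ~ P (A x) -> dq A x = 0}.
Proof.
move=> lA ndA [N [mN N0 PN]].
have cA := loclip_continuous lA.
have mA : measurable_fun setT (A : R -> R) by exact: continuous_measurable_fun.
have key (M : nat) : {ae mu, forall x, - M%:R < x < M%:R -> N (A x) -> dq A x = 0}.
  pose I : set R := `[- M%:R, M%:R]%classic.
  pose d : R -> \bar R := EFin \o (dq A \_ I).
  have md : measurable_fun setT d.
    apply/measurable_EFinP; apply/(measurable_restrictT _ _).1; first exact: measurable_itv.
        by apply: measurable_funTS; exact: measurable_dq.
  have d0 x : (0 <= d x)%E.
    by rewrite lee_fin patchE; case: ifP => // _; exact: ndecr_dq_ge0.
  pose nu0 := fun S : set (measurableTypeR R) => (\int[mu]_(t in S) d t)%E.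
  have nu00 : nu0 set0 = 0%E by rewrite /nu0 integral_set0.
  have nu0ge S : (0 <= nu0 S)%E by apply: integral_ge0.
  have nu0s := semi_sigma_additive_nng_induced (mu := mu) md d0.
  pose nu1 : {measure set (measurableTypeR R) -> \bar R} :=
    HB.pack nu0 (isMeasure.Build _ _ _ nu0 nu00 nu0ge nu0s).
  have mA' : measurable_fun (setT : set (measurableTypeR R))
    (A : measurableTypeR R -> measurableTypeR R) := mA.
  pose nu2 : {measure set (measurableTypeR R) -> \bar R} :=
    pushforward nu1 (A : measurableTypeR R -> measurableTypeR R).
  pose nu : {measure set (measurableTypeR R) -> \bar R} := nu2 mA'.
  have nuI a b : a <= b -> (nu `]a, b]%classic <= (1 * (b - a))%:E)%E.
    move=> ab; rewrite /nu/= /pushforward /nu0 /d mul1r.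
    have mS : measurable (A @^-1` `]a, b]%classic).
      by rewrite -[X in measurable X]setTI; exact: mA.
    have -> : (\int[mu]_(t in A @^-1` `]a, b]%classic) (EFin \o (dq A \_ I)) t =
        \int[mu]_(t in A @^-1` `]a, b]%classic `&` I) (dq A t)%:E)%E.
      by rewrite integral_mkcondr -restrict_EFin.
    have [[x0 [Sx0 Ix0]]|S0] := pselect (A @^-1` `]a, b]%classic `&` I !=set0); last first.
      rewrite (_ : _ `&` _ = set0) ?integral_set0 ?lee_fin ?subr_ge0//.
      by apply/seteqP; split => // x Sx; case: S0; exists x.
    pose S := A @^-1` `]a, b]%classic `&` I.
    have mSI : measurable (A @^-1` `]a, b]%classic `&` I).
      by apply: measurableI => //; exact: measurable_itv.
    (* The preimage S of ]a, b] lies between its infimum and its supremum. By continuity A is at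
       least a at the former and at most b at the latter, so the integral of [dq A] over S is at
       most b - a. *)
    have Sub : has_sup S.
      by split; [exists x0|exists M%:R => x [_]; rewrite /I/= in_itv/= => /andP[]].
    have Slb : has_inf S.
      by split; [exists x0|exists (- M%:R) => x [_]; rewrite /I/= in_itv/= => /andP[]].
    have [L L0 AL] := lA M%:R.
    have L1 : 0 < L + 1 by rewrite ltr_wpDl.
    have SM x : S x -> `|x| <= M%:R.
      by case=> _; rewrite /I/= in_itv/= ler_norml.
    have supM : `|sup S| <= M%:R.
      rewrite ler_norml; apply/andP; split.
        apply: (@le_trans _ _ x0); last by apply: ub_le_sup => //; case: Sub.
        by have := SM x0 (conj Sx0 Ix0); rewrite ler_norml => /andP[].
      apply: ge_sup; first by exists x0.
      by move=> x /SM; rewrite ler_norml => /andP[].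
    have infM : `|inf S| <= M%:R.
      rewrite ler_norml; apply/andP; split.
        apply: lb_le_inf; first by exists x0.
        by move=> x /SM; rewrite ler_norml => /andP[].
      apply: (@le_trans _ _ x0); first by apply: ge_inf => //; case: Slb.
      by have := SM x0 (conj Sx0 Ix0); rewrite ler_norml => /andP[].
    have AS : A (sup S) <= b.
      apply/ler_addgt0Pr => e e0.
      have [x Sx xs] := sup_adherent (divr_gt0 e0 L1) Sub.
      have xs' : x <= sup S by apply: ub_le_sup => //; case: Sub.
      have := AL _ _ supM (SM _ Sx); move=> /(le_trans (ler_norm _)).
      rewrite ger0_norm ?subr_ge0// => AL1.
      have Axb : A x <= b by case: Sx => /=; rewrite in_itv/= => /andP[].
      have : L * (sup S - x) <= (L + 1) * (e / (L + 1)).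
        by apply: ler_pM => //; rewrite ?subr_ge0// ?lerDl//; linarith.
      by rewrite (mulrC (L + 1)) divfK ?gt_eqF//; linarith.
    have AI : a <= A (inf S).
      apply/ler_addgt0Pr => e e0.
      have [x Sx xs] := inf_adherent (divr_gt0 e0 L1) Slb.
      have xs' : inf S <= x by apply: ge_inf => //; case: Slb.
      have := AL _ _ (SM _ Sx) infM; move=> /(le_trans (ler_norm _)).
      rewrite ger0_norm ?subr_ge0// => AL1.
      have Axb : a < A x by case: Sx => /=; rewrite in_itv/= => /andP[].
      have : L * (x - inf S) <= (L + 1) * (e / (L + 1)).
        by apply: ler_pM => //; rewrite ?subr_ge0// ?lerDl//; linarith.
      by rewrite (mulrC (L + 1)) divfK ?gt_eqF//; linarith.
    apply: (@le_trans _ _ (\int[mu]_(t in `[inf S, sup S]) (dq A t)%:E)%E).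
      apply: ge0_subset_integral => //.
      - by apply/measurable_EFinP/measurable_funTS; exact: measurable_dq.
      - by move=> x _; rewrite lee_fin; exact: ndecr_dq_ge0.
      - move=> x Sx /=; rewrite in_itv/=; apply/andP; split.
          by apply: ge_inf => //; case: Slb.
        by apply: ub_le_sup => //; case: Sub.
    have iS : inf S <= sup S.
      apply: (@le_trans _ _ x0); first by apply: ge_inf => //; case: Slb.
      by apply: ub_le_sup => //; case: Sub.
    rewrite -[leLHS]fineK; last by apply: integrable_fin_num => //; exact: loclip_integrable_dq.
    rewrite -/(Rintegral mu _ _) loclip_FTC// lee_fin; linarith.
  have : nu N = 0%E by apply: (null_of_itv_le _ nuI).
  rewrite /nu/= /pushforward /nu0 => I0.
  have mN' : measurable (A @^-1` N) by rewrite -[X in measurable X]setTI; exact: mA.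
  have mdN : measurable_fun (A @^-1` N) d by exact: measurable_funTS.
  have [h _] := ae_eq_integral_abs mu mN' mdN.
  have {h} := h _; rewrite (_ : integral _ _ _ = 0%E); last first.
    by rewrite -[RHS]I0; apply: eq_integral => x _; rewrite gee0_abs.
  move=> /(_ erefl); apply: ae_imp => x hx /andP[xM Mx] NAx.
  apply: EFin_inj; rewrite -[RHS](hx NAx) /d/= patchE mem_set//.
  by rewrite /I/= in_itv/= !ltW.
have {}key := ae_forall_nat key.
apply: ae_imp key => x /(_ (Num.bound x)) h nP; apply: h; last exact: PN.
by rewrite -ltr_norml; exact: unstable.ltr_norm_bound.
Qed.

End OneDimensionalTools.

(** * The obstacle problem in characteristic coordinates *)

Section Geometry.
Context {R : realType}.
Notation mu := (@lebesgue_measure R).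
Implicit Types (g f : R -> R) (V : R -> R -> R).

Definition lip2 V := forall N : R, exists2 L : R, 0 <= L &
  forall a a' b b' : R, `|a| <= N -> `|a'| <= N -> `|b| <= N -> `|b'| <= N ->
    `|V a b - V a' b'| <= L * (`|a - a'| + `|b - b'|).

(* In characteristic coordinates [g a - f b] is the free wave with the given
   data; [exc] is the excess of [V] over it. *)
Definition exc g f V (a b : R) := V a b - g a + f b.

(** In these coordinates box u = - 4 V_ab, whence the direction of [geo_rect]; all rectangles lie in
    a <= b, that is, in nonnegative time. [geo_init] says that V has the initial velocity of the
    free wave. It is stated along 1 / n.+1 only; monotonicity of the excess extends it to all small
    h in [exc_rate]. *)
Record geo g f V : Prop := Geo {
  geo_g : loclip g;
  geo_f : loclip f;
  geo_lip : lip2 V;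
  geo_ge0 : forall a b, a <= b -> 0 <= V a b;
  geo_rect : forall a1 a2 b1 b2, a1 <= a2 -> a2 <= b1 -> b1 <= b2 ->
    V a1 b1 + V a2 b2 <= V a1 b2 + V a2 b1;
  geo_mod : forall a1 a2 b1 b2, a1 <= a2 -> a2 <= b1 -> b1 <= b2 ->
    (forall a b, a1 <= a <= a2 -> b1 <= b <= b2 -> 0 < V a b) ->
    V a1 b1 + V a2 b2 = V a1 b2 + V a2 b1;
  geo_diag : forall x, V x x = g x - f x;
  geo_init : {ae mu, forall x, (fun n => n.+1%:R *
    exc g f V (x - n.+1%:R^-1) (x + n.+1%:R^-1)) @ \oo --> (0 : R)} }.

Lemma lip2_l V b : lip2 V -> loclip (V^~ b).
Proof.
move=> lV N; have [L L0 VL] := lV (Num.max N `|b|); exists L => // x y xN yN.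
have := VL x y b b; rewrite subrr normr0 addr0; apply; rewrite le_max ?xN ?yN//.
all: by rewrite lexx orbT.
Qed.

Lemma lip2_r V a : lip2 V -> loclip (V a).
Proof.
move=> lV N; have [L L0 VL] := lV (Num.max N `|a|); exists L => // x y xN yN.
have := VL a a x y; rewrite subrr normr0 add0r; apply; rewrite le_max ?xN ?yN//.
all: by rewrite lexx orbT.
Qed.

Lemma loclip_cst (c : R) : loclip (cst c : R -> R).
Proof. by move=> N; exists 0 => // x y _ _; rewrite subrr normr0 mul0r. Qed.

Lemma sym_derive_lim (p : R -> R) (x : R) : derivable p x 1 ->
  (fun n => n.+1%:R * (p (x + n.+1%:R^-1) - p (x - n.+1%:R^-1))) @ \oo -->
  p^`()%classic x + p^`()%classic x.
Proof.
move=> dp; rewrite (_ : (fun n => _) = (fun n => n.+1%:R * (p (x + n.+1%:R^-1) - p x)) +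
    (fun n => n.+1%:R * (p x - p (x - n.+1%:R^-1)))).
  by apply: cvgD; [exact: derive_seqr|exact: derive_seql].
by apply/funext => n /=; rewrite -mulrDr subrKA.
Qed.

(** The quotients are symmetric because the increment over [x - h, x + h] is what gets compared with
    the excess at (x - h, x + h), the quantity controlled by [geo_init]. *)
Lemma sym_derive_ge0 (p : R -> R) (x d : R) (u : nat -> R) : derivable p x 1 ->
  u @ \oo --> (0 : R) -> 0 < d ->
  (forall n, n.+1%:R^-1 < d -> u n <= n.+1%:R * (p (x + n.+1%:R^-1) - p (x - n.+1%:R^-1))) ->
  0 <= p^`()%classic x.
Proof.
move=> dp u0 d0 h; have hl : (fun n => n.+1%:R * (p (x + n.+1%:R^-1) - p (x - n.+1%:R^-1)) - u n) @ \oo -->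
    p^`()%classic x + p^`()%classic x.
  rewrite -[X in _ --> X]subr0; apply: cvgB => //; exact: sym_derive_lim.
suff : 0 <= p^`()%classic x + p^`()%classic x by linarith.
by apply: (seq_ge0 hl d0) => n /h; rewrite /= subr_ge0.
Qed.

Lemma sym_derive_eq0 (p : R -> R) (x d C : R) (u : nat -> R) : derivable p x 1 ->
  u @ \oo --> (0 : R) -> 0 < d ->
  (forall n, n.+1%:R^-1 < d -> `|n.+1%:R * (p (x + n.+1%:R^-1) - p (x - n.+1%:R^-1))| <= C * u n) ->
  p^`()%classic x = 0.
Proof.
move=> dp u0 d0 h.
have Cu : (fun n => C * u n) @ \oo --> (0 : R).
  by rewrite -[X in _ --> X](mulr0 C); apply: cvgM => //; exact: cvg_cst.
have s := sym_derive_lim dp.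
have h1 : 0 <= 0 - (p^`()%classic x + p^`()%classic x).
  apply: (seq_ge0 (cvgB Cu s) d0) => n /h; rewrite ler_norml => /andP[_].
  by rewrite /= subr_ge0.
have h2 : 0 <= 0 + (p^`()%classic x + p^`()%classic x).
  apply: (seq_ge0 (cvgD Cu s) d0) => n /h; rewrite ler_norml => /andP[+ _].
  by rewrite lerNl /= -subr_ge0 opprK.
linarith.
Qed.

Section OneSolution.
Variables (g f : R -> R) (V : R -> R -> R).
Hypothesis hV : geo g f V.
Local Notation n := (exc g f V).

Lemma exc_diag x : n x x = 0.
Proof. by rewrite /exc (geo_diag hV); ring. Qed.

(** This is the rectangle inequality with a corner at (c, c), on the diagonal, where V is known. *)
Lemma exc_super a c b : a <= c -> c <= b -> n a c + n c b <= n a b.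
Proof.
move=> ac cb; have := geo_rect hV ac (lexx c) cb.
by rewrite (geo_diag hV) /exc; linarith.
Qed.

Lemma exc_loclip_r a : loclip (n a).
Proof.
apply: loclipD (geo_f hV); apply: loclipD (lip2_r _ (geo_lip hV)) _.
exact: loclip_cst.
Qed.

(** By superadditivity the increment of [n a] over [x - h, x + h] is at least n (x - h) (x + h) =
    o(h), so its derivative is nonnegative almost everywhere. *)
Lemma exc_ge0 a b : a <= b -> 0 <= n a b.
Proof.
move=> ab; rewrite -(exc_diag a); apply: (loclip_ndecr (exc_loclip_r a) ab).
apply: ae_imp (geo_init hV) => x ix /andP[ax xb] dx.
apply: (sym_derive_ge0 (d := x - a) dx ix) => [|k hk]; first linarith.
rewrite ler_wpM2l//; have k0 : 0 < k.+1%:R^-1 :> R by rewrite invr_gt0.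
move: k0 hk; set h : R := k.+1%:R^-1 => k0 hk.
have h1 : a <= x - h by linarith.
have h2 : x - h <= x + h by linarith.
by have := exc_super h1 h2; linarith.
Qed.

Lemma exc_mono a' a b b' : a' <= a -> a <= b -> b <= b' -> n a b <= n a' b'.
Proof.
move=> aa ab bb; have ab' : a <= b' by linarith.
have := exc_super aa ab'; have := exc_super ab bb.
by have := exc_ge0 aa; have := exc_ge0 bb; linarith.
Qed.

Lemma exc_lip (N : R) : exists2 C : R, 0 <= C & forall a b : R, `|a| <= N -> `|b| <= N ->
  a <= b -> n a b <= C * (b - a).
Proof.
have [L L0 VL] := geo_lip hV N; have [K K0 fK] := geo_f hV N.
exists (L + K) => [|a b aN bN ab]; first exact: addr_ge0.
have := VL a a b a aN aN bN aN; rewrite subrr normr0 add0r.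
have := fK b a bN aN; rewrite (ger0_norm (x := b - a)) ?subr_ge0//.
move=> /(le_trans (ler_norm _)) h1 /(le_trans (ler_norm _)) h2.
by have := exc_diag a; rewrite /exc; linarith.
Qed.

(** The increment of D over [x - h, x + h] is bounded by the excess there, which is o(h) for almost
    every x; so b -> D a0 b is a Lipschitz function with derivative zero. It is applied to the
    excess itself where there is no contact, and to the energy defect in general. *)
Lemma additive_zero (D : R -> R -> R) (a0 b0 C : R) : a0 <= b0 ->
  (forall a c b, a0 <= a -> a <= c -> c <= b -> b <= b0 -> D a b = D a c + D c b) ->
  (forall a b, a0 <= a -> a <= b -> b <= b0 -> `|D a b| <= C * n a b) ->
  D a0 b0 = 0.
Proof.
move=> ab0 Dadd DC.
(* Truncation to [a0, b0] makes p defined and Lipschitz on the whole line, though D is controlled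
   only inside the triangle. *)
pose cl (t : R) : R := Num.max a0 (Num.min t b0).
have cl1 t : a0 <= cl t <= b0.
  by rewrite /cl le_max lexx/= ge_max ab0 ge_min lexx orbT.
have clE t : a0 <= t <= b0 -> cl t = t.
  by move=> /andP[h1 h2]; rewrite /cl min_l// max_r.
have cl2 s t : s <= t -> 0 <= cl t - cl s <= t - s.
  move=> st; rewrite /cl /Num.max /Num.min.
  by case: (ltP s b0) => ?; case: (ltP t b0) => ?; case: ltP => ?; case: ltP => ?; linarith.
have D00 : D a0 a0 = 0 by have := Dadd a0 a0 a0 (lexx _) (lexx _) (lexx _) ab0; linarith.
pose p t := D a0 (cl t).
have pE s t : s <= t -> p t - p s = D (cl s) (cl t).
  move=> /cl2/andP[h _]; have /andP[s1 s2] := cl1 s; have /andP[t1 t2] := cl1 t.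
  rewrite /p (Dadd a0 (cl s) (cl t))//; first by ring.
  by linarith.
have C0 : 0 <= C \/ (forall t, p t = 0).
  have [|Cn] := leP 0 C; [by left|right=> t].
  have /andP[t1 t2] := cl1 t; apply/eqP; rewrite -normr_eq0 eq_le normr_ge0 andbT.
  apply: le_trans (DC a0 (cl t) _ _ _) _ => //.
  by rewrite mulr_le0_ge0 ?exc_ge0// ltW.
case: C0 => [C0|p0]; last by have := p0 b0; rewrite /p clE// ab0 lexx.
have lp : loclip p.
  move=> N; pose M : R := Num.max `|a0| `|b0|.
  have [K K0 nK] := exc_lip M; exists (C * K) => [|x y _ _]; first exact: mulr_ge0.
  have clM t : `|cl t| <= M.
    by have /andP[t1 t2] := cl1 t; exact: normr_le_max.
  wlog xy : x y / x <= y.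
    move=> h; have [|/ltW] := leP x y; first exact: h.
    by rewrite distrC (distrC x); exact: h.
  rewrite distrC (pE _ _ xy) distrC (ger0_norm (x := y - x)) ?subr_ge0//.
  have /andP[h1 h2] := cl2 _ _ xy; have /andP[x1 x2] := cl1 x; have /andP[y1 y2] := cl1 y.
  apply: le_trans (DC _ _ _ _ _) _ => //; first by linarith.
  rewrite -mulrA ler_wpM2l//; apply: le_trans (nK _ _ (clM _) (clM _) _) _; first linarith.
  by rewrite ler_wpM2l.
have := loclip_eq lp ab0; rewrite /p !clE ?ab0 ?lexx// D00 => ->//.
apply: ae_imp (geo_init hV) => x ix /andP[ax xb] dx.
apply: (sym_derive_eq0 (d := Num.min (x - a0) (b0 - x)) (C := C) dx ix) => [|k].
  by rewrite lt_min; linarith.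
have k0 : 0 < k.+1%:R^-1 :> R by rewrite invr_gt0.
rewrite lt_min normrM ger0_norm// mulrCA ler_pM2l//.
move: k0; set h : R := k.+1%:R^-1 => k0 /andP[k1 k2].
rewrite -/(p _) -/(p _) pE; last by linarith.
rewrite !clE; [|linarith|linarith].
by apply: DC; linarith.
Qed.

Lemma rect_perturb (p q r p' q' r' s k e : R) : p + q = s + r -> `|p - p'| <= k ->
  `|q - q'| <= k -> `|r - r'| <= k + k -> 4 * k <= e -> `|p' + q' - (s + r')| <= e.
Proof.
by rewrite !ler_norml => ? /andP[? ?] /andP[? ?] /andP[? ?] ?; apply/andP; split; lra.
Qed.

(** The sides s = a2 and t = b1 may touch the contact set. The equality holds on the closed
    rectangle shrunk by d at these two sides, and the Lipschitz bound makes the error at most 4 L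
    d. *)
Lemma mod_open a1 a2 b1 b2 : a1 <= a2 -> a2 <= b1 -> b1 <= b2 ->
  (forall s t, a1 <= s < a2 -> b1 < t <= b2 -> 0 < V s t) ->
  V a1 b1 + V a2 b2 = V a1 b2 + V a2 b1.
Proof.
move=> a12 ab b12 pos.
move: a12; rewrite le_eqVlt => /predU1P[->|a12]; first by rewrite addrC.
move: b12; rewrite le_eqVlt => /predU1P[<-|b12]; first by [].
pose N : R := Num.max `|a1| `|b2|.
have inN x : a1 <= x -> x <= b2 -> `|x| <= N.
  exact: normr_le_max.
have [L L0 VL] := geo_lip hV N.
apply/eqP; rewrite -subr_eq0 -normr_eq0 eq_le normr_ge0 andbT.
apply/ler_addgt0Pr => e e0; rewrite add0r.
have L1 : 0 < 4 * L + 1 by rewrite ltr_wpDl// mulr_ge0.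
pose d := Num.min (e / (4 * L + 1)) (Num.min ((a2 - a1) / 2) ((b2 - b1) / 2)).
have d0 : 0 < d by rewrite !lt_min divr_gt0//=; linarith.
have [d1 d2 d3] : [/\ d <= e / (4 * L + 1), d <= (a2 - a1) / 2 & d <= (b2 - b1) / 2].
  by rewrite /d !ge_min !lexx !orbT.
have E : V a1 (b1 + d) + V (a2 - d) b2 = V a1 b2 + V (a2 - d) (b1 + d).
  apply: (geo_mod hV); [linarith|linarith|linarith|move=> s t /andP[? ?] /andP[? ?]].
  by apply: pos; linarith.
have := VL a1 a1 (b1 + d) b1; have := VL (a2 - d) a2 b2 b2.
have := VL (a2 - d) a2 (b1 + d) b1.
have -> : a2 - d - a2 = - d by ring.
have -> : b1 + d - b1 = d by ring.
rewrite !(subrr, normr0, normrN, add0r, addr0, ger0_norm (ltW d0)).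
have a12' := ltW a12; have b12' := ltW b12; have ab2 := le_trans ab b12'.
have i1 : `|a1| <= N by exact: inN (lexx _) (le_trans a12' ab2).
have i2 : `|a2| <= N by exact: inN a12' ab2.
have i3 : `|b1| <= N by exact: inN (le_trans a12' ab) b12'.
have i4 : `|b2| <= N by exact: inN (le_trans a12' ab2) (lexx _).
have i5 : `|a2 - d| <= N by apply: inN; linarith.
have i6 : `|b1 + d| <= N by apply: inN; linarith.
move=> /(_ i5 i2 i6 i3) h1 /(_ i5 i2 i4 i4) h2 /(_ i1 i1 i6 i3) h3.
have Le : 4 * (L * d) <= e.
  move: d1; rewrite ler_pdivlMr// mulrDr mulr1 mulrC -mulrA; apply: le_trans.
  by rewrite lerDl ltW.
by rewrite mulrDr in h1; exact: rect_perturb E h3 h2 h1 Le.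
Qed.

(* Case A of the energy arguments: on a vertical characteristic that does not
   meet the contact set the excess is locally constant. *)
Lemma exc_loc_cst s b : s < b -> (forall t, s <= t <= b -> 0 < V s t) ->
  exists2 d : R, 0 < d & forall s1 s2, s - d < s1 -> s1 <= s2 -> s2 < s + d -> s2 <= b ->
    n s1 b = n s2 b.
Proof.
move=> sb pos.
have cV : {within `[s, b], continuous (V s)}.
  apply: continuous_subspaceT; exact: loclip_continuous (lip2_r _ (geo_lip hV)).
have [t0 /[!in_itv]/= t0sb t0min] := EVT_min (ltW sb) cV.
have m0 := pos _ t0sb; set m := V s t0 in m0 t0min.
pose N : R := Num.max `|s - 1| `|b|.
have inN x : s - 1 <= x -> x <= b -> `|x| <= N.
  exact: normr_le_max.
have [L L0 VL] := geo_lip hV N.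
have L1 : 0 < 2 * L + 1 by rewrite ltr_wpDl// mulr_ge0.
pose d := Num.min (m / (2 * L + 1)) 1.
have d0 : 0 < d by rewrite lt_min divr_gt0//=.
have [d1 d2] : d <= m / (2 * L + 1) /\ d <= 1 by rewrite /d !ge_min !lexx !orbT.
have Ld : (2 * L + 1) * d <= m by rewrite -ler_pdivlMl// mulrC.
have posd s' t : s - d < s' -> s' < s + d -> s' <= t -> t <= b -> 0 < V s' t.
  move=> h1 h2 h3 h4.
  have h : `|s - s'| < d by rewrite ltr_norml; linarith.
  have s'N : `|s'| <= N by apply: inN; linarith.
  have tN : `|t| <= N by apply: inN; linarith.
  have sN : `|s| <= N by apply: inN; linarith.
  have [st|ts] := leP s t.
    have := t0min t; rewrite in_itv/= st h4 => /(_ erefl) mt.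
    have := VL s s' t t sN s'N tN tN; rewrite subrr normr0 addr0.
    rewrite ler_norml => /andP[_ h5].
    have : L * `|s - s'| <= L * d by rewrite ler_wpM2l// ltW.
    have : 0 <= L * d by rewrite mulr_ge0// ltW.
    linarith.
  have := t0min s; rewrite in_itv/= lexx ltW// => /(_ erefl) mt.
  have := VL s s' s t sN s'N sN tN; rewrite ler_norml => /andP[_ h5].
  have h6 : `|s - t| <= d by rewrite ler_norml; linarith.
  have : L * (`|s - s'| + `|s - t|) <= L * (d + d) by rewrite ler_wpM2l// lerD// ltW.
  linarith.
exists d => // s1 s2 h1 h12 h2 h2b.
have add a c b' : s1 <= a -> a <= c -> c <= b' -> b' <= b -> c <= s2 ->
    n a b' = n a c + n c b'.
  move=> sa ac cb b'b cs2;
  have E : V a c + V c b' = V a b' + V c c.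
    apply: (geo_mod hV ac (lexx c) cb) => x y /andP[ax xc] /andP[cy yb].
    apply: posd (le_trans xc cy) (le_trans yb b'b).
      exact: lt_le_trans h1 (le_trans sa ax).
    exact: le_lt_trans xc (le_lt_trans cs2 h2).
  by move: E; rewrite (geo_diag hV) /exc; linarith.
(* Without contact the excess is additive in this strip, so the difference between the two sides is
   the excess over [s1, s2]; there it is additive as well, hence zero by [additive_zero]. *)
rewrite (add s1 s2 b (lexx _) h12 h2b (lexx _) (lexx _)).
rewrite (additive_zero (D := n) (C := 1) h12) ?add0r// => [a c b' h3 h4 h5 h6|a b' h3 h4 h5].
  exact: add h3 h4 h5 (le_trans h6 h2b) (le_trans h5 h6).
by rewrite mul1r ger0_norm// exc_ge0.
Qed.

End OneSolution.

End Geometry.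

(** * Energy identity and contact points *)

Section Energy.
Context {R : realType}.
Notation mu := (@lebesgue_measure R).

(** The reflection x -> - x exchanges the two families of characteristics: (a, b) becomes (- b, -
    a), and g and f exchange their roles up to sign. Statements in the variable b follow from those
    in a. *)
Lemma geo_refl (g f : R -> R) (V : R -> R -> R) : geo g f V ->
  geo (fun a => - f (- a)) (fun b => - g (- b)) (fun a b => V (- b) (- a)).
Proof.
have lopp (h : R -> R) : loclip h -> loclip (fun a => - h (- a)).
  move=> lh N; have [L L0 hL] := lh N; exists L => // x y xN yN.
  rewrite -opprD normrN; have := hL (- x) (- y); rewrite !normrN => /(_ xN yN).
  by rewrite -opprD normrN.
case=> lg lf lV V0 rect mod diag init; split.
- exact: lopp.
- exact: lopp.
- move=> N; have [L L0 VL] := lV N; exists L => // a a' b b' aN aN' bN bN'.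
  have := VL (- b) (- b') (- a) (- a'); rewrite !normrN => /(_ bN bN' aN aN').
  have -> : - b - - b' = - (b - b') by ring.
  have -> : - a - - a' = - (a - a') by ring.
  by rewrite !normrN (addrC `|b - b'|).
- by move=> a b ab; apply: V0; rewrite lerN2.
- move=> a1 a2 b1 b2 h1 h2 h3.
  have := rect (- b2) (- b1) (- a2) (- a1); rewrite !lerN2 => /(_ h3 h2 h1).
  linarith.
- move=> a1 a2 b1 b2 h1 h2 h3 pos.
  have := mod (- b2) (- b1) (- a2) (- a1); rewrite !lerN2 => /(_ h3 h2 h1) E.
  have {}E : V (- b2) (- a2) + V (- b1) (- a1) = V (- b2) (- a1) + V (- b1) (- a2).
    apply: E => a b ha hb.
    by have := pos (- b) (- a); rewrite !opprK; apply; linarith.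
  linarith.
- by move=> x; rewrite diag; ring.
- apply: ae_imp (ae_opp init) => x; apply: cvg_trans; apply: near_eq_cvg; near=> k.
  by rewrite /exc; congr (_ * _); rewrite !opprD !opprK; ring.
Unshelve. all: by end_near. Qed.

Section OneSolution.
Variables (g f : R -> R) (V : R -> R -> R).
Hypothesis hV : geo g f V.
Local Notation n := (exc g f V).

Lemma exc_loc_cst' a t : a < t -> (forall s, a <= s <= t -> 0 < V s t) ->
  exists2 d : R, 0 < d & forall t1 t2, t - d < t1 -> t1 <= t2 -> t2 < t + d -> a <= t1 ->
    n a t1 = n a t2.
Proof.
move=> at_ pos.
have [|u hu|d d0 hd] := exc_loc_cst (geo_refl hV) (s := - t) (b := - a).
- by rewrite ltrN2.
- by rewrite opprK; apply: pos; linarith.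
exists d => // t1 t2 h1 h12 h2 h3.
have E := hd (- t2) (- t1).
have {}E : exc (fun a => - f (- a)) (fun b => - g (- b)) (fun a b => V (- b) (- a)) (- t2) (- a) =
  exc (fun a => - f (- a)) (fun b => - g (- b)) (fun a b => V (- b) (- a)) (- t1) (- a).
  by apply: E; linarith.
by move: E; rewrite /exc !opprK; linarith.
Qed.

Lemma derive_caseA s b : s < b -> (forall t, s <= t <= b -> 0 < V s t) ->
  derivable g s 1 -> (V^~ b)^`()%classic s = g^`()%classic s.
Proof.
move=> sb pos dg; have [d d0 hd] := exc_loc_cst hV sb pos.
have [] := @derive1_eq_near _ (V^~ b) g s (V s b - g s) dg _ => //.
near=> y.
have /andP[y1 y2] : s - Num.min d (b - s) < y < s + Num.min d (b - s).
  by near: y; apply: near_itv; rewrite ?ltrBlDr ?ltrDl lt_min; linarith.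
have [m1 m2] : Num.min d (b - s) <= d /\ Num.min d (b - s) <= b - s.
  by rewrite !ge_min !lexx orbT.
have [ys|sy] := orP (le_total y s).
  by have := hd y s; rewrite /exc => h; have := h ltac:(linarith) ys ltac:(linarith) ltac:(linarith); linarith.
by have := hd s y; rewrite /exc => h; have := h ltac:(linarith) sy ltac:(linarith) ltac:(linarith); linarith.
Unshelve. all: by end_near. Qed.

Lemma derive_caseA' a t : a < t -> (forall s, a <= s <= t -> 0 < V s t) ->
  derivable f t 1 -> (V a)^`()%classic t = - f^`()%classic t.
Proof.
move=> at_ pos df; have [d d0 hd] := exc_loc_cst' at_ pos.
have dN : derivable (- f) t 1 by exact: derivableN.
have <- : (- f)^`()%classic t = - f^`()%classic t by rewrite !derive1E (@deriveN _ _ _ f t 1 df).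
have [] := @derive1_eq_near _ (V a) (- f) t (V a t + f t) dN _ => //.
near=> y.
have /andP[y1 y2] : t - Num.min d (t - a) < y < t + Num.min d (t - a).
  by near: y; apply: near_itv; rewrite ?ltrBlDr ?ltrDl lt_min; linarith.
have [m1 m2] : Num.min d (t - a) <= d /\ Num.min d (t - a) <= t - a.
  by rewrite !ge_min !lexx orbT.
rewrite -[(- f) y]/(- f y).
have [yt|ty] := orP (le_total y t).
  by have := hd y t; rewrite /exc => h; have := h ltac:(linarith) yt ltac:(linarith) ltac:(linarith); linarith.
by have := hd t y; rewrite /exc => h; have := h ltac:(linarith) ty ltac:(linarith) ltac:(linarith); linarith.
Unshelve. all: by end_near. Qed.

(** Contact at (a, b) and at a point of its past triangle puts two zeros on the larger side of the
    rectangle inequality, which forces contact at the two other corners. *)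
Lemma zero_corners a b s t : a <= s -> s <= t -> t <= b -> V a b = 0 -> V s t = 0 ->
  V s b = 0 /\ V a t = 0.
Proof.
move=> as_ st tb h1 h2; have := geo_rect hV as_ st tb.
have at_ : a <= t by linarith.
have sb : s <= b by linarith.
by have := geo_ge0 hV at_; have := geo_ge0 hV sb; linarith.
Qed.

Lemma caseAP (s b : R) :
  (forall t, s <= t <= b -> 0 <= V s t) ->
  (forall t, s <= t <= b -> 0 < V s t) \/ exists2 t, s <= t <= b & V s t = 0.
Proof.
move=> V0; have [h|/existsNP[t /not_implyP[st /negP]]] := pselect (forall t, s <= t <= b -> 0 < V s t).
  by left.
by rewrite -leNgt => Vt; right; exists t => //; apply/eqP; rewrite eq_le Vt V0.
Qed.

End OneSolution.

Definition ene (V : R -> R -> R) (a b : R) := int2 (V^~ b) a b + int2 (V a) a b.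

Record charsol (g f : R -> R) (V : R -> R -> R) : Prop := CharSol {
  cs_geo : geo g f V;
  cs_ene : forall a c b, a <= c -> c <= b -> ene V a b = ene V a c + ene V c b }.

Lemma int2N (f : R -> R) (a b : R) : loclip f -> int2 (fun x => - f x) a b = int2 f a b.
Proof.
move=> lf; apply: ae_eq_Rintegral.
- by apply: measurable_dq2; exact: loclipN.
- exact: measurable_dq2.
apply: ae_imp (loclip_derivable lf) => x df _.
have dN : derivable (- f) x 1 by exact: derivableN.
by rewrite -[fun x => _]/(- f) !derive_dq// !derive1E (@deriveN _ _ _ f x 1 df) sqrrN.
Qed.

Lemma dq_bound_on (h : R -> R) (L N x : R) :
  (forall x y : R, `|x| <= N + 1 -> `|y| <= N + 1 -> `|h x - h y| <= L * `|x - y|) ->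
  `|x| <= N -> `|dq h x| <= L.
Proof. exact: loclip_dq_le. Qed.

Section OneCharSol.
Variables (g f : R -> R) (V : R -> R -> R).
Hypothesis hV : charsol g f V.
Let gV : geo g f V. Proof. exact: cs_geo hV. Qed.
Local Notation n := (exc g f V).

(** The defect between the energy of V and that of the data is additive. V differs from g,
    respectively - f, along a characteristic by a monotone function, the excess up to a constant, so
    [int2_diff_le] bounds the defect by a multiple of the excess and [additive_zero] applies. *)
Lemma ene_eq a b : a <= b -> ene V a b = int2 g a b + int2 f a b.
Proof.
move=> ab; pose N : R := Num.max `|a| `|b|.
have [L L0 VL] := geo_lip gV (N + 1).
have [K K0 gK] := geo_g gV (N + 1).
have [K' K'0 fK'] := geo_f gV (N + 1).
pose C := L + K + K'.
have N1 (x : R) : `|x| <= N -> `|x| <= N + 1 by linarith.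
have Vl y x : `|y| <= N -> `|x| <= N -> `|dq (V^~ y) x| <= C.
  move=> yN xN; apply: (@le_trans _ _ L); last by rewrite /C; linarith.
  apply: (dq_bound_on (N := N)) => // u v uN vN.
  by have := VL u v y y; rewrite subrr normr0 addr0; apply=> //; exact: N1.
have Vr y x : `|y| <= N -> `|x| <= N -> `|dq (V y) x| <= C.
  move=> yN xN; apply: (@le_trans _ _ L); last by rewrite /C; linarith.
  apply: (dq_bound_on (N := N)) => // u v uN vN.
  by have := VL y y u v; rewrite subrr normr0 add0r; apply=> //; exact: N1.
have gC x : `|x| <= N -> `|dq g x| <= C.
  move=> xN; apply: (@le_trans _ _ K); last by rewrite /C; linarith.
  exact: (dq_bound_on (N := N)).
have fC x : `|x| <= N -> `|dq (fun x => - f x) x| <= C.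
  move=> xN; apply: (@le_trans _ _ K'); last by rewrite /C; linarith.
  apply: (dq_bound_on (N := N)) => // u v uN vN.
  by rewrite -opprD normrN; exact: fK'.
have inN x : a <= x -> x <= b -> `|x| <= N by exact: normr_le_max.
have lg := geo_g gV; have lf := geo_f gV.
apply/eqP; rewrite -subr_eq0; apply/eqP.
pose D x y := ene V x y - (int2 g x y + int2 f x y).
apply: (additive_zero gV (D := D) (C := 2 * C + 2 * C) ab) => [x z y ax xz zy yb|x y ax xy yb].
  rewrite /D (cs_ene hV xz zy) (int2_cat lg xz zy) (int2_cat lf xz zy).
  move: (ene V x z) (ene V z y) (int2 g x z) (int2 g z y) (int2 f x z) (int2 f z y).
  by clear => *; ring.
have xb : x <= b by linarith.
have ay : a <= y by linarith.
have -> : D x y = (int2 (V^~ y) x y - int2 g x y) +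
    (int2 (V x) x y - int2 (fun t => - f t) x y).
  rewrite /D /ene int2N//; move: (int2 _ x y) (int2 _ x y) (int2 _ x y) (int2 _ x y).
  by clear => *; ring.
rewrite (le_trans (ler_normD _ _))// mulrDl lerD//.
  have -> : n x y = (-1) * (V y y - g y - (V x y - g x)).
    by rewrite /exc; have := exc_diag gV y; rewrite /exc; linarith.
  apply: int2_diff_le => //.
  - exact: lip2_l (geo_lip gV).
  - by right.
  - move=> s t xs st ty; have := exc_mono gV st ty (lexx _); rewrite /exc; linarith.
  - move=> z /andP[xz zy]; have zN := inN z (le_trans ax xz) (le_trans zy yb);
    by split; [exact: Vl (inN y ay yb) zN|exact: gC].
have -> : n x y = 1 * (V x y - - f y - (V x x - - f x)).
  by rewrite /exc; have := exc_diag gV x; rewrite /exc; linarith.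
apply: int2_diff_le => //.
- exact: lip2_r (geo_lip gV).
- exact: loclipN.
- by left.
- move=> s t xs st ty; have := exc_mono gV (lexx x) xs st; rewrite /exc; linarith.
- move=> z /andP[xz zy]; have zN := inN z (le_trans ax xz) (le_trans zy yb);
  by split; [exact: Vr (inN x ax xb) zN|exact: fC].
Qed.

(** Two defects of the same sign with sum zero both vanish. The sign e is - 1 below a contact point,
    where slopes cannot exceed those of the data, and 1 outside the domain of influence, where they
    cannot be smaller. *)
Lemma energy_squeeze (e a b : R) : a <= b -> e = 1 \/ e = -1 ->
  {ae mu, forall s, a < s < b -> 0 <= e * (dq (V^~ b) s ^+ 2 - dq g s ^+ 2)} ->
  {ae mu, forall t, a < t < b -> 0 <= e * (dq (V a) t ^+ 2 - dq f t ^+ 2)} ->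
  {ae mu, forall s, a < s < b -> dq (V^~ b) s ^+ 2 = dq g s ^+ 2}.
Proof.
move=> ab e1 h1 h2.
have lV1 := lip2_l b (geo_lip gV); have lV2 := lip2_r a (geo_lip gV).
have lg := geo_g gV; have lf := geo_f gV.
have E1 : `|e| = 1 by case: e1 => ->; rewrite ?normr1 ?normrN1.
have mk (h k : R -> R) : loclip h -> loclip k ->
   measurable_fun setT (fun s => e * (dq h s ^+ 2 - dq k s ^+ 2)) /\
   mu.-integrable `[a, b] (EFin \o (fun s => e * (dq h s ^+ 2 - dq k s ^+ 2))) /\
   \int[mu]_(s in `[a, b]) (e * (dq h s ^+ 2 - dq k s ^+ 2)) = e * (int2 h a b - int2 k a b).
  move=> lh lk; have mh := measurable_dq2 lh; have mk := measurable_dq2 lk.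
  have ih := integrable_dq2 a b lh; have ik := integrable_dq2 a b lk.
  have i1 : mu.-integrable `[a, b] (EFin \o (fun s => dq h s ^+ 2 - dq k s ^+ 2)).
    rewrite (_ : EFin \o _ = ((EFin \o (fun s => dq h s ^+ 2)%R) \- (EFin \o (fun s => dq k s ^+ 2)%R))%E).
      exact: integrableB.
    by apply/funext => s /=; rewrite EFinB.
  split; first by apply: measurable_funM => //; exact: measurable_funB.
  split.
    rewrite (_ : EFin \o _ = (fun x => e%:E * (EFin \o (fun s => (dq h s ^+ 2 - dq k s ^+ 2)%R)) x)%E)//.
    exact: integrableZl.
  by rewrite RintegralZl// RintegralB.
have [m1 [i1 I1]] := mk _ _ lV1 lg; have [m2 [i2 I2]] := mk _ _ lV2 lf.
have ge0I (h : R -> R) : measurable_fun setT h -> mu.-integrable `[a, b] (EFin \o h) ->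
    {ae mu, forall s, a < s < b -> 0 <= h s} -> 0 <= \int[mu]_(s in `[a, b]) h s.
  move=> mh ih h0.
  rewrite (@ae_eq_Rintegral _ h (fun s => `|h s|))//; last 2 first.
  - exact: measurableT_comp.
  - by apply: ae_imp h0 => x /[apply] /ger0_norm.
  exact: Rintegral_ge0.
have J2 := ge0I _ m2 i2 h2.
have J : \int[mu]_(s in `[a, b]) (e * (dq (V^~ b) s ^+ 2 - dq g s ^+ 2)) <= 0.
  have := ene_eq ab; rewrite /ene => E.
  have : e * (int2 (V^~ b) a b - int2 g a b) + e * (int2 (V a) a b - int2 f a b) = 0.
    rewrite -mulrDr; move: E; move: (int2 _ a b) (int2 _ a b) (int2 _ a b) (int2 _ a b).
    by clear => *; rewrite (_ : _ + _ = 0) ?mulr0//; linarith.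
  rewrite I1 => /eqP; rewrite addr_eq0 => /eqP ->; rewrite oppr_le0 -I2; exact: J2.
apply: ae_imp (Rintegral_ge0_eq0 m1 i1 h1 J) => s h sab; apply/eqP.
have /eqP := h sab; rewrite mulf_eq0 subr_eq0 => /orP[/eqP e0|//].
by move: E1; rewrite e0 normr0 => /esym/eqP; rewrite oner_eq0.
Qed.

Lemma exc_eq0 a b : a <= b ->
  {ae mu, forall s, a < s < b -> dq (V^~ b) s = dq g s} -> n a b = 0.
Proof.
move=> ab h; have lV1 := lip2_l b (geo_lip gV); have lg := geo_g gV.
have := loclip_FTC lV1 ab; have := loclip_FTC lg ab.
rewrite (ae_eq_Rintegral _ _ h); [|exact: measurable_dq..] => ->.
by have := exc_diag gV b; rewrite /exc; linarith.
Qed.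

Lemma ae4 (a b : R) : {ae mu, forall s, [/\ derivable (V^~ b) s 1, derivable g s 1,
   derivable (V a) s 1 & derivable f s 1]}.
Proof.
have := ae_and (ae_and (loclip_derivable (lip2_l b (geo_lip gV))) (loclip_derivable (geo_g gV)))
  (ae_and (loclip_derivable (lip2_r a (geo_lip gV))) (loclip_derivable (geo_f gV))).
by apply: ae_imp => s [[h1 h2] [h3 h4]]; exact: And4 h1 h2 h3 h4.
Qed.

(** Fix a characteristic issuing from the contact point. At a position whose transverse
    characteristic meets no contact, V has the slope of the data (case A). Otherwise [zero_corners]
    produces a zero of V on the fixed characteristic, an interior minimum, where the slope is 0.
    Squared slopes thus never exceed those of the data; by the energy identity they are equal, and
    so are the slopes. *)
Lemma contact_exc0 a b : a <= b -> V a b = 0 -> n a b = 0.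
Proof.
move=> ab Vab.
have caseB s t : a < s -> s <= t -> t <= b -> V s t = 0 -> derivable (V^~ b) s 1 ->
    s < b -> (V^~ b)^`()%classic s = 0.
  move=> as_ st tb Vst dV sb; have [Vsb _] := zero_corners gV (ltW as_) st tb Vab Vst.
  apply/eqP; rewrite eq_le; apply/andP; split.
    apply: (derive_le0_l (d := s - a) dV) => [|h h0 hd]; first linarith.
    by rewrite Vsb; apply: (geo_ge0 gV); linarith.
  apply: (derive_ge0_r (d := b - s) dV) => [|h h0 hd]; first linarith.
  by rewrite Vsb; apply: (geo_ge0 gV); linarith.
have caseB' s t : a <= s -> s <= t -> t < b -> V s t = 0 -> derivable (V a) t 1 ->
    a < t -> (V a)^`()%classic t = 0.
  move=> as_ st tb Vst dV at_; have [_ Vat] := zero_corners gV as_ st (ltW tb) Vab Vst.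
  apply/eqP; rewrite eq_le; apply/andP; split.
    apply: (derive_le0_l (d := t - a) dV) => [|h h0 hd]; first linarith.
    by rewrite Vat; apply: (geo_ge0 gV); linarith.
  apply: (derive_ge0_r (d := b - t) dV) => [|h h0 hd]; first linarith.
  by rewrite Vat; apply: (geo_ge0 gV); linarith.
have sq : {ae mu, forall s, a < s < b -> dq (V^~ b) s ^+ 2 = dq g s ^+ 2}.
  apply: (@energy_squeeze (-1)) => //; first by right.
    apply: ae_imp (ae4 a b) => s [dV dg _ _] /andP[as_ sb]; rewrite (derive_dq dV) (derive_dq dg).
    have V0 t : s <= t <= b -> 0 <= V s t by move=> /andP[? _]; exact: (geo_ge0 gV).
    have [pos|[t /andP[st tb] Vst]] := caseAP V0.
      by rewrite (derive_caseA gV sb pos dg) subrr mulr0.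
    rewrite (caseB s t)//; have := sqr_ge0 (g^`()%classic s); linarith.
  apply: ae_imp (ae4 a b) => t [_ _ dV df] /andP[at_ tb]; rewrite (derive_dq dV) (derive_dq df).
  have [pos|/existsNP[s /not_implyP[/andP[as_ st] /negP]]] := pselect (forall s, a <= s <= t -> 0 < V s t).
    by rewrite (derive_caseA' gV at_ pos df) sqrrN subrr mulr0.
  rewrite -leNgt => Vst; have {}Vst : V s t = 0.
    by apply/eqP; rewrite eq_le Vst (geo_ge0 gV).
  rewrite (caseB' s t)//; have := sqr_ge0 (f^`()%classic t); linarith.
apply: exc_eq0 => //.
apply: ae_imp (ae_and sq (ae4 a b)) => s [+ [dV dg _ _]] sab.
have /andP[as_ sb] := sab => /(_ sab); rewrite (derive_dq dV) (derive_dq dg).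
have V0 t : s <= t <= b -> 0 <= V s t by move=> /andP[? _]; exact: (geo_ge0 gV).
have [pos _|[t /andP[st tb] Vst]] := caseAP V0.
  exact: (derive_caseA gV sb pos dg).
rewrite (caseB s t)// expr0n /= => /esym/eqP.
by rewrite expf_eq0 /= => /eqP.
Qed.

Lemma contact_free a b : a <= b -> V a b = 0 -> g a = f b.
Proof. by move=> ab Vab; have := contact_exc0 ab Vab; rewrite /exc Vab; linarith. Qed.

(** If (s, t) is a contact point, then g s = f t by [contact_free], so s minimizes g over [a, s] and
    g' <= 0 there. Monotonicity of the excess gives V' <= g', hence V'^2 >= g'^2; in case A the
    slopes agree. Equality of energies then gives equal squares, and V' <= g' <= 0 removes the
    ambiguity of sign. The argument in b is the same. *)
Lemma no_influence_exc0 a b : a <= b ->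
  (forall s t, a <= s -> s <= t -> t <= b -> f t <= g s) -> n a b = 0.
Proof.
move=> ab w0.
have Vg s : a < s -> s < b -> derivable (V^~ b) s 1 -> derivable g s 1 ->
    (V^~ b)^`()%classic s <= g^`()%classic s.
  move=> as_ sb dV dg; have [dd E] := derive1_sub dV dg; rewrite -subr_le0 -E.
  apply: (derive_le0_r (d := b - s) dd) => [|h h0 hd]; first linarith.
  have := @exc_mono _ _ _ _ gV s (s + h) b b; rewrite /exc => H.
  by have := H ltac:(linarith) ltac:(linarith) ltac:(linarith); linarith.
have Vf t : a < t -> t < b -> derivable (V a) t 1 -> derivable f t 1 ->
    - f^`()%classic t <= (V a)^`()%classic t.
  move=> at_ tb dV df.
  have dN : derivable (- f) t 1 by exact: derivableN.
  have [dd E] := derive1_sub dV dN.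
  rewrite !derive1E -(@deriveN _ _ _ f t 1 df) -!derive1E -subr_ge0 -E.
  apply: (derive_ge0_r (d := b - t) dd) => [|h h0 hd]; first linarith.
  rewrite -[(- f) t]/(- f t) -[(- f) _]/(- f (t + h)).
  have := @exc_mono _ _ _ _ gV a a t (t + h); rewrite /exc => H.
  by have := H ltac:(linarith) ltac:(linarith) ltac:(linarith); linarith.
have caseB s t : a < s -> s <= t -> t <= b -> V s t = 0 -> derivable g s 1 ->
    g^`()%classic s <= 0.
  move=> as_ st tb Vst dg; have E := contact_free st Vst.
  apply: (derive_le0_l (d := s - a) dg) => [|h h0 hd]; first linarith.
  by rewrite E; apply: w0; linarith.
have caseB' s t : a <= s -> s <= t -> t < b -> V s t = 0 -> derivable f t 1 ->
    f^`()%classic t <= 0.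
  move=> as_ st tb Vst df; have E := contact_free st Vst.
  apply: (derive_le0_r (d := b - t) df) => [|h h0 hd]; first linarith.
  by rewrite -E; apply: w0; linarith.
have sq : {ae mu, forall s, a < s < b -> dq (V^~ b) s ^+ 2 = dq g s ^+ 2}.
  apply: (@energy_squeeze 1) => //; first by left.
    apply: ae_imp (ae4 a b) => s [dV dg _ _] /andP[as_ sb]; rewrite (derive_dq dV) (derive_dq dg) mul1r.
    have V0 t : s <= t <= b -> 0 <= V s t by move=> /andP[? _]; exact: (geo_ge0 gV).
    have [pos|[t /andP[st tb] Vst]] := caseAP V0.
      by rewrite (derive_caseA gV sb pos dg) subrr.
    have h1 := caseB s t as_ st tb Vst dg; have h2 := Vg s as_ sb dV dg.
    by rewrite subr_sqr mulr_le0//; linarith.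
  apply: ae_imp (ae4 a b) => t [_ _ dV df] /andP[at_ tb]; rewrite (derive_dq dV) (derive_dq df) mul1r.
  have [pos|/existsNP[s /not_implyP[/andP[as_ st] /negP]]] := pselect (forall s, a <= s <= t -> 0 < V s t).
    by rewrite (derive_caseA' gV at_ pos df) sqrrN subrr.
  rewrite -leNgt => Vst; have {}Vst : V s t = 0.
    by apply/eqP; rewrite eq_le Vst (geo_ge0 gV).
  have h1 := caseB' s t as_ st tb Vst df; have h2 := Vf t at_ tb dV df.
  by rewrite subr_sqr mulr_ge0//; linarith.
apply: exc_eq0 => //.
apply: ae_imp (ae_and sq (ae4 a b)) => s [+ [dV dg _ _]] sab.
have /andP[as_ sb] := sab => /(_ sab); rewrite (derive_dq dV) (derive_dq dg).
have V0 t : s <= t <= b -> 0 <= V s t by move=> /andP[? _]; exact: (geo_ge0 gV).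
have [pos _|[t /andP[st tb] Vst] /eqP] := caseAP V0.
  exact: (derive_caseA gV sb pos dg).
have h1 := caseB s t as_ st tb Vst dg; have h2 := Vg s as_ sb dV dg.
by rewrite eqf_sqr => /orP[/eqP//|/eqP E]; linarith.
Qed.

End OneCharSol.

End Energy.

(** * Uniqueness in characteristic coordinates *)

Section Uniqueness.
Context {R : realType}.
Notation mu := (@lebesgue_measure R).

Definition influenced (g f : R -> R) (a b : R) :=
  exists s t : R, [/\ a <= s, s <= t, t <= b & g s < f t].

Lemma influencedS g f (a a' b b' : R) : a' <= a -> b <= b' ->
  influenced g f a b -> influenced g f a' b'.
Proof.
by move=> aa bb [s [t [as_ st tb gf]]]; exists s, t; split => //; linarith.
Qed.

Section OneSolution.
Variables (g f : R -> R) (V : R -> R -> R).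
Hypothesis hV : charsol g f V.
Let gV : geo g f V. Proof. exact: cs_geo hV. Qed.

Lemma not_influencedE a b : a <= b -> ~ influenced g f a b -> V a b = g a - f b.
Proof.
move=> ab nI; have : exc g f V a b = 0.
  apply: (no_influence_exc0 hV ab) => s t as_ st tb.
  by rewrite leNgt; apply/negP => gf; apply: nI; exists s, t.
by rewrite /exc; linarith.
Qed.

Lemma influenced_exc a b : influenced g f a b -> 0 < exc g f V a b.
Proof.
move=> [s [t [as_ st tb gf]]]; apply: lt_le_trans (exc_mono gV as_ st tb).
by have := geo_ge0 gV st; rewrite /exc; linarith.
Qed.

(** Contact would make the excess vanish, whereas V >= 0 makes it positive after any point where the
    free wave is negative. Contact is thus confined to points outside the domain of influence. *)
Lemma influenced_gt0 a b : influenced g f a b -> 0 < V a b.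
Proof.
move=> I; have ab : a <= b by case: I => [s [t [? ? ? _]]]; linarith.
rewrite lt_neqAle (geo_ge0 gV ab) andbT; apply/eqP => V0.
by have := influenced_exc I; rewrite (contact_exc0 hV)// ltxx.
Qed.

Lemma pos_nbhd s0 t0 : 0 < V s0 t0 -> exists2 d : R, 0 < d & forall s t,
  `|s - s0| <= d -> `|t - t0| <= d -> 0 < V s t.
Proof.
move=> V0; have [L L0 VL] := geo_lip gV (Num.max `|s0| `|t0| + 1).
have L1 : 0 < 2 * L + 1 by rewrite ltr_wpDl// mulr_ge0.
pose d := Num.min (V s0 t0 / (2 * (2 * L + 1))) 1.
have d0 : 0 < d by rewrite lt_min divr_gt0//= ?mulr_gt0.
have [d1 d2] : d <= V s0 t0 / (2 * (2 * L + 1)) /\ d <= 1.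
  by rewrite /d !ge_min !lexx !orbT.
have Ld : 2 * ((2 * L + 1) * d) <= V s0 t0.
  by move: d1; rewrite ler_pdivlMr ?mulr_gt0// mulrC mulrA.
have near (x y : R) : `|y - x| <= d -> `|y| <= `|x| + 1.
  by move=> h; have := ler_normD (y - x) x; rewrite subrK; linarith.
exists d => // s t hs ht.
have m1 : `|s0| <= Num.max `|s0| `|t0| by rewrite le_max lexx.
have m2 : `|t0| <= Num.max `|s0| `|t0| by rewrite le_max lexx orbT.
have := VL s s0 t t0; have hs' := near _ _ hs; have ht' := near _ _ ht.
move=> /(_ (le_trans hs' (lerD m1 (lexx 1)))) h.
have {h} := h (ler_wpDr ler01 m1) (le_trans ht' (lerD m2 (lexx 1))) (ler_wpDr ler01 m2).
rewrite ler_norml => /andP[h _].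
have : L * (`|s - s0| + `|t - t0|) <= L * (d + d) by rewrite ler_wpM2l// lerD.
have : 0 <= L * d by rewrite mulr_ge0// ltW.
move: h Ld d0 V0; clear; linarith.
Qed.

End OneSolution.

Section Front.
Variables (g f : R -> R).
Hypothesis lg : loclip g.
Hypothesis lf : loclip f.
Hypothesis fg : forall x, f x <= g x.
Variables (a0 b0 : R).
Hypothesis I0 : influenced g f a0 b0.

(* The boundary of the domain of influence is the graph [t = front x]. *)
Definition front (x : R) : R := inf [set h | 0 <= h /\ influenced g f (x - h) (x + h)].

Let ab0 : a0 <= b0.
Proof. by case: I0 => [s [t [? ? ? _]]]; linarith. Qed.

Lemma front_has_inf x : has_inf [set h | 0 <= h /\ influenced g f (x - h) (x + h)].
Proof.
split; last by exists 0 => h [].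
exists (`|x - a0| + `|b0 - x|); split; first by rewrite addr_ge0.
apply: influencedS I0.
  by have := ler_norm (x - a0); have := normr_ge0 (b0 - x); linarith.
by have := ler_norm (b0 - x); have := normr_ge0 (x - a0); linarith.
Qed.

Lemma front_ge0 x : 0 <= front x.
Proof. by apply: lb_le_inf; [case: (front_has_inf x)|move=> h []]. Qed.

Lemma front_le x h : 0 <= h -> influenced g f (x - h) (x + h) -> front x <= h.
Proof. by move=> h0 I; apply: ge_inf => //; case: (front_has_inf x). Qed.

Lemma front_lt x h : front x < h -> influenced g f (x - h) (x + h).
Proof.
move=> xh; have e0 : 0 < h - front x by rewrite subr_gt0.
have [k [k0 Ik] kh] := inf_adherent e0 (front_has_inf x).
by apply: influencedS Ik; move: kh; rewrite -/(front x); linarith.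
Qed.

(** The domain of influence contains the future cone of each of its points, so its boundary has
    slope at most one; both characteristic coordinates [fl] and [fr] are therefore nondecreasing
    along it. *)
Lemma front_lip x y : front y <= front x + `|x - y|.
Proof.
apply/ler_addgt0Pr => e e0; apply: front_le.
  by have := front_ge0 x; have := normr_ge0 (x - y); linarith.
have xe : front x < front x + e by rewrite ltrDl.
apply: influencedS (front_lt xe).
  by have := ler_norm (y - x); rewrite distrC; linarith.
by have := ler_norm (x - y); linarith.
Qed.

Definition fl (x : R) : R := x - front x.
Definition fr (x : R) : R := x + front x.

Lemma fl_ndecr : {homo fl : x y / x <= y}.
Proof.
move=> x y xy; rewrite /fl; have := front_lip x y.
by rewrite distrC ger0_norm ?subr_ge0//; linarith.
Qed.

Lemma fr_ndecr : {homo fr : x y / x <= y}.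
Proof.
move=> x y xy; rewrite /fr; have := front_lip y x.
by rewrite ger0_norm ?subr_ge0//; linarith.
Qed.

Lemma fl_le_fr x : fl x <= fr x.
Proof. by rewrite /fl /fr; have := front_ge0 x; linarith. Qed.

Lemma front_dist x y : `|front x - front y| <= `|x - y|.
Proof.
have := front_lip x y; have := front_lip y x; rewrite (distrC y x) ler_norml.
by move=> *; apply/andP; split; linarith.
Qed.

Lemma front_overlap (d x x1 x2 y : R) : 0 < d -> d <= front x -> d <= x - x1 -> d <= x2 - x ->
  `|y - x| <= d / 2 -> [/\ fl y <= fr x, fl x <= fr y, `|y - x| <= d, x1 <= y & y <= x2].
Proof.
move=> d0 e3 e4 e5 yd; have := front_dist y x; move: (yd); rewrite /fl /fr !ler_norml.
by move=> /andP[y1 y2] /andP[f1 f2]; split; rewrite ?ler_norml; try (apply/andP; split); linarith.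
Qed.

Lemma fl_dist x y : `|fl x - fl y| <= 2 * `|x - y|.
Proof.
rewrite /fl (_ : _ - _ = (x - y) - (front x - front y)); last by ring.
by rewrite (le_trans (ler_normB _ _))// mulr_natl mulr2n lerD// front_dist.
Qed.

Lemma fr_dist x y : `|fr x - fr y| <= 2 * `|x - y|.
Proof.
rewrite /fr (_ : _ - _ = (x - y) + (front x - front y)); last by ring.
by rewrite (le_trans (ler_normD _ _))// mulr_natl mulr2n lerD// front_dist.
Qed.

Lemma loclip_fl : loclip fl.
Proof. by move=> N; exists 2 => // x y _ _; exact: fl_dist. Qed.

Lemma loclip_fr : loclip fr.
Proof. by move=> N; exists 2 => // x y _ _; exact: fr_dist. Qed.

Lemma front_future x s t : s < fl x -> fr x < t -> influenced g f s t.
Proof.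
rewrite /fl /fr => sx xt.
have h : front x < Num.min (x - s) (t - x) by rewrite lt_min; linarith.
have [h1 h2] : Num.min (x - s) (t - x) <= x - s /\ Num.min (x - s) (t - x) <= t - x.
  by rewrite !ge_min !lexx orbT.
by apply: influencedS (front_lt h); linarith.
Qed.

(** The strict inequality g s < f t survives moving s and t inwards by a small d, with s < t because
    f <= g. An influenced point of the front would therefore have an influenced point strictly below
    it. *)
Lemma front_not_influenced x : ~ influenced g f (fl x) (fr x).
Proof.
move=> [s [t [ls st tr gf]]].
have {}st : s < t.
  by rewrite lt_neqAle st andbT; apply/eqP => E; have := fg s; rewrite -E in gf; linarith.
pose N : R := Num.max `|s| `|t|.
have [K K0 gK] := lg N; have [L L0 fL] := lf N.
have KL : 0 < K + L + 1 by linarith.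
pose d := Num.min ((t - s) / 2) ((f t - g s) / 2 / (K + L + 1)).
have d0 : 0 < d by rewrite lt_min !divr_gt0// subr_gt0.
have [d1 d2] : d <= (t - s) / 2 /\ d <= (f t - g s) / 2 / (K + L + 1).
  by rewrite /d !ge_min !lexx orbT.
have d3 : (K + L + 1) * d <= (f t - g s) / 2 by rewrite -ler_pdivlMl// mulrC.
have inN z : s <= z -> z <= t -> `|z| <= N by exact: normr_le_max.
have : influenced g f (s + d) (t - d).
  exists (s + d), (t - d); split => //; first linarith.
  have h1 : s <= s + d by linarith.
  have h2 : s + d <= t by linarith.
  have h3 : s <= t - d by linarith.
  have h4 : t - d <= t by linarith.
  have := gK (s + d) s (inN _ h1 h2) (inN _ (lexx _) (ltW st)).
  have := fL t (t - d) (inN _ (ltW st) (lexx _)) (inN _ h3 h4).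
  have -> : t - (t - d) = d by ring.
  have -> : s + d - s = d by ring.
  rewrite (gtr0_norm d0) !ler_norml => /andP[_ ?] /andP[_ ?].
  have E : (K + L + 1) * d = K * d + L * d + d by ring.
  by linarith.
move=> I; have : front x <= front x - d.
  apply: front_le; first by move: ls tr; rewrite /fl /fr; linarith.
  by apply: influencedS I; move: ls tr; rewrite /fl /fr; linarith.
linarith.
Qed.

(** These are the points where the two past characteristics of (a0, b0) cross the front; the
    midpoint c separates them. *)
Lemma front_ends : exists x1 x2 : R, [/\ x1 <= x2, fl x1 = a0 & fr x2 = b0].
Proof.
pose c := (a0 + b0) / 2.
have fc : front c <= (b0 - a0) / 2.
  apply: front_le; first by rewrite divr_ge0// subr_ge0.
  by apply: influencedS I0; rewrite /c; linarith.
have cl_ : {within `[a0, c], continuous fl}.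
  by apply: continuous_subspaceT; exact: loclip_continuous loclip_fl.
have cr_ : {within `[c, b0], continuous fr}.
  by apply: continuous_subspaceT; exact: loclip_continuous loclip_fr.
have ac : a0 <= c by rewrite /c; move: ab0; linarith.
have cb : c <= b0 by rewrite /c; move: ab0; linarith.
have [|x1 x1ac E1] := @IVT R fl a0 c a0 ac cl_.
  have h1 : fl a0 <= a0 by rewrite /fl; have := front_ge0 a0; linarith.
  have h2 : a0 <= fl c by rewrite /fl; move: fc; rewrite /c; linarith.
  by rewrite ge_min h1/= le_max h2 orbT.
have [|x2 x2cb E2] := @IVT R fr c b0 b0 cb cr_.
  have h1 : b0 <= fr b0 by rewrite /fr; have := front_ge0 b0; linarith.
  have h2 : fr c <= b0 by rewrite /fr; move: fc; rewrite /c; linarith.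
  by rewrite ge_min h2/= le_max h1 orbT.
exists x1, x2; split => //; move: x1ac x2cb; rewrite !in_itv/=.
by move=> /andP[_ ?] /andP[? _]; linarith.
Qed.

End Front.

Lemma derive_comp_eq0 (p A : R -> R) (x : R) : loclip p -> loclip A ->
  derivable (fun y => p (A y)) x 1 -> derivable A x 1 -> A^`()%classic x = 0 ->
  (fun y => p (A y))^`()%classic x = 0.
Proof.
move=> lp lA dpA dA A0; have [L L0 AL] := lA (`|x| + 1).
have [K K0 pK] := lp (`|A x| + L).
apply/eqP; rewrite -normr_eq0 eq_le normr_ge0 andbT.
have cA := derive_seqr dA; rewrite A0 in cA.
have cn : (fun n => `|n.+1%:R * (p (A (x + n.+1%:R^-1)) - p (A x))|) @ \oo -->
    `|(fun y => p (A y))^`()%classic x| by exact: (cvg_norm (derive_seqr dpA)).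
have cK : (fun n => K * `|n.+1%:R * (A (x + n.+1%:R^-1) - A x)|) @ \oo --> (0 : R).
  rewrite -[X in _ --> X](mulr0 K); apply: cvgM; first exact: cvg_cst.
  by rewrite -(normr0 R); exact: cvg_norm.
apply: (ler_cvg_to cn cK); near=> n.
rewrite !normrM mulrCA ler_wpM2l//.
have n0 : `|n.+1%:R^-1 : R| <= 1 by rewrite ger0_norm// invf_le1// ler1n.
have h1 : `|x + n.+1%:R^-1| <= `|x| + 1 by rewrite (le_trans (ler_normD _ _))// lerD2l.
have h2 : `|x| <= `|x| + 1 by rewrite lerDl.
apply: pK; last by rewrite lerDl.
have := AL _ _ h1 h2; rewrite addrAC subrr add0r => h.
have {}h : `|A (x + n.+1%:R^-1) - A x| <= L.
  by apply: le_trans h _; rewrite ler_piMr.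
by have := ler_normD (A (x + n.+1%:R^-1) - A x) (A x); rewrite subrK; linarith.
Unshelve. all: by end_near. Qed.

(** Here v, u are the slopes of the two solutions in a, v2, u2 those in b, and al, be the
    derivatives of the front coordinates. Subtracting v2 + u2 times the momentum law from the energy
    law leaves d (v + u - v2 - u2) = 0. The second factor is a sum of four nonpositive terms, so if
    it vanishes then v = u = 0, and d = 0 in any case. *)
Lemma reflection_algebra (v u v2 u2 al be : R) : v <= 0 -> u <= 0 -> 0 <= v2 -> 0 <= u2 ->
  (v - u) * al + (v2 - u2) * be = 0 ->
  (v ^+ 2 - u ^+ 2) * al + (v2 ^+ 2 - u2 ^+ 2) * be = 0 -> (v - u) * al = 0.
Proof.
move=> v0 u0 v20 u20 E1 E2; set d := (v - u) * al in E1 *.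
have : d * (v + u - (v2 + u2)) = 0.
  have -> : d * (v + u - (v2 + u2)) = (v ^+ 2 - u ^+ 2) * al + (v2 ^+ 2 - u2 ^+ 2) * be
    - (v2 + u2) * (d + (v2 - u2) * be) by rewrite /d; ring.
  by rewrite E1 E2; ring.
move=> /eqP; rewrite mulf_eq0 => /orP[/eqP//|/eqP E3].
have E : v = u by linarith.
by rewrite /d E subrr mul0r.
Qed.

Lemma derive_comp_sub (p q A : R -> R) (x : R) : derivable p (A x) 1 ->
  derivable q (A x) 1 -> derivable A x 1 ->
  (fun y => p (A y) - q (A y))^`()%classic x = (p^`()%classic (A x) - q^`()%classic (A x)) * A^`()%classic x.
Proof.
move=> dp dq dA; have [d E] := derive1_sub dp dq.
by rewrite -E -(derive1_comp dA d).
Qed.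

Lemma derivable_comp1 (p A : R -> R) (x : R) : derivable p (A x) 1 -> derivable A x 1 ->
  derivable (p \o A) x 1.
Proof.
by move=> /derivable1_diffP dp /derivable1_diffP dA; apply: diff_derivable; exact: differentiable_comp.
Qed.

Lemma corner_cancel (s1 s2 v1 v2 u1 u2 c d : R) :
  u1 + s1 + (s2 + u2) = c + d -> v1 + s1 + (s2 + v2) = c + d -> v1 - u1 + (v2 - u2) = 0.
Proof. by move=> *; linarith. Qed.

Lemma primitive_cancel (v1 v2 u1 u2 F1 F2 G1 G2 : R) :
  v1 - u1 + (v2 - u2) = 0 -> F2 - F1 = v1 - u1 -> G2 - G1 = v2 - u2 -> F1 + G1 = F2 + G2.
Proof. by move=> *; linarith. Qed.

Lemma between_near (p q c s e : R) : `|p - c| <= e -> `|q - c| <= e -> p <= s <= q ->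
  `|s - c| <= e.
Proof.
by rewrite !ler_norml => /andP[? _] /andP[_ ?] /andP[? ?]; apply/andP; split; lra.
Qed.

Section TwoSolutions.
Variables (g f : R -> R) (V U : R -> R -> R).
Hypothesis hV : charsol g f V.
Hypothesis hU : charsol g f U.
Let gV : geo g f V. Proof. exact: cs_geo hV. Qed.
Let gU : geo g f U. Proof. exact: cs_geo hU. Qed.
Variables (a0 b0 : R).
Hypothesis I0 : influenced g f a0 b0.
Let lg : loclip g. Proof. exact: geo_g gV. Qed.
Let lf : loclip f. Proof. exact: geo_f gV. Qed.
Let fg x : f x <= g x.
Proof. by have := geo_ge0 gV (lexx x); rewrite (geo_diag gV); linarith. Qed.
Local Notation A := (fl g f).
Local Notation B := (fr g f).
Let D a b := V a b - U a b.

Lemma D_eq0 a b : a <= b -> ~ influenced g f a b -> D a b = 0.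
Proof.
by move=> ab nI; rewrite /D (not_influencedE hV)// (not_influencedE hU)// subrr.
Qed.

Lemma front_free x s t : A x <= s -> t <= B x -> ~ influenced g f s t.
Proof.
by move=> h1 h2 I; apply: (front_not_influenced lg lf fg I0 (x := x)); exact: influencedS I.
Qed.

Lemma fl_fr x : A x <= B x. Proof. exact: fl_le_fr I0 _. Qed.

Lemma D_front x : D (A x) (B x) = 0.
Proof. exact: D_eq0 (fl_fr x) (front_free (lexx _) (lexx _)). Qed.

(** Beyond the front there is no contact. The near corner of the rectangle may lie on the front
    itself, which is why [mod_open] tolerates zeros on the two adjacent sides. *)
Lemma modI W x s1 s2 t1 t2 : charsol g f W -> s1 <= s2 -> s2 <= A x -> B x <= t1 -> t1 <= t2 ->
  W s1 t1 + W s2 t2 = W s1 t2 + W s2 t1.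
Proof.
move=> hW s12 s2A Bt1 t12; have ABx := fl_fr x.
apply: (mod_open (cs_geo hW)) => //; first linarith.
move=> s t /andP[h1 h2] /andP[h3 h4]; apply: (influenced_gt0 hW).
by apply: (front_future I0 (x := x)); linarith.
Qed.

Variables (x1 x2 : R).
Hypothesis x12 : x1 <= x2.
Hypothesis E1 : A x1 = a0.
Hypothesis E2 : B x2 = b0.

Lemma fl_ge x : x1 <= x -> a0 <= A x. Proof. by rewrite -E1; exact: fl_ndecr I0 _ _. Qed.
Lemma fr_le x : x <= x2 -> B x <= b0. Proof. by rewrite -E2; exact: fr_ndecr I0 _ _. Qed.
Lemma fl_homo x y : x <= y -> A x <= A y. Proof. exact: fl_ndecr I0 _ _. Qed.
Lemma fr_homo x y : x <= y -> B x <= B y. Proof. exact: fr_ndecr I0 _ _. Qed.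

(** Traces of the difference of the solutions on the sides b = b0 and a = a0, where the
    characteristics leaving the front at x arrive. *)
Let D1 x := D (A x) b0.
Let D2 x := D a0 (B x).

(** The difference vanishes on the front and satisfies the rectangle identity beyond it. Uniqueness
    at (a0, b0) is thereby the constancy of [D1] along the front. *)
Lemma D_corner x y : x1 <= x -> x <= y -> y <= x2 -> D (A x) (B y) = D1 x - D1 y.
Proof.
move=> h1 h2 h3; rewrite /D1 /D.
have := modI hV (fl_homo h2) (lexx _) (lexx _) (fr_le h3).
have := modI hU (fl_homo h2) (lexx _) (lexx _) (fr_le h3).
by have := D_front y; rewrite /D; linarith.
Qed.

Lemma D_corner' x y : x1 <= x -> x <= y -> y <= x2 -> D (A x) (B y) = D2 y - D2 x.
Proof.
move=> h1 h2 h3; rewrite /D2 /D.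
have := modI hV (fl_ge h1) (lexx _) (lexx _) (fr_homo h2).
have := modI hU (fl_ge h1) (lexx _) (lexx _) (fr_homo h2).
by have := D_front x; rewrite /D; linarith.
Qed.

Lemma lV1 b : loclip (V^~ b). Proof. exact: lip2_l (geo_lip gV). Qed.
Lemma lU1 b : loclip (U^~ b). Proof. exact: lip2_l (geo_lip gU). Qed.
Lemma lV2 a : loclip (V a). Proof. exact: lip2_r (geo_lip gV). Qed.
Lemma lU2 a : loclip (U a). Proof. exact: lip2_r (geo_lip gU). Qed.

(** Energy identity on the triangle with apex (A x, B y). Before the front both solutions are the
    free wave and their contributions cancel; beyond it the slope in a is independent of b and
    conversely, so the remaining terms can be moved to the sides b = b0 and a = a0. *)
Lemma energy_front x y : x1 <= x -> x <= y -> y <= x2 ->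
  int2 (V^~ b0) (A x) (A y) - int2 (U^~ b0) (A x) (A y) +
  (int2 (V a0) (B x) (B y) - int2 (U a0) (B x) (B y)) = 0.
Proof.
move=> h1 h2 h3.
have xy : A x <= B y := le_trans (fl_homo h2) (fl_fr y).
have yb : B y <= b0 by exact: fr_le.
have ax : a0 <= A x by exact: fl_ge.
have shiftl W : charsol g f W -> int2 (W^~ (B y)) (A x) (A y) = int2 (W^~ b0) (A x) (A y).
  move=> hW; have gW := cs_geo hW; apply: int2_eq; [exact: lip2_l (geo_lip gW)..|].
  have key s t : s <= t -> t < A y -> W s (B y) - W s b0 = W t (B y) - W t b0.
    by move=> st ty; have := modI hW st (ltW ty) (lexx _) yb; linarith.
  move=> s t /andP[_ sy] /andP[_ ty]; have [st|ts] := orP (le_total s t); first exact: key.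
  by apply/esym; exact: key.
have shiftr W : charsol g f W -> int2 (W (A x)) (B x) (B y) = int2 (W a0) (B x) (B y).
  move=> hW; have gW := cs_geo hW; apply: int2_eq; [exact: lip2_r (geo_lip gW)..|].
  have key s t : s <= t -> B x < s -> W (A x) s - W a0 s = W (A x) t - W a0 t.
    by move=> st ty; have := modI hW ax (lexx _) (ltW ty) st; linarith.
  move=> s t /andP[sx _] /andP[tx _]; have [st|ts] := orP (le_total s t); first exact: key.
  by apply/esym; exact: key.
have same1 : int2 (V^~ (B y)) (A y) (B y) = int2 (U^~ (B y)) (A y) (B y).
  have z s : A y < s < B y -> V s (B y) - U s (B y) = 0.
    by move=> /andP[s1 s2]; exact: D_eq0 (ltW s2) (front_free (ltW s1) (lexx (B y))).
  by apply: (int2_eq (lV1 (B y)) (lU1 (B y))) => s t hs ht; rewrite !z.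
have same2 : int2 (V (A x)) (A x) (B x) = int2 (U (A x)) (A x) (B x).
  have z s : A x < s < B x -> V (A x) s - U (A x) s = 0.
    by move=> /andP[s1 s2]; exact: D_eq0 (ltW s1) (front_free (lexx (A x)) (ltW s2)).
  by apply: (int2_eq (lV2 (A x)) (lU2 (A x))) => s t hs ht; rewrite !z.
have := ene_eq hV xy; have := ene_eq hU xy; rewrite /ene.
rewrite (int2_cat (lV1 (B y)) (fl_homo h2) (fl_fr y)) (int2_cat (lU1 (B y)) (fl_homo h2) (fl_fr y)).
rewrite (int2_cat (lV2 (A x)) (fl_fr x) (fr_homo h2)) (int2_cat (lU2 (A x)) (fl_fr x) (fr_homo h2)).
rewrite (shiftl _ hV) (shiftl _ hU) (shiftr _ hV) (shiftr _ hU) same1 same2.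
exact: corner_cancel.
Qed.

(** If the front touched the diagonal where V = g - f > 0, then by continuity g s > f t for all s, t
    near x, against influenced points arbitrarily close. *)
Lemma noncontact_gap x : 0 < V (A x) (B x) -> 0 < front g f x.
Proof.
move=> V0; rewrite lt_neqAle (front_ge0 I0) andbT; apply/eqP => fx0.
move: V0; rewrite /fl /fr -fx0 subr0 addr0 (geo_diag gV) => V0.
have cgf : (fun y => g y - f y) @ x --> g x - f x.
  by apply: cvgB; [exact: loclip_continuous lg x|exact: loclip_continuous lf x].
pose N : R := `|x| + 1.
have [K K0 gK] := lg N; have [L L0 fL] := lf N.
have KL : 0 < K + L + 1 by linarith.
pose d := Num.min 1 ((g x - f x) / 2 / (K + L + 1)).
have d0 : 0 < d by rewrite lt_min ltr01 !divr_gt0// subr_gt0.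
have [d1 d2] : d <= 1 /\ d <= (g x - f x) / 2 / (K + L + 1).
  by rewrite /d !ge_min !lexx !orbT.
have d3 : (K + L + 1) * d <= (g x - f x) / 2 by rewrite -ler_pdivlMl// mulrC.
have fd : front g f x < d by rewrite -fx0.
have [s [t [xs st tx gf]]] := front_lt I0 fd.
have nr y : x - d <= y -> y <= x + d -> `|y - x| <= d.
  by move=> ? ?; rewrite ler_norml; apply/andP; split; linarith.
have inN y : `|y - x| <= d -> `|y| <= N.
  by move=> h; rewrite /N; have := ler_normD (y - x) x; rewrite subrK; linarith.
have xN : `|x| <= N by rewrite /N; linarith.
have sd := nr s xs ltac:(linarith); have td := nr t ltac:(linarith) tx.
have h1 : `|g s - g x| <= K * d by apply: le_trans (gK _ _ (inN _ sd) xN) _; rewrite ler_wpM2l.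
have h2 : `|f t - f x| <= L * d by apply: le_trans (fL _ _ (inN _ td) xN) _; rewrite ler_wpM2l.
move: h1 h2; rewrite !ler_norml => /andP[h1 _] /andP[_ h2].
have E : (K + L + 1) * d = K * d + L * d + d by ring.
by rewrite E in d3; linarith.
Qed.

(** The rectangle straddles the front: two corners lie on it and one before it, and D vanishes at
    all three. Without contact the rectangle identity makes D vanish at the fourth. *)
Lemma D1_rect y z : x1 <= y -> y <= z -> z <= x2 -> A z <= B y ->
  (forall s t, A y <= s <= A z -> B y <= t <= B z -> 0 < V s t /\ 0 < U s t) -> D1 y = D1 z.
Proof.
move=> xy yz zx ZY pos; suff: D (A y) (B z) = 0.
  by rewrite D_corner// => /eqP; rewrite subr_eq0 => /eqP.
have := geo_mod gV (fl_homo yz) ZY (fr_homo yz) (fun s t hs ht => proj1 (pos s t hs ht)).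
have := geo_mod gU (fl_homo yz) ZY (fr_homo yz) (fun s t hs ht => proj2 (pos s t hs ht)).
have := D_front y; have := D_front z.
have : D (A z) (B y) = 0 by exact: D_eq0 ZY (front_free (fl_homo yz) (lexx (B y))).
by rewrite /D; linarith.
Qed.

Lemma noncontact_const x : x1 < x -> x < x2 -> 0 < V (A x) (B x) ->
  D1^`()%classic x = 0.
Proof.
move=> h1 h2 V0; have gap := noncontact_gap V0.
have U0 : 0 < U (A x) (B x).
  by move: (D_front x); rewrite /D => /eqP; rewrite subr_eq0 => /eqP <-.
have [dV dV0 hdV] := pos_nbhd hV V0; have [dU dU0 hdU] := pos_nbhd hU U0.
(* The halves are due to the constant 2 in [fl_dist] and [fr_dist]; the term [front g f x] keeps A z
   <= B y, so that the rectangles stay in nonnegative time. *)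
pose d := Num.min (Num.min (dV / 2) (dU / 2)) (Num.min (front g f x) (Num.min (x - x1) (x2 - x))).
have d0 : 0 < d.
  by rewrite !lt_min !divr_gt0//= gap !subr_gt0 h1 h2.
have [e1 e2 e3 e4 e5] : [/\ d <= dV / 2, d <= dU / 2, d <= front g f x, d <= x - x1 & d <= x2 - x].
  by rewrite /d; split; rewrite !ge_min lexx ?orbT.
have dV2 : 2 * d <= dV by rewrite mulrC -ler_pdivlMr.
have dU2 : 2 * d <= dU by rewrite mulrC -ler_pdivlMr.
have rect y z : x1 <= y -> y <= z -> z <= x2 -> `|y - x| <= d -> `|z - x| <= d ->
    A z <= B y -> D1 y = D1 z.
  move=> xy yz zx yd zd ZY; apply: D1_rect => // s t hs ht.
  have s2 : `|s - A x| <= 2 * d.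
    by apply: between_near hs; apply: le_trans (fl_dist I0 _ _) _; rewrite ler_wpM2l.
  have t2 : `|t - B x| <= 2 * d.
    by apply: between_near ht; apply: le_trans (fr_dist I0 _ _) _; rewrite ler_wpM2l.
  split; [exact: hdV (le_trans s2 dV2) (le_trans t2 dV2)|].
  exact: hdU (le_trans s2 dU2) (le_trans t2 dU2).
have dc : derivable (cst 0 : R -> R) x 1 by exact: derivable_cst.
have [] := @derive1_eq_near _ D1 (cst 0) x (D1 x) dc _; last first.
  by move=> _ ->; rewrite derive1_cst.
have xd1 : x - d / 2 < x by rewrite ltrBlDr ltrDl divr_gt0.
have xd2 : x < x + d / 2 by rewrite ltrDl divr_gt0.
have := near_itv xd1 xd2; apply: filterS => y /andP[y1 y2]; rewrite add0r.
have yd : `|y - x| <= d / 2.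
  by rewrite ler_norml lerBrDr lerBlDr addrC (ltW y1) addrC (ltW y2).
have [AB BA ydd x1y yx2] := front_overlap I0 d0 e3 e4 e5 yd.
have xxd : `|x - x| <= d by rewrite subrr normr0 ltW.
have [xy|yx] := orP (le_total x y).
  by apply/esym; exact: rect (ltW h1) xy yx2 xxd ydd AB.
exact: rect x1y yx (ltW h2) ydd xxd BA.
Qed.

(** Take the rectangle with the contact point as inner corner: one of its terms is zero, another is
    nonnegative, and the two remaining ones compare values on the side b = b0, respectively a =
    a0. *)
Lemma contact_slopes W x : charsol g f W -> x1 < x -> x < x2 -> W (A x) (B x) = 0 ->
  (derivable (W^~ b0) (A x) 1 -> (W^~ b0)^`()%classic (A x) <= 0) /\
  (derivable (W a0) (B x) 1 -> 0 <= (W a0)^`()%classic (B x)).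
Proof.
move=> hW /ltW h1 /ltW h2 W0; have gW := cs_geo hW.
have ax := fl_ge h1; have bx := fr_le h2; have abx := fl_fr x.
split=> dW.
  apply: (derive_le0_l dW ltr01) => h h0 _.
  have sA : A x - h <= A x by linarith.
  have sB : A x - h <= B x by linarith.
  by have := geo_rect gW sA abx bx; have := geo_ge0 gW sB; linarith.
apply: (derive_ge0_r dW ltr01) => h h0 _.
have sA : B x <= B x + h by linarith.
have sB : A x <= B x + h by linarith.
by have := geo_rect gW ax abx sA; have := geo_ge0 gW sB; linarith.
Qed.

Lemma loclip_D1 : loclip D1.
Proof.
move=> N; have [L L0 h] := loclipD (lV1 b0) (loclipN (lU1 b0)) (N + 2 * N + `|A 0|).
exists (L * 2) => [|x y xN yN]; first by rewrite mulr_ge0.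
have inN z : `|z| <= N -> `|A z| <= N + 2 * N + `|A 0|.
  move=> zN; have := fl_dist I0 z 0; rewrite subr0 => hz.
  have := ler_normD (A z - A 0) (A 0); rewrite subrK => hz'.
  by have := normr_ge0 z; linarith.
apply: le_trans (h _ _ (inN _ xN) (inN _ yN)) _.
by rewrite -mulrA ler_wpM2l//; exact: fl_dist I0 _ _.
Qed.

Lemma loclip_D2 : loclip D2.
Proof.
move=> N; have [L L0 h] := loclipD (lV2 a0) (loclipN (lU2 a0)) (N + 2 * N + `|B 0|).
exists (L * 2) => [|x y xN yN]; first by rewrite mulr_ge0.
have inN z : `|z| <= N -> `|B z| <= N + 2 * N + `|B 0|.
  move=> zN; have := fr_dist I0 z 0; rewrite subr0 => hz.
  have := ler_normD (B z - B 0) (B 0); rewrite subrK => hz'.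
  by have := normr_ge0 z; linarith.
apply: le_trans (h _ _ (inN _ xN) (inN _ yN)) _.
by rewrite -mulrA ler_wpM2l//; exact: fr_dist I0 _ _.
Qed.

Lemma corner_le : a0 <= b0.
Proof. by case: I0 => [s [t [? ? ? _]]]; linarith. Qed.

(** F turns the energy law on the front into an identity F (A x) + G (B x) = constant, which the
    chain rule can differentiate. The ends a0 and b0 are put into the exceptional set, so that a
    front staying at a0 or b0 is also covered by [loclip_comp_null]. *)
Lemma primitives (p q : R -> R) : loclip p -> loclip q -> exists F : R -> R,
  [/\ loclip F, forall s t, a0 <= s -> s <= t -> t <= b0 ->
     F t - F s = int2 p s t - int2 q s t &
   {ae mu, forall z, [/\ z <> a0, z <> b0 & a0 < z < b0 ->
     [/\ derivable p z 1, derivable q z 1, derivable F z 1 &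
       F^`()%classic z = p^`()%classic z ^+ 2 - q^`()%classic z ^+ 2]]}].
Proof.
move=> lp lq; have [L L0 pL] := dq_bounded a0 b0 lp; have [K K0 qK] := dq_bounded a0 b0 lq.
have mF : measurable_fun setT (fun z => dq p z ^+ 2 - dq q z ^+ 2).
  by apply: measurable_funB; exact: measurable_dq2.
have [|F [lF FE FD]] := @loclip_primitive _ _ a0 b0 (L ^+ 2 + K ^+ 2) mF corner_le.
  move=> z hz; rewrite (le_trans (ler_normB _ _))// !normrX lerD// lerXn2r// ?nnegrE//.
    exact: pL.
  exact: qK.
exists F; split => //.
  move=> s t as_ st tb; rewrite FE// RintegralB//; exact: integrable_dq2.
have ne (c : R) : {ae mu, forall z, z <> c}.
  exists [set c]; split => //; first exact: lebesgue_measure_set1.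
  by move=> z /= /contrapT ->.
have := ae_and (ae_and (ne a0) (ne b0)) (ae_and FD (ae_and (loclip_derivable lp) (loclip_derivable lq))).
apply: ae_imp => z [[h1 h2] [h3 [h4 h5]]]; split; [exact: h1|exact: h2|move=> hz].
by have [h6 h7] := h3 hz; split => //; rewrite h7 !derive_dq.
Qed.

Lemma D1_const : D1 x1 = D1 x2.
Proof.
have [F [lF FE FD]] := primitives (lV1 b0) (lU1 b0).
have [G [lG GE GD]] := primitives (lV2 a0) (lU2 a0).
have lA := loclip_fl I0; have lB := loclip_fr I0.
have zA := loclip_comp_null lA (fl_ndecr I0) FD.
have zB := loclip_comp_null lB (fr_ndecr I0) GD.
have lFG : forall x y, x1 <= x -> x <= y -> y <= x2 -> F (A x) + G (B x) = F (A y) + G (B y).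
  move=> x y h1 h2 h3; have := energy_front h1 h2 h3.
  have h4 : A y <= b0 := le_trans (fl_fr y) (fr_le h3).
  have h5 : a0 <= B x := le_trans (fl_ge h1) (fl_fr x).
  by move/primitive_cancel; apply; [exact: FE (fl_ge h1) (fl_homo h2) h4|exact: GE h5 (fr_homo h2) (fr_le h3)].
apply: (loclip_eq loclip_D1 x12).
have := ae_and (ae_and zA zB) (ae_and (ae_and (loclip_derivable lA) (loclip_derivable lB))
  (loclip_derivable loclip_D2)).
apply: ae_imp => x [[zAx zBx] [[dA dB] dD2]] /andP[h1 h2] dD1.
have near12 : \forall y \near x, x1 < y < x2 by exact: near_itv.
have sumD : D2^`()%classic x = - D1^`()%classic x.
  have dN : derivable (- D1) x 1 by exact: derivableN.
  have -> : - D1^`()%classic x = (- D1)^`()%classic x by rewrite !derive1E (@deriveN _ _ _ D1 x 1 dD1).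
  have [] := @derive1_eq_near _ D2 (- D1) x (D2 x + D1 x) dN _ => //.
  apply: filterS near12 => y /andP[y1 y2].
  have key u v : x1 <= u -> u <= v -> v <= x2 -> D2 v + D1 v = D2 u + D1 u.
    by move=> u1 uv vx; have := D_corner u1 uv vx; have := D_corner' u1 uv vx; linarith.
  have -> : (- D1) y = - D1 y by [].
  have [xy|yx] := orP (le_total x y).
    by have := key x y (ltW h1) xy (ltW y2); linarith.
  by have := key y x (ltW y1) yx (ltW h2); linarith.
(* Where the front runs along a characteristic, [D1] or [D2] has derivative zero by
   [derive_comp_eq0]; since [D1] + [D2] is constant, either case settles the claim. *)
have [A'0|A'0] := eqVneq (dq A x) 0.
  apply: (@derive_comp_eq0 (fun a => D a b0) A x _ lA dD1 dA).
  - exact: loclipD (lV1 b0) (loclipN (lU1 b0)).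
  - by rewrite -derive_dq.
have [B'0|B'0] := eqVneq (dq B x) 0.
  suff: D2^`()%classic x = 0 by rewrite sumD => /eqP; rewrite oppr_eq0 => /eqP.
  apply: (@derive_comp_eq0 (D a0) B x _ lB dD2 dB).
  - exact: loclipD (lV2 a0) (loclipN (lU2 a0)).
  - by rewrite -derive_dq.
(* Both coordinates of the front move here, so by [loclip_comp_null] neither A x nor B x is an
   exceptional point, and all chain rules apply. *)
have {zAx}[na nb hA] : [/\ A x <> a0, A x <> b0 & a0 < A x < b0 ->
     [/\ derivable (V^~ b0) (A x) 1, derivable (U^~ b0) (A x) 1, derivable F (A x) 1 &
       F^`()%classic (A x) = (V^~ b0)^`()%classic (A x) ^+ 2 - (U^~ b0)^`()%classic (A x) ^+ 2]].
  by apply: contrapT => /zAx; apply/eqP.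
have {zBx}[na' nb' hB] : [/\ B x <> a0, B x <> b0 & a0 < B x < b0 ->
     [/\ derivable (V a0) (B x) 1, derivable (U a0) (B x) 1, derivable G (B x) 1 &
       G^`()%classic (B x) = (V a0)^`()%classic (B x) ^+ 2 - (U a0)^`()%classic (B x) ^+ 2]].
  by apply: contrapT => /zBx; apply/eqP.
have ax := fl_ge (ltW h1); have bx := fr_le (ltW h2); have abx := fl_fr x.
have ax' : a0 < A x by rewrite lt_neqAle ax andbT; apply/eqP => E; apply: na.
have bx' : B x < b0 by rewrite lt_neqAle bx andbT; apply/eqP => E; apply: nb'.
have {hA}[dV1 dU1 dF FE'] := hA ltac:(by rewrite ax' (le_lt_trans abx bx')).
have {hB}[dV2 dU2 dG GE'] := hB ltac:(by rewrite bx' (lt_le_trans ax' abx)).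
have [V0|V0] := ltP 0 (V (A x) (B x)); first exact: noncontact_const.
have {}V0 : V (A x) (B x) = 0 by apply/eqP; rewrite eq_le V0 (geo_ge0 gV (fl_fr x)).
have U0 : U (A x) (B x) = 0 by move: (D_front x); rewrite /D V0 add0r => /eqP; rewrite oppr_eq0 => /eqP.
have [/(_ dV1) v1 /(_ dV2) v2] := contact_slopes hV h1 h2 V0.
have [/(_ dU1) u1 /(_ dU2) u2] := contact_slopes hU h1 h2 U0.
have C1 : D1^`()%classic x =
    ((V^~ b0)^`()%classic (A x) - (U^~ b0)^`()%classic (A x)) * A^`()%classic x.
  exact: derive_comp_sub dV1 dU1 dA.
have C2 : D2^`()%classic x = ((V a0)^`()%classic (B x) - (U a0)^`()%classic (B x)) * B^`()%classic x.
  exact: derive_comp_sub dV2 dU2 dB.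
have dFA := derivable_comp1 dF dA.
have dGB := derivable_comp1 dG dB.
have sumF : (F \o A)^`()%classic x + (G \o B)^`()%classic x = 0.
  have dN : derivable (- (G \o B)) x 1 by exact: derivableN.
  have [] := @derive1_eq_near _ (F \o A) (- (G \o B)) x (F (A x) + G (B x)) dN _ => //.
    apply: filterS near12 => y /andP[y1 y2].
    rewrite -[(F \o A) y]/(F (A y)) -[(- (G \o B)) y]/(- G (B y)).
    have [xy|yx] := orP (le_total x y).
      by rewrite (lFG x y (ltW h1) xy (ltW y2)) addrC addrK.
    by rewrite -(lFG y x (ltW y1) yx (ltW h2)) addrC addrK.
  by move=> _ ->; rewrite !derive1E (@deriveN _ _ _ (G \o B) x 1 dGB) addNr.
rewrite (derive1_comp dA dF) (derive1_comp dB dG) FE' GE' in sumF.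
rewrite C1; apply: (reflection_algebra v1 u1 v2 u2 _ sumF).
by rewrite -C1 -C2 sumD; exact: subrr.
Qed.

Lemma two_solutions_corner : V a0 b0 = U a0 b0.
Proof.
have h1 : D1 x1 = D a0 b0 by rewrite /D1 E1.
have h2 : D1 x2 = 0 by rewrite /D1 -E2 D_front.
by have := D1_const; rewrite h1 h2 /D; linarith.
Qed.

End TwoSolutions.

Lemma charsol_unique (g f : R -> R) (V U : R -> R -> R) (a b : R) :
  charsol g f V -> charsol g f U -> a <= b -> V a b = U a b.
Proof.
move=> hV hU ab; have [I0|nI] := pselect (influenced g f a b); last first.
  by rewrite (not_influencedE hV)// (not_influencedE hU).
have [x1 [x2 [x12 E1 E2]]] := front_ends I0.
exact: two_solutions_corner E1 E2.
Qed.

End Uniqueness.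

(** * Existence by optimal trading *)

Section Trading.
Context {R : realType}.
Notation mu := (@lebesgue_measure R).
Implicit Types (g f : R -> R) (ts : seq R).

(* [gain g f i ts] is the profit of alternately buying at price [g] and
   selling at price [f] at the times [ts], a unit being held at the start iff
   [i]; [best g f i j a b] is the supremum over the schedules in [[a, b]] at the
   end of which a unit is held iff [j]. *)
Fixpoint gain g f (i : bool) ts : R :=
  if ts is t :: r then (if i then f t else - g t) + gain g f (~~ i) r else 0.

Definition schedule (a b : R) ts := path <=%R a (rcons ts b).

Definition gains g f (i j : bool) (a b : R) : set R :=
  [set gain g f i ts | ts in [set ts | schedule a b ts /\ odd (size ts) = i (+) j]].

Definition best g f i j (a b : R) : R := sup (gains g f i j a b).

Lemma gain_cat g f i s r : gain g f i (s ++ r) = gain g f i s + gain g f (i (+) odd (size s)) r.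
Proof.
elim: s i => [|t s IH] i /=; first by rewrite addbF add0r.
by rewrite IH addrA addbN addNb.
Qed.

Lemma schedule_le a a' b ts : a' <= a -> schedule a b ts -> schedule a' b ts.
Proof.
rewrite /schedule; case: ts => [|t r] aa /=; first by rewrite !andbT; exact: le_trans.
by move=> /andP[h ->]; rewrite (le_trans aa h).
Qed.

Lemma schedule_ends a b ts : schedule a b ts -> a <= b.
Proof.
rewrite /schedule; elim: ts a => [|t r IH] a /=; first by rewrite andbT.
by move=> /andP[h /IH]; exact: le_trans.
Qed.

Lemma schedule_cat a c b s r : schedule a c s -> schedule c b r -> schedule a b (s ++ r).
Proof.
rewrite /schedule rcons_path rcons_cat cat_path => /andP[-> h] /=.
exact: schedule_le.
Qed.

Lemma schedule_split a c b ts : a <= c -> c <= b -> schedule a b ts ->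
  exists s r, [/\ ts = s ++ r, schedule a c s & schedule c b r].
Proof.
move=> ac cb; elim: ts a ac => [|t ts IH] a ac.
  by move=> _; exists [::], [::]; rewrite /schedule /= ac cb.
rewrite /schedule /= => /andP[at_ tb]; have [tc|ct] := orP (le_total t c).
  have [s [r [-> h1 h2]]] := IH t tc tb.
  by exists (t :: s), r; split => //; rewrite /schedule /= at_.
by exists [::], (t :: ts); split => //; rewrite /schedule /= ?ac// ct.
Qed.

(* Valuing a held unit at a price [p] between [f] and [g], trading never
   creates value, so the wealth grows at most like the upward variation of [p]. *)
Lemma gain_le g f (p P : R -> R) i (a0 a b : R) ts : a0 <= a ->
  (forall x, a0 <= x <= b -> f x <= p x <= g x) ->
  (forall s t, a0 <= s -> s <= t -> t <= b -> P s <= P t /\ p t - p s <= P t - P s) ->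
  schedule a b ts ->
  gain g f i ts + (if i (+) odd (size ts) then p b else 0) <=
  (if i then p a else 0) + (P b - P a).
Proof.
move=> a0a fpg pP; elim: ts a a0a i => [|t r IH] a a0a i.
  rewrite /schedule /= andbT addbF => ab; have [] := pP a b a0a ab (lexx _).
  by case: i; linarith.
rewrite /schedule /= => /andP[at_ tb].
have tb' := schedule_ends tb; have := IH t (le_trans a0a at_) (~~ i) tb.
have := fpg t; rewrite (le_trans a0a at_) tb' => /(_ isT) /andP[].
have [] := pP a t a0a at_ tb'; rewrite addbN addNb.
move: (if ~~ _ then _ else _) => X; move: (gain _ _ _ _) => Y.
by case: i => /=; linarith.
Qed.

Section Best.
Variables (g f : R -> R).
Hypothesis lg : loclip g.
Hypothesis lf : loclip f.
Hypothesis fg : forall x, f x <= g x.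
Local Notation best := (best g f).
Local Notation gain := (gain g f).
Local Notation M := (best false false).
Local Notation K := (best true false).

Lemma gains_has_sup i j a b : a <= b -> has_sup (gains g f i j a b).
Proof.
move=> ab; split.
  case: (boolP (i (+) j)) => ij.
    exists (gain i [:: a]), [:: a] => //; split => /=; last by rewrite ij.
    by rewrite /schedule /= lexx ab.
  by exists 0, [::] => //; split => /=; [rewrite /schedule /= ab|rewrite (negbTE ij)].
have [L L0 fL] := lf (Num.max `|a| `|b|).
exists (`|f a| + L * b - L * a + `|f b|) => _ [ts [sts _] <-].
have := @gain_le g f f (fun x => L * x) i a a b ts (lexx _).
move=> /(_ (fun x _ => introT andP (conj (lexx _) (fg x)))) /(_ _ sts).
move=> /(_ _)/wrap[s t as_ st tb|].
  split; first by rewrite ler_wpM2l.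
  have := fL t s (normr_le_max (le_trans as_ st) tb) (normr_le_max as_ (le_trans st tb)).
  rewrite (ger0_norm (x := t - s)) ?subr_ge0// mulrBr; exact: le_trans (ler_norm _).
have := ler_norm (f a); have := ler_norm (- f b); rewrite normrN.
have := normr_ge0 (f a); have := normr_ge0 (f b).
by case: ifP => _; case: ifP => _; linarith.
Qed.

Lemma best_ge i j a b ts : schedule a b ts -> odd (size ts) = i (+) j ->
  gain i ts <= best i j a b.
Proof.
move=> sts o; apply: ub_le_sup; last by exists ts.
by case: (gains_has_sup i j (schedule_ends sts)).
Qed.

Lemma best_le i j a b c : a <= b ->
  (forall ts, schedule a b ts -> odd (size ts) = i (+) j -> gain i ts <= c) ->
  best i j a b <= c.
Proof.
move=> ab h; apply: ge_sup; first by case: (gains_has_sup i j ab).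
by move=> _ [ts [sts o] <-]; exact: h.
Qed.

Lemma best2_le i j a b i' j' a' b' c : a <= b -> a' <= b' ->
  (forall ts ts', schedule a b ts -> odd (size ts) = i (+) j ->
     schedule a' b' ts' -> odd (size ts') = i' (+) j' -> gain i ts + gain i' ts' <= c) ->
  best i j a b + best i' j' a' b' <= c.
Proof.
move=> ab ab' h; rewrite -lerBrDr; apply: best_le ab _ => ts sts o.
rewrite lerBrDr -lerBrDl; apply: best_le ab' _ => ts' sts' o'.
by rewrite lerBrDl; exact: h.
Qed.

(** The source of the upper bounds on profits: p is g, f or a constant between them, and P is C x,
    an upward variation of p, or 0. *)
Lemma best_pot (p P : R -> R) i j (a b : R) : a <= b ->
  (forall x, a <= x <= b -> f x <= p x <= g x) ->
  (forall s t, a <= s -> s <= t -> t <= b -> P s <= P t /\ p t - p s <= P t - P s) ->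
  best i j a b <= (if i then p a else 0) - (if j then p b else 0) + (P b - P a).
Proof.
move=> ab h1 h2; apply: best_le ab _ => ts sts o.
have := gain_le i (lexx _) h1 h2 sts; rewrite o addbA addbb addFb.
by case: ifP => _; case: ifP => _; linarith.
Qed.

Lemma best_tri i k j a c b : a <= c -> c <= b -> best i k a c + best k j c b <= best i j a b.
Proof.
move=> ac cb; apply: best2_le => // s r ss os sr or_.
rewrite (_ : gain k r = gain (i (+) odd (size s)) r).
  rewrite -gain_cat; apply: best_ge; first exact: schedule_cat ss sr.
  by rewrite size_cat oddD os or_ addbA -(addbA i) addbb addbF.
by rewrite os addbA addbb addFb.
Qed.

(** The boolean k records whether a unit is held at time c by an optimal trader. *)
Lemma best_split i j a c b : a <= c -> c <= b ->
  exists k, best i j a b = best i k a c + best k j c b.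
Proof.
move=> ac cb; have ab := le_trans ac cb.
have h : best i j a b <= Num.max (best i false a c + best false j c b)
    (best i true a c + best true j c b).
  apply: best_le ab _ => ts sts o.
  have [s [r [E ss sr]]] := schedule_split ac cb sts.
  have : gain i ts <= best i (i (+) odd (size s)) a c + best (i (+) odd (size s)) j c b.
    rewrite E gain_cat lerD// best_ge//; first by rewrite addbA addbb.
    by move: o; rewrite E size_cat oddD; case: i; case: j; case: (odd (size s)); case: (odd _).
  by rewrite le_max; case: (i (+) _) => ->; rewrite ?orbT.
have t1 := best_tri i false j ac cb; have t2 := best_tri i true j ac cb.
move: h; rewrite le_max => /orP[h|h]; [exists false|exists true]; apply/eqP;
  by rewrite eq_le h.
Qed.

Lemma best_ii_ge0 i a b : a <= b -> 0 <= best i i a b.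
Proof.
move=> ab; have := @best_ge i i a b [::]; rewrite /schedule /= ab addbb; exact.
Qed.

Lemma best_buy a b t : a <= t -> t <= b -> - g t <= best false true a b.
Proof.
move=> at_ tb; have := @best_ge false true a b [:: t].
by rewrite /schedule /= at_ tb addr0; exact.
Qed.

Lemma best_sell a b t : a <= t -> t <= b -> f t <= K a b.
Proof.
move=> at_ tb; have := @best_ge true false a b [:: t].
by rewrite /schedule /= at_ tb addr0; exact.
Qed.

(* Two schedules holding different amounts can be exchanged from their first
   trade on. *)
Lemma best_monge a b : a <= b ->
  best false true a b + K a b <= M a b + best true true a b.
Proof.
move=> ab; apply: best2_le => // -[|t ts] // -[|r rs] // st ot sr or_.
rewrite /= in ot or_; move: st sr; rewrite /schedule /= => /andP[at_ st] /andP[ar sr].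
have [tr|rt] := orP (le_total t r).
  have h1 : gain false (t :: r :: rs) <= M a b.
    by apply: best_ge; [rewrite /schedule /= at_ tr sr|rewrite /= or_].
  have h2 : gain true ts <= best true true a b.
    by apply: best_ge; [exact: schedule_le at_ st|move: ot; case: odd].
  by rewrite /= in h1 h2 *; linarith.
have h1 : gain true (r :: t :: ts) <= best true true a b.
  by apply: best_ge; [rewrite /schedule /= ar rt st|rewrite /= ot].
have h2 : gain false rs <= M a b.
  by apply: best_ge; [exact: schedule_le ar sr|move: or_; case: odd].
by rewrite /= in h1 h2 *; linarith.
Qed.

(** The converse exchange: two nonempty schedules are swapped from their first trade on, and if only
    one of them is nonempty it is cut after its first trade. The term 0 is the case in which neither
    trades. *)
Lemma best_monge_eq a b : a <= b ->
  M a b + best true true a b <= Num.max 0 (best false true a b + K a b).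
Proof.
move=> ab; apply: best2_le => // -[|t ts] // [|r rs] // st ot sr or_ //=;
  rewrite ?addr0 ?add0r le_max ?lexx//; apply/orP; right.
- move: sr; rewrite /schedule /= => /andP[ar sr].
  have h1 := best_sell (lexx a) ab.
  have h2 : f r <= K a b by apply: best_sell => //; exact: schedule_ends sr.
  have h3 : gain false rs <= best false true a b.
    by apply: best_ge; [exact: schedule_le ar sr|move: or_ => /=; case: odd].
  by linarith.
- move: st; rewrite /schedule /= => /andP[at_ st].
  have h2 : - g t <= best false true a b by apply: best_buy => //; exact: schedule_ends st.
  have h3 : gain true ts <= K a b.
    by apply: best_ge; [exact: schedule_le at_ st|move: ot => /=; case: odd].
  by linarith.
- rewrite /= in ot or_; move: st sr; rewrite /schedule /= => /andP[at_ st] /andP[ar sr].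
  have [tr|rt] := orP (le_total t r).
    have h1 : gain false (t :: r :: rs) <= best false true a b.
      by apply: best_ge; [rewrite /schedule /= at_ tr sr|rewrite /= or_].
    have h2 : gain true ts <= K a b.
      by apply: best_ge; [exact: schedule_le at_ st|move: ot; case: odd].
    by rewrite /= in h1 h2 *; linarith.
  have h1 : gain true (r :: t :: ts) <= K a b.
    by apply: best_ge; [rewrite /schedule /= ar rt st|rewrite /= ot].
  have h2 : gain false rs <= best false true a b.
    by apply: best_ge; [exact: schedule_le ar sr|move: or_; case: odd].
  by rewrite /= in h1 h2 *; linarith.
Qed.

Lemma best_rect a1 a2 b1 b2 : a1 <= a2 -> a2 <= b1 -> b1 <= b2 ->
  M a1 b1 + M a2 b2 <= M a1 b2 + M a2 b1.
Proof.
move=> a12 ab b12; have ab2 := le_trans ab b12; have ab1 := le_trans a12 ab.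
have [k ->] := best_split false false a12 ab.
have [j ->] := best_split false false ab b12.
(* The pieces over [a2, b1] recombine as they stand unless a unit is held at a2 in one optimal
   schedule and at b1 in the other; then [best_monge] exchanges them. *)
have := best_monge ab; case: k; case: j; last first.
- have := best_tri false false false a12 ab2; have := best_tri false false false ab b12.
  by linarith.
- have := best_tri false false false a12 ab2; have := best_tri false true false ab b12.
  by linarith.
- have := best_tri false true false a12 ab2; have := best_tri true false false ab b12.
  by linarith.
have := best_tri false true false a12 ab2; have := best_tri true true false ab b12.
by linarith.
Qed.

(* Equality fails only if one unit is held throughout, which costs at least
   the free wave at the corner. *)
Lemma best_mod_or a1 a2 b1 b2 C : a1 <= a2 -> a2 <= b1 -> b1 <= b2 -> 0 <= C ->
  (forall s t, a1 <= s -> s <= t -> t <= b2 -> `|g t - g s| <= C * (t - s) /\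
     `|f t - f s| <= C * (t - s)) ->
  M a1 b1 + M a2 b2 = M a1 b2 + M a2 b1 \/
  M a2 b1 = 0 /\ g a2 - f b1 <= C * (a2 - a1 + (b2 - b1)).
Proof.
move=> a12 ab b12 C0 lip; have ab2 := le_trans ab b12; have ab1 := le_trans a12 ab.
have rect := best_rect a12 ab b12.
have [k Ek] := best_split false false a12 ab2.
case: k Ek => Ek; last first.
  by left; have := best_tri false false false a12 ab; linarith.
have [j Ej] := best_split true false ab b12.
case: j Ej => Ej; last first.
  left; have := best_tri false true false a12 ab.
  by have := best_tri false false false ab b12; linarith.
have h := best_monge_eq ab.
have t1 := best_tri false true false a12 ab; have t2 := best_tri false true false ab b12.
move: h; rewrite le_max => /orP[h|h]; last by left; linarith.
have z1 := best_ii_ge0 false ab; have z2 := best_ii_ge0 true ab.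
right; split; first linarith.
have M0 : 0 <= M a1 b2 by apply: best_ii_ge0; linarith.
have p1 : best false true a1 a2 <= - g a2 + C * (a2 - a1).
  have := @best_pot g (fun x => C * x) false true a1 a2 a12; rewrite /= sub0r -mulrBr.
  apply; first by move=> x _; rewrite fg lexx.
  move=> s t as_ st tb; rewrite ler_wpM2l//; split => //.
  have [h1 _] := lip s t as_ st (le_trans tb ab2).
  by rewrite -mulrBr; apply: le_trans (ler_norm _) h1.
have p2 : K b1 b2 <= f b1 + C * (b2 - b1).
  have := @best_pot f (fun x => C * x) true false b1 b2 b12; rewrite /= subr0 -mulrBr.
  apply; first by move=> x _; rewrite fg lexx.
  move=> s t as_ st tb; rewrite ler_wpM2l//; split => //.
  have [_ h1] := lip s t (le_trans ab1 as_) st tb.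
  by rewrite -mulrBr; apply: le_trans (ler_norm _) h1.
by rewrite mulrDr; linarith.
Qed.

Lemma best_mono_l a a' b : a <= a' -> a' <= b -> M a' b <= M a b.
Proof.
move=> aa ab; have := best_tri false false false aa ab.
by have := best_ii_ge0 false aa; linarith.
Qed.

Lemma sell_mono_l a a' b : a <= a' -> a' <= b -> K a' b <= K a b.
Proof.
move=> aa ab; have := best_tri true true false aa ab.
by have := best_ii_ge0 true aa; linarith.
Qed.

(** A unit held at a' can instead be bought there, at a price that exceeds the earlier one by at
    most the rise of G. *)
Lemma best_incr_l (G : R -> R) a a' b : a <= a' -> a' <= b ->
  (forall s t, a <= s -> s <= t -> t <= a' -> G s <= G t /\ g t - g s <= G t - G s) ->
  M a b <= M a' b + (G a' - G a).
Proof.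
move=> aa ab hG; have gp x : a <= x <= a' -> f x <= g x <= g x by rewrite fg lexx.
have [[] ->] := best_split false false aa ab; last first.
  by have := best_pot false false aa gp hG; rewrite /=; linarith.
have := best_pot false true aa gp hG; rewrite /= => h1.
have := best_tri false true false (lexx a') ab.
by have := best_buy (lexx a') (lexx a'); linarith.
Qed.

(** C enters once for the upward variation of f on [a, a'] and once for comparing f a with f a'. *)
Lemma sell_incr_l (C : R) a a' b : 0 <= C -> a <= a' -> a' <= b ->
  (forall s t, a <= s -> s <= t -> t <= a' -> `|f t - f s| <= C * (t - s)) ->
  K a b <= K a' b + 2 * C * (a' - a).
Proof.
move=> C0 aa ab lip; have fp x : a <= x <= a' -> f x <= f x <= g x by rewrite fg lexx.
have hF s t : a <= s -> s <= t -> t <= a' -> C * s <= C * t /\ f t - f s <= C * t - C * s.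
  move=> as_ st ta; rewrite ler_wpM2l//; split => //.
  by rewrite -mulrBr; apply: le_trans (ler_norm _) (lip _ _ as_ st ta).
have := lip a a' (lexx _) aa (lexx _); rewrite ler_norml => /andP[l1 _].
have [[] ->] := best_split true false aa ab.
  by have := @best_pot f _ true true a a' aa fp hF; rewrite /= -mulrBr; linarith.
have := @best_pot f _ true false a a' aa fp hF; rewrite /= -mulrBr.
have := best_tri true false false (lexx a') ab.
by have := best_sell (lexx a') (lexx a'); linarith.
Qed.

End Best.

Lemma loclip_itv (h : R -> R) (a b : R) : loclip h -> exists2 C : R, 0 <= C &
  forall s t, a <= s -> s <= t -> t <= b -> `|h t - h s| <= C * (t - s).
Proof.
move=> lh; have [C C0 hC] := lh (Num.max `|a| `|b|); exists C => // s t as_ st tb.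
rewrite -[X in _ <= _ * X]ger0_norm ?subr_ge0//; apply: hC.
  exact: normr_le_max (le_trans as_ st) tb.
exact: normr_le_max as_ (le_trans st tb).
Qed.

End Trading.

(** * Regularity, rectangle identity and slopes of the trading solution *)

Section TradingSolution.
Context {R : realType}.
Notation mu := (@lebesgue_measure R).

Lemma lip2_continuous (V : R -> R -> R) : lip2 V -> continuous (fun p : R * R => V p.1 p.2).
Proof.
move=> lV p; have [L L0 VL] := lV (Num.max `|p.1| `|p.2| + 1).
apply/cvgrPdist_le => /= e e0.
have L1 : 0 < 2 * L + 1 by rewrite ltr_wpDl// mulr_ge0.
pose d : R := Num.min 1 (e / (2 * L + 1)).
have d0 : 0 < d by rewrite lt_min ltr01 divr_gt0.
have [d1 d2] : d <= 1 /\ d <= e / (2 * L + 1) by rewrite /d !ge_min !lexx !orbT.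
have Ld : (2 * L + 1) * d <= e by rewrite -ler_pdivlMl// mulrC.
have : \forall q \near p, ball p d q by exact: nbhsx_ballx.
apply: filterS => q [/= h1 h2].
have {}h1 : `|p.1 - q.1| < d by [].
have {}h2 : `|p.2 - q.2| < d by [].
have near (x y m : R) : `|x| <= m -> `|x - y| < d -> `|y| <= m + 1.
  by move=> xm xy; have := ler_normD (y - x) x; rewrite subrK distrC; linarith.
have m1 : `|p.1| <= Num.max `|p.1| `|p.2| by rewrite le_max lexx.
have m2 : `|p.2| <= Num.max `|p.1| `|p.2| by rewrite le_max lexx orbT.
have := VL p.1 q.1 p.2 q.2 ltac:(linarith) (near _ _ _ m1 h1) ltac:(linarith) (near _ _ _ m2 h2).
move=> h; apply: (le_trans h); apply: le_trans Ld.
have : L * (`|p.1 - q.1| + `|p.2 - q.2|) <= L * (d + d).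
  by rewrite ler_wpM2l// lerD// ltW.
by linarith.
Qed.

Lemma additive_small (h : R -> R -> R) (a b d : R) : 0 < d -> a <= b ->
  (forall x y z, a <= x -> x <= y -> y <= z -> z <= b -> h x z = h x y + h y z) ->
  (forall x y, a <= x -> x <= y -> y <= b -> y - x <= d -> h x y = 0) ->
  h a b = 0.
Proof.
move=> d0 ab hadd h0.
have key n : forall y, a <= y -> y <= b -> y - a <= n%:R * d -> h a y = 0.
  elim: n => [|n IH] y ay yb; first by rewrite mul0r => ?; apply: h0 => //; linarith.
  rewrite -natr1 mulrDl mul1r => yn.
  pose z : R := Num.max a (y - d).
  have az : a <= z by rewrite le_max lexx.
  have yz : y - d <= z by rewrite le_max lexx orbT.
  have zy : z <= y by rewrite ge_max ay; linarith.
  have zn : z - a <= n%:R * d.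
    rewrite lerBlDr ge_max; apply/andP; split; last linarith.
    by rewrite lerDr mulr_ge0// ltW.
  rewrite (hadd a z y)// IH//; last linarith.
  by rewrite add0r h0//; linarith.
have [n hn] : exists n : nat, b - a <= n%:R * d.
  exists (Num.bound ((b - a) / d)); rewrite -ler_pdivrMr// ltW// archi_boundP//.
  by rewrite divr_ge0 ?subr_ge0// ltW.
exact: key hn.
Qed.

(** H is the primitive of the positive part of h'. Unlike the crude potential C x it has derivative
    zero where h' <= 0, which is what the points with g = f require. *)
Lemma upward_variation (h : R -> R) (N : R) : loclip h -> 0 <= N ->
  exists H : R -> R, (forall s t, - N <= s -> s <= t -> t <= N ->
      H s <= H t /\ h t - h s <= H t - H s) /\
    {ae mu, forall x, - N < x < N -> [/\ derivable h x 1, derivable H x 1 &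
      H^`()%classic x = Num.max 0 (h^`()%classic x)]}.
Proof.
move=> lh N0; have NN : - N <= N by linarith.
have [L L0 hL] := dq_bounded (- N) N lh.
have md := measurable_dq lh.
have mp : measurable_fun setT (fun x => Num.max 0 (dq h x)).
  by apply: measurable_maxr => //; exact: measurable_cst.
have bp x : - N <= x <= N -> `|Num.max 0 (dq h x)| <= L.
  move=> xN; rewrite ger0_norm ?le_max ?lexx// ge_max L0/=.
  exact: le_trans (ler_norm _) (hL x xN).
have [H [lH HE HD]] := loclip_primitive mp NN bp.
exists H; split.
  move=> s t Ns st tN; rewrite HE// -(loclip_FTC lh st).
  have bnd x : s <= x <= t -> - N <= x <= N by move=> /andP[? ?]; apply/andP; split; linarith.
  split.
    rewrite -subr_ge0 HE//; apply: Rintegral_ge0 => x _.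
    by rewrite le_max lexx.
  apply: (@ae_le_Rintegral _ _ _ _ _ L) => //.
    by move=> x /bnd xN; split; [exact: hL|exact: bp].
  by apply: aeW => x _; rewrite le_max lexx orbT.
have := ae_and HD (loclip_derivable lh); apply: ae_imp => x [h1 h2] /h1[h3 h4].
by split => //; rewrite h4 derive_dq.
Qed.

Section Reflection.
Variables (g f : R -> R).
Local Notation g' := (fun x => - f (- x)).
Local Notation f' := (fun x => - g (- x)).

(** Time reversal: read backwards with times and prices negated, each purchase at g becomes a sale
    at - g and each sale at f a purchase at - f. *)
Lemma gain_refl i ts : gain g' f' (i (+) odd (size ts)) (rev (map -%R ts)) = gain g f i ts.
Proof.
elim: ts i => [//|t r IH] i.
rewrite [map _ _]/= rev_cons -cats1 gain_cat.
have -> : i (+) odd (size (t :: r)) = ~~ i (+) odd (size r) by rewrite /= addbN addNb.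
rewrite IH size_rev size_map -addbA addbb addbF /= !opprK addr0 addrC.
by case: i.
Qed.

Lemma schedule_refl (a b : R) ts : schedule a b ts -> schedule (- b) (- a) (rev (map -%R ts)).
Proof.
rewrite /schedule => h.
have -> : path <=%R (- b) (rcons (rev (map -%R ts)) (- a)) =
    sorted <=%R (map -%R (rev (a :: rcons ts b))).
  by rewrite rev_cons rev_rcons map_rcons /= map_rev.
rewrite sorted_map rev_sorted; apply: (@sub_sorted _ <=%R); last exact: h.
move=> x y /=.
by rewrite lerN2.
Qed.

Lemma gains_refl i j (a b : R) : gains g f i j a b `<=` gains g' f' j i (- b) (- a).
Proof.
move=> _ [ts [sts o] <-]; exists (rev (map -%R ts)).
  split; first exact: schedule_refl.
  by rewrite size_rev size_map o addbC.
by rewrite -(gain_refl i) o addbA addbb addFb.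
Qed.

End Reflection.

Lemma best_refl (g f : R -> R) i j (a b : R) :
  best (fun x => - f (- x)) (fun x => - g (- x)) j i (- b) (- a) = best g f i j a b.
Proof.
congr sup; apply/seteqP; split; last exact: gains_refl.
have := @gains_refl (fun x => - f (- x)) (fun x => - g (- x)) j i (- b) (- a).
have Eg : (fun x => - - g (- - x)) = g by apply/funext => x; rewrite !opprK.
have Ef : (fun x => - - f (- - x)) = f by apply/funext => x; rewrite !opprK.
by rewrite !opprK Eg Ef.
Qed.

Lemma loclip_opp (h : R -> R) : loclip h -> loclip (fun x => - h (- x)).
Proof.
move=> lh N; have [L L0 hL] := lh N; exists L => // x y xN yN.
rewrite -opprD normrN; have := hL (- x) (- y); rewrite !normrN => /(_ xN yN).
by rewrite -opprD normrN.
Qed.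

Definition trade_wave (g f : R -> R) (a b : R) : R := g a - f b + 2 * best g f false false a b.

(** The symmetric extension to a > b makes the function Lipschitz on the whole plane, as [lip2]
    demands. *)
Definition trade_sol (g f : R -> R) (a b : R) : R :=
  trade_wave g f (Num.min a b) (Num.max a b).

Lemma trade_solE g f a b : a <= b -> trade_sol g f a b = g a - f b + 2 * best g f false false a b.
Proof. by move=> ab; rewrite /trade_sol min_l// max_r. Qed.

Lemma trade_sol_sym g f a b : trade_sol g f a b = trade_sol g f b a.
Proof. by rewrite /trade_sol minC maxC. Qed.

Lemma trade_sol_refl g f a b :
  trade_sol (fun x => - f (- x)) (fun x => - g (- x)) (- b) (- a) = trade_sol g f a b.
Proof.
wlog ab : a b / a <= b.
  move=> h; have [/h//|/ltW/h] := leP a b.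
  by rewrite trade_sol_sym [RHS]trade_sol_sym.
rewrite !trade_solE ?lerN2// best_refl !opprK; ring.
Qed.

Lemma min_dist (a a' b b' : R) :
  `|Num.min a b - Num.min a' b'| <= `|a - a'| + `|b - b'|.
Proof.
have := ler_norm (a - a'); have := ler_norm (a' - a); have := ler_norm (b - b').
have := ler_norm (b' - b); rewrite (distrC a') (distrC b') => *; rewrite ler_norml.
have [h|/ltW h] := leP a b; have [h'|/ltW h'] := leP a' b'; apply/andP; split; linarith.
Qed.

Lemma max_dist (a a' b b' : R) :
  `|Num.max a b - Num.max a' b'| <= `|a - a'| + `|b - b'|.
Proof.
have := ler_norm (a - a'); have := ler_norm (a' - a); have := ler_norm (b - b').
have := ler_norm (b' - b); rewrite (distrC a') (distrC b') => *; rewrite ler_norml.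
have [h|/ltW h] := leP a b; have [h'|/ltW h'] := leP a' b'; apply/andP; split; linarith.
Qed.

Lemma wave_diff_le (g1 g2 f1 f2 m1 m2 x y X Y : R) :
  `|g1 - g2| <= x -> `|f1 - f2| <= y -> m1 - m2 <= x + y -> m2 - m1 <= x + y ->
  x <= X -> y <= Y -> 0 <= X -> 0 <= Y ->
  `|g1 - f1 + 2 * m1 - (g2 - f2 + 2 * m2)| <= 6 * X + 6 * Y.
Proof. by rewrite !ler_norml => /andP[? ?] /andP[? ?] *; apply/andP; split; linarith. Qed.

Section Properties.
Variables (g f : R -> R).
Hypothesis lg : loclip g.
Hypothesis lf : loclip f.
Hypothesis fg : forall x, f x <= g x.
Local Notation M := (best g f false false).
Local Notation K := (best g f true false).
Local Notation V := (trade_sol g f).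
Let fg' x : - g (- x) <= - f (- x). Proof. by rewrite lerN2. Qed.

Lemma best_decr_r (F : R -> R) a b b' : a <= b' -> b' <= b ->
  (forall s t, b' <= s -> s <= t -> t <= b -> F s <= F t /\ f t - f s <= F t - F s) ->
  M a b <= M a b' + (F b - F b').
Proof.
move=> ab bb hF; rewrite -!(best_refl g f).
have -> : F b - F b' = (fun x => - F (- x)) (- b') - (fun x => - F (- x)) (- b).
  by rewrite !opprK addrC.
apply: (@best_incr_l _ _ _ (loclip_opp lg) fg' (fun x => - F (- x))); rewrite ?lerN2//.
move=> s t bs st tb; have [] := hF (- t) (- s); rewrite ?lerN2//; first by rewrite lerNr.
  by rewrite lerNl.
by split; linarith.
Qed.

Lemma best_mono_r a b' b : a <= b' -> b' <= b -> M a b' <= M a b.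
Proof.
move=> ab bb; rewrite -!(best_refl g f).
by apply: (best_mono_l (loclip_opp lg) fg'); rewrite lerN2.
Qed.

Lemma best_itv (G : R -> R) a b : a <= b ->
  (forall s t, a <= s -> s <= t -> t <= b -> G s <= G t /\ g t - g s <= G t - G s) ->
  M a b <= G b - G a.
Proof.
move=> ab hG; have := @best_pot _ _ _ lf fg g G false false a b ab; rewrite /= subrr add0r.
by apply => // x _; rewrite fg lexx.
Qed.

(** If a constant price separates f from g, units can be valued at c, which has no variation; no
    schedule gains. *)
Lemma best_gap (c : R) a b : a <= b -> (forall x, a <= x <= b -> f x <= c <= g x) ->
  M a b = 0 /\ best g f true true a b = 0.
Proof.
move=> ab h; have hc s t : a <= s -> s <= t -> t <= b -> (0 : R) <= 0 /\ c - c <= 0 - 0 :> R.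
  by rewrite !subrr lexx.
have := @best_pot _ _ _ lf fg (cst c) (cst 0) false false a b ab h hc.
have := @best_pot _ _ _ lf fg (cst c) (cst 0) true true a b ab h hc.
have := best_ii_ge0 lf fg false ab; have := best_ii_ge0 lf fg true ab.
by rewrite /=; linarith.
Qed.

Lemma best_xx x : M x x = 0.
Proof.
by have [|//] := @best_gap (f x) x x (lexx x) => y /andP[xy yx]; rewrite (@le_anti _ _ y x) ?xy ?yx// lexx fg.
Qed.

Lemma trade_sol_ge0 a b : 0 <= V a b.
Proof.
wlog ab : a b / a <= b; first by move=> h; have [/h//|/ltW/h] := leP a b; rewrite trade_sol_sym.
rewrite trade_solE//; have := best_ii_ge0 lf fg false ab.
have := best_tri lf fg false true false ab (lexx b).
have := best_buy lf fg (lexx a) ab; have := best_sell lf fg (lexx b) (lexx b).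
by linarith.
Qed.

Lemma trade_sol_lip : lip2 V.
Proof.
move=> N; have [C C0 gC] := loclip_itv (- N) N lg; have [D D0 fD] := loclip_itv (- N) N lf.
have CD0 : 0 <= 2 * (C + D) by linarith.
have nested p P q Q : - N <= P -> P <= p -> p <= q -> q <= Q -> Q <= N ->
    M p q <= M P Q /\ M P Q <= M p q + (C * (p - P) + D * (Q - q)).
  move=> NP Pp pq qQ QN; have pQ := le_trans pq qQ.
  have h1 := best_mono_l lf fg Pp pQ; have h2 := best_mono_r pq qQ.
  have h3 : M P Q <= M p Q + ((fun x => C * x) p - (fun x => C * x) P).
    apply: (best_incr_l lf fg Pp pQ) => s t Ps st tp /=.
    have := gC s t ltac:(linarith) st ltac:(linarith); have := ler_norm (g t - g s).
    by rewrite ler_wpM2l// -mulrBr; split => //; linarith.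
  have h4 : M p Q <= M p q + ((fun x => D * x) Q - (fun x => D * x) q).
    apply: (best_decr_r pq qQ) => s t Ps st tp /=.
    have := fD s t ltac:(linarith) st ltac:(linarith); have := ler_norm (f t - f s).
    by rewrite ler_wpM2l// -mulrBr; split => //; linarith.
  by rewrite /= in h3 h4; rewrite !mulrBr; linarith.
have gC' s t : `|s| <= N -> `|t| <= N -> `|g t - g s| <= C * `|t - s|.
  move=> /ler_normlP[? ?] /ler_normlP[? ?].
  have [st|ts] := orP (le_total s t).
    by rewrite (ger0_norm (x := t - s)) ?subr_ge0//; apply: gC => //; linarith.
  by rewrite distrC (distrC t) (ger0_norm (x := s - t)) ?subr_ge0//; apply: gC => //; linarith.
have fD' s t : `|s| <= N -> `|t| <= N -> `|f t - f s| <= D * `|t - s|.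
  move=> /ler_normlP[? ?] /ler_normlP[? ?].
  have [st|ts] := orP (le_total s t).
    by rewrite (ger0_norm (x := t - s)) ?subr_ge0//; apply: fD => //; linarith.
  by rewrite distrC (distrC t) (ger0_norm (x := s - t)) ?subr_ge0//; apply: fD => //; linarith.
have half p q p' q' : `|p| <= N -> `|q| <= N -> `|p'| <= N -> `|q'| <= N -> p <= q -> p' <= q' ->
    M p q - M p' q' <= C * `|p - p'| + D * `|q - q'|.
  move=> /ler_normlP[? ?] /ler_normlP[? ?] /ler_normlP[? ?] /ler_normlP[? ?] pq pq'.
  pose P : R := Num.min p p'; pose Q : R := Num.max q q'.
  have [P1 P2] : P <= p /\ P <= p' by rewrite /P !ge_min !lexx orbT.
  have [Q1 Q2] : q <= Q /\ q' <= Q by rewrite /Q !le_max !lexx orbT.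
  have NP : - N <= P by rewrite le_min; apply/andP; split; linarith.
  have QN : Q <= N by rewrite ge_max; apply/andP; split; linarith.
  have [h1 _] := nested p P q Q NP P1 pq Q1 QN.
  have [_ h2] := nested p' P q' Q NP P2 pq' Q2 QN.
  have e1 : p' - P <= `|p - p'|.
    have := ler_norm (p' - p); have := normr_ge0 (p' - p); rewrite distrC.
    by have [h|h] := orP (le_total p p'); [rewrite /P (min_l h)|rewrite /P (min_r h)]; linarith.
  have e2 : Q - q' <= `|q - q'|.
    have := ler_norm (q - q'); have := normr_ge0 (q - q').
    by have [h|h] := orP (le_total q q'); [rewrite /Q (max_r h)|rewrite /Q (max_l h)]; linarith.
  have := ler_wpM2l C0 e1; have := ler_wpM2l D0 e2; linarith.
exists (2 * (2 * C + 2 * D + C + D)) => [|a a' b b' aN aN' bN bN']; first linarith.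
pose mn (x y : R) : R := Num.min x y; pose mx (x y : R) : R := Num.max x y.
have mnE (x y : R) : (x <= y /\ mn x y = x /\ mx x y = y) \/ (y <= x /\ mn x y = y /\ mx x y = x).
  have [h|h] := orP (le_total x y); [left|right];
  by rewrite /mn /mx ?(min_l h) ?(max_r h) ?(min_r h) ?(max_l h).
have mnN (x y : R) : `|x| <= N -> `|y| <= N -> `|mn x y| <= N /\ `|mx x y| <= N /\ mn x y <= mx x y.
  by case: (mnE x y) => [[? [-> ->]]|[? [-> ->]]].
have d1 : `|mn a b - mn a' b'| <= `|a - a'| + `|b - b'| by exact: min_dist.
have d2 : `|mx a b - mx a' b'| <= `|a - a'| + `|b - b'| by exact: max_dist.
have [p1 [q1 pq1]] := mnN a b aN bN; have [p2 [q2 pq2]] := mnN a' b' aN' bN'.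
rewrite /trade_sol /trade_wave -/(mn a b) -/(mx a b) -/(mn a' b') -/(mx a' b').
have := half _ _ _ _ p1 q1 p2 q2 pq1 pq2; have := half _ _ _ _ p2 q2 p1 q1 pq2 pq1.
rewrite (distrC (mn a' b')) (distrC (mx a' b')).
have := gC' _ _ p2 p1; have := fD' _ _ q2 q1.
have := ler_wpM2l C0 d1; have := ler_wpM2l D0 d2.
move: d1 d2; pose S : R := `|a - a'| + `|b - b'|; rewrite -/S.
set dm := `|mn a b - _|; set dM := `|mx a b - _|.
move=> d1 d2 e1 e2 e3 e4 e5 e6.
have S0 : 0 <= S by rewrite addr_ge0.
have -> : 2 * (2 * C + 2 * D + C + D) * S = 6 * (C * S) + 6 * (D * S) by ring.
by apply: (@wave_diff_le _ _ _ _ _ _ (C * dm) (D * dM)) => //; rewrite mulr_ge0.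
Qed.

Lemma trade_sol_rect a1 a2 b1 b2 : a1 <= a2 -> a2 <= b1 -> b1 <= b2 ->
  V a1 b1 + V a2 b2 <= V a1 b2 + V a2 b1.
Proof.
move=> h1 h2 h3; have h4 := le_trans h1 h2; have h5 := le_trans h2 h3.
rewrite !trade_solE//; last exact: le_trans h4 h3.
by have := best_rect lf fg h1 h2 h3; linarith.
Qed.

(** V has a positive minimum c on the closed rectangle. On a subrectangle with sides at most d the
    alternative in [best_mod_or] would give c <= V <= 2 (C + D) d < c, so the identity holds there.
    The defect J is additive in each variable, and the rectangle is exhausted by small steps, in a
    within thin strips and then in b. *)
Lemma trade_sol_mod a1 a2 b1 b2 : a1 <= a2 -> a2 <= b1 -> b1 <= b2 ->
  (forall a b, a1 <= a <= a2 -> b1 <= b <= b2 -> 0 < V a b) ->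
  V a1 b1 + V a2 b2 = V a1 b2 + V a2 b1.
Proof.
move=> h1 h2 h3 pos.
have [c c0 cV] : exists2 c : R, 0 < c & forall a b, a1 <= a <= a2 -> b1 <= b <= b2 -> c <= V a b.
  have cV := lip2_continuous trade_sol_lip.
  have [|||q /set_mem [q1 q2] qV] := @compact_EVT_min _ _ (fun p : R * R => V p.1 p.2)
      (`[a1, a2]%classic `*` `[b1, b2]%classic).
  - by exists (a1, b1); split; rewrite /= in_itv/= lexx.
  - by apply: compact_setX; exact: segment_compact.
  - exact: continuous_subspaceT.
  rewrite /= !in_itv/= in q1 q2.
  exists (V q.1 q.2) => [|a b ha hb]; first exact: pos.
  by apply: (qV (a, b)); rewrite inE; split; rewrite /= in_itv.
have [C C0 gC] := loclip_itv a1 b2 lg; have [D D0 fD] := loclip_itv a1 b2 lf.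
have CD0 : 0 <= C + D by linarith.
have CD1 : 0 < 2 * (C + D + 1) by linarith.
pose d : R := c / (2 * (C + D + 1)).
have d0 : 0 < d by rewrite divr_gt0.
have dE : 2 * ((C + D + 1) * d) = c by rewrite mulrA /d mulrC divfK// gt_eqF.
have lip s t : a1 <= s -> s <= t -> t <= b2 -> `|g t - g s| <= (C + D) * (t - s) /\
    `|f t - f s| <= (C + D) * (t - s).
  move=> as_ st tb; have ts : 0 <= t - s by rewrite subr_ge0.
  rewrite mulrDl; have := mulr_ge0 C0 ts; have := mulr_ge0 D0 ts.
  by have := gC s t as_ st tb; have := fD s t as_ st tb; split; linarith.
pose J (s t u v : R) : R := M s v + M t u - M s u - M t v.
have small s t u v : a1 <= s -> s <= t -> t <= a2 -> b1 <= u -> u <= v -> v <= b2 ->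
    t - s <= d -> v - u <= d -> J s t u v = 0.
  move=> as_ st ta bu uv vb ts vu; have tu : t <= u by linarith.
  have lip' x y : s <= x -> x <= y -> y <= v -> `|g y - g x| <= (C + D) * (y - x) /\
    `|f y - f x| <= (C + D) * (y - x) by move=> *; apply: lip => //; linarith.
  have [|[M0 w]] := best_mod_or lf fg st tu uv CD0 lip'; first by rewrite /J; linarith.
  have := cV t u ltac:(apply/andP; split; linarith) ltac:(apply/andP; split; linarith).
  rewrite trade_solE// M0 mulr0 addr0 => cw.
  have : (C + D) * (t - s + (v - u)) <= (C + D) * (d + d) by rewrite ler_wpM2l// lerD.
  move=> h; exfalso; have E : (C + D + 1) * d = (C + D) * d + d by ring.
  by rewrite E in dE; linarith.
have strip u v : b1 <= u -> u <= v -> v <= b2 -> v - u <= d -> J a1 a2 u v = 0.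
  move=> bu uv vb vu; apply: (@additive_small (fun s t => J s t u v) a1 a2 d) => //.
    by move=> x y z *; rewrite /J; ring.
  by move=> x y *; exact: small.
have : J a1 a2 b1 b2 = 0.
  apply: (@additive_small (J a1 a2) b1 b2 d) => //.
  by move=> x y z *; rewrite /J; ring.
have h4 := le_trans h1 h2; have h5 := le_trans h2 h3.
by rewrite /J !trade_solE ?(le_trans h4 h3)//; linarith.
Qed.

End Properties.

Section Slopes.
Variables (g f : R -> R).
Hypothesis lg : loclip g.
Hypothesis lf : loclip f.
Hypothesis fg : forall x, f x <= g x.
(** The compatibility condition u1 >= 0 on {u0 = 0} in terms of the profile: there u0' = 0, so g' =
    - u1 / 2. *)
Hypothesis gf_init : {ae mu, forall x, g x = f x -> derivable g x 1 -> g^`()%classic x <= 0}.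
Local Notation M := (best g f false false).
Local Notation K := (best g f true false).
Local Notation V := (trade_sol g f).

Lemma ae_upward_variation : {ae mu, forall x, exists (G : R -> R) (N : R), [/\ - N < x < N,
  forall s t, - N <= s -> s <= t -> t <= N -> G s <= G t /\ g t - g s <= G t - G s,
  derivable g x 1, derivable G x 1 & G^`()%classic x = Num.max 0 (g^`()%classic x)]}.
Proof.
have h n : {ae mu, forall x, - n.+1%:R < x < n.+1%:R -> exists (G : R -> R),
   [/\ forall s t, - n.+1%:R <= s -> s <= t -> t <= n.+1%:R -> G s <= G t /\ g t - g s <= G t - G s,
  derivable g x 1, derivable G x 1 & G^`()%classic x = Num.max 0 (g^`()%classic x)]}.
  have n0 : 0 <= n.+1%:R :> R by [].
  have [G [GM GD]] := upward_variation lg n0.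
  by apply: ae_imp GD => x Gx /Gx[h1 h2 h3]; exists G; split.
have := ae_forall_nat h; apply: ae_imp => x hx.
pose n := Num.bound `|x|.
have xn : - n.+1%:R < x < n.+1%:R.
  rewrite -ltr_norml; apply: lt_trans (archi_boundP (normr_ge0 x)) _.
  by rewrite ltr_nat.
by have [G [? ? ? ?]] := hx n xn; exists G, n.+1%:R; split.
Qed.

Lemma cvg0_le (u v : nat -> R) (d : R) : 0 < d ->
  (forall n, n.+1%:R^-1 < d -> 0 <= u n <= v n) -> v @ \oo --> (0 : R) -> u @ \oo --> (0 : R).
Proof.
move=> d0 uv v0; apply: (squeeze_cvgr (f := cst 0) (h := v)); [|exact: cvg_cst|exact: v0].
by have := near_infty_natSinv_lt (PosNum d0); apply: filterS => n /= /uv.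
Qed.

Lemma middle_between (p q p' q' k l : R) : `|q' - q| <= k -> `|p' - p| <= l ->
  k + l <= (q - p) / 2 -> p' <= (p + q) / 2 <= q'.
Proof.
by rewrite !ler_norml => /andP[? ?] /andP[? ?] ?; apply/andP; split; linarith.
Qed.

(** The excess is 2 M. If f x < g x, a constant separates the prices near x and M = 0 there. If g x
    = f x, then M is at most the rise of the upward variation of g, whose derivative at x is zero
    because g' <= 0. *)
Lemma trade_sol_init : {ae mu, forall x, (fun n => n.+1%:R *
    exc g f V (x - n.+1%:R^-1) (x + n.+1%:R^-1)) @ \oo --> (0 : R)}.
Proof.
have := ae_and gf_init ae_upward_variation; apply: ae_imp => x [ix [G [N [xN GM dg dG GE]]]].
have excE h : 0 < h -> exc g f V (x - h) (x + h) = 2 * M (x - h) (x + h).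
  by move=> h0; rewrite /exc trade_solE; linarith.
have [/andP[Nx xN']] := xN.
have [gx|fx] := eqVneq (g x) (f x).
  have G0 : G^`()%classic x = 0 by rewrite GE max_l// ix.
  have c0 : (fun n => 2 * (n.+1%:R * (G (x + n.+1%:R^-1) - G (x - n.+1%:R^-1)))) @ \oo --> (0 : R).
    rewrite -[X in _ --> X](mulr0 2); apply: cvgM; first exact: cvg_cst.
    by have := sym_derive_lim dG; rewrite G0 addr0.
  pose d : R := Num.min (x + N) (N - x).
  have d0 : 0 < d by rewrite lt_min; apply/andP; split; linarith.
  have [d1 d2] : d <= x + N /\ d <= N - x by rewrite /d !ge_min !lexx orbT.
  apply: (cvg0_le d0 _ c0) => n nd.
  have h0 : 0 < n.+1%:R^-1 :> R by rewrite invr_gt0.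
  move: h0 nd; set h : R := n.+1%:R^-1 => h0 nd; have xx : x - h <= x + h by linarith.
  rewrite excE// mulrCA; have M0 := best_ii_ge0 lf fg false xx.
  rewrite !mulr_ge0//= ler_wpM2l// ler_wpM2l//.
  by apply: (best_itv lf fg xx) => s t *; apply: GM; linarith.
have {}fx : f x < g x by rewrite lt_neqAle fg andbT eq_sym.
pose c : R := (f x + g x) / 2.
have [d d0 hd] : exists2 d : R, 0 < d & forall y, x - d <= y <= x + d -> f y <= c <= g y.
  have [C C0 gC] := lg (`|x| + 1); have [D D0 fD] := lf (`|x| + 1).
  have CD : 0 < C + D + 1 by linarith.
  pose d : R := Num.min 1 ((g x - f x) / 2 / (C + D + 1)).
  have d0 : 0 < d by rewrite lt_min ltr01 !divr_gt0// subr_gt0.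
  have [d1 d2] : d <= 1 /\ d <= (g x - f x) / 2 / (C + D + 1) by rewrite /d !ge_min !lexx !orbT.
  have d3 : (C + D + 1) * d <= (g x - f x) / 2 by rewrite -ler_pdivlMl// mulrC.
  exists d => // y /andP[y1 y2].
  have yx : `|y - x| <= d by rewrite ler_norml; apply/andP; split; linarith.
  have yN : `|y| <= `|x| + 1 by have := ler_normD (y - x) x; rewrite subrK; linarith.
  have xN0 : `|x| <= `|x| + 1 by linarith.
  apply: (middle_between (le_trans (gC y x yN xN0) (ler_wpM2l C0 yx))
    (le_trans (fD y x yN xN0) (ler_wpM2l D0 yx))).
  by apply: le_trans d3; rewrite !mulrDl mul1r lerDl ltW.
apply: (@cvg0_le _ (cst 0) d d0); last exact: cvg_cst.
move=> n nd; have h0 : 0 < n.+1%:R^-1 :> R by rewrite invr_gt0.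
move: h0 nd; set h : R := n.+1%:R^-1 => h0 nd; have xx : x - h <= x + h by linarith.
rewrite excE// (proj1 (best_gap lf fg xx (c := c) _)) ?mulr0 ?lexx// => y /andP[y1 y2].
by apply: hd; apply/andP; split; linarith.
Qed.

Definition lip_on (C l r : R) (h : R -> R) :=
  forall s t : R, l <= s -> s <= t -> t <= r -> `|h t - h s| <= C * (t - s).

Section LocalSlopes.
Variables (a b C : R).
Hypothesis ab : a < b.
Hypothesis C0 : 0 < C.
Hypothesis gC : lip_on C (a - 1) b g.
Hypothesis fC : lip_on C (a - 1) b f.

Lemma wait_or_buy y : y <= b -> K y b - g y <= M y b.
Proof.
move=> yb; have := best_tri lf fg false true false (lexx y) yb.
by have := best_buy lf fg (lexx y) (lexx y); linarith.
Qed.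

(** A scale at which a strict preference by e at a persists: the factor 10 leaves room for the
    errors of [values_nearby] and [linear_potential]. At the same scale the mean price at a
    separates f from g, so trading inside the window gains nothing. *)
Lemma no_trade_nearby (e : R) : f a < g a -> 0 < e -> exists2 d : R, 0 < d & [/\ d <= 1, d <= b - a,
    10 * (C * d) <= e & forall y z, a - d <= y -> y <= z -> z <= a + d ->
      M y z = 0 /\ best g f true true y z = 0].
Proof.
move=> fga e0; pose d : R := Num.min (Num.min 1 (b - a)) (Num.min (e / (10 * C)) ((g a - f a) / (2 * C))).
have d0 : 0 < d by rewrite !lt_min ltr01 subr_gt0 ab !divr_gt0 ?mulr_gt0// subr_gt0.
have [d1 d2 d3 d4] : [/\ d <= 1, d <= b - a, d <= e / (10 * C) & d <= (g a - f a) / (2 * C)].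
  by rewrite /d; split; rewrite !ge_min lexx ?orbT.
have {}d3 : 10 * (C * d) <= e by move: d3; rewrite ler_pdivlMr ?mulr_gt0// mulrC mulrA.
have {}d4 : 2 * (C * d) <= g a - f a by move: d4; rewrite ler_pdivlMr ?mulr_gt0// mulrC mulrA.
exists d => //; split => // y z ay yz za.
apply: (best_gap lf fg yz (c := (f a + g a) / 2)) => x /andP[yx xz].
have x1 : a - 1 <= x by linarith.
have xb : x <= b by linarith.
have [xa|ax] := orP (le_total x a).
  have h : C * (a - x) <= C * d by apply: (ler_wpM2l (ltW C0)); linarith.
  have := gC x1 xa (ltW ab); have := fC x1 xa (ltW ab).
  by rewrite !ler_norml => /andP[? ?] /andP[? ?]; apply/andP; split; linarith.
have h : C * (x - a) <= C * d by apply: (ler_wpM2l (ltW C0)); linarith.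
have a1 : a - 1 <= a by linarith.
have := gC a1 ax xb; have := fC a1 ax xb.
by rewrite !ler_norml => /andP[? ?] /andP[? ?]; apply/andP; split; linarith.
Qed.

Lemma buy_step y z : a - 1 <= y -> y <= z -> z <= b -> M z b <= M y b /\ M y b <= M z b + C * (z - y).
Proof.
move=> ay yz zb; split; first exact: (best_mono_l lf fg yz zb).
have := @best_incr_l _ _ _ lf fg (fun x => C * x) y z b yz zb; rewrite -mulrBr; apply.
move=> s t ys st tz; rewrite (ler_wpM2l (ltW C0) st) -mulrBr; split => //.
by apply: le_trans (ler_norm _) _; apply: gC => //; linarith.
Qed.

Lemma sell_step y z : a - 1 <= y -> y <= z -> z <= b ->
  K z b <= K y b /\ K y b <= K z b + 2 * C * (z - y).
Proof.
move=> ay yz zb; split; first exact: (sell_mono_l lf fg yz zb).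
apply: (sell_incr_l lf fg (ltW C0) yz zb) => s t ys st tz.
by apply: fC => //; linarith.
Qed.

Lemma values_nearby d y : 0 < d -> d <= 1 -> d <= b - a -> a - d <= y -> y <= a + d ->
  [/\ `|M y b - M a b| <= C * d, `|K y b - K a b| <= 2 * (C * d), `|g y - g a| <= C * d &
   `|f y - f a| <= C * d].
Proof.
move=> d0 d1 d2 y1 y2; have a1 : a - 1 <= a by linarith.
have y1' : a - 1 <= y by linarith.
have yb : y <= b by linarith.
have [ya|ay] := orP (le_total y a).
  have h : C * (a - y) <= C * d by apply: (ler_wpM2l (ltW C0)); linarith.
  have [h1 h2] := buy_step y1' ya (ltW ab); have [h3 h4] := sell_step y1' ya (ltW ab).
  rewrite -!mulrA in h4; rewrite (distrC (g y)) (distrC (f y)).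
  split; [| |exact: le_trans (gC y1' ya (ltW ab)) h|exact: le_trans (fC y1' ya (ltW ab)) h].
    by rewrite ler_norml; apply/andP; split; linarith.
  by rewrite ler_norml; apply/andP; split; linarith.
have h : C * (y - a) <= C * d by apply: (ler_wpM2l (ltW C0)); linarith.
have [h1 h2] := buy_step a1 ay yb; have [h3 h4] := sell_step a1 ay yb.
rewrite -!mulrA in h4.
split; [| |exact: le_trans (gC a1 ay yb) h|exact: le_trans (fC a1 ay yb) h].
  by rewrite ler_norml; apply/andP; split; linarith.
by rewrite ler_norml; apply/andP; split; linarith.
Qed.

Lemma linear_potential (d y z : R) (p : R -> R) : 0 < d -> d <= 1 -> d <= b - a ->
  a - d <= y -> y <= z -> z <= a + d -> lip_on C (a - 1) b p ->
  (forall s t, y <= s -> s <= t -> t <= z -> C * s <= C * t /\ p t - p s <= C * t - C * s) /\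
    C * z - C * y <= 2 * (C * d).
Proof.
move=> d0 d1 d2 y1 yz z1 hp; split.
  move=> s t ys st tz; rewrite (ler_wpM2l (ltW C0) st) -mulrBr; split => //.
  by apply: le_trans (ler_norm _) _; apply: hp => //; linarith.
have : C * (z - y) <= C * (2 * d) by apply: (ler_wpM2l (ltW C0)); linarith.
by rewrite mulrBr mulrCA.
Qed.

(** At a, keeping a unit is strictly better than selling it at once. If a unit held at y were
    optimally sold before z, the potential f would bound K y b by about f a + M a b, against that
    preference. So the unit is kept from y to z, and trading in between gains nothing. *)
Lemma sell_locally_constant d y z : 0 < d -> d <= 1 -> d <= b - a ->
  10 * (C * d) <= K a b - M a b - f a ->
  (forall y z, a - d <= y -> y <= z -> z <= a + d -> M y z = 0 /\ best g f true true y z = 0) ->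
  a - d <= y -> y <= z -> z <= a + d -> K y b = K z b.
Proof.
move=> d0 d1 d2 d3 gap ay yz za; have zb : z <= b by linarith.
have [[] Ek] := best_split lf fg true false yz zb; have [M0 K0] := gap y z ay yz za.
  by rewrite Ek K0 add0r.
exfalso; have [h1 h2] := linear_potential d0 d1 d2 ay yz za fC.
have fp x : y <= x <= z -> f x <= f x <= g x by rewrite fg lexx.
have := @best_pot _ _ _ lf fg f _ true false y z yz fp h1; rewrite /= subr0.
have ya : y <= a + d by linarith.
have az : a - d <= z by linarith.
have [_ ky _ fy] := values_nearby d0 d1 d2 ay ya; have [mz _ _ _] := values_nearby d0 d1 d2 az za.
by move: ky fy mz; have Cd := mulr_gt0 C0 d0; rewrite !ler_norml => /andP[? ?] /andP[? ?] /andP[? ?]; linarith.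
Qed.

Lemma buy_locally_constant d y z : 0 < d -> d <= 1 -> d <= b - a ->
  10 * (C * d) <= M a b - (K a b - g a) ->
  (forall y z, a - d <= y -> y <= z -> z <= a + d -> M y z = 0 /\ best g f true true y z = 0) ->
  a - d <= y -> y <= z -> z <= a + d -> M y b = M z b.
Proof.
move=> d0 d1 d2 d3 gap ay yz za; have zb : z <= b by linarith.
have [[] Ek] := best_split lf fg false false yz zb; have [M0 K0] := gap y z ay yz za; last first.
  by rewrite Ek M0 add0r.
exfalso; have [h1 h2] := linear_potential d0 d1 d2 ay yz za gC.
have fp x : y <= x <= z -> f x <= g x <= g x by rewrite fg lexx.
have := @best_pot _ _ _ lf fg g _ false true y z yz fp h1; rewrite /= sub0r.
have ya : y <= a + d by linarith.
have az : a - d <= z by linarith.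
have [my _ _ _] := values_nearby d0 d1 d2 ay ya; have [_ kz gz _] := values_nearby d0 d1 d2 az za.
by move: my kz gz; have Cd := mulr_gt0 C0 d0; rewrite !ler_norml => /andP[? ?] /andP[? ?] /andP[? ?]; linarith.
Qed.

End LocalSlopes.

(* Near [a] the trader either waits, and then the profit is constant, or buys
   at once, and then it decreases like [g]. *)
Lemma trade_slope_free (m : R -> R) a b : a < b -> f a < g a ->
  (forall y, y <= b -> m y = M y b) -> derivable m a 1 -> derivable g a 1 ->
  m^`()%classic a = 0 \/ m^`()%classic a = - g^`()%classic a.
Proof.
move=> ab fga mE dm dg.
have [C1 C10 gC1] := loclip_itv (a - 1) b lg; have [C2 C20 fC2] := loclip_itv (a - 1) b lf.
pose C := C1 + C2 + 1; have C0 : 0 < C by rewrite /C; linarith.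
have gC : lip_on C (a - 1) b g.
  move=> s t s1 st tb; have ts : 0 <= t - s by linarith.
  by apply: le_trans (gC1 s t s1 st tb) _; rewrite ler_wpM2r// /C; linarith.
have fC : lip_on C (a - 1) b f.
  move=> s t s1 st tb; have ts : 0 <= t - s by linarith.
  by apply: le_trans (fC2 s t s1 st tb) _; rewrite ler_wpM2r// /C; linarith.
have common (e : R) := no_trade_nearby (e := e) ab C0 gC fC fga.
have := wait_or_buy (ltW ab); rewrite le_eqVlt => /predU1P[ME|MK].
(* Buying at once is optimal, so reselling at once would lose g a - f a. Hence K is constant near a;
   M + g >= K, with equality at a, makes a a minimum of M + g. *)
- right; have e0 : 0 < K a b - M a b - f a by linarith.
  have [d d0 [d1 d2 d3 gap]] := common _ e0.
  have ad1 : a - d <= a by linarith.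
  have ad2 : a <= a + d by linarith.
  have key y : a - d <= y -> y <= a + d -> m a + g a <= m y + g y.
    move=> y1 y2; have yb : y <= b by linarith.
    have -> : m a + g a = K y b.
      have Kc := sell_locally_constant ab C0 gC fC d0 d1 d2 d3 gap.
      rewrite mE; last exact: ltW.
      rewrite -ME subrK; have [ya|ay] := orP (le_total y a); last exact: Kc ad1 ay y2.
      by apply/esym; exact: Kc y1 ya ad2.
    by rewrite mE// -lerBlDr; exact: wait_or_buy.
  have dmg : derivable (fun y => m y + g y) a 1 by exact: derivableD.
  have E : (fun y => m y + g y)^`()%classic a = m^`()%classic a + g^`()%classic a.
    by rewrite !derive1E (@deriveD _ _ _ m g a 1 dm dg).
  have h1 := derive_ge0_r dmg d0 (fun h h0 hd => key (a + h) ltac:(linarith) ltac:(linarith)).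
  have h2 := derive_le0_l dmg d0 (fun h h0 hd => key (a - h) ltac:(linarith) ltac:(linarith)).
  by apply/eqP; rewrite -addr_eq0 -E eq_le h1 h2.
- left; have e0 : 0 < M a b - (K a b - g a) by linarith.
  have [d d0 [d1 d2 d3 gap]] := common _ e0.
  have dc : derivable (cst 0 : R -> R) a 1 by exact: derivable_cst.
  have [] := @derive1_eq_near _ m (cst 0) a (m a) dc _; last first.
    by move=> _ ->; rewrite derive1_cst.
  have ad1 : a - d < a by linarith.
  have ad2 : a < a + d by linarith.
  have Mc := buy_locally_constant ab C0 gC fC d0 d1 d2 d3 gap.
  have := near_itv ad1 ad2; apply: filterS => y /andP[y1 y2]; rewrite add0r.
  rewrite !mE; [|exact: ltW|linarith].
  have [ya|ay] := orP (le_total y a); first exact: Mc (ltW y1) ya (ltW ad2).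
  by apply/esym; exact: Mc (ltW ad1) ay (ltW y2).
Qed.

(** With m the profit, V' = g' + 2 m', and m' is 0 or - g', so V' is g' or - g'. At a point with g =
    f the separation of prices is lost; there m is nonincreasing, m plus the upward variation G is
    nondecreasing, and G' = 0, so m' = 0. *)
Lemma trade_slope_l b : {ae mu, forall a, a < b -> dq (V^~ b) a ^+ 2 = dq g a ^+ 2}.
Proof.
have lV := lip2_l b (trade_sol_lip lg lf fg).
have := ae_and (ae_and gf_init ae_upward_variation) (loclip_derivable lV).
apply: ae_imp => a [[ia [G [N [/andP[Na aN] GM dg dG GE]]]] dV] ab.
pose p (y : R) : R := V y b - g y + f b.
pose m : R -> R := (2^-1 : R) *: p.
have dm0 : derivable (fun y => V y b - g y) a 1 by exact: derivableB.
have dc : derivable (cst (f b) : R -> R) a 1 by exact: derivable_cst.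
have dp : derivable p a 1.
  exact: (@derivableD _ _ _ (fun y => V y b - g y) (cst (f b)) a 1 dm0 dc).
have dm : derivable m a 1 by exact: (@derivableZ _ _ _ p (2^-1) a 1 dp).
have mE y : y <= b -> m y = M y b.
  by move=> yb; rewrite -[m y]/(2^-1 * p y) /p trade_solE//; field.
have VE : (V^~ b)^`()%classic a = g^`()%classic a + 2 * m^`()%classic a.
  have -> : m^`()%classic a = 2^-1 * ((V^~ b)^`()%classic a - g^`()%classic a).
    rewrite !derive1E (@deriveZ _ _ _ p (2^-1) a 1 dp).
    rewrite (@deriveD _ _ _ (fun y => V y b - g y) (cst (f b)) a 1 dm0 dc) derive_cst addr0.
    by rewrite (@deriveB _ _ _ (V^~ b) g a 1 dV dg).
  by rewrite mulrA divff// mul1r addrC subrK.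
rewrite !derive_dq// VE.
suff [->|->] : m^`()%classic a = 0 \/ m^`()%classic a = - g^`()%classic a.
- by rewrite mulr0 addr0.
- by ring.
have [gfa|/eqP gfa] := eqVneq (g a) (f a); last first.
  by apply: (trade_slope_free ab _ mE dm dg); rewrite lt_neqAle fg andbT eq_sym; exact/eqP.
left; have G0 : G^`()%classic a = 0 by rewrite GE max_l// ia.
pose d : R := Num.min (a + N) 1.
have d0 : 0 < d by rewrite lt_min ltr01 andbT; linarith.
have [d1 d2] : d <= a + N /\ d <= 1 by rewrite /d !ge_min !lexx orbT.
apply/eqP; rewrite eq_le; apply/andP; split.
  apply: (derive_le0_l dm d0) => h h0 hd; rewrite !mE; [|linarith|exact: ltW].
  by apply: (best_mono_l lf fg); linarith.
have dmG : derivable (fun y => m y + G y) a 1 by exact: derivableD.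
have E : (fun y => m y + G y)^`()%classic a = m^`()%classic a + G^`()%classic a.
  by rewrite !derive1E (@deriveD _ _ _ m G a 1 dm dG).
rewrite G0 addr0 in E; rewrite -E.
apply: (derive_ge0_l dmG d0) => h h0 hd; rewrite !mE; [|exact: ltW|linarith].
suff : M (a - h) b <= M a b + (G a - G (a - h)) by linarith.
apply: (best_incr_l lf fg); [linarith|exact: ltW|].
by move=> s t *; apply: GM; linarith.
Qed.

End Slopes.

Lemma derive1_oppr (h : R -> R) (x : R) : derivable h (- x) 1 ->
  derivable (fun y => h (- y)) x 1 /\ (fun y => h (- y))^`()%classic x = - h^`()%classic (- x).
Proof.
move=> dh; have h1 : is_derive (- x) 1 h (h^`()%classic (- x)).
  by apply: DeriveDef dh _; rewrite derive1E.
have h2 : is_derive x 1 (fun y : R => - y) (-1) by exact: is_deriveN.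
by have [dd E] := is_derive1_comp h1 h2; split; rewrite // derive1E E; exact: mulrN1.
Qed.

(** Follows by reflection. The compatibility condition is inherited because g - f >= 0 is minimal
    where g = f, so that f' = g' there. *)
Lemma trade_slope_r (g f : R -> R) a : loclip g -> loclip f -> (forall x, f x <= g x) ->
  {ae mu, forall x, g x = f x -> derivable g x 1 -> g^`()%classic x <= 0} ->
  {ae mu, forall b, a < b -> dq (trade_sol g f a) b ^+ 2 = dq f b ^+ 2}.
Proof.
move=> lg lf fg ini.
pose g' x := - f (- x); pose f' x := - g (- x).
have lg' : loclip g' by exact: loclip_opp.
have lf' : loclip f' by exact: loclip_opp.
have fg' x : f' x <= g' x by rewrite lerN2.
have ini' : {ae mu, forall x, g' x = f' x -> derivable g' x 1 -> g'^`()%classic x <= 0}.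
  have := ae_opp (ae_and ini (ae_and (loclip_derivable lg) (loclip_derivable lf))).
  apply: ae_imp => x [ix [dg df]] E _; have {}E : g (- x) = f (- x) by rewrite /g' /f' in E; linarith.
  have [d1 E1] := derive1_oppr df.
  have -> : g'^`()%classic x = f^`()%classic (- x).
    by rewrite derive1E (@deriveN _ _ _ (fun y => f (- y)) x 1 d1) -derive1E E1 opprK.
  have [dd Ed] := derive1_sub dg df.
  have h1 := derive_ge0_r dd ltr01 (fun h h0 hd => _ : g (- x) - f (- x) <= g (- x + h) - f (- x + h)).
  have h2 := derive_le0_l dd ltr01 (fun h h0 hd => _ : g (- x) - f (- x) <= g (- x - h) - f (- x - h)).
  have {}h1 := h1 (fun h => ltac:(rewrite E subrr subr_ge0; exact: fg)).
  have {}h2 := h2 (fun h => ltac:(rewrite E subrr subr_ge0; exact: fg)).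
  by have := ix E dg; rewrite Ed in h1 h2; linarith.
have lV := lip2_l (- a) (trade_sol_lip lg' lf' fg').
have := ae_opp (ae_and (trade_slope_l lg' lf' fg' ini' (- a)) (ae_and (loclip_derivable lV) (loclip_derivable lg'))).
apply: ae_imp => b [h [dV dg]] ab.
have {}h := h ltac:(by rewrite ltrN2).
rewrite (derive_dq dV) (derive_dq dg) in h.
have [dV' EV] := derive1_oppr dV; have [dg' Eg] := derive1_oppr dg.
have EVf : trade_sol g f a = (fun y => trade_sol g' f' (- y) (- a)).
  by apply/funext => y; rewrite trade_sol_refl.
have Eff : f = - (fun y => g' (- y)) by apply/funext => y; rewrite fctE /g' !opprK.
rewrite EVf (derive_dq dV') EV sqrrN h [in RHS]Eff (derive_dq (derivableN dg')).
by rewrite [in RHS]derive1E (@deriveN _ _ _ (fun y => g' (- y)) b 1 dg') sqrrN -derive1E Eg sqrrN.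
Qed.

Lemma trade_sol_charsol (g f : R -> R) : loclip g -> loclip f -> (forall x, f x <= g x) ->
  {ae mu, forall x, g x = f x -> derivable g x 1 -> g^`()%classic x <= 0} ->
  charsol g f (trade_sol g f).
Proof.
move=> lg lf fg ini; have lV := trade_sol_lip lg lf fg; set V := trade_sol g f in lV *; split.
  split => //; [by move=> *; exact: trade_sol_ge0|exact: trade_sol_rect|exact: trade_sol_mod| |].
    by move=> x; rewrite /V trade_solE// best_xx// mulr0 addr0.
  exact: trade_sol_init.
have E a b : a <= b -> ene V a b = int2 g a b + int2 f a b.
  move=> ab; rewrite /ene.
  have h1 : {ae mu, forall x, a < x < b -> dq (V^~ b) x ^+ 2 = dq g x ^+ 2}.
    by apply: ae_imp (trade_slope_l lg lf fg ini b) => x h /andP[_ /h].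
  have h2 : {ae mu, forall x, a < x < b -> dq (V a) x ^+ 2 = dq f x ^+ 2}.
    by apply: ae_imp (trade_slope_r a lg lf fg ini) => x h /andP[/h].
  have -> : int2 (V^~ b) a b = int2 g a b.
    exact: ae_eq_Rintegral (measurable_dq2 (lip2_l b lV)) (measurable_dq2 lg) h1.
  have -> // : int2 (V a) a b = int2 f a b.
  exact: ae_eq_Rintegral (measurable_dq2 (lip2_r a lV)) (measurable_dq2 lf) h2.
move=> a c b ac cb; rewrite !E// ?(le_trans ac cb)// (int2_cat lg ac cb) (int2_cat lf ac cb).
by move: (int2 g a c) (int2 g c b) (int2 f a c) (int2 f c b); clear => *; linarith.
Qed.

End TradingSolution.

(** * Measure and calculus in the plane *)

Section MeasureTools.
Context {R : realType}.
Notation mu := (@lebesgue_measure R).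
Notation mu2 := (@lebesgue_measure R \x @lebesgue_measure R)%E.

Lemma tonelli1 (F : R * R -> \bar R) : measurable_fun setT F -> (forall p, 0 <= F p)%E ->
  (\int[mu2]_p F p = \int[mu]_a \int[mu]_b F (a, b))%E.
Proof. move=> mF F0; exact: (@fubini_tonelli1 _ _ _ _ _ mu mu F mF F0). Qed.

Lemma tonelli2 (F : R * R -> \bar R) : measurable_fun setT F -> (forall p, 0 <= F p)%E ->
  (\int[mu2]_p F p = \int[mu]_b \int[mu]_a F (a, b))%E.
Proof. move=> mF F0; exact: (@fubini_tonelli2 _ _ _ _ _ mu mu F mF F0). Qed.

Lemma measurable_tonelli1 (F : R * R -> \bar R) : measurable_fun setT F -> (forall p, 0 <= F p)%E ->
  measurable_fun setT (fun a => \int[mu]_b F (a, b))%E.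
Proof. move=> mF F0; exact: (@measurable_fun_fubini_tonelli_F _ _ _ _ _ mu F mF F0). Qed.

(** The image of Lebesgue measure under the affine map, scaled by c, agrees with it on intervals;
    uniqueness of Lebesgue measure does the rest. *)
Lemma ge0_integral_affine (c d : R) (F : R -> \bar R) : 0 < c ->
  measurable_fun setT F -> (forall x, 0 <= F x)%E ->
  (\int[mu]_x F (c * x + d)%R = (c^-1)%:E * \int[mu]_x F x)%E.
Proof.
move=> c0 mF F0.
have maff : measurable_fun setT (fun x : R => c * x + d).
  by apply: continuous_measurable_fun => x; apply: cvgD; [apply: cvgM|]; exact: cvg_cst || exact: cvg_id.
have maff' : measurable_fun (setT : set (measurableTypeR R))
  ((fun x : R => c * x + d) : measurableTypeR R -> measurableTypeR R) := maff.
pose nu0 : {measure set (measurableTypeR R) -> \bar R} :=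
  pushforward mu ((fun x : R => c * x + d) : measurableTypeR R -> measurableTypeR R).
pose nu : {measure set (measurableTypeR R) -> \bar R} := nu0 maff'.
have ci0 : 0 <= c^-1 by rewrite invr_ge0 ltW.
pose cn : {nonneg R} := NngNum ci0.
have cK : c * c^-1 = 1 by rewrite divff// gt_eqF.
have nuE A : measurable A -> mu A = mscale (NngNum (ltW c0)) nu A.
  apply: lebesgue_measure_unique => X [[a b]] _ <-.
  rewrite -[RHS]/(c%:E * mu ((fun x : R => (c * x + d)%R) @^-1` `]a, b]%classic))%E.
  have -> : (fun x : R => c * x + d) @^-1` `]a, b]%classic = `](a - d) / c, (b - d) / c]%classic.
    apply/seteqP; split => x /=; rewrite !in_itv/= ltr_pdivrMr// ler_pdivlMr// ltrBlDr lerBrDr mulrC;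
    by move=> /andP[-> ->].
  rewrite !lebesgue_measure_itv/= !lte_fin ltr_pM2r ?invr_gt0// ltrD2r.
  case: ifP => _; last by rewrite mule0.
  by rewrite -!EFinD -EFinM -mulrBl mulrCA cK mulr1; congr EFin; ring.
have : (\int[mu]_x F x = \int[mscale (NngNum (ltW c0)) nu]_x F x)%E.
  by apply: eq_measure_integral => A mA _; exact: nuE.
rewrite (ge0_integral_mscale nu measurableT (NngNum (ltW c0)) mF (fun x _ => F0 x)) => ->.
rewrite muleA -EFinM /= mulrC cK mul1e.
by rewrite /nu /nu0 (ge0_integral_pushforward maff' mu measurableT mF).
Qed.

Definition char_coord (p : R * R) : R * R := (p.1 - p.2, p.1 + p.2).

Lemma measurable_char_coord : measurable_fun setT char_coord.
Proof.
apply/measurable_fun_pairP; split.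
  by apply: measurable_funB; [exact: measurable_fst|exact: measurable_snd].
by apply: measurable_funD; [exact: measurable_fst|exact: measurable_snd].
Qed.

(** A change of variables by shears: for fixed t put s = x - t, then for fixed s put b = s + 2 t.
    The factor is the inverse Jacobian of the second substitution. *)
Lemma ge0_integral_char (F : R * R -> \bar R) : measurable_fun setT F ->
  (forall p, 0 <= F p)%E -> (\int[mu2]_p F (char_coord p) = (2^-1)%:E * \int[mu2]_p F p)%E.
Proof.
move=> mF F0; have mFT : measurable_fun setT (F \o char_coord).
  by apply: measurableT_comp mF _; exact: measurable_char_coord.
have mS : measurable_fun setT (fun p : R * R => F (p.1, p.1 + 2 * p.2)).
  apply: measurableT_comp mF _; apply/measurable_fun_pairP; split; first exact: measurable_fst.
  apply: measurable_funD; first exact: measurable_fst.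
  by apply: measurable_funM; [exact: measurable_cst|exact: measurable_snd].
rewrite (tonelli2 mFT); last by move=> p; exact: F0.
transitivity (\int[mu]_t \int[mu]_s F (s, s + 2 * t)%R)%E.
  apply: eq_integral => t _.
  have mG : measurable_fun setT (fun s : R => F (s, s + 2 * t)%R).
    by have := measurableT_comp mS (pair2_measurable t).
  have := @ge0_integral_affine 1 (- t) _ ltr01 mG (fun s => F0 _).
  rewrite invr1 mul1e => <-; apply: eq_integral => x _ /=; congr F; rewrite /char_coord /=.
  by congr pair; ring.
have := tonelli1 mS (fun p => F0 _); rewrite (tonelli2 mS (fun p => F0 _)) /= => ->.
rewrite (tonelli1 mF)// -ge0_integralZl//.
- apply: eq_integral => s _.
  have mG : measurable_fun setT (fun b : R => F (s, b)).
    by have := measurableT_comp mF (pair1_measurable s).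
  rewrite -(@ge0_integral_affine 2 s _ _ mG)//.
  by apply: eq_integral => t _; rewrite addrC.
- exact: measurable_tonelli1.
- by move=> s _; apply: integral_ge0.
Qed.

Lemma integral2_indic (A : set (R * R)) : measurable A ->
  (\int[mu2]_p (\1_A p)%:E = mu2 A)%E.
Proof.
move=> mA; have e : (\int[mu2]_p (\1_A p)%:E = mu2 (A `&` setT))%E :=
  integral_indic mu2 measurableT mA.
by rewrite setIT in e.
Qed.

Lemma integral1_indic (A : set R) : measurable A -> (\int[mu]_x (\1_A x)%:E = mu A)%E.
Proof.
move=> mA; have e : (\int[mu]_p (\1_A p)%:E = mu (A `&` setT))%E :=
  integral_indic mu measurableT mA.
by rewrite setIT in e.
Qed.

Lemma measurable_indic2 (A : set (R * R)) : measurable A ->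
  measurable_fun setT (fun p => (\1_A p)%:E : \bar R).
Proof. by move=> mA; exact/measurable_EFinP. Qed.

Lemma null_preimage_char (A : set (R * R)) : measurable A -> mu2 A = 0%E ->
  mu2 (char_coord @^-1` A) = 0%E.
Proof.
move=> mA A0.
have mA' : measurable (char_coord @^-1` A).
  by rewrite -[X in measurable X]setTI; exact: measurable_char_coord.
have I0 p : (0 <= (\1_A p)%:E :> \bar R)%E by rewrite lee_fin.
have := ge0_integral_char (measurable_indic2 mA) I0.
rewrite (integral2_indic mA) A0 mule0 => <-; rewrite -(integral2_indic mA').
by apply: eq_integral.
Qed.

Lemma measure2_ysection (A : set (R * R)) : measurable A ->
  mu2 A = (\int[mu]_b mu [set a | A (a, b)])%E.
Proof.
move=> mA; have I0 p : (0 <= (\1_A p)%:E :> \bar R)%E by rewrite lee_fin.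
rewrite -(integral2_indic mA) (tonelli2 (measurable_indic2 mA) I0).
apply: eq_integral => b _.
have mAb : measurable [set a | A (a, b)].
  by rewrite -[X in measurable X]setTI; exact: (pair2_measurable b).
by rewrite -(integral1_indic mAb); apply: eq_integral.
Qed.

Lemma null_slices (A : set (R * R)) : measurable A ->
  mu2 A = 0%E <-> {ae mu, forall b, mu [set a | A (a, b)] = 0%E}.
Proof.
move=> mA; rewrite (measure2_ysection mA).
have mE : measurable_fun setT (fun b => mu [set a | A (a, b)]).
  have := measurable_fun_ysection mu mA.
  by apply: eq_measurable_fun => b _ /=; congr (mu _); apply/seteqP; split => a; rewrite /ysection /= inE.
have E : (\int[mu]_b mu [set a | A (a, b)] = \int[mu]_(b in setT) `|mu [set a | A (a, b)]|)%E.
  by apply: eq_integral => b _; rewrite gee0_abs.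
have K := ae_eq_integral_abs mu measurableT mE.
rewrite E; split => h; first by apply: ae_imp (proj1 K h) => b /(_ I).
by apply: (proj2 K); apply: ae_imp h => b ->.
Qed.

(* Functions for which every form of Fubini's theorem and of the change of
   variables holds without further hypotheses. *)
Definition boxed (G : R * R -> R) := measurable_fun setT G /\
  exists2 N : R, 0 <= N & exists C : R, (forall p, `|G p| <= C) /\
    (forall p, G p <> 0 -> `|p.1| <= N /\ `|p.2| <= N).

Lemma boxed_integrable G : boxed G -> mu2.-integrable setT (EFin \o G).
Proof.
move=> [mG [N N0 [C [GC Gs]]]]; pose I : set R := `[- N, N]%classic.
have mI : measurable I by exact: measurable_itv.
have mII : measurable (I `*` I) by exact: measurableX.
have E : EFin \o G = (EFin \o G) \_ (I `*` I).
  apply/funext => p; rewrite patchE; case: ifPn => // /negP pI /=.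
  suff -> : G p = 0 by [].
  apply: contrapT => /Gs[h1 h2]; apply: pI; rewrite inE; split; rewrite /I /= in_itv/= -ler_norml//.
rewrite E -(@integrable_mkcond _ _ _ mu2 _ _ mII); apply: measurable_bounded_integrable => //.
- rewrite [X in (X < _)%E](_ : _ = mu I * mu I)%E; last exact: product_measure1E.
  by rewrite /I /= lebesgue_measure_itv/=; case: ifP => _; rewrite ?mule0// -EFinD -EFinM ltry.
- exact: measurable_funTS.
- by exists C; split; [exact: num_real|move=> D CD p _; exact: le_trans (GC p) (ltW CD)].
Qed.

Lemma boxed_slice1 G a : boxed G -> mu.-integrable setT (EFin \o (fun b => G (a, b))).
Proof.
move=> [mG [N N0 [C [GC Gs]]]]; pose I : set R := `[- N, N]%classic.
have mI : measurable I by exact: measurable_itv.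
have mGa : measurable_fun setT (fun b : R => G (a, b)).
  exact: measurableT_comp mG (pair1_measurable a).
have E : EFin \o (fun b => G (a, b)) = (EFin \o (fun b => G (a, b))) \_ I.
  apply/funext => b; rewrite patchE; case: ifPn => // /negP pI /=.
  suff -> : G (a, b) = 0 by [].
  by apply: contrapT => /Gs[h1 h2]; apply: pI; rewrite inE /I /= in_itv/= -ler_norml.
rewrite E -(@integrable_mkcond _ _ _ mu _ _ mI).
by apply: (bounded_integrable_itv (C := C) mGa) => b _; exact: GC.
Qed.

Lemma boxed_slice2 G b : boxed G -> mu.-integrable setT (EFin \o (fun a => G (a, b))).
Proof.
move=> [mG [N N0 [C [GC Gs]]]]; pose I : set R := `[- N, N]%classic.
have mI : measurable I by exact: measurable_itv.
have mGa : measurable_fun setT (fun a : R => G (a, b)).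
  exact: measurableT_comp mG (pair2_measurable b).
have E : EFin \o (fun a => G (a, b)) = (EFin \o (fun a => G (a, b))) \_ I.
  apply/funext => a; rewrite patchE; case: ifPn => // /negP pI /=.
  suff -> : G (a, b) = 0 by [].
  by apply: contrapT => /Gs[h1 h2]; apply: pI; rewrite inE /I /= in_itv/= -ler_norml.
rewrite E -(@integrable_mkcond _ _ _ mu _ _ mI).
by apply: (bounded_integrable_itv (C := C) mGa) => a _; exact: GC.
Qed.

Lemma fubini1E (F : R * R -> \bar R) : mu2.-integrable setT F ->
  (\int[mu2]_p F p = \int[mu]_a \int[mu]_b F (a, b))%E.
Proof. by move=> iF; exact/esym/(@integral12_prod_meas1 _ _ _ _ _ mu mu F iF). Qed.

Lemma fubini2E (F : R * R -> \bar R) : mu2.-integrable setT F ->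
  (\int[mu2]_p F p = \int[mu]_b \int[mu]_a F (a, b))%E.
Proof. by move=> iF; exact/esym/(@integral21_prod_meas1 _ _ _ _ _ mu mu F iF). Qed.

Lemma boxed_fubini1 G : boxed G -> \int[mu2]_p G p = \int[mu]_a \int[mu]_b G (a, b).
Proof.
move=> bG; rewrite /Rintegral (fubini1E (boxed_integrable bG)).
congr fine; apply: eq_integral => a _; rewrite -[LHS]fineK//.
apply: (@integrable_fin_num _ _ _ mu) => //; exact: boxed_slice1.
Qed.

Lemma boxed_fubini2 G : boxed G -> \int[mu2]_p G p = \int[mu]_b \int[mu]_a G (a, b).
Proof.
move=> bG; rewrite /Rintegral (fubini2E (boxed_integrable bG)).
congr fine; apply: eq_integral => b _; rewrite -[LHS]fineK//.
apply: (@integrable_fin_num _ _ _ mu) => //; exact: boxed_slice2.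
Qed.

Lemma boxed_integrable_slice1 G : boxed G ->
  mu.-integrable setT (EFin \o (fun a => \int[mu]_b G (a, b))).
Proof.
move=> bG; have iG := boxed_integrable bG.
have := @integrable_fubini_F _ _ _ _ _ mu mu (EFin \o G) iG.
apply: eq_integrable => // a _; rewrite /fubini_F -[LHS]fineK//.
apply: (@integrable_fin_num _ _ _ mu) => //; exact: boxed_slice1.
Qed.

Lemma boxed_swap G : boxed G -> boxed (fun p => G (p.2, p.1)).
Proof.
move=> [mG [N N0 [C [GC Gs]]]]; split.
  by apply: (measurableT_comp mG); apply/measurable_fun_pairP; split;
    [exact: measurable_snd|exact: measurable_fst].
by exists N => //; exists C; split => // p /Gs[].
Qed.

Lemma boxed_integrable_slice2 G : boxed G ->
  mu.-integrable setT (EFin \o (fun b => \int[mu]_a G (a, b))).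
Proof. by move=> /boxed_swap; exact: boxed_integrable_slice1. Qed.

Lemma Rintegral_char G : mu2.-integrable setT (EFin \o G) ->
  \int[mu2]_p G (char_coord p) = 2^-1 * \int[mu2]_p G p.
Proof.
move=> iG; have mE : measurable_fun setT (EFin \o G) by case/integrableP: iG.
have mFp : measurable_fun setT ((EFin \o G)^\+)%E by exact: measurable_funepos.
have mFn : measurable_fun setT ((EFin \o G)^\-)%E by exact: measurable_funeneg.
have e1 : (\int[mu2]_p (fun p => (G (char_coord p))%:E)^\+ p =
    (2^-1)%:E * \int[mu2]_p (EFin \o G)^\+ p)%E.
  rewrite -(ge0_integral_char mFp (funepos_ge0 _)).
  by apply: eq_integral => p _; rewrite !funeposE.
have e2 : (\int[mu2]_p (fun p => (G (char_coord p))%:E)^\- p =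
    (2^-1)%:E * \int[mu2]_p (EFin \o G)^\- p)%E.
  rewrite -(ge0_integral_char mFn (funeneg_ge0 _)).
  by apply: eq_integral => p _; rewrite !funenegE.
have fp := integrable_pos_fin_num measurableT iG.
have fn := integrable_neg_fin_num measurableT iG.
rewrite /Rintegral [X in fine X = _]integralE [in RHS]integralE e1 e2.
by rewrite -(fineK fp) -(fineK fn) -!EFinM -!EFinB /= mulrBr.
Qed.

Lemma integrable_char G : measurable_fun setT G ->
  mu2.-integrable setT (EFin \o (fun p => G (char_coord p))) -> mu2.-integrable setT (EFin \o G).
Proof.
move=> mG /integrableP[_ iG]; have mE : measurable_fun setT (EFin \o G) by exact/measurable_EFinP.
apply/integrableP; split => //; move: iG.
have mA : measurable_fun setT (fun p => `|(G p)%:E|%E) by exact: measurableT_comp.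
rewrite -[X in (X < _)%E]/(\int[mu2]_p (fun p => `|(G p)%:E|%E) (char_coord p))%E.
rewrite (ge0_integral_char mA); last by move=> p; exact: abse_ge0.
rewrite -[X in _ -> (X < _)%E]/(\int[mu2]_p `|(G p)%:E|)%E => h.
have : (2%:E * ((2^-1)%:E * \int[mu2]_p `|(G p)%:E|) < +oo)%E by rewrite lte_mul_pinfty.
by rewrite muleA -EFinM divff ?mul1e.
Qed.

End MeasureTools.

(** * Smooth functions and a smooth step *)

Section SmoothFunctions.
Context {R : realType}.
Notation mu := (@lebesgue_measure R).
Implicit Types f g h : R -> R.

Lemma is_derive_conv f g (a b x : R) : is_derive x 1 f a -> f = g -> a = b -> is_derive x 1 g b.
Proof. by move=> h <- <-. Qed.

Definition smooth h := forall (n : nat) (x : R), derivable (h^`(n))%classic x 1.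

(** Smoothness by coinduction: a class of differentiable functions closed under differentiation.
    This dispenses with formulas for higher derivatives. *)
Lemma smooth_coind (P : (R -> R) -> Prop) :
  (forall h, P h -> (forall x : R, derivable h x 1) /\ P (h^`())%classic) ->
  forall h, P h -> smooth h.
Proof.
move=> hP h Ph n; suff : P (h^`(n))%classic by move=> /hP[].
by elim: n => // n IH; rewrite derive1nS; case: (hP _ IH).
Qed.

Lemma smooth_derivable h x : smooth h -> derivable h x 1.
Proof. by move=> /(_ 0%N x). Qed.

Lemma smooth_derive h : smooth h -> smooth (h^`())%classic.
Proof. by move=> sh n x; rewrite -derive1Sn; exact: sh. Qed.

Lemma derive1_eq f f' : (forall x : R, is_derive x 1 f (f' x)) ->
  (forall x : R, derivable f x 1) /\ (f^`())%classic = f'.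
Proof.
by move=> h; split=> [x|]; [case: (h x)|apply/funext => x; rewrite derive1E; exact: derive_val].
Qed.

Lemma smooth_is_derive h (x : R) : smooth h -> is_derive x 1 h ((h^`())%classic x).
Proof. by move=> sh; rewrite derive1E; apply: DeriveDef => //; exact: smooth_derivable. Qed.

Lemma smoothD f g : smooth f -> smooth g -> smooth (fun x => f x + g x).
Proof.
move=> sf sg; pose P h := exists f g, [/\ smooth f, smooth g & h = fun x => f x + g x].
apply: (@smooth_coind P); last by exists f, g.
move=> _ [f1 [g1 [s1 t1 ->]]].
have [|d ->] := @derive1_eq (fun x => f1 x + g1 x) (fun x => (f1^`())%classic x + (g1^`())%classic x).
  by move=> x; apply: is_deriveD; exact: smooth_is_derive.
by split; [exact: d|exists (f1^`())%classic, (g1^`())%classic; split; [exact: smooth_derive|exact: smooth_derive|]].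
Qed.

Lemma smooth_affine f (k c d : R) : smooth f -> smooth (fun x => k * f (c * x + d)).
Proof.
move=> sf; pose P h := exists k f, smooth f /\ h = fun x => k * f (c * x + d).
apply: (@smooth_coind P); last by exists k, f.
move=> _ [k1 [f1 [s1 ->]]].
have [|dd ->] := @derive1_eq (fun x => k1 * f1 (c * x + d))
    (fun x => k1 * c * (f1^`())%classic (c * x + d)).
  move=> x; have h1 : is_derive x 1 (fun x : R => c * x + d) c.
    by apply: is_derive_eq; rewrite /GRing.scale/= mulr1 addr0.
  have h2 : is_derive (c * x + d) 1 f1 ((f1^`())%classic (c * x + d)) by exact: smooth_is_derive.
  have h3 : is_derive x 1 (f1 \o (fun x : R => c * x + d)) ((f1^`())%classic (c * x + d) * c).
    exact: is_derive1_comp.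
  apply: (is_derive_conv (@is_deriveZ _ _ _ _ k1 _ _ _ h3)) => //.
  by rewrite /GRing.scale/=; ring.
by split; [exact: dd|exists (k1 * c), (f1^`())%classic; split; [exact: smooth_derive|]].
Qed.

(** Finite sums of products of smooth functions: the class that the Leibniz rule makes closed under
    differentiation. *)
Inductive product_sum : (R -> R) -> Prop :=
| product_sum_mul f g : smooth f -> smooth g -> product_sum (fun x => f x * g x)
| product_sum_add f g : product_sum f -> product_sum g -> product_sum (fun x => f x + g x).

Lemma smoothM f g : smooth f -> smooth g -> smooth (fun x => f x * g x).
Proof.
move=> sf sg; apply: (@smooth_coind product_sum); last exact: product_sum_mul.
move=> h; elim=> {h} [f1 g1 s1 t1|f1 g1 _ [d1 p1] _ [d2 p2]].
  have [|d ->] := @derive1_eq (fun x => f1 x * g1 x)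
      (fun x => f1 x * (g1^`())%classic x + g1 x * (f1^`())%classic x).
    by move=> x; apply: is_deriveM; exact: smooth_is_derive.
  split; first exact: d.
  by apply: product_sum_add; (apply: product_sum_mul; [assumption|exact: smooth_derive]).
have [|d ->] := @derive1_eq (fun x => f1 x + g1 x) (fun x => (f1^`())%classic x + (g1^`())%classic x).
  by move=> x; apply: is_deriveD; rewrite derive1E; exact: DeriveDef.
by split; [exact: d|exact: product_sum_add].
Qed.

(** Reciprocal powers times exp (- 1 / x): their linear combinations are closed under
    differentiation, also at 0, where the factorial bound in [flat_le] makes the derivative
    vanish. *)
Definition flat (n : nat) (x : R) : R := if 0 < x then x^-1 ^+ n * expR (- x^-1) else 0.

Lemma flat_le n (x : R) : 0 < x -> `|x^-1 * flat n x| <= n.+2`!%:R * x.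
Proof.
move=> x0; rewrite /flat x0; set y := x^-1; have y0 : 0 < y by rewrite invr_gt0.
rewrite mulrA -exprS ger0_norm; last by rewrite mulr_ge0 ?expR_ge0// exprn_ge0// ltW.
have : y ^+ n.+2 / n.+2`!%:R <= expR y.
  by apply: le_trans (expR_ge1Dxn n.+1 (ltW y0)); rewrite lerDr.
rewrite ler_pdivrMr ?ltr0n ?fact_gt0// => h.
rewrite expRN ler_pdivrMr ?expR_gt0//.
have -> : x = y^-1 by rewrite invrK.
by rewrite mulrAC ler_pdivlMr// -exprSr mulrC.
Qed.

Lemma is_derive_flat n (x : R) :
  is_derive x 1 (flat n) (flat n.+2 x - n%:R * flat n.+1 x).
Proof.
have [x0|x0|->] := ltgtP x 0.
- have -> : flat n.+2 x - n%:R * flat n.+1 x = 0 by rewrite /flat ltNge (ltW x0)/=; ring.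
  apply: (near_eq_is_derive (f := cst 0)).
  near=> y; rewrite /flat ifF//; apply/negbTE; rewrite -leNgt.
  by near: y; apply: filterS (lt_nbhsl x0) => z; exact: ltW.
- apply: (near_eq_is_derive (f := fun y : R => y^-1 ^+ n * expR (- y^-1))).
    by near=> y; rewrite /flat ifT//; near: y; exact: lt_nbhsr.
  have xn0 : x != 0 by rewrite gt_eqF.
  have dV : is_derive x 1 (fun y : R => y^-1) (- x ^- 2).
    split; first exact: derivableV.
    by rewrite deriveV// derive_id /GRing.scale/= mulr1.
  have dX : is_derive x 1 (fun y : R => y^-1 ^+ n) (- (n%:R * x^-1 ^+ n.+1)).
    case: n => [|n]; first by rewrite mul0r oppr0; exact: is_derive_cst.
    apply: (is_derive_conv (@is_deriveX _ _ _ n.+1 _ _ _ dV)); first by apply/funext => y; rewrite exprfctE.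
    by rewrite -exprVn; move: x^-1 => y; rewrite /GRing.scale/= !exprS expr0; ring.
  have dN : is_derive x 1 (fun y : R => - y^-1) (x ^- 2).
    by have := is_deriveN dV; rewrite opprK.
  have dE : is_derive x 1 (fun y : R => expR (- y^-1)) (expR (- x^-1) * x ^- 2).
    exact: (is_derive1_comp (is_derive_expR _) dN).
  apply: (is_derive_conv (is_deriveM dX dE)) => //.
  rewrite /flat x0 -exprVn; move: x^-1 => y; rewrite /GRing.scale/= !exprS expr0; ring.
rewrite /flat ltxx mulr0 subr0.
suff h : (fun h : R => h^-1 *: (flat n (h *: 1 + 0) - flat n 0)) @ 0^' --> (0 : R).
  by apply: DeriveDef; [apply/cvg_ex; exists 0; exact: h|exact: cvg_lim h].
apply/cvgrPdist_le => e e0.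
pose C : R := n.+2`!%:R; have C0 : 0 < C by rewrite ltr0n fact_gt0.
near=> h; rewrite sub0r normrN addr0 /GRing.scale/= mulr1 [flat n 0]/flat ltxx subr0.
have [h0|h0] := ltP 0 h; last by rewrite /flat ltNge h0/= mulr0 normr0 ltW.
apply: le_trans (flat_le n h0) _.
rewrite -ler_pdivlMl//; apply: ltW; apply: le_lt_trans (ler_norm _) _.
near: h; apply: dnbhs0_lt; rewrite mulr_gt0// invr_gt0//.
Unshelve. all: by end_near. Qed.

Inductive flat_sum : (R -> R) -> Prop :=
| flat_sum_flat (c : R) n : flat_sum (fun x => c * flat n x)
| flat_sum_add f g : flat_sum f -> flat_sum g -> flat_sum (fun x => f x + g x).

Lemma smooth_flat : smooth (flat 0).
Proof.
apply: (@smooth_coind flat_sum); last first.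
  rewrite (_ : flat 0 = fun x => 1 * flat 0 x); first exact: flat_sum_flat.
  by apply/funext => x; rewrite mul1r.
move=> h; elim=> {h} [c n|f1 g1 _ [d1 p1] _ [d2 p2]].
  have [|d ->] := @derive1_eq (fun x => c * flat n x)
      (fun x => c * flat n.+2 x + (- c * n%:R) * flat n.+1 x).
    move=> x; apply: (is_derive_conv (is_deriveZ c (is_derive_flat n x))) => //.
    by rewrite /GRing.scale/=; ring.
  by split; [exact: d|apply: flat_sum_add; exact: flat_sum_flat].
have [|d ->] := @derive1_eq (fun x => f1 x + g1 x) (fun x => (f1^`())%classic x + (g1^`())%classic x).
  by move=> x; apply: is_deriveD; rewrite derive1E; exact: DeriveDef.
by split; [exact: d|exact: flat_sum_add].
Qed.

Lemma smooth_continuous f : smooth f -> continuous f.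
Proof.
by move=> sf x; apply: differentiable_continuous; apply/derivable1_diffP; exact: smooth_derivable.
Qed.

Lemma smooth_primitive f F : smooth f -> (forall x : R, derivable F x 1 /\ (F^`())%classic x = f x) -> smooth F.
Proof.
move=> sf h [|n] x; first by case: (h x).
rewrite derive1Sn; have -> : (F^`())%classic = f by apply/funext => y; case: (h y).
exact: sf.
Qed.

Lemma smooth_step : exists S : R -> R, [/\ smooth S, {homo S : x y / x <= y},
  forall x, x <= 0 -> S x = 0 & forall x, 1 <= x -> S x = 1].
Proof.
pose k (x : R) := flat 0 x * (1 * flat 0 ((-1) * x + 1)).
have sk : smooth k by apply: smoothM; [exact: smooth_flat|apply: smooth_affine; exact: smooth_flat].
have flat0 x : 0 <= flat 0 x by rewrite /flat; case: ifP => // _; rewrite mulr_ge0 ?expR_ge0.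
have k0 x : 0 <= k x by rewrite /k mul1r mulr_ge0.
have kout x : x <= 0 \/ 1 <= x -> k x = 0.
  rewrite /k mul1r /flat => -[x0|x1]; first by rewrite ltNge x0/= mul0r.
  by rewrite [X in _ * X]ifF ?mulr0//; apply/negbTE; rewrite -leNgt; linarith.
have mk : measurable_fun setT k by apply: continuous_measurable_fun; exact: smooth_continuous.
have ik : mu.-integrable setT (EFin \o k).
  have E : EFin \o k = (EFin \o k) \_ `[0, 1]%classic.
    apply/funext => x; rewrite patchE; case: ifPn => // /negP xI /=; rewrite kout//.
    move: xI; rewrite inE /= in_itv/= => /negP; rewrite negb_and -!ltNge => /orP[/ltW|/ltW]; by [left|right].
  have mI : measurable (`[0, 1]%classic : set R) by exact: measurable_itv.
  rewrite E -(@integrable_mkcond _ _ _ mu _ _ mI).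
  have [C kC] : exists C, forall x, 0 <= x <= 1 -> `|k x| <= C.
    have ck : {within `[(0 : R), 1], continuous k} by apply: continuous_subspaceT; exact: smooth_continuous.
    have [c c01 h] := @EVT_max R k 0 1 ler01 ck.
    by exists (k c) => x x01; rewrite ger0_norm//; apply: h; rewrite in_itv.
  exact: bounded_integrable_itv kC.
pose F (x : R) := \int[mu]_(t in `]-oo, x]) k t.
have FD x : derivable F x 1 /\ (F^`())%classic x = k x.
  apply: (@continuous_FTC1 _ k -oo%O x (x + 1)); first by rewrite ltrDl.
  - exact: integrableS ik.
  - by rewrite ltNyr.
  - exact: smooth_continuous.
have sF : smooth F by exact: smooth_primitive sk FD.
have Fmono : {homo F : x y / x <= y}.
  move=> x y xy; rewrite -subr_ge0 /F Rintegral_itvB ?bnd_simp//; last exact: integrableS ik.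
  by apply: Rintegral_ge0 => t _.
have Fneg x : x <= 0 -> F x = 0.
  move=> x0; rewrite /F /Rintegral integral0_eq// => t /=; rewrite in_itv/= => tx.
  by rewrite kout//; left; exact: le_trans x0.
have Fpos x : 1 <= x -> F x = F 1.
  move=> x1; apply/eqP; rewrite -subr_eq0 /F Rintegral_itvB ?bnd_simp//; last exact: integrableS ik.
  rewrite /Rintegral integral0_eq// => t /=; rewrite in_itv/= => /andP[t1 _].
  by rewrite kout//; right; exact: ltW.
have F1 : 0 < F 1.
  rewrite lt_neqAle eq_sym; apply/andP; split; last by rewrite -(Fneg 0)// Fmono.
  apply/eqP => F10.
  have F0 x : F x = 0.
    have [x0|x0] := orP (le_total x 0); first exact: Fneg.
    have [x1|x1] := orP (le_total x 1); last by rewrite Fpos.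
    by apply/eqP; rewrite eq_le -{1}F10 Fmono//= -(Fneg 0)// Fmono.
  have [_] := FD 2^-1; have -> : F = cst 0 by apply/funext.
  rewrite derive1_cst /k mul1r /flat => /esym/eqP; apply/negP.
  rewrite ifT ?invr_gt0// ifT; last by linarith.
  by rewrite !expr0 !mul1r mulf_neq0// gt_eqF ?expR_gt0.
exists (fun x => (F 1)^-1 * F (1 * x + 0)); split.
- exact: smooth_affine.
- by move=> x y xy; rewrite !mul1r !addr0 ler_wpM2l ?Fmono// invr_ge0 ltW.
- by move=> x x0; rewrite mul1r addr0 (Fneg _ x0) mulr0.
- by move=> x x1; rewrite mul1r addr0 (Fpos _ x1) mulVf// gt_eqF.
Qed.

End SmoothFunctions.

(** * Measurability and product test functions in the plane *)

Section PlaneCalculus.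
Context {R : realType}.
Notation mu := (@lebesgue_measure R).
Implicit Types (phi : R * R -> R) (A B : R -> R).

(** An open set is the union of the boxes with rational centre and half-side 1 / n.+1 that it
    contains, and these are countably many products of intervals. *)
Lemma open_measurable2 (O : set (R * R)) : open O -> measurable O.
Proof.
move=> oO.
pose box (i : rat * rat * nat) : set (R * R) :=
  `]ratr i.1.1 - i.2.+1%:R^-1, ratr i.1.1 + i.2.+1%:R^-1[%classic `*`
  `]ratr i.1.2 - i.2.+1%:R^-1, ratr i.1.2 + i.2.+1%:R^-1[%classic.
pose F i := if `[< box i `<=` O >] then box i else set0.
have -> : O = \bigcup_i F i.
  apply/seteqP; split => [z Oz|z [i _]]; last first.
    by rewrite /F; case: ifPn => // /asboolP; exact.
  have /nbhs_ballP[e /= e0 zeO] : nbhs z O by exact: open_nbhs_nbhs.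
  have e20 : 0 < e / 2 by rewrite divr_gt0.
  have [n _ /(_ n (leqnn n)) ne] := near_infty_natSinv_lt (PosNum e20).
  rewrite /= in ne; set h : R := n.+1%:R^-1 in ne.
  have h0 : 0 < h by rewrite invr_gt0.
  have [p] : exists q, ratr q \in `]z.1 - h, z.1 + h[ by apply: rat_in_itvoo; linarith.
  have [q] : exists q, ratr q \in `]z.2 - h, z.2 + h[ by apply: rat_in_itvoo; linarith.
  rewrite !in_itv/= => /andP[q1 q2] /andP[p1 p2]; exists (p, q, n) => //.
  rewrite /F ifT; first by split; rewrite /= in_itv/= -/h; apply/andP; linarith.
  apply/asboolP => w [/=]; rewrite !in_itv/= -/h => /andP[w1 w2] /andP[w3 w4].
  apply: zeO; split; rewrite /ball/= ltr_norml; apply/andP; linarith.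
apply: countable_bigcupT_measurable => [|i]; first exact: countableP.
rewrite /F; case: ifPn => // _; apply: measurableX; exact: measurable_itv.
Qed.

Lemma closed_measurable2 (O : set (R * R)) : closed O -> measurable O.
Proof. by move=> /closed_openC/open_measurable2/measurableC; rewrite setCK. Qed.

Lemma continuous_measurable2 phi : continuous phi -> measurable_fun setT phi.
Proof.
move=> /continuousP cf; apply: (measurability _ (RGenOpens.measurableE R)).
move=> _ [_ [a [b ->] <-]]; rewrite setTI; apply: open_measurable2.
exact/cf/interval_open.
Qed.

Lemma compact_measurable2 (K : set (R * R)) : compact K -> measurable K.
Proof. by move=> cK; apply: closed_measurable2; apply: compact_closed cK; exact: norm_hausdorff. Qed.

Lemma derive_along phi (c : R -> R * R) v (s : R) :
  (forall h, c (h + s) = h *: v + c s) -> derivable phi (c s) v ->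
  is_derive s 1 (fun r => phi (c r)) ('D_v phi (c s)).
Proof.
move=> cE dphi.
have E : (fun h : R => h^-1 *: (((fun r => phi (c r)) \o shift s) (h *: 1) - phi (c s))) =
    (fun h : R => h^-1 *: ((phi \o shift (c s)) (h *: v) - phi (c s))).
  by apply/funext => h; rewrite /= -[h *: (1 : R)]/(h * 1) mulr1 cE.
by split; rewrite /derivable /derive E.
Qed.

Lemma derive_of_line phi (p v : R * R) (d : R) :
  is_derive (0 : R) 1 (fun h : R => phi (h *: v + p)) d -> is_derive p v phi d.
Proof.
have E : (fun h : R => h^-1 *: ((phi \o shift p) (h *: v) - phi p)) =
    (fun h : R => h^-1 *: (((fun h : R => phi (h *: v + p)) \o shift 0) (h *: 1) - phi (0 *: v + p))).
  by apply/funext => h; rewrite -[h *: 1]/(h * 1) mulr1 /= addr0 scale0r add0r.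
by move=> [d1 d2]; split; rewrite /derivable /derive E.
Qed.

Definition char_prod A B (p : R * R) : R := A (p.1 - p.2) * B (p.1 + p.2).

Lemma is_derive_char_prod A B (p v : R * R) : smooth A -> smooth B ->
  is_derive p v (char_prod A B)
    ((v.1 - v.2) * char_prod (A^`())%classic B p + (v.1 + v.2) * char_prod A (B^`())%classic p).
Proof.
move=> sA sB; apply: derive_of_line.
have line (h : R -> R) (c d : R) : smooth h ->
    is_derive (0 : R) 1 (fun s : R => h (c * s + d)) (c * (h^`())%classic d).
  move=> sh; have h1 : is_derive (0 : R) 1 (fun x : R => c * x + d) c.
    by apply: is_derive_eq; rewrite /GRing.scale/= mulr1 addr0.
  have := smooth_is_derive (c * 0 + d) sh => h2.
  have h3 : is_derive (0 : R) 1 (h \o (fun x : R => c * x + d)) ((h^`())%classic (c * 0 + d) * c).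
    exact: is_derive1_comp.
  apply: (is_derive_conv h3) => //.
  by rewrite mulr0 add0r mulrC.
have lA := line A (v.1 - v.2) (p.1 - p.2) sA.
have lB := line B (v.1 + v.2) (p.1 + p.2) sB.
apply: (is_derive_conv (is_deriveM lA lB)).
  apply/funext => s; rewrite /char_prod /= /GRing.scale/=.
  by congr (A _ * B _); ring.
by rewrite /char_prod /GRing.scale/= !mulr0 !add0r; ring.
Qed.

Definition lin_form (c d : R) (p : R * R) : R^o := c * p.1 + d * p.2.

Fact lin_form_is_linear c d : linear (lin_form c d).
Proof. by move=> k u v; rewrite /lin_form /= /GRing.scale/=; ring. Qed.

HB.instance Definition _ c d := GRing.isLinear.Build R (R * R)%type R^o _ (lin_form c d)
  (lin_form_is_linear c d).

Lemma differentiable_lin (c d : R) (p : R * R) : differentiable (fun p : R * R => c * p.1 + d * p.2) p.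
Proof.
apply: (@linear_differentiable _ _ _ (lin_form c d)) => q.
have h1 : {for q, continuous (fun p : R * R => p.1)} by exact: cvg_fst.
have h2 : {for q, continuous (fun p : R * R => p.2)} by exact: cvg_snd.
by apply: (@continuousD _ _ _ (fun p : R * R => c * p.1) (fun p : R * R => d * p.2) q);
  apply: continuousM => //; exact: cst_continuous.
Qed.

Lemma continuous_lin (c d : R) : continuous (fun p : R * R => c * p.1 + d * p.2).
Proof. by move=> p; exact: differentiable_continuous (differentiable_lin c d p). Qed.

Lemma differentiable_char_prod A B (p : R * R) : smooth A -> smooth B ->
  differentiable (char_prod A B) p.
Proof.
move=> sA sB.
have dA : differentiable (fun p : R * R => A (1 * p.1 + (-1) * p.2)) p.
  apply: (@differentiable_comp _ _ _ _ (fun p : R * R => 1 * p.1 + (-1) * p.2) A).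
    exact: differentiable_lin.
  by apply/derivable1_diffP; exact: smooth_derivable.
have dB : differentiable (fun p : R * R => B (1 * p.1 + 1 * p.2)) p.
  apply: (@differentiable_comp _ _ _ _ (fun p : R * R => 1 * p.1 + 1 * p.2) B).
    exact: differentiable_lin.
  by apply/derivable1_diffP; exact: smooth_derivable.
have -> : char_prod A B = (fun p : R * R => A (1 * p.1 + (-1) * p.2)) *
    (fun p : R * R => B (1 * p.1 + 1 * p.2)).
  by apply/funext => q; rewrite /char_prod mulrfctE !mul1r mulN1r.
exact: differentiableM.
Qed.

(** Closed under derivatives in every direction, so that all iterated partial derivatives of
    [char_prod] are differentiable at once. *)
Inductive char_sum : (R * R -> R) -> Prop :=
| char_sum_prod A B : smooth A -> smooth B -> char_sum (char_prod A B)
| char_sum_add f g : char_sum f -> char_sum g -> char_sum (fun p => f p + g p).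

Lemma char_sum_derive phi v : char_sum phi ->
  (forall p, differentiable phi p) /\ char_sum ('D_v phi).
Proof.
elim=> {phi} [A B sA sB|f g _ [df sf] _ [dg sg]].
  split; first by move=> p; exact: differentiable_char_prod.
  have -> : 'D_v (char_prod A B) = fun p =>
      char_prod (fun x => (v.1 - v.2) * (A^`())%classic (1 * x + 0)) B p +
      char_prod (fun x => (v.1 + v.2) * A (1 * x + 0)) (B^`())%classic p.
    apply/funext => p; have [_ ->] := is_derive_char_prod p v sA sB.
    by rewrite /char_prod !mul1r !addr0 !mulrA.
  apply: char_sum_add; apply: char_sum_prod.
  - by apply: smooth_affine; exact: smooth_derive.
  - exact: sB.
  - exact: smooth_affine.
  - exact: smooth_derive.
split; first by move=> p; exact: differentiableD.
have -> : 'D_v (fun p => f p + g p) = fun p => 'D_v f p + 'D_v g p.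
  by apply/funext => p; apply: (@deriveD _ _ _ f g); exact: diff_derivable.
exact: char_sum_add.
Qed.

Lemma char_sum_partials phi s : char_sum phi -> char_sum (partials s phi).
Proof.
move=> sphi; elim: s => //= b s IH.
by case: (char_sum_derive (if b then et else ex) IH).
Qed.

Definition char_inv (q : R * R) : R * R := (2^-1 * (q.1 + q.2), 2^-1 * (q.2 - q.1)).

Lemma char_invK q : char_coord (char_inv q) = q.
Proof. by case: q => a b; rewrite /char_coord /char_inv /=; congr pair; field. Qed.

Lemma char_coordK p : char_inv (char_coord p) = p.
Proof. by case: p => a b; rewrite /char_coord /char_inv /=; congr pair; field. Qed.

Lemma continuous_lin2 (c d e k : R) :
  continuous (fun q : R * R => (c * q.1 + d * q.2, e * q.1 + k * q.2)).
Proof. by move=> q; exact: (cvg_pair (@continuous_lin c d q) (@continuous_lin e k q)). Qed.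

Lemma continuous_char_inv : continuous char_inv.
Proof.
have -> : char_inv = fun q => (2^-1 * q.1 + 2^-1 * q.2, - 2^-1 * q.1 + 2^-1 * q.2).
  by apply/funext => q; rewrite /char_inv; congr pair; ring.
exact: continuous_lin2.
Qed.

Lemma continuous_char_coord : continuous (@char_coord R).
Proof.
have -> : @char_coord R = fun q => (1 * q.1 + (-1) * q.2, 1 * q.1 + 1 * q.2).
  by apply/funext => q; rewrite /char_coord; congr pair; ring.
exact: continuous_lin2.
Qed.

Lemma test_char_prod (Omega : set (R * R)) A B a1 a2 b1 b2 : smooth A -> smooth B ->
  (forall x, ~ (a1 <= x <= a2) -> A x = 0) -> (forall x, ~ (b1 <= x <= b2) -> B x = 0) ->
  (forall p, a1 <= p.1 - p.2 <= a2 -> b1 <= p.1 + p.2 <= b2 -> Omega p) ->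
  test_fun Omega (char_prod A B).
Proof.
move=> sA sB A0 B0 O; split.
  move=> s p; have := char_sum_partials s (char_sum_prod sA sB).
  by move=> /(char_sum_derive 0)[].
exists (char_inv @` (`[a1, a2]%classic `*` `[b1, b2]%classic)); split.
- apply: continuous_compact; first exact/continuous_subspaceT/continuous_char_inv.
  by apply: compact_setX; exact: segment_compact.
- move=> _ [[a b] [h1 h2] <-]; rewrite /= !in_itv/= in h1 h2.
  have := char_invK (a, b); rewrite /char_coord => -[e1 e2].
  by apply: O; rewrite ?e1 ?e2.
move=> p pK; rewrite /char_prod.
have [h1|h1] := pselect (a1 <= p.1 - p.2 <= a2); last by rewrite A0// mul0r.
have [h2|h2] := pselect (b1 <= p.1 + p.2 <= b2); last by rewrite B0// mulr0.
exfalso; apply: pK; exists (char_coord p); last exact: char_coordK.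
by split; rewrite /= in_itv.
Qed.

End PlaneCalculus.

(** * Integration by parts in characteristic coordinates *)

Section WeakCalculus.
Context {R : realType}.
Notation mu := (@lebesgue_measure R).
Notation mu2 := (@lebesgue_measure R \x @lebesgue_measure R)%E.
Implicit Types (phi F G : R * R -> R) (V : R -> R -> R).

Definition lbounded F := measurable_fun setT F /\ forall N : R, exists2 C : R, 0 <= C &
  forall p, `|p.1| <= N -> `|p.2| <= N -> `|F p| <= C.

Lemma continuous_lbounded F : continuous F -> lbounded F.
Proof.
move=> cF; split; first exact: continuous_measurable2.
move=> N; pose B : set (R * R) := `[- N, N]%classic `*` `[- N, N]%classic.
have cB : compact B by apply: compact_setX; exact: segment_compact.
have cn : continuous (fun p => `|F p|).
  by move=> p; apply: (continuous_comp (cF p)); exact: norm_continuous.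
have [N0|N0] := ltP N 0.
  by exists 0 => // p p1; have := normr_ge0 p.1; linarith.
have B0 : B !=set0 by exists (0, 0); split; rewrite /= in_itv/=; apply/andP; linarith.
have [c _ cmax] := compact_EVT_max B0 cB (continuous_subspaceT cn).
exists `|F c| => // p p1 p2; apply: cmax; rewrite inE; split; rewrite /= in_itv/= -ler_norml//.
Qed.

Lemma lboundedM F G : lbounded F -> lbounded G -> lbounded (fun p => F p * G p).
Proof.
move=> [mF bF] [mG bG]; split; first exact: measurable_funM.
move=> N; have [C C0 FC] := bF N; have [D D0 GD] := bG N.
exists (C * D) => [|p p1 p2]; first exact: mulr_ge0.
by rewrite normrM ler_pM// ?FC// GD.
Qed.

Lemma lboundedD F G : lbounded F -> lbounded G -> lbounded (fun p => F p + G p).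
Proof.
move=> [mF bF] [mG bG]; split; first exact: measurable_funD.
move=> N; have [C C0 FC] := bF N; have [D D0 GD] := bG N.
exists (C + D) => [|p p1 p2]; first exact: addr_ge0.
by rewrite (le_trans (ler_normD _ _))// lerD// ?FC// GD.
Qed.

Lemma lboundedZ (k : R) F : lbounded F -> lbounded (fun p => k * F p).
Proof. by apply: lboundedM; apply: continuous_lbounded => p; exact: cvg_cst. Qed.

Definition box_supported G := exists N : R, forall p, G p <> 0 -> `|p.1| <= N /\ `|p.2| <= N.

Lemma boxedM F G : lbounded F -> lbounded G -> box_supported G -> boxed (fun p => F p * G p).
Proof.
move=> bF bG [N GN]; have [m h] := lboundedM bF bG.
pose N' := Num.max N 0; have NN : N <= N' by rewrite le_max lexx.
have [C C0 FGC] := h N'; split => //.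
exists N'; first by rewrite le_max lexx orbT.
have GN' p : F p * G p <> 0 -> `|p.1| <= N' /\ `|p.2| <= N'.
  move=> FG; have : G p <> 0 by move=> G0; apply: FG; rewrite G0 mulr0.
  by move=> /GN[h1 h2]; split; exact: le_trans NN.
exists C; split => // p; have [E|/eqP/GN'[h1 h2]] := eqVneq (F p * G p) 0; last exact: FGC.
by rewrite E normr0.
Qed.

Lemma half_plane_to_char F G : boxed G ->
  (forall p, 0 < p.2 -> F p = G (char_coord p)) ->
  (forall p, ~ 0 < p.2 -> G (char_coord p) = 0) ->
  \int[mu2]_(p in half_plane) F p = 2^-1 * \int[mu2]_p G p.
Proof.
move=> bG FG G0; rewrite -(Rintegral_char (boxed_integrable bG)).
rewrite Rintegral_mkcond; apply: eq_Rintegral => p _.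
rewrite patchE; case: ifPn => [|/negP]; rewrite inE /half_plane /=.
  by move=> /FG.
by move=> /G0.
Qed.

Lemma measurable_half_plane : measurable (@half_plane R).
Proof.
apply: open_measurable2; rewrite (_ : half_plane = (fun p : R * R => p.2) @^-1` [set x | 0 < x]) //.
by apply: open_comp => [p _|]; [exact: cvg_snd|exact: open_gt].
Qed.

Lemma lbounded_L1_loc F G : lbounded G -> (forall p, 0 < p.2 -> F p = G (char_coord p)) ->
  L1_loc_half F.
Proof.
move=> [mG bG] FG.
have mGT : measurable_fun setT (fun p => G (char_coord p)).
  exact: measurableT_comp mG measurable_char_coord.
split.
  apply: (@eq_measurable_fun _ _ _ _ _ (fun p => G (char_coord p))).
    by move=> p; rewrite inE => hp; rewrite FG.
  exact: measurable_funTS.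
move=> K cK KH; have mK := compact_measurable2 cK.
have c1 : {within K, continuous (fun p : R * R => `|p.1| + `|p.2|)}.
  apply: continuous_subspaceT => p; apply: cvgD; apply: cvg_norm; [exact: cvg_fst|exact: cvg_snd].
have [N KN] : exists N : R, forall p, K p -> `|p.1| + `|p.2| <= N.
  have [->|/set0P K0] := eqVneq K set0; first by exists 0.
  have [c cK' cmax] := compact_EVT_max K0 cK c1.
  by exists (`|c.1| + `|c.2|) => p Kp; apply: cmax; rewrite inE.
have [C C0 GC] := bG N.
pose B : set (R * R) := `[- N, N]%classic `*` `[- N, N]%classic.
have KB : K `<=` B.
  move=> p /KN h; have := normr_ge0 p.1; have := normr_ge0 p.2 => h1 h2.
  by split; rewrite /= in_itv/= -ler_norml; linarith.
have mB : measurable B by apply: measurableX; exact: measurable_itv.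
have fB : (mu2 B < +oo)%E.
  pose I : set R := `[- N, N]%classic; have mI : measurable I by exact: measurable_itv.
  rewrite [X in (X < _)%E](_ : _ = mu I * mu I)%E; last exact: product_measure1E.
  by rewrite /I /= lebesgue_measure_itv/=; case: ifP => _; rewrite ?mule0// -EFinD -EFinM ltry.
apply: (@le_lt_trans _ _ (\int[mu2]_(p in K) (C%:E))%E).
  apply: ge0_le_integral => //.
  - apply/measurable_EFinP; apply: measurableT_comp => //.
    apply: (@eq_measurable_fun _ _ _ _ _ (fun p => G (char_coord p))).
      by move=> p; rewrite inE => /KH hp; rewrite FG.
    exact: measurable_funTS.
  - by move=> p Kp; rewrite lee_fin (FG _ (KH _ Kp)) GC// /char_coord /=;
      rewrite (le_trans _ (KN _ Kp))// ?ler_normB ?ler_normD.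
rewrite integral_cst// (@le_lt_trans _ _ (C%:E * mu2 B))%E//.
  by rewrite lee_wpmul2l ?lee_fin//; apply: le_measure => //; rewrite inE.
by rewrite lte_mul_pinfty.
Qed.

Definition slope_l V (p : R * R) : R := dq (V^~ p.2) p.1.
Definition slope_r V (p : R * R) : R := dq (V p.1) p.2.

Lemma lip2_quot_bound (V : R -> R -> R) : lip2 V -> forall N, exists2 C : R, 0 <= C & forall p : R * R,
  `|p.1| <= N -> `|p.2| <= N -> (forall n, `|n.+1%:R * (V (p.1 + n.+1%:R^-1) p.2 - V p.1 p.2)| <= C) /\
    (forall n, `|n.+1%:R * (V p.1 (p.2 + n.+1%:R^-1) - V p.1 p.2)| <= C).
Proof.
move=> lV N; have [L L0 VL] := lV (N + 1); exists L => // p p1 p2.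
have hn n : `|n.+1%:R^-1 : R| <= 1 by rewrite ger0_norm// invf_le1// ler1n.
have h1 (x : R) n : `|x| <= N -> `|x + n.+1%:R^-1| <= N + 1.
  by move=> xN; rewrite (le_trans (ler_normD _ _))// lerD.
have h2 (x : R) : `|x| <= N -> `|x| <= N + 1 by move=> xN; linarith.
split=> n; rewrite normrM ger0_norm// -ler_pdivlMl ?ltr0n// mulrC.
  have := VL _ _ _ _ (h1 _ n p1) (h2 _ p1) (h2 _ p2) (h2 _ p2).
  by rewrite subrr normr0 addr0 addrAC subrr add0r (ger0_norm (x := n.+1%:R^-1)).
have := VL _ _ _ _ (h2 _ p1) (h2 _ p1) (h1 _ n p2) (h2 _ p2).
by rewrite subrr normr0 add0r addrAC subrr add0r (ger0_norm (x := n.+1%:R^-1)).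
Qed.

Lemma measurable_limn_sup2 (u : nat -> R * R -> R) :
  (forall n, measurable_fun setT (u n)) ->
  (forall p, exists C : R, forall n, `|u n p| <= C) ->
  measurable_fun setT (fun p => limn_sup (u ^~ p)).
Proof.
move=> mu_ bd; apply: measurable_fun_limn_sup => [t _|t _|//].
- by have [C hC] := bd t; exists C => _ [n _ <-]; exact: le_trans (ler_norm _) (hC n).
- have [C hC] := bd t; exists (- C) => _ [n _ <-].
  by have := hC n; rewrite ler_norml => /andP[].
Qed.

Lemma lip2_shift V (h k : R) : lip2 V -> lip2 (fun a b => V (a + h) (b + k)).
Proof.
move=> lV N; have [L L0 VL] := lV (N + `|h| + `|k|); exists L => // a a' b b' aN aN' bN bN'.
have sh (x : R) : `|x| <= N -> `|x + h| <= N + `|h| + `|k|.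
  by move=> xN; rewrite (le_trans (ler_normD _ _))//; have := normr_ge0 k; linarith.
have sk (x : R) : `|x| <= N -> `|x + k| <= N + `|h| + `|k|.
  by move=> xN; rewrite (le_trans (ler_normD _ _))//; have := normr_ge0 h; linarith.
have := VL _ _ _ _ (sh _ aN) (sh _ aN') (sk _ bN) (sk _ bN').
have -> : a + h - (a' + h) = a - a' by ring.
by have -> : b + k - (b' + k) = b - b' by ring.
Qed.

Lemma lbounded_slopes V : lip2 V -> lbounded (slope_l V) /\ lbounded (slope_r V).
Proof.
move=> lV; have bd := lip2_quot_bound lV; have cV := lip2_continuous lV.
have mV : measurable_fun setT (fun p : R * R => V p.1 p.2) by exact: continuous_measurable2.
have mVs h k : measurable_fun setT (fun p : R * R => V (p.1 + h) (p.2 + k)).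
  by apply: continuous_measurable2; exact: (lip2_continuous (lip2_shift h k lV)).
split; split.
- apply: measurable_limn_sup2 => [n|p].
    apply: measurable_funM => //; apply: measurable_funB => //.
    have := mVs n.+1%:R^-1 0; apply: eq_measurable_fun => p _ /=; by rewrite addr0.
  have [C C0 hC] := bd (Num.max `|p.1| `|p.2|); exists C => n.
  by case: (hC p) => //; rewrite le_max lexx ?orbT.
- move=> N; have [C C0 hC] := bd N; exists C => // p p1 p2.
  by apply: dq_le => n; case: (hC p p1 p2).
- apply: measurable_limn_sup2 => [n|p].
    apply: measurable_funM => //; apply: measurable_funB => //.
    have := mVs 0 n.+1%:R^-1; apply: eq_measurable_fun => p _ /=; by rewrite addr0.
  have [C C0 hC] := bd (Num.max `|p.1| `|p.2|); exists C => n.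
  by case: (hC p) => //; rewrite le_max lexx ?orbT.
- move=> N; have [C C0 hC] := bd N; exists C => // p p1 p2.
  by apply: dq_le => n; case: (hC p p1 p2).
Qed.

Lemma Rintegral_supp (h : R -> R) (M : R) : (forall x, M < `|x| -> h x = 0) ->
  \int[mu]_x h x = \int[mu]_(x in `[- M, M]) h x.
Proof.
move=> h0; rewrite [RHS]Rintegral_mkcond; apply: eq_Rintegral => x _.
rewrite patchE; case: ifPn => // /negP; rewrite inE /= in_itv/= -ler_norml => /negP.
by rewrite -ltNge => /h0.
Qed.

Lemma loclip_bounded (h : R -> R) (N : R) : loclip h -> exists2 C : R, 0 <= C &
  forall x, `|x| <= N -> `|h x| <= C.
Proof.
move=> lh; have [L L0 hL] := lh N.
have [N0|N0] := ltP N 0.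
  by exists 0 => // x xN; have := normr_ge0 x; linarith.
exists (`|h 0| + L * N); first by rewrite addr_ge0 ?mulr_ge0.
move=> x xN; have := hL x 0 xN; rewrite normr0 subr0 => /(_ N0) h1.
have := ler_normD (h x - h 0) (h 0); rewrite subrK.
have := ler_wpM2l L0 xN; linarith.
Qed.

Lemma loclipM (h k : R -> R) : loclip h -> loclip k -> loclip (fun x => h x * k x).
Proof.
move=> lh lk N; have [L L0 hL] := lh N; have [K K0 kK] := lk N.
have [C C0 hC] := loclip_bounded N lh; have [D D0 kD] := loclip_bounded N lk.
exists (C * K + L * D) => [|x y xN yN]; first by rewrite addr_ge0 ?mulr_ge0.
have -> : h x * k x - h y * k y = h x * (k x - k y) + (h x - h y) * k y by ring.
rewrite (le_trans (ler_normD _ _))// !normrM mulrDl lerD//.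
  by rewrite -mulrA ler_pM ?hC ?kK.
by rewrite mulrAC ler_pM ?hL ?kD.
Qed.

Lemma C1_loclip (psi psi' : R -> R) : (forall x : R, is_derive x 1 psi (psi' x)) ->
  continuous psi' -> loclip psi.
Proof.
move=> d c N; have [N0|N0] := ltP N 0.
  by exists 0 => // x y xN; have := normr_ge0 x; linarith.
have cpsi : continuous psi.
  by move=> x; apply: differentiable_continuous; apply/derivable1_diffP; case: (d x).
have cn : {within `[- N, N], continuous (fun x => `|psi' x|)}.
  apply: continuous_subspaceT => x; apply: (continuous_comp (c x)); exact: norm_continuous.
have [m _ mm] := EVT_max (a := - N) (b := N) ltac:(linarith) cn.
exists `|psi' m| => // x y xN yN.
wlog xy : x y xN yN / x <= y.
  move=> H; have [xy|yx] := orP (le_total x y); first exact: H.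
  by rewrite distrC (distrC x); exact: H.
move: xy; rewrite le_eqVlt => /predU1P[->|xy]; first by rewrite !subrr normr0 mulr0.
have [e exy E] := MVT xy (fun z _ => d z) (continuous_subspaceT cpsi).
rewrite distrC E normrM (distrC x) ler_wpM2r//; apply: mm.
move: exy xN yN; rewrite !in_itv/= !ler_norml => /andP[? ?] /andP[? ?] /andP[? ?].
by apply/andP; split; linarith.
Qed.

Lemma parts1 (h psi psi' : R -> R) (N : R) : loclip h -> (forall x : R, is_derive x 1 psi (psi' x)) ->
  continuous psi' -> (forall x, N < `|x| -> psi x = 0 /\ psi' x = 0) ->
  \int[mu]_x (h x * psi' x) = - \int[mu]_x (dq h x * psi x).
Proof.
move=> lh d c psi0; have lpsi := C1_loclip d c.
pose M := Num.max N 0 + 1; have MN : N < M by rewrite /M ltr_pwDr// le_max lexx.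
have M0 : 0 < M by rewrite /M ltr_wpDl// le_max lexx orbT.
have MM : - M <= M by linarith.
have NM (x : R) : M < `|x| -> N < `|x| by exact: lt_trans.
rewrite !(@Rintegral_supp _ M); last 2 first.
- by move=> x /NM/psi0[-> _]; rewrite mulr0.
- by move=> x /NM/psi0[_ ->]; rewrite mulr0.
have lP : loclip (fun x => h x * psi x) by exact: loclipM.
have mpsi' : measurable_fun setT psi' by exact: continuous_measurable_fun.
have mpsi : measurable_fun setT psi by exact: continuous_measurable_fun (loclip_continuous lpsi).
have mh : measurable_fun setT h by exact: continuous_measurable_fun (loclip_continuous lh).
have mdh := measurable_dq lh.
have := loclip_FTC lP MM.
have -> : h M * psi M - h (- M) * psi (- M) = 0.
  have M1 : N < `|M| by rewrite gtr0_norm//; linarith.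
  by rewrite (psi0 _ M1).1 (psi0 (- M) _).1 ?normrN//; ring.
have e : {ae mu, forall x, - M < x < M -> dq (fun x => h x * psi x) x = dq h x * psi x + h x * psi' x}.
  apply: ae_imp (loclip_derivable lh) => x dh _.
  have dh' : is_derive x 1 h (dq h x) by rewrite derive_dq// derive1E; exact: DeriveDef.
  have [dP EP] := is_deriveM dh' (d x).
  by rewrite derive_dq// derive1E EP /GRing.scale/= addrC mulrC.
have m1 : measurable_fun setT (fun x => dq h x * psi x) by exact: measurable_funM.
have m2 : measurable_fun setT (fun x => h x * psi' x) by exact: measurable_funM.
have m12 : measurable_fun setT (fun x => dq h x * psi x + h x * psi' x) by exact: measurable_funD.
rewrite (ae_eq_Rintegral (measurable_dq lP) m12 e).
have [L L0 hL] := dq_bounded (- M) M lh.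
have [C C0 hC] := loclip_bounded M lh; have [D D0 kD] := loclip_bounded M lpsi.
have [K hK] : exists K : R, forall x, - M <= x <= M -> `|psi' x| <= K.
  have cn : {within `[- M, M], continuous (fun x => `|psi' x|)}.
    apply: continuous_subspaceT => x; apply: (continuous_comp (c x)); exact: norm_continuous.
  have [m _ mm] := EVT_max MM cn.
  by exists `|psi' m| => x xM; apply: mm; rewrite in_itv.
have i1 : mu.-integrable `[- M, M] (EFin \o (fun x => dq h x * psi x)).
  apply: (bounded_integrable_itv (C := L * D) m1) => x xM; rewrite normrM ler_pM ?hL//.
  by apply: kD; rewrite ler_norml.
have i2 : mu.-integrable `[- M, M] (EFin \o (fun x => h x * psi' x)).
  apply: (bounded_integrable_itv (C := C * K) m2) => x xM; rewrite normrM ler_pM ?hK//.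
  by apply: hC; rewrite ler_norml.
by rewrite RintegralD// => /eqP; rewrite addr_eq0 => /eqP ->; rewrite opprK.
Qed.

(** A test function read in characteristic coordinates, with its two partial derivatives there.
    First derivatives suffice because [box_flux] moves one derivative onto the wave. The support is
    kept as a compact set so that positive margins can be taken on it. *)
Record char_test (K : set (R * R)) (psi pa pb : R * R -> R) : Prop := CharTest {
  ct_psi : continuous psi;
  ct_pa : continuous pa;
  ct_pb : continuous pb;
  ct_dpa : forall a b : R, is_derive a 1 (fun s : R => psi (s, b)) (pa (a, b));
  ct_dpb : forall a b : R, is_derive b 1 (fun s : R => psi (a, s)) (pb (a, b));
  ct_compact : compact K;
  ct_out : forall p, ~ K p -> [/\ psi p = 0, pa p = 0 & pb p = 0] }.

Lemma test_fun_derive (Omega : set (R * R)) phi (b : bool) : test_fun Omega phi ->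
  test_fun Omega ('D_(if b then et else ex) phi).
Proof.
move=> [sphi [K [cK KO K0]]]; split.
  by move=> s p; have := sphi (rcons s b) p; rewrite /partials foldr_rcons.
exists K; split => // p Kp.
have oK : open (~` K) by apply: closed_openC; apply: compact_closed cK; exact: norm_hausdorff.
have near0 : \forall q \near p, phi q = cst 0 q.
  have : \forall q \near p, (~` K) q by exact: open_nbhs_nbhs.
  by apply: filterS => q /K0.
by rewrite (near_eq_derive _ near0) derive_cst.
Qed.

Lemma test_fun_char (Omega : set (R * R)) phi : test_fun Omega phi ->
  exists K, [/\ K `<=` [set q | Omega (char_inv q)],
    char_test K (fun q => phi (char_inv q))
      (fun q => 2^-1 * ('D_ex phi (char_inv q) - 'D_et phi (char_inv q)))
      (fun q => 2^-1 * ('D_ex phi (char_inv q) + 'D_et phi (char_inv q))) &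
    forall p, ~ K (char_coord p) -> [/\ phi p = 0, 'D_ex phi p = 0 & 'D_et phi p = 0]].
Proof.
move=> tphi; have [sphi [K [cK KO K0]]] := tphi.
have [sx _] := test_fun_derive false tphi; have [st _] := test_fun_derive true tphi.
have out p : ~ K p -> [/\ phi p = 0, 'D_ex phi p = 0 & 'D_et phi p = 0].
  move=> Kp; have oK : open (~` K) by apply: closed_openC; apply: compact_closed cK; exact: norm_hausdorff.
  have near0 : \forall q \near p, phi q = cst 0 q.
    have : \forall q \near p, (~` K) q by exact: open_nbhs_nbhs.
    by apply: filterS => q /K0.
  by rewrite K0// !(near_eq_derive _ near0) !derive_cst.
have cont (f : R * R -> R) : (forall p, differentiable f p) -> continuous (fun q => f (char_inv q)).
  move=> df q; apply: (@continuous_comp _ _ _ char_inv f q); first exact: continuous_char_inv.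
  exact: differentiable_continuous.
have dphi p : differentiable phi p by exact: (sphi [::] p).
have cphi := cont _ dphi.
have cx := cont _ (sx [::]); have ct := cont _ (st [::]).
have clin (k l : R) : continuous (fun q => k * 'D_ex phi (char_inv q) + l * 'D_et phi (char_inv q)).
  move=> q; apply: cvgD; (apply: cvgM; first exact: cvg_cst); [exact: cx|exact: ct].
have dv p (k l : R) : 'D_(k, l) phi p = k * 'D_ex phi p + l * 'D_et phi p.
  have -> : (k, l) = k *: ex + l *: et :> R * R.
    by rewrite /ex /et; congr pair; rewrite /= /GRing.scale/=; ring.
  by rewrite !deriveE// linearD !linearZ.
exists (char_coord @` K); split.
- by move=> _ [p Kp <-]; rewrite /= char_coordK; exact: KO.
- split.
  + exact: cphi.
  + have -> : (fun q => 2^-1 * ('D_ex phi (char_inv q) - 'D_et phi (char_inv q))) =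
        fun q => 2^-1 * 'D_ex phi (char_inv q) + (- 2^-1) * 'D_et phi (char_inv q).
      by apply/funext => q; rewrite mulrBr mulNr.
    exact: clin.
  + have -> : (fun q => 2^-1 * ('D_ex phi (char_inv q) + 'D_et phi (char_inv q))) =
        fun q => 2^-1 * 'D_ex phi (char_inv q) + 2^-1 * 'D_et phi (char_inv q).
      by apply/funext => q; rewrite mulrDr.
    exact: clin.
  + move=> a b; have h : is_derive a 1 (fun s : R => phi (char_inv (s, b)))
        ('D_(2^-1, - 2^-1) phi (char_inv (a, b))).
      apply: derive_along => [h|]; last exact: diff_derivable.
      by rewrite /char_inv /=; congr pair; rewrite /= /GRing.scale/=; ring.
    by apply: (is_derive_conv h) => //; rewrite dv mulrBr mulNr.
  + move=> a b; have h : is_derive b 1 (fun s : R => phi (char_inv (a, s)))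
        ('D_(2^-1, 2^-1) phi (char_inv (a, b))).
      apply: derive_along => [h|]; last exact: diff_derivable.
      by rewrite /char_inv /=; congr pair; rewrite /= /GRing.scale/=; ring.
    by apply: (is_derive_conv h) => //; rewrite dv mulrDr.
  + by apply: continuous_compact => //; apply: continuous_subspaceT; exact: continuous_char_coord.
  + move=> q qK; have := out (char_inv q); case.
      by move=> h; apply: qK; exists (char_inv q) => //; exact: char_invK.
    by move=> -> -> ->; rewrite subr0 addr0 mulr0.
- by move=> p h; apply: out => Kp; apply: h; exists p.
Qed.

Lemma char_test_box K psi pa pb : char_test K psi pa pb -> exists N : R,
  forall p, N < `|p.1| \/ N < `|p.2| -> [/\ psi p = 0, pa p = 0 & pb p = 0].
Proof.
move=> ct; have cK := ct_compact ct.
have c1 : {within K, continuous (fun p : R * R => `|p.1| + `|p.2|)}.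
  apply: continuous_subspaceT => p; apply: cvgD; apply: cvg_norm; [exact: cvg_fst|exact: cvg_snd].
have [N KN] : exists N : R, forall p, K p -> `|p.1| + `|p.2| <= N.
  have [->|/set0P K0] := eqVneq K set0; first by exists 0.
  have [c cK' cmax] := compact_EVT_max K0 cK c1.
  by exists (`|c.1| + `|c.2|) => p Kp; apply: cmax; rewrite inE.
exists N => p h; apply: (ct_out ct) => /KN.
by have := normr_ge0 p.1; have := normr_ge0 p.2; case: h; linarith.
Qed.

Lemma char_test_boxed K psi pa pb F : char_test K psi pa pb -> lbounded F ->
  [/\ boxed (fun p => F p * psi p), boxed (fun p => F p * pa p) & boxed (fun p => F p * pb p)].
Proof.
move=> ct bF; have [N hN] := char_test_box ct.
have sup G : (forall p, N < `|p.1| \/ N < `|p.2| -> G p = 0) -> box_supported G.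
  move=> G0; exists N => p Gp; split; rewrite leNgt; apply/negP => h; apply: Gp; apply: G0;
  by [left|right].
split; apply: boxedM => //; try exact/continuous_lbounded/(ct_psi ct);
  try exact/continuous_lbounded/(ct_pa ct); try exact/continuous_lbounded/(ct_pb ct);
  by apply: sup => p /hN[].
Qed.

Lemma parts2 K psi pa pb V : char_test K psi pa pb -> lip2 V ->
  (\int[mu2]_p (V p.1 p.2 * pa p) = - (\int[mu2]_p (slope_l V p * psi p))) /\
  (\int[mu2]_p (V p.1 p.2 * pb p) = - (\int[mu2]_p (slope_r V p * psi p))).
Proof.
move=> ct lV; have [N hN] := char_test_box ct.
have bV := continuous_lbounded (lip2_continuous lV).
have [bl br] := lbounded_slopes lV.
have [_ b1 b2] := char_test_boxed ct bV.
have [b3 _ _] := char_test_boxed ct bl; have [b4 _ _] := char_test_boxed ct br.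
rewrite (boxed_fubini2 b1) (boxed_fubini2 b3) (boxed_fubini1 b2) (boxed_fubini1 b4).
have slicel (b : R) : continuous (fun a : R => (a, b)).
  by move=> a; exact: (cvg_pair (@cvg_id _ (nbhs a)) (cvg_cst b)).
have slicer (a : R) : continuous (fun b : R => (a, b)).
  by move=> b; exact: (cvg_pair (cvg_cst a) (@cvg_id _ (nbhs b))).
have neg (f g : R -> R) : (forall x, f x = - g x) -> mu.-integrable setT (EFin \o g) ->
    \int[mu]_x f x = - \int[mu]_x g x.
  move=> fg ig; rewrite -mulN1r -RintegralZl//; apply: eq_Rintegral => x _.
  by rewrite fg mulN1r.
split.
- apply: neg => [b|].
    apply: (parts1 (N := N)); first exact: lip2_l.
    + by move=> a; exact: (ct_dpa ct).
    + by move=> a; apply: (continuous_comp (slicel b a)); exact: (ct_pa ct).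
    + by move=> a aN; have [] := hN (a, b) (or_introl aN).
  exact: (boxed_integrable_slice2 b3).
- apply: neg => [a|].
    apply: (parts1 (N := N)); first exact: lip2_r.
    + by move=> b; exact: (ct_dpb ct).
    + by move=> b; apply: (continuous_comp (slicer a b)); exact: (ct_pb ct).
    + by move=> b bN; have [] := hN (a, b) (or_intror bN).
  exact: (boxed_integrable_slice1 b4).
Qed.

End WeakCalculus.

(** * From characteristic to distributional solutions *)

Section StrongToWeak.
Context {R : realType}.
Notation mu := (@lebesgue_measure R).
Notation mu2 := (@lebesgue_measure R \x @lebesgue_measure R)%E.
Implicit Types (phi F G : R * R -> R) (V : R -> R -> R).

Lemma limn_sup_le (u v : nat -> R) (C : R) (n0 : nat) :
  (forall n, `|u n| <= C /\ `|v n| <= C) -> (forall n, (n0 <= n)%N -> u n <= v n) ->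
  limn_sup u <= limn_sup v.
Proof.
move=> bd uv.
have ubr (w : nat -> R) : (forall n, `|w n| <= C) -> has_ubound (range w) /\ has_lbound (range w).
  move=> hw; split; first by exists C => _ [n _ <-]; exact: le_trans (ler_norm _) (hw n).
  by exists (- C) => _ [n _ <-]; have := hw n; rewrite ler_norml => /andP[].
have [ubu lbu] := ubr u (fun n => (bd n).1); have [ubv lbv] := ubr v (fun n => (bd n).2).
have /cvg_lim := cvg_sups_inf ubu lbu; move=> /(_ (@Rhausdorff _)).
rewrite -[lim _]/(limn_sup u) => ->.
have /cvg_lim := cvg_sups_inf ubv lbv; move=> /(_ (@Rhausdorff _)).
rewrite -[lim _]/(limn_sup v) => ->.
apply: lb_le_inf; first by exists (sups v 0%N), 0%N.
move=> _ [m _ <-]; pose k := maxn m n0.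
apply: (@le_trans _ _ (sups u k)).
  apply: ge_inf; last by exists k.
  exists (- C) => _ [i _ <-]; apply: (@le_trans _ _ (u i)).
    by have := (bd i).1; rewrite ler_norml => /andP[].
  by apply: ub_le_sup; [exact: has_ubound_sdrop|exists i => /=].
apply: ge_sup; first by exists (u k), k => /=.
move=> _ [i /= ki <-]; apply: (@le_trans _ _ (v i)).
  by apply: uv; apply: leq_trans ki; rewrite leq_max leqnn orbT.
apply: ub_le_sup; first exact: has_ubound_sdrop.
by exists i => //=; apply: leq_trans ki; rewrite leq_max leqnn.
Qed.

(** The comparison holds at every point, differentiable or not, so the slopes of V at two shifted
    positions can be compared pointwise, without exceptional sets depending on the shift. *)
Lemma dq_mono (f g : R -> R) (x d : R) : loclip f -> loclip g -> 0 < d ->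
  (forall h, 0 < h -> h < d -> f (x + h) - f x <= g (x + h) - g x) -> dq f x <= dq g x.
Proof.
move=> lf lg d0 fg; have [L L0 fL] := lf (`|x| + 1); have [K K0 gK] := lg (`|x| + 1).
have quot (h : R -> R) (C : R) : 0 <= C ->
    (forall s t : R, `|s| <= `|x| + 1 -> `|t| <= `|x| + 1 -> `|h s - h t| <= C * `|s - t|) ->
    forall n, `|n.+1%:R * (h (x + n.+1%:R^-1) - h x)| <= C.
  move=> C0 hC n; rewrite normrM ger0_norm// -ler_pdivlMl// mulrC.
  apply: le_trans (hC _ _ _ _) _.
  - rewrite (le_trans (ler_normD _ _))// lerD2l ger0_norm// invf_le1//.
    by rewrite ler1n.
  - by rewrite lerDl.
  - by rewrite addrAC subrr add0r ger0_norm.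
have [n0 _ hn0] := near_infty_natSinv_lt (PosNum d0).
apply: (@limn_sup_le _ _ (L + K) n0) => [n|n n0n].
  by split; [apply: le_trans (quot _ _ L0 fL n) _|apply: le_trans (quot _ _ K0 gK n) _]; rewrite ?lerDl ?lerDr.
by rewrite ler_wpM2l// fg ?invr_gt0//; exact: hn0.
Qed.

Lemma dominated_Rintegral d (T : measurableType d) (nu : {measure set T -> \bar R})
    (D : set T) (f_ : nat -> T -> R) (f : T -> R) (C : R) :
  measurable D -> (nu D < +oo)%E -> (forall n, measurable_fun D (f_ n)) ->
  (forall x, D x -> f_ n x @[n --> \oo] --> f x) -> (forall n x, D x -> `|f_ n x| <= C) ->
  \int[nu]_(x in D) f_ n x @[n --> \oo] --> \int[nu]_(x in D) f x.
Proof.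
move=> mD fD mf cf bf.
have iC : nu.-integrable D (cst C%:E).
  apply: measurable_bounded_integrable => //.
  by exists `|C|; split; [exact: num_real|move=> M CM x _; exact: ltW].
have mE n : measurable_fun D (EFin \o f_ n) by exact/measurable_EFinP.
have cE x : D x -> (EFin \o f_ n) x @[n --> \oo] --> (EFin \o f) x.
  by move=> Dx; apply: cvg_EFin; [exact: nearW|exact: cf].
have bE n x : D x -> (`|(EFin \o f_ n) x| <= cst C%:E x)%E by move=> Dx; rewrite lee_fin bf.
have gfin x : D x -> (cst C%:E : T -> \bar R) x \is a fin_num by [].
have h := dominated_cvg mD mE cE gfin iC bE.
apply: fine_cvg; rewrite /Rintegral fineK//.
apply: (@integrable_fin_num _ _ _ nu) => //.
have mf' : measurable_fun D f by exact: (measurable_fun_cvg mf cf).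
apply: measurable_bounded_integrable => //.
exists C; split; [exact: num_real|move=> M CM x Dx]; apply: (le_trans _ (ltW CM)).
apply: (cvgr_to_le (cvg_norm (cf x Dx))).
by apply: nearW => n; exact: bf.
Qed.

Lemma Rintegral_translation (h : R -> R) (c : R) : measurable_fun setT h ->
  mu.-integrable setT (EFin \o h) ->
  \int[mu]_x h (x + c) = \int[mu]_x h x.
Proof.
move=> mh ih.
have mE : measurable_fun setT (EFin \o h) by exact/measurable_EFinP.
have mEp : measurable_fun setT (EFin \o h)^\+%E by exact: measurable_funepos.
have mEn : measurable_fun setT (EFin \o h)^\-%E by exact: measurable_funeneg.
have tr (F : R -> \bar R) : measurable_fun setT F -> (forall x, 0 <= F x)%E ->
    (\int[mu]_x F (x + c)%R = \int[mu]_x F x)%E.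
  move=> mF F0; have := ge0_integral_affine c ltr01 mF F0.
  rewrite invr1 mul1e => <-; apply: eq_integral => x _; by rewrite mul1r.
rewrite /Rintegral [in LHS]integralE [in RHS]integralE.
rewrite -(tr _ mEp (funepos_ge0 _)) -(tr _ mEn (funeneg_ge0 _)).
congr (fine (_ - _)%E); apply: eq_integral => x _; by rewrite ?funeposE ?funenegE.
Qed.

(** Discrete integration by parts: psi' is replaced by a difference quotient with step 1 / n.+1 and
    the shift is moved onto m, which yields an integrand of known sign. Dominated convergence passes
    to the limit, and m need not be continuous. *)
Lemma monotone_flux (m psi psi' : R -> R) (N : R) (n0 : nat) : measurable_fun setT m ->
  (forall M : R, exists2 C : R, 0 <= C & forall x, `|x| <= M -> `|m x| <= C) ->
  (forall x : R, is_derive x 1 psi (psi' x)) -> continuous psi' ->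
  (forall x, N < `|x| -> psi x = 0 /\ psi' x = 0) ->
  (forall n x, (n0 <= n)%N -> 0 <= (m (x - n.+1%:R^-1) - m x) * psi x) ->
  0 <= \int[mu]_x (m x * psi' x).
Proof.
move=> mm bm d c psi0 sgn; have lpsi := C1_loclip d c.
pose M : R := Num.max N 0 + 1.
have NM0 : N <= Num.max N 0 by rewrite le_max lexx.
have NM : N <= M by rewrite /M; linarith.
have [C C0 hC] := bm (M + 1); have [L L0 hL] := lpsi (M + 1).
have cpsi := loclip_continuous lpsi.
have mpsi : measurable_fun setT psi by exact: continuous_measurable_fun.
pose q n x : R := n.+1%:R * (psi (x + n.+1%:R^-1) - psi x).
have hn n : 0 < n.+1%:R^-1 :> R /\ n.+1%:R^-1 <= 1 :> R.
  by rewrite invr_gt0 ltr0n invf_le1// ler1n.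
have q0 n x : M < `|x| -> q n x = 0.
  move=> Mx; have [h0 h1] := hn n.
  have Nx : N < `|x| by linarith.
  have Nxh : N < `|x + n.+1%:R^-1|.
    move: h0 h1; set h : R := n.+1%:R^-1 => h0 h1.
    have := ler_normB (x + h) h; rewrite addrK (gtr0_norm h0) => h2.
    have : N + 1 <= M by rewrite /M lerD2r le_max lexx.
    by linarith.
  by rewrite /q (psi0 _ Nx).1 (psi0 _ Nxh).1 subrr mulr0.
have qL n x : `|x| <= M -> `|q n x| <= L.
  move=> xM; have [h0 h1] := hn n; rewrite /q normrM ger0_norm// -ler_pdivlMl// mulrC.
  have xh : `|x + n.+1%:R^-1| <= M + 1.
    by rewrite (le_trans (ler_normD _ _))// lerD// gtr0_norm.
  have xM1 : `|x| <= M + 1 by linarith.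
  by apply: le_trans (hL _ _ xh xM1) _; rewrite addrAC subrr add0r gtr0_norm.
have mshift (h : R -> R) (k : R) : measurable_fun setT h ->
    measurable_fun setT (fun x : R => h (x + k)).
  move=> mh; apply: (measurableT_comp mh); apply: continuous_measurable_fun => x.
  by apply: cvgD; [exact: cvg_id|exact: cvg_cst].
have mq n : measurable_fun setT (q n).
  by apply: measurable_funM => //; apply: measurable_funB => //; exact: mshift.
have cq x : q n x @[n --> \oo] --> psi' x.
  have [dx Ex] := d x; have := derive_seqr dx; rewrite derive1E Ex; exact.
have lim : \int[mu]_(x in `[- M, M]) (m x * q n x) @[n --> \oo] -->
    \int[mu]_(x in `[- M, M]) (m x * psi' x).
  apply: (@dominated_Rintegral _ _ mu _ _ _ (C * L)) => //.
  - by rewrite /= lebesgue_measure_itv/=; case: ifP => _; rewrite ?ltry// -EFinD ltry.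
  - move=> n; have mmq : measurable_fun setT (fun x : R => m x * q n x) by exact: measurable_funM.
    exact: (measurable_funTS mmq).
  - by move=> x _; apply: cvgM; [exact: cvg_cst|exact: cq].
  - move=> n x; rewrite /= in_itv/= -ler_norml => xM; rewrite normrM ler_pM ?qL// hC//.
    by linarith.
rewrite (@Rintegral_supp _ _ M); last first.
  move=> x Mx; have Nx : N < `|x| by linarith.
  by rewrite (psi0 _ Nx).2 mulr0.
apply: (cvgr_to_ge lim); exists n0 => // n /= n0n.
have [h0 h1] := hn n; move: h0 h1 (q0 n) (qL n) (mq n) (sgn n).
rewrite /q; set h : R := n.+1%:R^-1 => h0 h1 q0n qLn mqn sgnn.
rewrite -(@Rintegral_supp _ (fun x => m x * (n.+1%:R * (psi (x + h) - psi x)))); last first.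
  by move=> x /q0n ->; rewrite mulr0.
have ib (f : R -> R) (K D : R) : measurable_fun setT f -> (forall x, `|x| <= K -> `|f x| <= D) ->
    (forall x, K < `|x| -> f x = 0) -> mu.-integrable setT (EFin \o f).
  move=> mf fD f0; have mI : measurable (`[- K, K]%classic : set R) by exact: measurable_itv.
  have -> : EFin \o f = (EFin \o f) \_ `[- K, K]%classic.
    apply/funext => x; rewrite patchE; case: ifPn => // /negP; rewrite inE /= in_itv/= -ler_norml.
    by move=> /negP; rewrite -ltNge => /f0 ->.
  rewrite -(@integrable_mkcond _ _ _ mu _ _ mI).
  by apply: (bounded_integrable_itv (C := D) mf) => x; rewrite -ler_norml; exact: fD.
have [D D0 hD] := loclip_bounded (M + 1) lpsi.
have psiM x : M < `|x| -> psi x = 0 by move=> Mx; have /psi0[] : N < `|x| by linarith.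
have i1 : mu.-integrable setT (EFin \o (fun x => m (x - h) * psi x)).
  apply: (ib _ M (C * D)); first by apply: measurable_funM => //; exact: mshift.
    move=> x xM; rewrite normrM ler_pM ?hD//; last linarith.
    by apply: hC; rewrite (le_trans (ler_normB _ _))// lerD// gtr0_norm.
  by move=> x /psiM ->; rewrite mulr0.
have i2 : mu.-integrable setT (EFin \o (fun x => m x * psi x)).
  apply: (ib _ M (C * D)); first exact: measurable_funM.
    by move=> x xM; rewrite normrM ler_pM ?hD ?hC//; linarith.
  by move=> x /psiM ->; rewrite mulr0.
have m1 : measurable_fun setT (fun x : R => m (x - h) * psi x).
  by apply: measurable_funM => //; exact: mshift.
have i1' : mu.-integrable setT (EFin \o (fun x => m x * psi (x + h))).
  apply: (ib _ (M + 1) (C * D)).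
  - by apply: measurable_funM => //; exact: mshift.
  - move=> x xM; rewrite normrM ler_pM ?hC//.
    have [xhM|Mxh] := leP `|x + h| (M + 1); first exact: hD.
    by rewrite psiM ?normr0//; linarith.
  move=> x xM; rewrite psiM ?mulr0//.
  have := ler_normB (x + h) h; rewrite addrK (gtr0_norm h0); linarith.
have -> : \int[mu]_x (m x * (n.+1%:R * (psi (x + h) - psi x))) =
    n.+1%:R * (\int[mu]_x (m x * psi (x + h)) - \int[mu]_x (m x * psi x)).
  rewrite -RintegralB// -RintegralZl//; last first.
    by have := integrableB measurableT i1' i2; exact.
  by apply: eq_Rintegral => x _; ring.
have -> : \int[mu]_x (m x * psi (x + h)) = \int[mu]_x (m (x - h) * psi x).
  rewrite -(Rintegral_translation h m1 i1); apply: eq_Rintegral => x _; by rewrite addrK.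
rewrite -RintegralB// mulr_ge0//; apply: Rintegral_ge0 => x _.
by rewrite -mulrBl; exact: sgnn.
Qed.

End StrongToWeak.

(** * Weak gradient and wave operator of a characteristic function *)

Section WaveTransfer.
Context {R : realType}.
Notation mu := (@lebesgue_measure R).
Notation mu2 := (@lebesgue_measure R \x @lebesgue_measure R)%E.
Implicit Types (phi F G : R * R -> R) (V : R -> R -> R).

Lemma boxedD F G : boxed F -> boxed G -> boxed (fun p => F p + G p).
Proof.
move=> [mF [N N0 [C [FC FN]]]] [mG [M M0 [D [GD GM]]]].
split; first exact: measurable_funD.
exists (Num.max N M); first by rewrite le_max N0.
exists (C + D); split => [p|p FG].
  by rewrite (le_trans (ler_normD _ _))// lerD.
have [F0|/eqP/FN[h1 h2]] := eqVneq (F p) 0; last by rewrite !le_max h1 h2.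
have [h1 h2] : `|p.1| <= M /\ `|p.2| <= M by apply: GM => G0; apply: FG; rewrite F0 G0 addr0.
by rewrite !le_max h1 h2 !orbT.
Qed.

Lemma RintegralD_boxed F G : boxed F -> boxed G ->
  \int[mu2]_p (F p + G p) = \int[mu2]_p F p + \int[mu2]_p G p.
Proof. by move=> /boxed_integrable iF /boxed_integrable iG; rewrite RintegralD. Qed.

Lemma RintegralZ_boxed (k : R) F : boxed F ->
  \int[mu2]_p (k * F p) = k * \int[mu2]_p F p.
Proof. by move=> /boxed_integrable iF; rewrite RintegralZl. Qed.

Lemma boxed_char G : boxed G -> boxed (fun p => G (char_coord p)).
Proof.
move=> [mG [N N0 [C [GC GN]]]]; split.
  exact: measurableT_comp mG measurable_char_coord.
exists N => //; exists C; split => // p /GN; rewrite /char_coord /= !ler_norml.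
by move=> [/andP[? ?] /andP[? ?]]; split; apply/andP; linarith.
Qed.

Definition phi_a phi (q : R * R) := 2^-1 * ('D_ex phi (char_inv q) - 'D_et phi (char_inv q)).
Definition phi_b phi (q : R * R) := 2^-1 * ('D_ex phi (char_inv q) + 'D_et phi (char_inv q)).

Lemma test_half phi : test_fun half_plane phi -> exists K,
  [/\ forall q, K q -> q.1 < q.2,
    char_test K (fun q => phi (char_inv q)) (phi_a phi) (phi_b phi) &
    forall p, ~ 0 < p.2 -> [/\ phi p = 0, 'D_ex phi p = 0 & 'D_et phi p = 0]].
Proof.
move=> /test_fun_char[K [KO ct out]]; exists K; split => // [q /KO|p hp].
  by rewrite /half_plane /char_inv /= pmulr_rgt0 ?invr_gt0// subr_gt0.
by apply: out => /KO; rewrite /= char_coordK.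
Qed.

Lemma half_flux phi F1 F2 f : test_fun half_plane phi -> lbounded F1 -> lbounded F2 ->
  (forall p, 0 < p.2 -> f p = F1 (char_coord p) * 'D_ex phi p + F2 (char_coord p) * 'D_et phi p) ->
  \int[mu2]_(p in half_plane) f p =
  2^-1 * (\int[mu2]_q ((F1 q - F2 q) * phi_a phi q) + \int[mu2]_q ((F1 q + F2 q) * phi_b phi q)).
Proof.
move=> tphi b1 b2 fE; have [K [KO ct out]] := test_half tphi.
have b12 : lbounded (fun q => F1 q - F2 q).
  have := lboundedD b1 (lboundedZ (-1) b2); congr lbounded; apply/funext => q; ring.
have b12' := lboundedD b1 b2.
have [_ g1 _] := char_test_boxed ct b12; have [_ _ g2] := char_test_boxed ct b12'.
rewrite -(RintegralD_boxed g1 g2).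
apply: (half_plane_to_char (boxedD g1 g2)) => p hp.
  rewrite fE// /phi_a /phi_b char_coordK.
  by move: ('D_ex phi p) ('D_et phi p) (F1 _) (F2 _) => x t k l; field.
rewrite /phi_a /phi_b char_coordK.
by have [_ -> ->] := out p hp; rewrite subr0 addr0 !mulr0 addr0.
Qed.

Lemma half_source phi F f : test_fun half_plane phi -> lbounded F ->
  (forall p, 0 < p.2 -> f p = F (char_coord p) * phi p) ->
  \int[mu2]_(p in half_plane) f p = 2^-1 * \int[mu2]_q (F q * phi (char_inv q)).
Proof.
move=> tphi bF fE; have [K [KO ct out]] := test_half tphi.
have [g1 _ _] := char_test_boxed ct bF.
apply: (half_plane_to_char g1) => p hp; rewrite char_coordK ?fE//.
by have [-> _ _] := out p hp; rewrite mulr0.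
Qed.

Definition wave V (p : R * R) : R := V (p.1 - p.2) (p.1 + p.2).
Definition wave_x V (p : R * R) : R := slope_l V (char_coord p) + slope_r V (char_coord p).
Definition wave_t V (p : R * R) : R := slope_r V (char_coord p) - slope_l V (char_coord p).

Lemma wave_gradient V : lip2 V -> weak_gradient (wave V) (wave_x V) (wave_t V).
Proof.
move=> lV; have [bl br] := lbounded_slopes lV.
have bV := continuous_lbounded (lip2_continuous lV).
have b0 : lbounded (fun=> 0 : R) by apply: continuous_lbounded => p; exact: cvg_cst.
have bx := lboundedD bl br.
have bt : lbounded (fun q => slope_r V q - slope_l V q).
  have := lboundedD br (lboundedZ (-1) bl); congr lbounded; apply/funext => q; ring.
have LV : L1_loc_half (wave V) by exact: (lbounded_L1_loc bV).
have Lx : L1_loc_half (wave_x V) by exact: (lbounded_L1_loc bx).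
have Lt : L1_loc_half (wave_t V) by exact: (lbounded_L1_loc bt).
have src phi : test_fun half_plane phi ->
    [/\ \int[mu2]_q (V q.1 q.2 * phi_a phi q) = - (\int[mu2]_q (slope_l V q * phi (char_inv q))),
        \int[mu2]_q (V q.1 q.2 * phi_b phi q) = - (\int[mu2]_q (slope_r V q * phi (char_inv q))),
        boxed (fun q => slope_l V q * phi (char_inv q)) &
        boxed (fun q => slope_r V q * phi (char_inv q))].
  move=> tphi; have [K [KO ct out]] := test_half tphi.
  by have [-> ->] := parts2 ct lV; have [? _ _] := char_test_boxed ct bl; have [? _ _] := char_test_boxed ct br.
split; split => // phi tphi; have [e1 e2 g1 g2] := src phi tphi.
- rewrite (half_flux tphi bV b0) => [|p _]; last by rewrite mul0r addr0.
  rewrite (half_source tphi bx) => [|p _]; last by [].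
  under eq_Rintegral do rewrite subr0.
  under [X in _ * (_ + X)]eq_Rintegral do rewrite addr0.
  have -> : \int[mu2]_q ((slope_l V q + slope_r V q) * phi (char_inv q)) =
      \int[mu2]_q (slope_l V q * phi (char_inv q)) + \int[mu2]_q (slope_r V q * phi (char_inv q)).
    by rewrite -(RintegralD_boxed g1 g2); apply: eq_Rintegral => q _; ring.
  by rewrite e1 e2 -opprD mulrN.
- rewrite (half_flux tphi b0 bV) => [|p _]; last by rewrite mul0r add0r.
  rewrite (half_source tphi bt) => [|p _]; last by [].
  have -> : \int[mu2]_q ((0 - V q.1 q.2) * phi_a phi q) = \int[mu2]_q (slope_l V q * phi (char_inv q)).
    have [K [KO ct out]] := test_half tphi; have [_ g3 _] := char_test_boxed ct bV.
    rewrite -[RHS]opprK -e1 -mulN1r -(RintegralZ_boxed _ g3).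
    by apply: eq_Rintegral => q _; ring.
  under [X in _ * (_ + X)]eq_Rintegral do rewrite add0r.
  have -> : \int[mu2]_q ((slope_r V q - slope_l V q) * phi (char_inv q)) =
      \int[mu2]_q (slope_r V q * phi (char_inv q)) - \int[mu2]_q (slope_l V q * phi (char_inv q)).
    have g1' : boxed (fun q => (-1) * (slope_l V q * phi (char_inv q))).
      have [K [KO ct out]] := test_half tphi.
      have [+ _ _] := char_test_boxed ct (lboundedZ (-1) bl).
      by congr boxed; apply/funext => q; rewrite mulrA.
    rewrite -mulN1r -(RintegralZ_boxed _ g1) -(RintegralD_boxed g2 g1').
    by apply: eq_Rintegral => q _; ring.
  rewrite e2; move: (\int[mu2]_q _) (\int[mu2]_q _) => I J; ring.
Qed.

Lemma slope_boxed phi V : test_fun half_plane phi -> lip2 V ->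
  [/\ boxed (fun q => slope_l V q * phi_b phi q), boxed (fun q => slope_r V q * phi_b phi q),
    boxed (fun q => slope_l V q * phi_a phi q) & boxed (fun q => slope_r V q * phi_a phi q)].
Proof.
move=> tphi lV; have [bl br] := lbounded_slopes lV; have [K [KO ct out]] := test_half tphi.
by have [_ ? ?] := char_test_boxed ct bl; have [_ ? ?] := char_test_boxed ct br.
Qed.

(* Integrating by parts once, [D_t] against [D_t] and [D_x] against [D_x],
   avoids the symmetry of the second derivatives. *)
Lemma box_flux phi V : test_fun half_plane phi -> lip2 V ->
  \int[mu2]_(p in half_plane) (wave V p * box phi p) =
  \int[mu2]_q (slope_l V q * phi_b phi q) + \int[mu2]_q (slope_r V q * phi_a phi q).
Proof.
move=> tphi lV; have [bl br] := lbounded_slopes lV.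
have bV := continuous_lbounded (lip2_continuous lV).
have tt : test_fun half_plane ('D_et phi) by exact: (test_fun_derive true tphi).
have tx : test_fun half_plane ('D_ex phi) by exact: (test_fun_derive false tphi).
have ttt : test_fun half_plane ('D_et ('D_et phi)) by exact: (test_fun_derive true tt).
have txx : test_fun half_plane ('D_ex ('D_ex phi)) by exact: (test_fun_derive false tx).
have [[_ _ gx] [_ _ gt]] := wave_gradient lV.
have b0 : lbounded (fun=> 0 : R) by apply: continuous_lbounded => p; exact: cvg_cst.
have bt : lbounded (fun q => slope_r V q - slope_l V q).
  have := lboundedD br (lboundedZ (-1) bl); congr lbounded; apply/funext => q; ring.
have bx := lboundedD bl br.
have btest psi : test_fun half_plane psi ->
    forall F, lbounded F -> mu2.-integrable half_plane (EFin \o (fun p => F (char_coord p) * psi p)).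
  move=> tpsi F bF; have [K [KO ct out]] := test_half tpsi.
  have [g _ _] := char_test_boxed ct bF.
  have : mu2.-integrable setT (EFin \o (fun p => F (char_coord p) * psi p)).
    have := boxed_integrable (boxed_char g).
    by apply: eq_integrable => // p _; rewrite /= char_coordK.
  by apply: integrableS => //; exact: measurable_half_plane.
have ht := gt _ tt; have hx := gx _ tx.
have -> : \int[mu2]_(p in half_plane) (wave V p * box phi p) =
    (- (\int[mu2]_(p in half_plane) (wave_t V p * 'D_et phi p))) -
    (- (\int[mu2]_(p in half_plane) (wave_x V p * 'D_ex phi p))).
  transitivity (\int[mu2]_(p in half_plane) (wave V p * 'D_et ('D_et phi) p) -
    \int[mu2]_(p in half_plane) (wave V p * 'D_ex ('D_ex phi) p)); last first.
    exact: (f_equal2 (fun x y => x - y) ht hx).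
  rewrite -RintegralB; first by apply: eq_Rintegral => p _; rewrite /box mulrBr.
  - exact: measurable_half_plane.
  - exact: (btest _ ttt _ bV).
  - exact: (btest _ txx _ bV).
rewrite opprK addrC.
have [s1 s2 s3 s4] := slope_boxed tphi lV.
have -> : \int[mu2]_(p in half_plane) (wave_x V p * 'D_ex phi p) -
    \int[mu2]_(p in half_plane) (wave_t V p * 'D_et phi p) =
  \int[mu2]_(p in half_plane) (wave_x V p * 'D_ex phi p - wave_t V p * 'D_et phi p).
  rewrite -RintegralB//; first exact: measurable_half_plane.
  - exact: (btest _ tx _ bx).
  - exact: (btest _ tt _ bt).
rewrite (half_flux (f := fun p => wave_x V p * 'D_ex phi p - wave_t V p * 'D_et phi p)
    tphi bx (lboundedZ (-1) bt)) => [|p _]; last first.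
  rewrite /wave_x /wave_t; move: ('D_ex phi p) ('D_et phi p) (slope_l _ _) (slope_r _ _).
  by move=> x t k l; ring.
have -> : \int[mu2]_q ((slope_l V q + slope_r V q - (-1) * (slope_r V q - slope_l V q)) * phi_a phi q) =
    2 * \int[mu2]_q (slope_r V q * phi_a phi q).
  by rewrite -(RintegralZ_boxed _ s4); apply: eq_Rintegral => q _; ring.
have -> : \int[mu2]_q ((slope_l V q + slope_r V q + (-1) * (slope_r V q - slope_l V q)) * phi_b phi q) =
    2 * \int[mu2]_q (slope_l V q * phi_b phi q).
  by rewrite -(RintegralZ_boxed _ s1); apply: eq_Rintegral => q _; ring.
by field.
Qed.

(** Fubini reduces the two fluxes to lines, where [monotone_flux] applies. The sign of the slope
    differences is required only where phi does not vanish, since nothing is known about them near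
    the diagonal or, for the equality, near contact. The value s = 1 serves for the inequality, 1
    and - 1 together for the equality. *)
Lemma box_flux_ge0 phi V (s : R) (n0 : nat) : test_fun half_plane phi -> lip2 V ->
  (forall n q, (n0 <= n)%N -> phi (char_inv q) != 0 ->
    0 <= s * (slope_l V (q.1, q.2 - n.+1%:R^-1) - slope_l V q) * phi (char_inv q) /\
    0 <= s * (slope_r V (q.1 - n.+1%:R^-1, q.2) - slope_r V q) * phi (char_inv q)) ->
  0 <= s * \int[mu2]_(p in half_plane) (wave V p * box phi p).
Proof.
move=> tphi lV sgn; rewrite (box_flux tphi lV) mulrDr.
have [s1 s2 s3 s4] := slope_boxed tphi lV.
have [[ml bl] [mr br]] := lbounded_slopes lV.
have [K [KO ct out]] := test_half tphi; have [N hN] := char_test_box ct.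
have sgn' n q : (n0 <= n)%N ->
    0 <= (s * slope_l V (q.1, q.2 - n.+1%:R^-1) - s * slope_l V q) * phi (char_inv q) /\
    0 <= (s * slope_r V (q.1 - n.+1%:R^-1, q.2) - s * slope_r V q) * phi (char_inv q).
  move=> n0n; rewrite -!mulrBr.
  by have [->|/(sgn _ _ n0n)//] := eqVneq (phi (char_inv q)) 0; rewrite !mulr0.
have bd (m : R * R -> R) : lbounded m -> forall a M, exists2 C : R, 0 <= C &
    forall x, `|x| <= M -> `|s * m (a, x)| <= C /\ `|s * m (x, a)| <= C.
  move=> [_ bm] a M; have [C C0 hC] := bm (Num.max `|a| M).
  exists (`|s| * C) => [|x xM]; first exact: mulr_ge0.
  by rewrite !normrM !ler_wpM2l// hC//= le_max ?lexx ?xM ?orbT.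
have slicel (b : R) : continuous (fun a : R => (a, b)).
  by move=> a; exact: (cvg_pair (@cvg_id _ (nbhs a)) (cvg_cst b)).
have slicer (a : R) : continuous (fun b : R => (a, b)).
  by move=> b; exact: (cvg_pair (cvg_cst a) (@cvg_id _ (nbhs b))).
have sb G : boxed G -> boxed (fun p => s * G p).
  move=> [mG [M M0 [C [GC GM]]]]; split; first exact: measurable_funM.
  exists M => //; exists (`|s| * C); split => [p|p sG]; first by rewrite normrM ler_wpM2l.
  by apply: GM => G0; apply: sG; rewrite G0 mulr0.
rewrite -(RintegralZ_boxed _ s1) -(RintegralZ_boxed _ s4).
rewrite (boxed_fubini1 (sb _ s1)) (boxed_fubini2 (sb _ s4)).
apply: addr_ge0; apply: Rintegral_ge0 => x _.
- under eq_Rintegral do rewrite mulrA.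
  apply: (monotone_flux (m := fun b => s * slope_l V (x, b)) (psi := fun b => phi (char_inv (x, b)))
    (psi' := fun b => phi_b phi (x, b)) (N := N) (n0 := n0)).
  + apply: measurable_funM => //; exact: measurableT_comp ml (pair1_measurable x).
  + move=> M; have [C C0 hC] := bd _ (conj ml bl) x M; exists C => // y /hC[]//.
  + exact: (ct_dpb ct).
  + by move=> b; apply: (continuous_comp (slicer x b)); exact: (ct_pb ct).
  + by move=> b bN; have [] := hN (x, b) (or_intror bN).
  + by move=> n b n0n; have [] := sgn' n (x, b) n0n.
- under eq_Rintegral do rewrite mulrA.
  apply: (monotone_flux (m := fun a => s * slope_r V (a, x)) (psi := fun a => phi (char_inv (a, x)))
    (psi' := fun a => phi_a phi (a, x)) (N := N) (n0 := n0)).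
  + apply: measurable_funM => //; exact: measurableT_comp mr (pair2_measurable x).
  + move=> M; have [C C0 hC] := bd _ (conj mr br) x M; exists C => // y /hC[]//.
  + move=> a; exact: (ct_dpa ct).
  + by move=> a; apply: (continuous_comp (slicel x a)); exact: (ct_pa ct).
  + by move=> a aN; have [] := hN (a, x) (or_introl aN).
  + by move=> n a n0n; have [] := sgn' n (a, x) n0n.
Qed.

Lemma compact_margin (K : set (R * R)) F : compact K -> continuous F ->
  (forall q, K q -> 0 < F q) -> exists2 c : R, 0 < c & forall q, K q -> c <= F q.
Proof.
move=> cK cF pos; have [->|/set0P K0] := eqVneq K set0; first by exists 1.
have [c cK' cmin] := compact_EVT_min K0 cK (continuous_subspaceT cF).
rewrite inE in cK'; exists (F c) => [|q Kq]; first exact: pos.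
by apply: cmin; rewrite inE.
Qed.

(** Two sides of a rectangle of width k give the two quotients; d is the margin to the diagonal that
    admits all k < d. *)
Lemma slope_drop f g V (a b h d : R) : geo g f V -> 0 < d -> 0 < h -> a + h + d <= b ->
  slope_l V (a, b) <= slope_l V (a, b - h) /\ slope_r V (a, b) <= slope_r V (a - h, b).
Proof.
move=> hV d0 h0 ab; have lV := geo_lip hV; split.
- apply: (dq_mono (d := d)) => [|||k k0 kd]; [exact: lip2_l|exact: lip2_l|by []|].
  have := @geo_rect _ _ _ _ hV a (a + k) (b - h) b; rewrite /=; linarith.
- apply: (dq_mono (d := d)) => [|||k k0 kd]; [exact: lip2_r|exact: lip2_r|by []|].
  have := @geo_rect _ _ _ _ hV (a - h) a b (b + k); rewrite /=; linarith.
Qed.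

Lemma slope_flat f g V (a b h d : R) : geo g f V -> 0 < d -> 0 < h -> a + h + d <= b -> h <= d ->
  (forall s t, `|s - a| <= d -> `|t - b| <= d -> 0 < V s t) ->
  slope_l V (a, b - h) <= slope_l V (a, b) /\ slope_r V (a - h, b) <= slope_r V (a, b).
Proof.
move=> hV d0 h0 ab hd pos; have lV := geo_lip hV; split.
- apply: (dq_mono (d := d)) => [|||k k0 kd]; [exact: lip2_l|exact: lip2_l|by []|].
  have := @geo_mod _ _ _ _ hV a (a + k) (b - h) b; rewrite /=.
  have h1 s t : a <= s <= a + k -> b - h <= t <= b -> 0 < V s t.
    by move=> /andP[? ?] /andP[? ?]; apply: pos; rewrite ler_norml; apply/andP; linarith.
  by move=> H; have := H ltac:(linarith) ltac:(linarith) ltac:(linarith) h1; linarith.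
- apply: (dq_mono (d := d)) => [|||k k0 kd]; [exact: lip2_r|exact: lip2_r|by []|].
  have := @geo_mod _ _ _ _ hV (a - h) a b (b + k); rewrite /=.
  have h1 s t : a - h <= s <= a -> b <= t <= b + k -> 0 < V s t.
    by move=> /andP[? ?] /andP[? ?]; apply: pos; rewrite ler_norml; apply/andP; linarith.
  by move=> H; have := H ltac:(linarith) ltac:(linarith) ltac:(linarith) h1; linarith.
Qed.

End WaveTransfer.

(** * Obstacle equation, energy law and initial velocity of a wave *)

Section WaveSolution.
Context {R : realType}.
Notation mu := (@lebesgue_measure R).
Notation mu2 := (@lebesgue_measure R \x @lebesgue_measure R)%E.
Implicit Types (phi F G : R * R -> R) (V : R -> R -> R).

Lemma lebesgue_measure_setT_gt0 : (0 < mu [set: measurableTypeR R])%E.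
Proof.
apply: (@lt_le_trans _ _ (mu `[0, 1]%classic)).
  by rewrite lebesgue_measure_itv/= lte_fin ltr01 oppr0 addr0 lte_fin ltr01.
by apply: le_measure; rewrite ?inE//; exact: measurable_itv.
Qed.

Lemma Loo_norm_leP (f : R -> R) (C : \bar R) :
  (Loo_norm f <= C)%E <-> {ae mu, forall x, (`|f x|%:E <= C)%E}.
Proof.
rewrite /Loo_norm unlock /Lnorm lebesgue_measure_setT_gt0.
by split => [/ess_sup_inf.ess_supP//|h]; apply/ess_sup_inf.ess_supP.
Qed.

Lemma Loo_norm_ge0 (f : R -> R) : (0 <= Loo_norm f)%E.
Proof. exact: Lnorm_ge0. Qed.

(** On the compact support of the test function the distance to the diagonal and, for the equality,
    the value of V have positive lower bounds. Shifts below these margins involve only rectangles to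
    which [geo_rect], respectively [geo_mod], applies. *)
Lemma obstacle_wave g f V : geo g f V -> obstacle_equation (wave V).
Proof.
move=> hV; have lV := geo_lip hV.
have cV := lip2_continuous lV.
have gap : continuous (fun q : R * R => q.2 - q.1).
  by move=> q; apply: cvgB; [exact: cvg_snd|exact: cvg_fst].
split.
- by move=> p p0; apply: (geo_ge0 hV); linarith.
- move=> phi tphi phi0; have [K [KO ct out]] := test_half tphi.
  have [c c0 Kc] : exists2 c : R, 0 < c & forall q, K q -> c <= q.2 - q.1.
    by apply: (compact_margin (ct_compact ct) gap) => q /KO; rewrite subr_gt0.
  have c40 : 0 < c / 4 by rewrite divr_gt0.
  have [n0 _ hn0] := near_infty_natSinv_lt (PosNum c40).
  rewrite -[leRHS]mul1r; apply: (box_flux_ge0 (n0 := n0) tphi lV) => n q n0n phiq.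
  have Kq : K q.
    by apply: contrapT => /(ct_out ct)[h _ _]; rewrite h eqxx in phiq.
  have hq := Kc _ Kq; have hn := hn0 _ n0n; rewrite /= in hn.
  have h0 : 0 < n.+1%:R^-1 :> R by rewrite invr_gt0.
  have gapq : q.1 + n.+1%:R^-1 + c / 4 <= q.2.
    by move: h0 hn; set h : R := n.+1%:R^-1; linarith.
  case: q gapq phiq {Kq hq} => a b /= gapq phiq.
  have [h1 h2] := slope_drop hV c40 h0 gapq.
  by rewrite !mul1r !mulr_ge0 ?subr_ge0.
- move=> phi tphi.
  have tphi' : test_fun half_plane phi.
    by case: tphi => sphi [K [cK KO K0]]; split => //; exists K; split => // p /KO[].
  have [K [KO ct out]] := test_fun_char tphi.
  have [c c0 Kc] : exists2 c : R, 0 < c & forall q, K q -> c <= q.2 - q.1.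
    apply: (compact_margin (ct_compact ct) gap) => q /KO[].
    by rewrite /half_plane /char_inv /= pmulr_rgt0 ?invr_gt0.
  have [e e0 Ke] : exists2 e : R, 0 < e & forall q, K q -> e <= V q.1 q.2.
    apply: (compact_margin (ct_compact ct) cV) => q /KO[_].
    rewrite /= /wave /char_inv/=.
    by congr (0 < V _ _); field.
  have [N hN] := char_test_box ct.
  have [L L0 VL] := lV (N + 1).
  pose d : R := Num.min (Num.min 1 (c / 4)) (e / (2 * (L + 1)) / 2).
  have L1 : 0 < 2 * (L + 1) by linarith.
  have d0 : 0 < d by rewrite !lt_min ltr01 !divr_gt0.
  have d1 : d <= 1 by rewrite !ge_min lexx.
  have dc : d <= c / 4 by rewrite !ge_min lexx orbT.
  have de : d * (2 * (L + 1)) < e.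
    have : d <= e / (2 * (L + 1)) / 2 by rewrite ge_min lexx orbT.
    rewrite ler_pdivlMr// ler_pdivlMr//; nra.
  have [n0 _ hn0] := near_infty_natSinv_lt (PosNum d0).
  have flat n q : (n0 <= n)%N -> phi (char_inv q) != 0 ->
      slope_l V (q.1, q.2 - n.+1%:R^-1) = slope_l V q /\
      slope_r V (q.1 - n.+1%:R^-1, q.2) = slope_r V q.
    move=> n0n phiq.
    have Kq : K q.
      by apply: contrapT => /(ct_out ct)[h _ _]; rewrite h eqxx in phiq.
    have hq := Kc _ Kq; have hn := hn0 _ n0n; rewrite /= in hn.
    have h0 : 0 < n.+1%:R^-1 :> R by rewrite invr_gt0.
    have gapq : q.1 + n.+1%:R^-1 + d <= q.2.
      by move: h0 hn; set h : R := n.+1%:R^-1; linarith.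
    have pos s t : `|s - q.1| <= d -> `|t - q.2| <= d -> 0 < V s t.
      move=> sd td; have qN1 : `|q.1| <= N.
        by rewrite leNgt; apply/negP => /or_introl/hN[h _ _]; rewrite h eqxx in phiq.
      have qN2 : `|q.2| <= N.
        by rewrite leNgt; apply/negP => /or_intror/hN[h _ _]; rewrite h eqxx in phiq.
      have sN : `|s| <= N + 1 by have := ler_normD (s - q.1) q.1; rewrite subrK; linarith.
      have tN : `|t| <= N + 1 by have := ler_normD (t - q.2) q.2; rewrite subrK; linarith.
      have NN : N <= N + 1 by linarith.
      have := VL _ _ _ _ sN (le_trans qN1 NN) tN (le_trans qN2 NN).
      have : L * (`|s - q.1| + `|t - q.2|) <= L * (d + d) by rewrite ler_wpM2l// lerD.
      have := Ke _ Kq; move=> h1 h2 h3.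
      have := le_trans h3 h2; rewrite ler_norml => /andP[h4 _].
      have h5 : d * (2 * (L + 1)) = L * (d + d) + 2 * d by ring.
      have := d0; move: h4 h5 de h1; set X := L * _; set Y := d * _.
      move: (V s t) (V _ _) => v w; linarith.
    case: q gapq pos {hq Kq phiq} => a b /= gapq pos.
    have [h1 h2] := slope_drop hV d0 h0 gapq.
    have [h3 h4] := slope_flat hV d0 h0 gapq (ltW hn) pos.
    by split; apply/le_anti; rewrite ?h1 ?h2 ?h3 ?h4.
  apply/le_anti/andP; split.
  + rewrite -oppr_ge0 -mulN1r; apply: (box_flux_ge0 (n0 := n0) tphi' lV) => n q n0n phiq.
    by have [-> ->] := flat _ _ n0n phiq; rewrite !subrr mulr0 !mul0r.
  + rewrite -[leRHS]mul1r; apply: (box_flux_ge0 (n0 := n0) tphi' lV) => n q n0n phiq.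
    by have [-> ->] := flat _ _ n0n phiq; rewrite !subrr mulr0 !mul0r.
Qed.

Lemma ae_eq_RintegralT (h k : R -> R) : measurable_fun setT h -> measurable_fun setT k ->
  {ae mu, forall x, h x = k x} -> \int[mu]_x h x = \int[mu]_x k x.
Proof.
move=> mh mk hk; rewrite /Rintegral; congr fine; apply: ae_eq_integral => //.
- exact/measurable_EFinP.
- exact/measurable_EFinP.
- by apply: ae_imp hk => x E _; rewrite E.
Qed.

Lemma Rintegral_derivative (psi psi' : R -> R) (N : R) : (forall x : R, is_derive x 1 psi (psi' x)) ->
  continuous psi' -> (forall x, N < `|x| -> psi x = 0 /\ psi' x = 0) ->
  \int[mu]_x psi' x = 0.
Proof.
move=> d c psi0; have := parts1 (loclip_cst 1) d c psi0.
under eq_Rintegral do rewrite mul1r.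
move=> ->; rewrite -[RHS]oppr0; congr (- _).
have -> : \int[mu]_x (dq (cst 1) x * psi x) = \int[mu]_x (cst 0 x).
  apply: eq_Rintegral => x _; rewrite derive_dq; last exact: derivable_cst.
  by rewrite derive1_cst mul0r.
by rewrite Rintegral_cst// mul0r.
Qed.

(** With l, r the slopes in a and b, u_x = l + r and u_t = r - l, and the energy law becomes d/da
    (r^2) = d/db (l^2). *)
Lemma energy_fluxE V phi : lip2 V -> test_fun half_plane phi ->
  \int[mu2]_(p in half_plane)
      (- ((- 2 * wave_x V p * wave_t V p) * 'D_ex phi p) -
       (wave_x V p ^+ 2 + wave_t V p ^+ 2) * 'D_et phi p) =
  2 * (\int[mu2]_q (slope_r V q ^+ 2 * phi_a phi q) - \int[mu2]_q (slope_l V q ^+ 2 * phi_b phi q)).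
Proof.
move=> lV tphi; have [bl br] := lbounded_slopes lV.
have bl2 : lbounded (fun q => 2 * slope_l V q ^+ 2) by apply: lboundedZ; exact: lboundedM.
have br2 : lbounded (fun q => 2 * slope_r V q ^+ 2) by apply: lboundedZ; exact: lboundedM.
have b1 := lboundedD br2 (lboundedZ (-1) bl2).
have b2 := lboundedZ (-1) (lboundedD br2 bl2).
rewrite (half_flux tphi b1 b2) => [|p _]; last first.
  rewrite /wave_x /wave_t; move: ('D_ex phi p) ('D_et phi p) (slope_l _ _) (slope_r _ _).
  by move=> x t k l; ring.
have [K [KO ct out]] := test_half tphi.
have br2' : lbounded (fun q => slope_r V q ^+ 2) by exact: lboundedM.
have bl2' : lbounded (fun q => slope_l V q ^+ 2) by exact: lboundedM.
have [_ r1 _] := char_test_boxed ct br2'; have [_ _ l1] := char_test_boxed ct bl2'.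
have -> : \int[mu2]_q ((2 * slope_r V q ^+ 2 + -1 * (2 * slope_l V q ^+ 2) -
      -1 * (2 * slope_r V q ^+ 2 + 2 * slope_l V q ^+ 2)) * phi_a phi q) =
    4 * \int[mu2]_q (slope_r V q ^+ 2 * phi_a phi q).
  by rewrite -(RintegralZ_boxed _ r1); apply: eq_Rintegral => q _; ring.
have -> : \int[mu2]_q ((2 * slope_r V q ^+ 2 + -1 * (2 * slope_l V q ^+ 2) +
      -1 * (2 * slope_r V q ^+ 2 + 2 * slope_l V q ^+ 2)) * phi_b phi q) =
    (- 4) * \int[mu2]_q (slope_l V q ^+ 2 * phi_b phi q).
  by rewrite -(RintegralZ_boxed _ l1); apply: eq_Rintegral => q _; ring.
by move: (Rintegral _ _ _) (Rintegral _ _ _) => I J; field.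
Qed.

(** The square l^2 is a function of a alone and is tested against a derivative in b, and conversely
    for r^2; each flux therefore contains the integral of a derivative with compact support. *)
Lemma energy_flux g f V phi : lip2 V -> loclip g -> loclip f ->
  (forall b, {ae mu, forall a, a < b -> slope_l V (a, b) ^+ 2 = dq g a ^+ 2}) ->
  (forall a, {ae mu, forall b, a < b -> slope_r V (a, b) ^+ 2 = dq f b ^+ 2}) ->
  test_fun half_plane phi ->
  \int[mu2]_(p in half_plane)
      (- ((- 2 * wave_x V p * wave_t V p) * 'D_ex phi p) -
       (wave_x V p ^+ 2 + wave_t V p ^+ 2) * 'D_et phi p) = 0.
Proof.
move=> lV lg lf hl hr tphi; have [bl br] := lbounded_slopes lV.
rewrite (energy_fluxE lV tphi).
have [K [KO ct out]] := test_half tphi; have [N hN] := char_test_box ct.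
have slicel (b : R) : continuous (fun a : R => (a, b)).
  by move=> a; exact: (cvg_pair (@cvg_id _ (nbhs a)) (cvg_cst b)).
have slicer (a : R) : continuous (fun b : R => (a, b)).
  by move=> b; exact: (cvg_pair (cvg_cst a) (@cvg_id _ (nbhs b))).
have lbdq (h : R -> R) : loclip h -> lbounded (fun q => dq h q.1 ^+ 2) /\ lbounded (fun q => dq h q.2 ^+ 2).
  move=> lh; have mh := measurable_dq2 lh.
  have bd M : exists2 C : R, 0 <= C & forall x : R, `|x| <= M -> `|dq h x ^+ 2| <= C.
    have [L L0 hL] := dq_bounded (- M) M lh; exists (L ^+ 2); first exact: exprn_ge0.
    by move=> x; rewrite ler_norml => /hL xL; rewrite normrX lerXn2r ?nnegrE.
  split; split.
  - exact: measurableT_comp mh measurable_fst.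
  - by move=> M; have [C C0 hC] := bd M; exists C => // p p1 _; exact: hC.
  - exact: measurableT_comp mh measurable_snd.
  - by move=> M; have [C C0 hC] := bd M; exists C => // p _ p2; exact: hC.
have zero q : q.2 <= q.1 -> phi_a phi q = 0 /\ phi_b phi q = 0.
  move=> qq; have : ~ K q by move=> /KO; rewrite ltNge qq.
  by move=> /(ct_out ct)[].
have out1 (x y : R) : N < `|x| -> phi (char_inv (x, y)) = 0 /\ phi_a phi (x, y) = 0.
  by move=> xN; have [] := hN (x, y) (or_introl xN).
have out2 (x y : R) : N < `|y| -> phi (char_inv (x, y)) = 0 /\ phi_b phi (x, y) = 0.
  by move=> xN; have [] := hN (x, y) (or_intror xN).
have [_ lbg] := lbdq _ lg; have [lbg1 _] := lbdq _ lg; have [_ lbf2] := lbdq _ lf.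
have br2' : lbounded (fun q => slope_r V q ^+ 2) by exact: lboundedM.
have bl2' : lbounded (fun q => slope_l V q ^+ 2) by exact: lboundedM.
have [_ r1 _] := char_test_boxed ct br2'; have [_ r2 _] := char_test_boxed ct lbf2.
have [_ _ l1] := char_test_boxed ct bl2'; have [_ _ l2] := char_test_boxed ct lbg1.
have Ir : \int[mu2]_q (slope_r V q ^+ 2 * phi_a phi q) = 0.
  rewrite (boxed_fubini1 r1).
  transitivity (\int[mu]_a \int[mu]_b (dq f b ^+ 2 * phi_a phi (a, b))).
    apply: eq_Rintegral => a _; apply: ae_eq_RintegralT.
    - exact: measurableT_comp r1.1 (pair1_measurable a).
    - exact: measurableT_comp r2.1 (pair1_measurable a).
    - apply: ae_imp (hr a) => b h; have [ba|ab] := leP b a; last by rewrite h.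
      by rewrite (zero (a, b) ba).1 !mulr0.
  rewrite -(boxed_fubini1 r2) (boxed_fubini2 r2).
  transitivity (\int[mu]_b (cst 0 b : R)); last by rewrite Rintegral_cst// mul0r.
  apply: eq_Rintegral => b _ /=.
  rewrite RintegralZl//.
    rewrite (Rintegral_derivative (N := N) (fun a => ct_dpa ct a b)) ?mulr0//.
    + by move=> a; apply: (continuous_comp (slicel b a)); exact: (ct_pa ct).
    + by move=> a /out1.
  have b1' : lbounded (fun=> 1 : R) by apply: continuous_lbounded => p; exact: cvg_cst.
  have [_ k _] := char_test_boxed ct b1'.
  have := boxed_slice2 b k; apply: eq_integrable => // a _ /=; by rewrite mul1r.
have Il : \int[mu2]_q (slope_l V q ^+ 2 * phi_b phi q) = 0.
  rewrite (boxed_fubini2 l1).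
  transitivity (\int[mu]_b \int[mu]_a (dq g a ^+ 2 * phi_b phi (a, b))).
    apply: eq_Rintegral => b _; apply: ae_eq_RintegralT.
    - exact: measurableT_comp l1.1 (pair2_measurable b).
    - exact: measurableT_comp l2.1 (pair2_measurable b).
    - apply: ae_imp (hl b) => a h; have [ba|ab] := leP b a; last by rewrite h.
      by rewrite (zero (a, b) ba).2 !mulr0.
  rewrite -(boxed_fubini2 l2) (boxed_fubini1 l2).
  transitivity (\int[mu]_a (cst 0 a : R)); last by rewrite Rintegral_cst// mul0r.
  apply: eq_Rintegral => a _ /=.
  rewrite RintegralZl//.
    rewrite (Rintegral_derivative (N := N) (fun b => ct_dpb ct a b)) ?mulr0//.
    + by move=> b; apply: (continuous_comp (slicer a b)); exact: (ct_pb ct).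
    + by move=> b /out2.
  have b1' : lbounded (fun=> 1 : R) by apply: continuous_lbounded => p; exact: cvg_cst.
  have [_ _ k] := char_test_boxed ct b1'.
  have := boxed_slice1 a k; apply: eq_integrable => // b _ /=; by rewrite mul1r.
by rewrite Ir Il subrr mulr0.
Qed.

(** Monotonicity of the excess fills the gaps of the sequence: for 1 / n.+2 < h <= 1 / n.+1 the
    excess at h is at most that at 1 / n.+1. Since n.+2 <= 2 n.+1 this costs a factor 2, whence the
    tolerance e / 2. *)
Lemma exc_rate g f V (x : R) : geo g f V ->
  (fun n => n.+1%:R * exc g f V (x - n.+1%:R^-1) (x + n.+1%:R^-1)) @ \oo --> (0 : R) ->
  exc g f V (x - h) (x + h) / h @[h --> 0^'+] --> (0 : R).
Proof.
move=> hV hx; apply/cvgrPdist_le => /= e e0.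
have e20 : 0 < e / 2 by rewrite divr_gt0.
move/cvgrPdist_le: hx => /(_ _ e20)[n0 _ hn0].
have d0 : 0 < n0.+1%:R^-1 :> R by rewrite invr_gt0.
near=> h; have h0 : 0 < h by near: h; exact: nbhs_right_gt.
have hd : h < n0.+1%:R^-1 by near: h; exact: nbhs_right_lt.
have hi0 : 0 <= h^-1 by rewrite invr_ge0 ltW.
have /andP[] := truncn_itv hi0; set m := Num.truncn h^-1 => mh hm.
have n0m : (n0 < m)%N.
  rewrite -ltnS -(ltr_nat R); apply: le_lt_trans hm.
  by rewrite -[leLHS]invrK lef_pV2 ?posrE//; exact: ltW.
case: m mh hm n0m => // n mh hm n0n.
have hn : h <= n.+1%:R^-1 by rewrite -[h]invrK lef_pV2 ?posrE ?invr_gt0.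
have e1 := exc_ge0 hV (a := x - h) (b := x + h) ltac:(linarith).
have e2 : exc g f V (x - h) (x + h) <= exc g f V (x - n.+1%:R^-1) (x + n.+1%:R^-1).
  by move: hn; set k : R := n.+1%:R^-1 => hn; apply: exc_mono => //; linarith.
have := hn0 n n0n; rewrite /= sub0r normrN ger0_norm; last first.
  by rewrite mulr_ge0//; exact: le_trans e2.
move=> e3; rewrite sub0r normrN ger0_norm ?mulr_ge0// ler_pdivrMr//.
apply: (le_trans e2); move: e3 hm hn mh; set E := exc _ _ _ _ _.
rewrite -ler_pdivlMl// => e3 hm hn mh; apply: (le_trans e3).
rewrite mulrC -mulrA ler_pM2l// -ler_pdivlMl// mulrC.
have : n.+2%:R * h > 1 by rewrite -ltr_pdivrMr// mul1r.
have : n.+2%:R <= 2 * n.+1%:R :> R by rewrite -natrM ler_nat mul2n -addnn -[n.+2]addn1 leq_add2l.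
rewrite invrK => h1 h2; rewrite -[leLHS]mul1r ler_pdivrMr//; apply: (le_trans (ltW h2)).
by have -> : h * 2 * n.+1%:R = 2 * n.+1%:R * h; [ring|rewrite ler_pM2r].
Unshelve. all: by end_near. Qed.

Lemma initial_wave g f V (u0 u1 : R -> R) : geo g f V -> (forall x, u0 x = g x - f x) ->
  {ae mu, forall x, g^`()%classic x + f^`()%classic x = - u1 x} ->
  initial_conditions u0 u1 (wave V).
Proof.
move=> hV u0E u1E; split.
  by move=> x; rewrite /wave /= subr0 addr0 (geo_diag hV) u0E.
have ini := ae_and (geo_init hV) (ae_and u1E (ae_and (loclip_derivable (geo_g hV)) (loclip_derivable (geo_f hV)))).
apply: ae_imp ini => x [ix [ux [dg df]]].
have cexc := exc_rate hV ix.
have cr : (fun h : R => h) @ 0^'+ --> (0 : R)^'.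
  move=> A [e /= e0 eA]; near=> h; apply: eA => /=.
    by rewrite sub0r normrN gtr0_norm//; near: h; exact: nbhs_right_lt.
  by rewrite gt_eqF//; near: h; exact: nbhs_right_gt.
have cl : (fun h : R => - h) @ 0^'+ --> (0 : R)^'.
  move=> A [e /= e0 eA]; suff: \forall h \near (0 : R)^'+, A (- h) by [].
  near=> h; apply: eA => /=.
    by rewrite sub0r normrN normrN gtr0_norm//; near: h; exact: nbhs_right_lt.
  by rewrite oppr_eq0 gt_eqF//; near: h; exact: nbhs_right_gt.
have cg := cvg_comp _ _ cl dg; have cf := cvg_comp _ _ cr df.
rewrite -[lim _]/('D_1 g x) -derive1E in cg; rewrite -[lim _]/('D_1 f x) -derive1E in cf.
have -> : u1 x = 0 - g^`()%classic x - f^`()%classic x.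
  by rewrite -[LHS]opprK -ux; ring.
apply: cvg_trans (cvgB (cvgB cexc cg) cf); apply: near_eq_cvg.
near=> h; have h0 : 0 < h by near: h; exact: nbhs_right_gt.
rewrite !fctE /= /wave /= subr0 addr0 (geo_diag hV) /exc /GRing.scale/= !mulr1 invrN.
by rewrite (addrC h) (addrC (- h)); field; exact: lt0r_neq0.
Unshelve. all: by end_near. Qed.

End WaveSolution.

(** * From distributional to characteristic solutions *)

Section DuBoisReymond.
Context {R : realType}.
Notation mu := (@lebesgue_measure R).
Notation mu2 := (@lebesgue_measure R \x @lebesgue_measure R)%E.
Implicit Types (phi F G : R * R -> R) (V : R -> R -> R).

Lemma rat_dense_eq0 (F : R -> R) (a b y : R) : {within `[a, b], continuous F} ->
  (forall q : rat, a < ratr q < b -> F (ratr q) = 0) -> a < y < b -> F y = 0.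
Proof.
move=> cF F0 /andP[ay yb]; apply/eqP/negP => /negP Fy.
have ab : a < b by exact: lt_trans ay yb.
have cy : {for y, continuous F}.
  have := cF; move=> /continuous_within_itvP => /(_ ab)[+ _ _]; apply.
  by rewrite in_itv/= ay.
have Fn : \forall z \near y, F z != 0.
  have : \forall z \near F y, z != 0 by apply: open_nbhs_nbhs; split => //; exact: open_neq.
  by move=> /cy.
have [e /= e0 he] := Fn.
pose c := Num.min (y + e) b.
have yc : y < c by rewrite lt_min yb ltrDl e0.
have [q] := rat_in_itvoo yc; rewrite in_itv/= => /andP[yq].
rewrite lt_min => /andP[qe qb].
have /eqP : F (ratr q) = 0 by apply: F0; rewrite (lt_trans ay yq).
apply/negP; apply: he => /=; rewrite ler0_norm ?opprB; linarith.
Qed.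

Lemma fine_integrable (H : R -> \bar R) : mu.-integrable setT H ->
  mu.-integrable setT (EFin \o (fun x => fine (H x))) /\ {ae mu, forall x, H x = (fine (H x))%:E}.
Proof.
move=> iH; have mH : measurable_fun setT H by case/integrableP: iH.
split.
  apply: le_integrable iH => //.
    by apply/measurable_EFinP; apply: measurableT_comp => //; exact: fine_measurable.
  by move=> x _ /=; case: (H x) => //= *; rewrite ?normr0 ?leey.
have := @integrable_ae _ _ _ mu _ measurableT _ iH.
by apply: ae_imp => x /(_ I)/fineK ->.
Qed.

Lemma rat_itv_null (H : R -> \bar R) : mu.-integrable setT H ->
  (forall r s : rat, (\int[mu]_(x in `]ratr r, ratr s[) H x = 0)%E) ->
  {ae mu, forall x, H x = 0%E}.
Proof.
move=> iH H0; have [ik kE] := fine_integrable iH.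
pose k x : R := fine (H x).
have ikI (I : interval R) : mu.-integrable [set` I] (EFin \o k).
  by apply: integrableS ik => //; exact: measurable_itv.
have k0 (r s : rat) : \int[mu]_(x in `[ratr r, ratr s]) k x = 0.
  rewrite -Rintegral_itv_bndo_bndc// -Rintegral_itv_obnd_cbnd// /Rintegral.
  have -> : (\int[mu]_(x in `]ratr r, ratr s[) (k x)%:E = \int[mu]_(x in `]ratr r, ratr s[) H x)%E.
    apply: ae_eq_integral => //.
    - by case/integrableP: (ikI `]ratr r, ratr s[).
    - apply: measurable_funTS; by case/integrableP: iH.
    - by apply: ae_imp kE => x -> _.
  by rewrite H0.
have all n (a b : R) : - n.+1%:R <= a -> a <= b -> b <= n.+1%:R -> \int[mu]_(t in `[a, b]) k t = 0.
  have nr : - n.+1%:R = ratr (- n.+1%:R) :> R by rewrite rmorphN /= ratr_nat.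
  have nr' : n.+1%:R = ratr (n.+1%:R) :> R by rewrite ratr_nat.
  pose F (y : R) := \int[mu]_(t in `[- n.+1%:R, y]) k t.
  have nn : - n.+1%:R <= n.+1%:R :> R by rewrite ge0_cp// oppr_le0.
  have cF : {within `[- n.+1%:R, n.+1%:R], continuous F} := parameterized_integral_continuous nn (ikI _).
  have F0 (q : rat) : F (ratr q) = 0 by rewrite /F nr k0.
  have Fz y : - n.+1%:R <= y <= n.+1%:R -> F y = 0.
    move=> /andP[]; rewrite le_eqVlt => /predU1P[<- _|ny]; first by rewrite nr F0.
    rewrite le_eqVlt => /predU1P[->|yn]; first by rewrite nr' F0.
    by apply: (rat_dense_eq0 cF) => [q _|]; [exact: F0|rewrite ny].
  move=> na ab bn; have := Rintegral_cat na ab (ikI `[- n.+1%:R, b]).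
  rewrite -/(F _) -/(F _) !Fz ?add0r ?na ?bn ?(le_trans na) ?(le_trans ab)//.
have main n : {ae mu, forall x : R, - n.+1%:R < x < n.+1%:R -> k x = 0}.
  have lk0 : locally_integrable setT (k \_ `[- n.+1%:R, n.+1%:R]).
    by apply: integrable_locally => //; exact: ikI.
  apply: ae_imp (lebesgue_differentiation lk0) => x k0x /andP[Nx xN].
  have cd : forall a b : R, - n.+1%:R <= a -> a <= b -> b <= n.+1%:R ->
      cst 0 b - cst 0 a = \int[mu]_(t in `[a, b]) k t.
    by move=> a b na ab bn; rewrite subrr (all n).
  have [_] := density_derivable (f := cst 0) (ikI _) cd Nx xN k0x.
  by rewrite derive1_cst.
apply: ae_imp (ae_and kE (ae_forall_nat main)) => x [-> h].
rewrite -/(k x) (h (Num.bound x))//.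
rewrite -ltr_norml (lt_le_trans (unstable.ltr_norm_bound x))// ler_nat.
by [].
Qed.

Lemma ae0_integral (H : R -> \bar R) : measurable_fun setT H ->
  {ae mu, forall x, H x = 0%E} -> (\int[mu]_x H x = 0)%E.
Proof.
move=> mH H0; rewrite -[RHS](integral0 mu setT); apply: ae_eq_integral => //.
by apply: ae_imp H0 => x -> _.
Qed.

Definition open_rect (x1 x2 y1 y2 : R) : set (R * R) := `]x1, x2[%classic `*` `]y1, y2[%classic.

Lemma measurable_open_rect x1 x2 y1 y2 : measurable (open_rect x1 x2 y1 y2).
Proof. by apply: measurableX; exact: measurable_itv. Qed.

(** Rational intervals in b suffice, so that countably many exceptional sets of a are discarded; on
    almost every slice F then integrates to zero over all rational intervals and vanishes almost
    everywhere. *)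
Lemma rect_null F : mu2.-integrable setT (EFin \o F) ->
  (forall x1 x2 y1 y2, (\int[mu2]_(p in open_rect x1 x2 y1 y2) (F p)%:E = 0)%E) ->
  {ae mu2, forall p, F p = 0}.
Proof.
move=> iF F0.
have mF : measurable_fun setT (EFin \o F) by case/integrableP: iF.
have sl (r s : rat) : {ae mu, forall a, (\int[mu]_(b in `]ratr r, ratr s[) (F (a, b))%:E = 0)%E}.
  pose Z : set (R * R) := setT `*` `]ratr r, ratr s[%classic.
  have mZ : measurable Z by apply: measurableX => //; exact: measurable_itv.
  have iZ : mu2.-integrable setT ((EFin \o F) \_ Z).
    by rewrite -(@integrable_mkcond _ _ _ mu2 _ _ mZ); exact: integrableS iF.
  have HE a : (fubini_F mu ((EFin \o F) \_ Z) a = \int[mu]_(b in `]ratr r, ratr s[) (F (a, b))%:E)%E.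
    rewrite /fubini_F [RHS]integral_mkcond; apply: eq_integral => b _; rewrite !patchE.
    congr (if _ then _ else _); apply/idP/idP; rewrite !inE; [by case|by split].
  have h := rat_itv_null (@integrable_fubini_F _ _ _ _ _ mu mu _ iZ).
  suff : forall x1 x2 : rat, (\int[mu]_(x in `]ratr x1, ratr x2[) fubini_F mu ((EFin \o F) \_ Z) x = 0)%E.
    by move=> /h; apply: ae_imp => a e; exact: eq_trans (esym (HE a)) e.
  move=> x1 x2.
  have iZ' : mu2.-integrable setT ((EFin \o F) \_ (open_rect (ratr x1) (ratr x2) (ratr r) (ratr s))).
    rewrite -(@integrable_mkcond _ _ _ mu2 _ _ (measurable_open_rect _ _ _ _)).
    by apply: integrableS iF => //; exact: measurable_open_rect.
  have := F0 (ratr x1) (ratr x2) (ratr r) (ratr s); rewrite integral_mkcond (fubini1E iZ') => E.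
  rewrite -[RHS]E integral_mkcond; apply: eq_integral => a _; rewrite patchE; case: ifPn => aI.
    rewrite /fubini_F; apply: eq_integral => b _; rewrite !patchE.
    congr (if _ then _ else _); apply/idP/idP; rewrite !inE => -[h1 h2]; split => //.
    by move: aI; rewrite inE.
  rewrite integral0_eq// => b _; rewrite patchE ifF//; apply/negP; rewrite inE => -[h1 _].
  by move/negP: aI; apply; rewrite inE.
have sl0 : {ae mu, forall a, {ae mu, forall b, F (a, b) = 0}}.
  have h1 : {ae mu, forall a, forall r s : rat, (\int[mu]_(b in `]ratr r, ratr s[) (F (a, b))%:E = 0)%E}.
    pose e n : rat * rat := odflt (0, 0) (unpickle n).
    have := ae_forall_nat (fun n => sl (e n).1 (e n).2).
    apply: ae_imp => a h r s; have := h (pickle (r, s)); by rewrite /e pickleK.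
  have h2 := @ae_integrable1 _ _ _ _ _ mu mu _ iF.
  apply: ae_imp (ae_and h1 h2) => a [ha1 ha2].
  by apply: ae_imp (rat_itv_null ha2 ha1) => b /= [].
have iA : mu2.-integrable setT (abse \o (EFin \o F)) by exact: integrable_abse.
have Z0 : (\int[mu2]_(p in setT) `|(EFin \o F) p| = 0)%E.
  rewrite (fubini1E iA).
  have mA : measurable_fun setT (fubini_F mu (abse \o (EFin \o F))).
    by case/integrableP: (@integrable_fubini_F _ _ _ _ _ mu mu _ iA).
  apply: (ae0_integral mA); apply: ae_imp sl0 => a ha; rewrite /fubini_F /=.
  apply: ae0_integral; last by apply: ae_imp ha => b ->; rewrite normr0.
  apply/measurable_EFinP; apply: measurableT_comp => //.
  apply: (measurableT_comp (f := F)); last exact: pair1_measurable.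
  exact/measurable_EFinP.
have := proj1 (@ae_eq_integral_abs _ _ _ mu2 setT measurableT (EFin \o F) mF) Z0.
by apply: filterS => p /(_ I)[].
Qed.

(** Products of two steps rescaled by n, rising inside the interval, so that they vanish outside
    ]x1, x2[ and their limit is exactly its indicator. *)
Lemma smooth_window (x1 x2 : R) : exists A : nat -> R -> R,
  [/\ forall n, smooth (A n), forall n s, 0 <= A n s <= 1,
    forall n s, ~ (x1 < s < x2) -> A n s = 0 &
    forall s, A n s @[n --> \oo] --> ((x1 < s < x2)%R%:R : R)].
Proof.
have [S [sS ndS S0 S1]] := @smooth_step R.
have S01 x : 0 <= S x <= 1.
  have := ndS (Num.min x 0) x; rewrite S0 ge_min lexx ?orbT// => -> //=.
  have m1 : 1 <= Num.max x 1 by rewrite le_max lexx orbT.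
  by rewrite -(S1 _ m1) ndS// le_max lexx.
pose A n s := (1 * S (n%:R * s + - n%:R * x1)) * (1 * S (- n%:R * s + n%:R * x2)).
have out n s : ~ (x1 < s < x2) -> A n s = 0.
  move=> h; rewrite /A !mul1r; have [sx|xs] := leP s x1.
    by rewrite S0 ?mul0r// mulNr -mulrBr mulr_ge0_le0// subr_le0.
  have sx : x2 <= s by rewrite leNgt; apply/negP => sx; apply: h; rewrite xs.
  by rewrite (S0 (- n%:R * s + _)) ?mulr0// mulNr addrC -mulrBr mulr_ge0_le0// subr_le0.
exists A; split; last first; [| exact: out | | ].
- move=> s; have [/andP[h1 h2]|/negP h] := boolP (x1 < s < x2); last first.
    under eq_fun do rewrite (out _ _ h); exact: cvg_cst.
  apply: cvg_near_cst.
  have d0 : 0 < Num.min (s - x1) (x2 - s) by rewrite lt_min !subr_gt0 h1.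
  have [n0 _ hn0] := near_infty_natSinv_lt (PosNum d0).
  exists n0.+1 => // -[//|n] /= n0n; have := hn0 n n0n; rewrite /= lt_min => /andP[k1 k2].
  have big (x : R) : n.+1%:R^-1 < x -> 1 <= n.+1%:R * x.
    by move=> /ltW nx; rewrite mulrC -ler_pdivrMr// mul1r.
  have e1 : n.+1%:R * s + - n.+1%:R * x1 = n.+1%:R * (s - x1) by ring.
  have e2 : - n.+1%:R * s + n.+1%:R * x2 = n.+1%:R * (x2 - s) by ring.
  by rewrite /A !mul1r e1 e2 !S1 ?mul1r// big.
- move=> n s; rewrite /A !mul1r; have /andP[h1 h2] := S01 (n%:R * s + - n%:R * x1).
  have /andP[h3 h4] := S01 (- n%:R * s + n%:R * x2).
  by rewrite mulr_ge0// mulr_ile1.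
- by move=> n; apply: smoothM; exact: smooth_affine.
Qed.

Lemma ae_char (P : R * R -> Prop) : {ae mu2, forall q, P q} -> {ae mu2, forall p, P (char_coord p)}.
Proof.
move=> [N [mN N0 PN]]; exists (char_coord @^-1` N); split.
- by rewrite -[X in measurable X]setTI; exact: measurable_char_coord.
- exact: null_preimage_char.
- by move=> p /= h; exact: PN.
Qed.

Lemma ae2_imp (P Q : R * R -> Prop) : (forall x, P x -> Q x) ->
  {ae mu2, forall x, P x} -> {ae mu2, forall x, Q x}.
Proof.
move=> PQ [A [mA A0 PA]]; exists A; split => //.
by apply: subset_trans PA; apply: subsetC => x; exact: PQ.
Qed.

Lemma ae2_forall_nat (P : nat -> R * R -> Prop) : (forall n, {ae mu2, forall x, P n x}) ->
  {ae mu2, forall x, forall n, P n x}.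
Proof.
move=> hP; have := negligible_bigcup hP; apply: negligibleS => x /= /existsNP[n hn].
by exists n.
Qed.

(** The fundamental lemma of the calculus of variations. Only products of functions of x - t and x +
    t are used as tests, so it is proved on characteristic rectangles off the diagonal, where
    products of windows converge to indicators, and then transported. *)
Lemma half_plane_null G : L1_loc_half G ->
  (forall phi, test_fun half_plane phi -> \int[mu2]_(p in half_plane) (G p * phi p) = 0) ->
  {ae mu2, forall p, 0 < p.2 -> G p = 0}.
Proof.
move=> [mG lG] G0; pose Gh := G \_ half_plane; pose H q := Gh (char_inv q).
have mhp := @measurable_half_plane R.
have mGh : measurable_fun setT Gh by exact/(measurable_restrictT _ mhp).
have mH : measurable_fun setT H.
  apply: (measurableT_comp mGh).
  rewrite (_ : char_inv = fun q => (2^-1 * (q.1 + q.2), 2^-1 * (q.2 - q.1)))//.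
  apply/measurable_fun_pairP; split => /=.
  - by apply: measurable_funM => //; apply: measurable_funD; [exact: measurable_fst|exact: measurable_snd].
  - by apply: measurable_funM => //; apply: measurable_funB; [exact: measurable_snd|exact: measurable_fst].
have key a1 a2 b1 b2 : a2 < b1 -> {ae mu2, forall q, (H \_ (open_rect a1 a2 b1 b2)) q = 0}.
  move=> ab; set Q := open_rect a1 a2 b1 b2; set HQ := H \_ Q.
  have mQ : measurable Q by exact: measurable_open_rect.
  have mHQ : measurable_fun setT HQ by apply/(measurable_restrictT _ mQ); exact: measurable_funTS.
  pose K := char_inv @` (`[a1, a2]%classic `*` `[b1, b2]%classic : set (R * R)).
  have cK : compact K.
    apply: continuous_compact; first exact/continuous_subspaceT/continuous_char_inv.
    by apply: compact_setX; exact: segment_compact.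
  have mK := compact_measurable2 cK.
  have KH : K `<=` half_plane.
    move=> _ [[a b] [h1 h2] <-]; rewrite /half_plane /char_inv /= !in_itv/= in h1 h2 *.
    by move: h1 h2 => /andP[? ?] /andP[? ?]; rewrite pmulr_rgt0 ?invr_gt0//; linarith.
  have iG : mu2.-integrable setT ((EFin \o G) \_ K).
    rewrite -(@integrable_mkcond _ _ _ mu2 _ _ mK); apply/integrableP; split; last exact: lG.
    by apply/measurable_EFinP; apply: measurable_funS mG.
  have iHQ : mu2.-integrable setT (EFin \o HQ).
    apply: integrable_char => //; apply: le_integrable iG => //.
      apply/measurable_EFinP; apply: (measurableT_comp mHQ); exact: measurable_char_coord.
    move=> p _; rewrite /= /HQ patchE; case: ifPn => [|_]; last by rewrite normr0 abse_ge0.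
    rewrite inE /Q /open_rect /= !in_itv/= => -[/andP[h1 h2] /andP[h3 h4]].
    have Kp : K p.
      exists (char_coord p); last exact: char_coordK.
      by rewrite /= !in_itv/= !ltW.
    rewrite /H char_coordK /Gh !patchE !mem_set//; exact: KH.
  apply: (rect_null iHQ) => x1 x2 y1 y2.
  have [A [sA A01 Aout Acv]] := smooth_window (Num.max x1 a1) (Num.min x2 a2).
  have [B [sB B01 Bout Bcv]] := smooth_window (Num.max y1 b1) (Num.min y2 b2).
  have AQ n q : A n q.1 * B n q.2 != 0 -> open_rect x1 x2 y1 y2 q /\ Q q.
    rewrite mulf_eq0 negb_or => /andP[A0 B0].
    have h1 : Num.max x1 a1 < q.1 < Num.min x2 a2.
      by apply: contrapT => /(Aout n) h; rewrite h eqxx in A0.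
    have h2 : Num.max y1 b1 < q.2 < Num.min y2 b2.
      by apply: contrapT => /(Bout n) h; rewrite h eqxx in B0.
    move: h1 h2.
    rewrite !gt_max !lt_min => /andP[/andP[? ?] /andP[? ?]] /andP[/andP[? ?] /andP[? ?]].
    by split; split; rewrite /= in_itv/=; apply/andP.
  have tphi n : test_fun half_plane (char_prod (A n) (B n)).
    apply: (@test_char_prod _ _ _ _ (Num.max x1 a1) (Num.min x2 a2) (Num.max y1 b1) (Num.min y2 b2)) => //.
    - by move=> x h; apply: Aout => /andP[h1 h2]; apply: h; rewrite !ltW.
    - by move=> x h; apply: Bout => /andP[h1 h2]; apply: h; rewrite !ltW.
    - move=> p; rewrite /half_plane /= le_min ge_max => /andP[_ /andP[_ h1]].
      by rewrite ge_max => /andP[/andP[_ h2] _]; linarith.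
  have mAB n : measurable_fun setT (fun q : R * R => A n q.1 * B n q.2).
    have mA : measurable_fun setT (A n) by apply: continuous_measurable_fun; exact: smooth_continuous.
    have mB : measurable_fun setT (B n) by apply: continuous_measurable_fun; exact: smooth_continuous.
    by apply: measurable_funM; [exact: measurableT_comp mA measurable_fst|exact: measurableT_comp mB measurable_snd].
  have AB1 n q : `|A n q.1 * B n q.2| <= 1.
    have /andP[h1 h2] := A01 n q.1; have /andP[h3 h4] := B01 n q.2.
    by rewrite ger0_norm ?mulr_ge0// mulr_ile1.
  have iAB n : mu2.-integrable setT (EFin \o (fun q => HQ q * (A n q.1 * B n q.2))).
    apply: le_integrable iHQ => //; first by apply/measurable_EFinP; exact: (measurable_funM mHQ (mAB n)).
    by move=> q _; rewrite /= lee_fin normrM ler_piMr.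
  have zero n : (\int[mu2]_q (HQ q * (A n q.1 * B n q.2))%:E = 0)%E.
    rewrite -[LHS]fineK; last by apply: (@integrable_fin_num _ _ _ mu2) => //; exact: iAB.
    congr EFin; rewrite -[LHS]/(\int[mu2]_q (HQ q * (A n q.1 * B n q.2))).
    have := Rintegral_char (iAB n).
    have -> : \int[mu2]_p (HQ (char_coord p) * (A n (char_coord p).1 * B n (char_coord p).2)) =
        \int[mu2]_(p in half_plane) (G p * char_prod (A n) (B n) p).
      rewrite [RHS]Rintegral_mkcond; apply: eq_Rintegral => p _.
      rewrite /char_prod /char_coord /=; set AB := A n _ * B n _.
      have [AB0|AB0] := eqVneq AB 0; first by rewrite [RHS]patchE -/AB AB0 !mulr0; case: ifP.
      have [_ Qp] := AQ n (char_coord p) AB0.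
      have hp : half_plane p.
        move: Qp; rewrite /Q /open_rect /half_plane /= !in_itv/= => -[/andP[_ ?] /andP[? _]]; linarith.
      rewrite /HQ !patchE !mem_set// /H -/(char_coord p) char_coordK /Gh patchE mem_set//.
    by rewrite G0// => /eqP; rewrite eq_sym mulf_eq0 invr_eq0 pnatr_eq0/= => /eqP.
  pose lim q := HQ q * ((Num.max x1 a1 < q.1 < Num.min x2 a2)%R%:R * (Num.max y1 b1 < q.2 < Num.min y2 b2)%R%:R).
  have cv : (\int[mu2]_q (HQ q * (A n q.1 * B n q.2))%:E)%E @[n --> \oo] --> (\int[mu2]_q (lim q)%:E)%E.
    apply: (@dominated_cvg _ _ _ mu2 setT measurableT _ _ (fun q => `|HQ q|%:E)) => //.
    - by move=> n; apply/measurable_EFinP; exact: (measurable_funM mHQ (mAB n)).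
    - move=> q _; apply: cvg_EFin; first exact: nearW.
      by apply: cvgM; [exact: cvg_cst|apply: cvgM; [exact: Acv|exact: Bcv]].
    - exact: (integrable_abse iHQ).
    - by move=> n q _; rewrite /= lee_fin normrM ler_piMr.
  have -> : (\int[mu2]_(p in open_rect x1 x2 y1 y2) (HQ p)%:E = \int[mu2]_q (lim q)%:E)%E.
    rewrite integral_mkcond; apply: eq_integral => q _; rewrite patchE /lim.
    rewrite !gt_max !lt_min; case: ifPn => [|/negP]; rewrite inE /open_rect /= !in_itv/=.
      move=> [/andP[-> ->] /andP[-> ->]] /=; rewrite /HQ patchE; case: ifPn => [|_]; last by rewrite mul0r.
      by rewrite inE /Q /open_rect /= !in_itv/= => -[/andP[-> ->] /andP[-> ->]] /=; rewrite !mulr1.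
    move=> h; case: (boolP (x1 < q.1)) => h1 /=; last by rewrite mul0r mulr0.
    case: (boolP (q.1 < x2)) => h2 /=; last by rewrite andbF mul0r mulr0.
    case: (boolP (y1 < q.2)) => h3 /=; last by rewrite mulr0 mulr0.
    case: (boolP (q.2 < y2)) => h4 /=; last by rewrite andbF mulr0 mulr0.
    by exfalso; apply: h; rewrite h1 h2 h3 h4.
  have z0 : (fun n => \int[mu2]_q (HQ q * (A n q.1 * B n q.2))%:E)%E = cst 0%E.
    by apply/funext => n; rewrite zero.
  rewrite z0 in cv; have c0 : (cst 0%E : nat -> \bar R) @ \oo --> (0%E : \bar R) by exact: cvg_cst.
  exact: (cvg_unique _ cv c0).
have all : {ae mu2, forall q, q.1 < q.2 -> H q = 0}.
  (* With N = n.+1, the rectangles ]r - N, r[ x ]r + 1 / N, r + N[ for rational r exhaust a < b, and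
     the gap 1 / N keeps each off the diagonal, as [key] requires. The default value merely repeats
     one of them. *)
  pose e n : rat * nat := odflt (0, 0%N) (unpickle n).
  have := ae2_forall_nat (fun n => key (ratr (e n).1 - (e n).2.+1%:R) (ratr (e n).1)
    (ratr (e n).1 + (e n).2.+1%:R^-1) (ratr (e n).1 + (e n).2.+1%:R) ltac:(by rewrite ltrDl invr_gt0)).
  apply: ae2_imp => q h qq; have [r] := rat_in_itvoo qq; rewrite in_itv/= => /andP[qr rq].
  have d0 : 0 < q.2 - ratr r by linarith.
  have [n0 _ hn0] := near_infty_natSinv_lt (PosNum d0).
  pose M := Num.bound (`|ratr r - q.1| + `|q.2 - ratr r|); pose n := maxn n0 M.
  have := h (pickle (r, n)); rewrite /e pickleK /= patchE mem_set//.
  have hM : `|ratr r - q.1| + `|q.2 - ratr r| < n.+1%:R.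
    apply: (lt_le_trans (archi_boundP _)); first by rewrite addr_ge0.
    by rewrite ler_nat (leq_trans (leq_maxr n0 M)).
  have hn := hn0 n (leq_maxl _ _); rewrite /= in hn.
  move: hM hn; rewrite !ger0_norm; [|linarith..].
  move: qr rq; move: (ratr r : R) => t {}qr {}rq; move: (n.+1%:R^-1 : R) => k; move: (n.+1%:R : R) => N hM hn.
  by split; rewrite /= in_itv/=; apply/andP; split; linarith.
apply: ae2_imp (ae_char all) => p /= h p0.
have := h ltac:(rewrite /char_coord /=; linarith); rewrite /H char_coordK /Gh patchE mem_set//.
Qed.

End DuBoisReymond.

(** * Uniqueness of weak gradients and conservative waves *)

Section ConservativeWave.
Context {R : realType}.
Notation mu := (@lebesgue_measure R).
Notation mu2 := (@lebesgue_measure R \x @lebesgue_measure R)%E.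
Implicit Types (phi F G : R * R -> R) (V : R -> R -> R).

Lemma L1_loc_integrable G (K : set (R * R)) : L1_loc_half G -> compact K -> K `<=` half_plane ->
  mu2.-integrable K (EFin \o G).
Proof.
move=> [mG lG] cK KH; apply/integrableP; split; last exact: lG.
apply/measurable_EFinP; apply: measurable_funS mG => //; exact: measurable_half_plane.
Qed.

Lemma L1_loc_halfB F G : L1_loc_half F -> L1_loc_half G -> L1_loc_half (fun p => F p - G p).
Proof.
move=> lF lG; split; first by apply: measurable_funB; [case: lF|case: lG].
move=> K cK KH; have mK := compact_measurable2 cK.
have := @integrableB _ _ _ mu2 _ mK _ _ (L1_loc_integrable lF cK KH) (L1_loc_integrable lG cK KH).
by case/integrableP.
Qed.

Lemma compact_bound F (K : set (R * R)) : compact K -> continuous F ->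
  exists C : R, forall p, K p -> `|F p| <= C.
Proof.
move=> cK cF; have cn : continuous (fun p => `|F p|).
  by move=> p; apply: (continuous_comp (cF p)); exact: norm_continuous.
have [->|/set0P K0] := eqVneq K set0; first by exists 0.
have [c _ cmax] := compact_EVT_max K0 cK (continuous_subspaceT cn).
by exists `|F c| => p Kp; apply: cmax; rewrite inE.
Qed.

Lemma test_fun_continuous (Omega : set (R * R)) phi : test_fun Omega phi -> continuous phi.
Proof. by move=> [sphi _] p; apply: differentiable_continuous; exact: (sphi [::]). Qed.

Lemma L1_loc_test G phi : L1_loc_half G -> test_fun half_plane phi ->
  mu2.-integrable half_plane (EFin \o (fun p => G p * phi p)).
Proof.
move=> lG tphi; have cphi := test_fun_continuous tphi.
have [_ [K [cK KH K0]]] := tphi; have mK := compact_measurable2 cK.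
have [C hC] := compact_bound cK cphi.
have mhp := @measurable_half_plane R; have mphi := continuous_measurable2 cphi.
have mG : measurable_fun half_plane G by case: lG.
have iG := L1_loc_integrable lG cK KH.
have iCG : mu2.-integrable K (fun p => C%:E * (EFin \o G) p)%E by exact: integrableZl.
have iK : mu2.-integrable K (EFin \o (fun p => G p * phi p)).
  apply: le_integrable iCG => //.
    apply/measurable_EFinP; apply: measurable_funM; last exact: measurable_funTS.
    exact: measurable_funS mG.
  move=> p Kp; rewrite /= lee_fin !normrM mulrC ler_wpM2r//.
  by rewrite (le_trans (hC _ Kp))// ler_norm.
have iT : mu2.-integrable setT ((EFin \o (fun p => G p * phi p)) \_ K).
  by rewrite -(@integrable_mkcond _ _ _ mu2 _ _ mK).
apply: (@eq_integrable _ _ _ mu2 _ mhp ((EFin \o (fun p => G p * phi p)) \_ K)); last first.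
  by apply: integrableS iT.
move=> p _; rewrite patchE; case: ifPn => // /negP; rewrite inE => /K0 h.
by rewrite /= h mulr0.
Qed.

Lemma weak_partial_unique v F G1 G2 : weak_partial v F G1 -> weak_partial v F G2 ->
  {ae mu2, forall p, 0 < p.2 -> G1 p = G2 p}.
Proof.
move=> [_ l1 h1] [_ l2 h2]; have := half_plane_null (L1_loc_halfB l1 l2) _.
move=> h; have : forall phi, test_fun half_plane phi ->
    \int[mu2]_(p in half_plane) ((G1 p - G2 p) * phi p) = 0.
  move=> phi tphi.
  have -> : \int[mu2]_(p in half_plane) ((G1 p - G2 p) * phi p) =
      \int[mu2]_(p in half_plane) (G1 p * phi p) - \int[mu2]_(p in half_plane) (G2 p * phi p).
    rewrite -RintegralB; first by apply: eq_Rintegral => p _; rewrite mulrBl.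
    - exact: measurable_half_plane.
    - exact: L1_loc_test.
    - exact: L1_loc_test.
  by rewrite -[X in X - _]opprK -h1// h2// opprK subrr.
by move=> /h; apply: ae2_imp => p e p0; apply/eqP; rewrite -subr_eq0 e.
Qed.

Lemma ae_eq_Rintegral_half F G : measurable_fun half_plane F -> measurable_fun half_plane G ->
  {ae mu2, forall p, 0 < p.2 -> F p = G p} ->
  \int[mu2]_(p in half_plane) F p = \int[mu2]_(p in half_plane) G p.
Proof.
move=> mF mG FG; rewrite /Rintegral; congr fine; apply: ae_eq_integral => //.
- exact: measurable_half_plane.
- exact/measurable_EFinP.
- exact/measurable_EFinP.
- by apply: ae2_imp FG => p e hp; rewrite /= e.
Qed.

(** Conservation quantifies over every choice of weak gradient; any two agree almost everywhere, so
    one explicit gradient is enough. *)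
Lemma energy_conservation_unique u ux ut : weak_gradient u ux ut ->
  (forall phi, test_fun half_plane phi ->
    \int[mu2]_(p in half_plane)
      (- ((- 2 * ux p * ut p) * 'D_ex phi p) - (ux p ^+ 2 + ut p ^+ 2) * 'D_et phi p) = 0) ->
  energy_conservation u.
Proof.
move=> [gx gt] h vx vt [hx ht] phi tphi; rewrite -[RHS](h phi tphi).
have mh G : L1_loc_half G -> measurable_fun half_plane G by case.
have mphi (psi : R * R -> R) : test_fun half_plane psi -> measurable_fun half_plane psi.
  move=> tpsi; apply: measurable_funTS; apply: continuous_measurable2.
  exact: test_fun_continuous tpsi.
have mx : measurable_fun half_plane ('D_ex phi) := mphi _ (test_fun_derive false tphi).
have mt : measurable_fun half_plane ('D_et phi) := mphi _ (test_fun_derive true tphi).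
have meas (wx wt : R * R -> R) : measurable_fun half_plane wx -> measurable_fun half_plane wt ->
    measurable_fun half_plane (fun p : R * R =>
      - ((- 2 * wx p * wt p) * 'D_ex phi p) - (wx p ^+ 2 + wt p ^+ 2) * 'D_et phi p).
  move=> mwx mwt; apply: measurable_funB.
    have m1 : measurable_fun half_plane (fun p => - 2 * wx p) by exact: measurable_funM.
    have m2 : measurable_fun half_plane (fun p => - 2 * wx p * wt p) by exact: measurable_funM.
    exact: measurable_funN (measurable_funM m2 mx).
  by apply: measurable_funM => //; apply: measurable_funD; exact: measurable_funX.
apply: ae_eq_Rintegral_half.
- by apply: meas; apply: mh; [case: hx|case: ht].
- by apply: meas; apply: mh; [case: gx|case: gt].
have ex := weak_partial_unique hx gx; have et := weak_partial_unique ht gt.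
have := ae2_forall_nat (P := fun n p => if n is 0 then 0 < p.2 -> vx p = ux p else 0 < p.2 -> vt p = ut p).
move=> k; have := k (fun n => match n with 0 => ex | _ => et end).
by apply: ae2_imp => p e p0; rewrite (e 0%N p0) (e 1%N p0).
Qed.

Lemma Loo_norm_patch (f : R -> R) (K : set R) (C : R) : 0 <= C ->
  (forall x, K x -> `|f x| <= C) -> (Loo_norm (f \_ K) <= C%:E)%E.
Proof.
move=> C0 fC; apply/Loo_norm_leP; apply: ae_imp (loclip_derivable (loclip_cst 0)) => x _.
rewrite lee_fin patchE; case: ifPn => [|_]; last by rewrite normr0.
by rewrite inE => /fC.
Qed.

Lemma compact_radius (K : set R) : compact K -> exists2 N : R, 0 <= N & forall x, K x -> `|x| <= N.
Proof.
move=> cK; have [->|/set0P K0] := eqVneq K set0; first by exists 0.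
have cn : {within K, continuous (fun x : R => `|x|)}.
  by apply: continuous_subspaceT => x; exact: norm_continuous.
have [c _ cmax] := compact_EVT_max K0 cK cn.
by exists `|c| => // x Kx; apply: cmax; rewrite inE.
Qed.

Lemma energy_space_wave V : lip2 V -> energy_space (wave V).
Proof.
move=> lV; split.
  apply: continuous_subspaceT => p.
  apply: (@continuous_comp _ _ _ (@char_coord R) (fun q => V q.1 q.2) p).
    exact: continuous_char_coord.
  exact: lip2_continuous.
exists (wave_x V), (wave_t V); split; first exact: wave_gradient.
move=> K T cK T0; have [N N0 KN] := compact_radius cK.
have [bl br] := lbounded_slopes lV; have bV := continuous_lbounded (lip2_continuous lV).
have [_ hV] := bV; have [C C0 hC] := hV (N + T).
have [_ hx] := lboundedD bl br; have [D D0 hD] := hx (N + T).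
have [_ ht] := lboundedD br (lboundedZ (-1) bl); have [E E0 hE] := ht (N + T).
exists (C + D + E); apply: ae_imp (loclip_derivable (loclip_cst 0)) => t _ /andP[t0 tT].
have bd x : K x -> `|x - t| <= N + T /\ `|x + t| <= N + T.
  move=> /KN xN; have tt : `|t| <= T by rewrite gtr0_norm// ltW.
  by split; [rewrite (le_trans (ler_normB _ _))|rewrite (le_trans (ler_normD _ _))]; rewrite ?lerD.
rewrite !EFinD; apply: leeD; first apply: leeD; apply: Loo_norm_patch => // x /bd[h1 h2].
- exact: (hC (x - t, x + t)).
- exact: (hD (x - t, x + t)).
- by have := hE (x - t, x + t) h1 h2; rewrite /wave_t mulN1r.
Qed.

Lemma wave_conservative g f V (u0 u1 : R -> R) : geo g f V ->
  (forall b, {ae mu, forall a, a < b -> slope_l V (a, b) ^+ 2 = dq g a ^+ 2}) ->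
  (forall a, {ae mu, forall b, a < b -> slope_r V (a, b) ^+ 2 = dq f b ^+ 2}) ->
  (forall x, u0 x = g x - f x) ->
  {ae mu, forall x, g^`()%classic x + f^`()%classic x = - u1 x} ->
  conservative_solution u0 u1 (wave V).
Proof.
move=> hV hl hr u0E u1E; have lV := geo_lip hV; split.
- exact: energy_space_wave.
- exact: obstacle_wave hV.
- exact: initial_wave u1E.
- apply: (energy_conservation_unique (wave_gradient lV)) => phi tphi.
  exact: energy_flux (geo_g hV) (geo_f hV) hl hr tphi.
Qed.

End ConservativeWave.

(** * Mollified steps and averaging kernels *)

Section Mollification.
Context {R : realType}.
Notation mu := (@lebesgue_measure R).
Notation mu2 := (@lebesgue_measure R \x @lebesgue_measure R)%E.
Implicit Types (phi F G : R * R -> R) (V : R -> R -> R).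

(** The kernel [kn] = [st]' has mass one on [c, c + e]. A difference of two steps is a compactly
    supported window whose derivative is a difference of two kernels, so testing with it samples a
    function near the two ends. *)
Record mollified_step (e c : R) (st kn : R -> R) : Prop := MollifiedStep {
  ms_smooth : smooth st;
  ms_derive : forall s : R, is_derive s 1 st (kn s);
  ms_continuous : continuous kn;
  ms_01 : forall s, 0 <= st s <= 1;
  ms_l : forall s, s <= c -> st s = 0;
  ms_r : forall s, c + e <= s -> st s = 1;
  ms_ge0 : forall s, 0 <= kn s;
  ms_out : forall s, ~ (c <= s <= c + e) -> kn s = 0;
  ms_smooth_kn : smooth kn }.

Lemma mollified_step_exists : exists st kn : R -> R -> R -> R,
  (forall e c, 0 < e -> mollified_step e c (st e c) (kn e c)) /\
  forall e c c' s, 0 < e -> c <= c' -> st e c' s <= st e c s.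
Proof.
have [S [sS ndS S0 S1]] := @smooth_step R.
pose st e c s := 1 * S (e^-1 * s + (- e^-1 * c)).
exists st, (fun e c => (st e c)^`()%classic); split; last first.
  move=> e c c' s e0 cc; rewrite /st !mul1r ndS// lerD2l !mulNr lerN2 ler_pM2l//.
  by rewrite invr_gt0.
move=> e c e0.
have sst : smooth (st e c) by exact: smooth_affine.
have ei : 0 < e^-1 by rewrite invr_gt0.
have nd : {homo st e c : x y / x <= y}.
  by move=> x y xy; rewrite /st !mul1r ndS// lerD2r ler_pM2l.
have l0 s : s <= c -> st e c s = 0.
  by move=> sc; rewrite /st mul1r S0// mulNr -mulrBr; apply: mulr_ge0_le0; [exact: ltW|rewrite subr_le0].
have r1 s : c + e <= s -> st e c s = 1.
  by move=> sc; rewrite /st mul1r S1// mulNr -mulrBr mulrC ler_pdivlMr// mul1r; linarith.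
have d s := smooth_is_derive s sst.
have dd s : derivable (st e c) s 1 by exact: smooth_derivable.
have kn0 s : 0 <= (st e c)^`()%classic s.
  by apply: (derive_ge0_r (d := 1)) => // h h0 _; apply: nd; rewrite lerDl ltW.
split; [exact: sst|exact: d| | |exact: l0|exact: r1|exact: kn0| |exact: smooth_derive].
- by apply: smooth_continuous; exact: smooth_derive.
- move=> s; rewrite -{1}(l0 (Num.min s c)) ?ge_min ?lexx ?orbT// nd ?ge_min ?lexx//=.
  have m1 : c + e <= Num.max s (c + e) by rewrite le_max lexx orbT.
  by rewrite -(r1 _ m1) nd// le_max lexx.
- move=> s h; apply/le_anti; rewrite kn0 andbT.
  have [sc|cs] := ltP s c.
    apply: (derive_le0_r (d := c - s)) => //; first by rewrite subr_gt0.
    by move=> k k0 kc; rewrite !l0//; linarith.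
  have sc : c + e < s by rewrite ltNge; apply/negP => sc; apply: h; rewrite cs.
  apply: (derive_le0_r (d := 1)) => // k k0 _; rewrite !r1//; linarith.
Qed.

Lemma ms_integrable e c st kn : mollified_step e c st kn -> mu.-integrable setT (EFin \o kn).
Proof.
move=> h; have mI : measurable (`[c, c + e]%classic : set R) by exact: measurable_itv.
have -> : EFin \o kn = (EFin \o kn) \_ `[c, c + e]%classic.
  apply/funext => x; rewrite patchE; case: ifPn => // /negP; rewrite inE /= in_itv/=.
  by move=> /(ms_out h) ->.
rewrite -(@integrable_mkcond _ _ _ mu _ _ mI).
apply: continuous_compact_integrable; first exact: segment_compact.
by apply: continuous_subspaceT; exact: (ms_continuous h).
Qed.

Lemma ms_Rintegral e c st kn : 0 < e -> mollified_step e c st kn -> \int[mu]_x kn x = 1.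
Proof.
move=> e0 h; pose M : R := Num.max `|c| `|c + e|.
have cM : `|c| <= M by rewrite le_max lexx.
have ceM : `|c + e| <= M by rewrite le_max lexx orbT.
have M0 : - M <= M by have := normr_ge0 c; linarith.
move: (cM) (ceM); rewrite !ler_norml => /andP[c1 c2] /andP[c3 c4].
have lst := C1_loclip (ms_derive h) (ms_continuous h).
rewrite (@Rintegral_supp _ _ M) => [|x Mx]; last first.
  by apply: (ms_out h) => /andP[x1 x2]; move: Mx; rewrite ltNge ler_norml => /negP; apply; apply/andP; linarith.
have := loclip_FTC lst M0; rewrite (ms_l h c1) (ms_r h c4) subr0 => <-.
apply: eq_Rintegral => x _; have [d k] := ms_derive h x.
by rewrite derive_dq// derive1E k.
Qed.

Lemma derive1_out (h : R -> R) (c d : R) : (forall s, ~ (c <= s <= d) -> h s = 0) ->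
  forall s, ~ (c <= s <= d) -> h^`()%classic s = 0.
Proof.
move=> h0 s hs; have near0 : \forall z \near s, h z = cst 0 z.
  have : \forall z \near s, (~` `[c, d]%classic : set R) z.
    apply: open_nbhs_nbhs; split; first by apply: closed_openC; exact: itv_closed.
    by rewrite /= in_itv.
  by apply: filterS => z; rewrite /= in_itv/= => /h0.
by rewrite derive1E (near_eq_derive _ near0) derive_cst.
Qed.

Lemma step_difference (e c c' : R) st kn st' kn' : 0 < e -> c <= c' ->
  mollified_step e c st kn -> mollified_step e c' st' kn' ->
  [/\ smooth (fun s => st s - st' s), continuous (fun s => kn s - kn' s),
    forall s : R, is_derive s 1 (fun s => st s - st' s) (kn s - kn' s) &
    forall s, ~ (c <= s <= c' + e) -> st s - st' s = 0 /\ kn s - kn' s = 0].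
Proof.
move=> e0 cc h h'; split.
- have -> : (fun s => st s - st' s) = (fun s => st s + (-1) * st' (1 * s + 0)).
    by apply/funext => s; rewrite mul1r addr0 mulN1r.
  by apply: smoothD; [exact: (ms_smooth h)|apply: smooth_affine; exact: (ms_smooth h')].
- by move=> s; apply: cvgB; [exact: (ms_continuous h)|exact: (ms_continuous h')].
- by move=> s; apply: is_deriveB; [exact: (ms_derive h)|exact: (ms_derive h')].
move=> s hs; rewrite (ms_out h) ?(ms_out h') ?subr0; first last.
- by move=> /andP[? ?]; apply: hs; apply/andP; linarith.
- by move=> /andP[? ?]; apply: hs; apply/andP; linarith.
split => //; have [sc|cs] := ltP s c; first by rewrite (ms_l h) ?(ms_l h')//; linarith.
have sr : c' + e <= s by rewrite leNgt; apply/negP => k; apply: hs; rewrite cs ltW.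
by rewrite (ms_r h) ?(ms_r h') ?subrr//; linarith.
Qed.

Lemma Rintegral_unit_bump (A : R -> R) (c d : R) : continuous A -> c <= d ->
  (forall s, 0 <= A s <= 1) -> (forall s, ~ (c <= s <= d) -> A s = 0) ->
  mu.-integrable setT (EFin \o A) /\ \int[mu]_x A x <= d - c.
Proof.
move=> cA cd A01 A0; have mI : measurable (`[c, d]%classic : set R) by exact: measurable_itv.
have E : EFin \o A = (EFin \o A) \_ `[c, d]%classic.
  by apply/funext => x; rewrite patchE; case: ifPn => // /negP; rewrite inE /= in_itv/= => /A0 ->.
have iI : mu.-integrable `[c, d]%classic (EFin \o A).
  by apply: continuous_compact_integrable; [exact: segment_compact|exact: continuous_subspaceT].
split; first by rewrite E -(@integrable_mkcond _ _ _ mu _ _ mI).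
have -> : \int[mu]_x A x = \int[mu]_(x in `[c, d]) A x.
  rewrite [RHS]Rintegral_mkcond; apply: eq_Rintegral => x _; rewrite patchE.
  by case: ifPn => // /negP; rewrite inE /= in_itv/= => /A0.
have mA : measurable_fun setT A by exact: continuous_measurable_fun.
apply: (@le_trans _ _ (\int[mu]_(x in `[c, d]) (cst 1 x : R))).
  apply: (ae_le_Rintegral (C := 1)) => //.
    by move=> x _; rewrite /= normr1 ger0_norm; have /andP[] := A01 x.
  by apply: ae_imp (loclip_derivable (loclip_cst 0)) => x _ _; have /andP[] := A01 x.
by rewrite Rintegral_cst//= lebesgue_measure_itv/= lte_fin mul1r; case: ltP => //= *; linarith.
Qed.

Lemma kernel_product_boxed F e1 e2 c1 c2 st1 st2 kn1 kn2 :
  mollified_step e1 c1 st1 kn1 -> mollified_step e2 c2 st2 kn2 -> lbounded F ->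
  boxed (fun q => F q * (kn1 q.1 * kn2 q.2)).
Proof.
move=> h1 h2 bF; apply: boxedM => //.
  apply: continuous_lbounded => q; apply: cvgM.
    by apply: continuous_comp; [exact: cvg_fst|exact: (ms_continuous h1)].
  by apply: continuous_comp; [exact: cvg_snd|exact: (ms_continuous h2)].
exists (Num.max (`|c1| + `|e1|) (`|c2| + `|e2|)) => q /eqP; rewrite mulf_eq0 negb_or => /andP[k1 k2].
have {}k1 : c1 <= q.1 <= c1 + e1 by apply: contrapT => /(ms_out h1) k; rewrite k eqxx in k1.
have {}k2 : c2 <= q.2 <= c2 + e2 by apply: contrapT => /(ms_out h2) k; rewrite k eqxx in k2.
rewrite !le_max; have := ler_norm c1; have := ler_norm e1; have := ler_norm c2; have := ler_norm e2.
have := ler_norm (- c1); have := ler_norm (- c2); rewrite !normrN.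
have := normr_ge0 e1; have := normr_ge0 e2; move: k1 k2 => /andP[? ?] /andP[? ?] *.
split; apply/orP; [left|right]; rewrite ler_norml; apply/andP; split; linarith.
Qed.

Lemma kernel_average F e1 e2 c1 c2 st1 st2 kn1 kn2 (l r : R) : 0 < e1 -> 0 < e2 ->
  mollified_step e1 c1 st1 kn1 -> mollified_step e2 c2 st2 kn2 -> lbounded F ->
  (forall q, c1 <= q.1 <= c1 + e1 -> c2 <= q.2 <= c2 + e2 -> `|F q - l| <= r) ->
  `|\int[mu2]_q (F q * (kn1 q.1 * kn2 q.2)) - l| <= r.
Proof.
move=> e10 e20 h1 h2 bF Fl.
have bc (k : R) : lbounded (fun=> k : R) by apply: continuous_lbounded => p; exact: cvg_cst.
have bK (k : R) := kernel_product_boxed h1 h2 (bc k).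
have bFK := kernel_product_boxed h1 h2 bF.
have K1 (k : R) : \int[mu2]_q (k * (kn1 q.1 * kn2 q.2)) = k.
  rewrite (boxed_fubini1 (bK k)) /=.
  transitivity (\int[mu]_a (k * kn1 a)).
    apply: eq_Rintegral => a _; under eq_Rintegral do rewrite mulrA.
    by rewrite RintegralZl//; [rewrite (ms_Rintegral e20 h2) mulr1|exact: (ms_integrable h2)].
  by rewrite RintegralZl//; [rewrite (ms_Rintegral e10 h1) mulr1|exact: (ms_integrable h1)].
have main (s : R) : (forall q, c1 <= q.1 <= c1 + e1 -> c2 <= q.2 <= c2 + e2 -> 0 <= s * F q + (r - s * l)) ->
    0 <= s * \int[mu2]_q (F q * (kn1 q.1 * kn2 q.2)) + (r - s * l).
  move=> pos; rewrite -[X in _ + X]K1 -(RintegralZ_boxed s bFK).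
  have bs : boxed (fun q => s * (F q * (kn1 q.1 * kn2 q.2))).
    have := kernel_product_boxed h1 h2 (lboundedZ s bF).
    by congr boxed; apply/funext => q; ring.
  rewrite -(RintegralD_boxed bs (bK _)); apply: Rintegral_ge0 => q _.
  rewrite mulrA -mulrDl; have [k1|/negP/(ms_out h1) ->] := boolP (c1 <= q.1 <= c1 + e1); last by rewrite mul0r mulr0.
  have [k2|/negP/(ms_out h2) ->] := boolP (c2 <= q.2 <= c2 + e2); last by rewrite !mulr0.
  by rewrite mulr_ge0 ?pos// mulr_ge0 ?(ms_ge0 h1) ?(ms_ge0 h2).
have p1 := main 1; have p2 := main (-1); rewrite ler_norml; apply/andP; split.
- have := p1 _; set I := Rintegral _ _ _.
  have k : forall q, c1 <= q.1 <= c1 + e1 -> c2 <= q.2 <= c2 + e2 -> 0 <= 1 * F q + (r - 1 * l).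
    by move=> q q1 q2; have := Fl q q1 q2; rewrite ler_norml => /andP[? ?]; linarith.
  by move=> /(_ k); linarith.
- have := p2 _; set I := Rintegral _ _ _.
  have k : forall q, c1 <= q.1 <= c1 + e1 -> c2 <= q.2 <= c2 + e2 -> 0 <= -1 * F q + (r - -1 * l).
    by move=> q q1 q2; have := Fl q q1 q2; rewrite ler_norml => /andP[? ?]; linarith.
  by move=> /(_ k); linarith.
Qed.

Lemma continuous_square F (x y r : R) : continuous F -> 0 < r -> exists2 d : R, 0 < d &
  forall e, 0 < e -> e < d -> forall q, x <= q.1 <= x + e -> y <= q.2 <= y + e -> `|F q - F (x, y)| <= r.
Proof.
move=> cF r0; have /cvgrPdist_le /(_ _ r0) := cF (x, y).
move=> /nbhs_ballP[d /= d0 hd]; exists d => // e e0 ed q /andP[q1 q2] /andP[q3 q4].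
rewrite distrC; apply: hd; split; rewrite /= -ball_normE /= ltr_norml; apply/andP; linarith.
Qed.

Lemma tensor_boxed F (A B : R -> R) (a1 a2 b1 b2 : R) : lbounded F -> continuous A -> continuous B ->
  (forall s, ~ (a1 <= s <= a2) -> A s = 0) -> (forall s, ~ (b1 <= s <= b2) -> B s = 0) ->
  boxed (fun q => F q * (A q.1 * B q.2)).
Proof.
move=> bF cA cB A0 B0.
have supp q : A q.1 * B q.2 <> 0 -> a1 <= q.1 <= a2 /\ b1 <= q.2 <= b2.
  by move=> AB; split; apply: contrapT => h; apply: AB; [rewrite A0 ?mul0r|rewrite B0 ?mulr0].
apply: boxedM => //.
  apply: continuous_lbounded => q; apply: cvgM.
    by apply: continuous_comp; [exact: cvg_fst|exact: cA].
  by apply: continuous_comp; [exact: cvg_snd|exact: cB].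
exists (Num.max (Num.max `|a1| `|a2|) (Num.max `|b1| `|b2|)) => q /supp[/andP[h1 h2] /andP[h3 h4]].
rewrite !le_max; have := ler_norm a2; have := ler_norm b2; have := ler_norm (- a1); have := ler_norm (- b1).
rewrite !normrN => k1 k2 k3 k4; split; rewrite !ler_norml.
  have [q0|q0] := leP 0 q.1; [rewrite (_ : (_ <= q.1 <= `|a2|))|rewrite (_ : (_ <= q.1 <= `|a1|))];
  by rewrite ?orbT//; apply/andP; linarith.
have [q0|q0] := leP 0 q.2; [rewrite (_ : (_ <= q.2 <= `|b2|))|rewrite (_ : (_ <= q.2 <= `|b1|))];
by rewrite ?orbT//; apply/andP; linarith.
Qed.

Lemma half_char F (A B : R -> R) (a1 a2 b1 b2 : R) : lbounded F -> continuous A -> continuous B ->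
  (forall s, ~ (a1 <= s <= a2) -> A s = 0) -> (forall s, ~ (b1 <= s <= b2) -> B s = 0) -> a2 < b1 ->
  \int[mu2]_(p in half_plane) (F (char_coord p) * char_prod A B p) =
  2^-1 * \int[mu2]_q (F q * (A q.1 * B q.2)).
Proof.
move=> bF cA cB A0 B0 ab.
apply: (half_plane_to_char (tensor_boxed bF cA cB A0 B0)) => p hp //.
have [a|/A0 ->] := pselect (a1 <= (char_coord p).1 <= a2); last by rewrite mul0r mulr0.
have [b|/B0 ->] := pselect (b1 <= (char_coord p).2 <= b2); last by rewrite !mulr0.
by exfalso; apply: hp; move: a b; rewrite /char_coord /= => /andP[_ h1] /andP[h2 _]; linarith.
Qed.

Lemma tensor_integral (A B : R -> R) : boxed (fun q => A q.1 * B q.2) ->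
  mu.-integrable setT (EFin \o A) -> mu.-integrable setT (EFin \o B) ->
  \int[mu2]_q (A q.1 * B q.2) = (\int[mu]_a A a) * \int[mu]_b B b.
Proof.
move=> g iA iB; rewrite (boxed_fubini1 g) /= mulrC -RintegralZl//.
by apply: eq_Rintegral => a _; rewrite RintegralZl// mulrC.
Qed.

End Mollification.

(** * Lipschitz continuity of distributional solutions *)

Lemma sorted_dist (R : realFieldType) (a b a' b' : R) : a <= b -> b' <= a' ->
  `|a - b'| + `|b - a'| <= `|a - a'| + `|b - b'|.
Proof.
move=> ab ba; case: (ler0P (a - b')); case: (ler0P (b - a'));
  case: (ler0P (a - a')); case: (ler0P (b - b')); linarith.
Qed.

Lemma small_scale (R : realFieldType) (d1 d2 g1 g2 r C : R) : 0 < d1 -> 0 < d2 -> 0 < g1 -> 0 < g2 ->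
  0 < r -> 0 <= C -> exists e : R, [/\ 0 < e, e < d1, e < d2, e < g1 & e < g2] /\ C * e <= r.
Proof.
move=> d10 d20 g10 g20 r0 C0; have C1 : 0 < C + 1 by linarith.
pose m := Num.min (Num.min d1 d2) (Num.min (Num.min g1 g2) (r / (C + 1))).
have m0 : 0 < m by rewrite !lt_min d10 d20 g10 g20 divr_gt0.
have k1 : m <= d1 by rewrite !ge_min lexx.
have k2 : m <= d2 by rewrite !ge_min lexx ?orbT.
have k3 : m <= g1 by rewrite !ge_min lexx ?orbT.
have k4 : m <= g2 by rewrite !ge_min lexx ?orbT.
have k5 : m <= r / (C + 1) by rewrite !ge_min lexx ?orbT.
clearbody m; exists (m / 2); split; first by split; linarith.
move: k5; rewrite ler_pdivlMr// => k5; nra.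
Qed.

Lemma corner_windows (R : realFieldType) (a1 a2 b1 b2 e : R) : 0 < e -> e < (a2 - a1) / 4 -> e < (b2 - b1) / 2 ->
  [/\ a1 + e <= a2 - e - e, a2 - e - e <= a2 - e, a2 - e < a2 & b1 + e <= b2 - e].
Proof. by move=> ? ? ?; split; lra. Qed.

Lemma three_errors (R : realFieldType) (C h e r I I1 I2 l1 l2 : R) : 0 <= C -> I <= h + e -> C * e <= r / 3 ->
  `|I2 - l2| <= r / 3 -> `|I1 - l1| <= r / 3 -> `|I1 - I2| <= C * I -> `|l2 - l1| <= C * h + r.
Proof.
move=> C0 Ih Ce; rewrite !ler_norml => /andP[? ?] /andP[? ?] /andP[? ?].
have : C * I <= C * h + r / 3 by rewrite (le_trans (ler_wpM2l C0 Ih))// mulrDr lerD2l.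
by move=> ?; apply/andP; split; linarith.
Qed.

Lemma char_region (R : realFieldType) (x t a1 a2 b1 b2 N : R) :
  a1 <= x - t /\ x - t <= a2 -> b1 <= x + t /\ x + t <= b2 -> - N <= a1 -> b2 <= N -> 0 < t ->
  `|x| <= N /\ t <= N.
Proof. by move=> [? ?] [? ?] ? ? ?; rewrite ler_norml; split; [apply/andP; split|]; linarith. Qed.

Lemma two_norms (R : realFieldType) (C I X Y : R) : `|2^-1 * X + 2^-1 * Y| <= C * (2^-1 * I) ->
  `|2^-1 * Y - 2^-1 * X| <= C * (2^-1 * I) -> `|X| <= C * I /\ `|Y| <= C * I.
Proof.
have -> : C * (2^-1 * I) = 2^-1 * (C * I) by ring.
rewrite !ler_norml => /andP[? ?] /andP[? ?]; split; apply/andP; split; linarith.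
Qed.

Section WeakSolution.
Context {R : realType}.
Notation mu := (@lebesgue_measure R).
Notation mu2 := (@lebesgue_measure R \x @lebesgue_measure R)%E.
Implicit Types (phi F G u ux ut : R * R -> R) (V : R -> R -> R).

(* The even extension across [t = 0] makes [fold u] a function on the whole
   characteristic plane. *)
Definition fold u (a b : R) : R := u (2^-1 * (a + b), 2^-1 * `|b - a|).

Lemma fold_sym u a b : fold u a b = fold u b a.
Proof. by rewrite /fold addrC distrC. Qed.

Lemma wave_fold u p : 0 <= p.2 -> wave (fold u) p = u p.
Proof.
move=> p0; rewrite /wave /fold; have -> : p.1 + p.2 - (p.1 - p.2) = 2 * p.2 by ring.
rewrite ger0_norm; last linarith.
by case: p p0 => x t /= _; congr (u (_, _)); field.
Qed.

Lemma fold_continuous u : {within [set p : R * R | 0 <= p.2], continuous u} ->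
  continuous (fun q => fold u q.1 q.2).
Proof.
move=> /subspace_continuousP cu q; pose m (q : R * R) := (2^-1 * (q.1 + q.2), 2^-1 * `|q.2 - q.1|) : R * R.
have mH z : 0 <= (m z).2 by rewrite /m /= mulr_ge0.
have cm : m @ q --> m q.
  have c1 : (fun q : R * R => 2^-1 * (q.1 + q.2)) @ q --> 2^-1 * (q.1 + q.2).
    by apply: cvgM; [exact: cvg_cst|apply: cvgD; [exact: cvg_fst|exact: cvg_snd]].
  have c2 : (fun q : R * R => 2^-1 * `|q.2 - q.1|) @ q --> 2^-1 * `|q.2 - q.1|.
    by apply: cvgM; [exact: cvg_cst|apply: cvg_norm; apply: cvgB; [exact: cvg_snd|exact: cvg_fst]].
  exact: (cvg_pair c1 c2).
apply: (cvg_comp m u _ (cu (m q) (mH q))) => P /=.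
rewrite /within /= => hP; have := cm _ hP; rewrite /nbhs /=; apply: filterS => z; exact.
Qed.

Lemma weak_gradient_ext u v ux ut : (forall p, 0 < p.2 -> u p = v p) ->
  weak_gradient u ux ut -> weak_gradient v ux ut.
Proof.
move=> uv; have eqI (F G : R * R -> R) : (forall p, 0 < p.2 -> F p = G p) ->
    \int[mu2]_(p in half_plane) F p = \int[mu2]_(p in half_plane) G p.
  by move=> FG; apply: eq_Rintegral => p; rewrite inE => /FG.
have ext w g : weak_partial w u g -> weak_partial w v g.
  move=> [[mu_ lu] lg h]; split => //.
    split; first by apply: (eq_measurable_fun u) mu_ => p; rewrite inE => /uv.
    move=> K cK KH; rewrite (_ : (\int[mu2]_(p in K) `|v p|%:E = \int[mu2]_(p in K) `|u p|%:E)%E); first exact: lu.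
    by apply: eq_integral => p; rewrite inE => /KH/uv ->.
  move=> phi tphi; rewrite -h//; apply: eqI => p p0; by rewrite uv.
by move=> [h1 h2]; split; exact: ext.
Qed.

Lemma obstacle_equation_ext u v : (forall p, 0 <= p.2 -> u p = v p) ->
  obstacle_equation u -> obstacle_equation v.
Proof.
move=> uv [h1 h2 h3].
have eqI phi : \int[mu2]_(p in half_plane) (u p * box phi p) =
    \int[mu2]_(p in half_plane) (v p * box phi p).
  by apply: eq_Rintegral => p; rewrite inE /half_plane /= => p0; rewrite uv// ltW.
split.
- by move=> p p0; rewrite -uv// h1.
- by move=> phi tphi phi0; rewrite -eqI h2.
- move=> phi [sphi [K [cK KO K0]]]; rewrite -eqI; apply: h3; split => //; exists K; split => //.
  by move=> p /KO[p0 vp]; split => //=; rewrite uv// ltW.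
Qed.

Definition strip_bounded (ux ut : R * R -> R) := forall N : R, exists2 C : R, 0 <= C &
  {ae mu2, forall p, 0 < p.2 -> `|p.1| <= N -> p.2 <= N -> `|ux p| <= C /\ `|ut p| <= C}.

(** The bounds on almost every time slice become a bound almost everywhere in the plane: the set A
    where it fails is measurable and has null slices for almost every t. *)
Lemma energy_space_strip u : energy_space u -> exists ux ut,
  weak_gradient u ux ut /\ strip_bounded ux ut.
Proof.
move=> [_ [ux [ut [gu bd]]]]; exists ux, ut; split => // N.
have mhp := @measurable_half_plane R.
have [[_ [mx _] _] [_ [mt _] _]] := gu.
have bound (w : R * R -> R) C : measurable_fun half_plane w ->
    {ae mu, forall t : R, 0 < t < N + 1 -> {ae mu, forall x : R, `|x| <= N -> `|w (x, t)| <= C}} ->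
    {ae mu2, forall p, 0 < p.2 -> `|p.1| <= N -> p.2 <= N -> `|w p| <= C}.
  move=> mw h; pose W := w \_ half_plane.
  have mW : measurable_fun setT W by exact/(measurable_restrictT _ mhp).
  pose A := half_plane `&` ([set p : R * R | `|p.1| <= N] `&` ([set p | p.2 <= N] `&` [set p | C < `|W p|])).
  have mle (f : R * R -> R) (c : R) : measurable_fun setT f -> measurable [set p | f p <= c].
    move=> mf; rewrite (_ : [set p | f p <= c] = setT `&` f @^-1` `]-oo, c]%classic).
      by apply: mf => //; exact: measurable_itv.
    by rewrite setTI; apply/seteqP; split => p; rewrite /= in_itv.
  have mlt (f : R * R -> R) (c : R) : measurable_fun setT f -> measurable [set p | c < f p].
    move=> mf; rewrite (_ : [set p | c < f p] = setT `&` f @^-1` `]c, +oo[%classic).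
      by apply: mf => //; exact: measurable_itv.
    by rewrite setTI; apply/seteqP; split => p; rewrite /= in_itv/= andbT.
  have mA : measurable A.
    apply: measurableI => //; apply: measurableI; first by apply: mle; apply: measurableT_comp => //; exact: measurable_fst.
    apply: measurableI; first by apply: mle; exact: measurable_snd.
    by apply: mlt; exact: measurableT_comp.
  have A0 : mu2 A = 0%E.
    apply/(null_slices mA); apply: ae_imp h => t ht.
    have mAt : measurable [set x | A (x, t)].
      by rewrite -[X in measurable X]setTI; exact: (pair2_measurable t).
    have [t01|/negP t01] := boolP (0 < t < N + 1); last first.
      rewrite (_ : [set x | A (x, t)] = set0)//; apply/seteqP; split => // x [t0 [_ [tN _]]].
      by apply: t01; rewrite /half_plane /= in t0 tN; rewrite t0/=; linarith.
    have [B [mB B0 hB]] := ht t01; apply/eqP; rewrite -measure_le0 -B0.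
    apply: le_measure; rewrite ?inE// => x [t0 [xN [tN Cw]]]; apply: hB => /= hx.
    have := hx xN; rewrite leNgt => /negP; apply.
    by move: Cw; rewrite /= /W patchE mem_set.
  exists A; split => // p hp; apply: contrapT => Ap; apply: hp => p0 p1 p2.
  rewrite leNgt; apply/negP => Cw; apply: Ap; split => //; split => //; split => //=.
  by rewrite /W patchE mem_set.
pose I : set R := `[- N, N]%classic.
have cK : compact I by exact: segment_compact.
have [N1|N1] := ltP 0 (N + 1); last first.
  exists 0 => //; exists set0; split; [exact: measurable0|exact: measure0|].
  move=> p h; apply: h => _ p1; exfalso; have := normr_ge0 p.1; linarith.
have [C hC] := bd _ _ cK N1.
have slice (w : R * R -> R) : (forall t, (Loo_norm ((fun x => w (x, t)) \_ I) <=
      Loo_norm ((fun x => u (x, t)) \_ I) + Loo_norm ((fun x => ux (x, t)) \_ I) +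
      Loo_norm ((fun x => ut (x, t)) \_ I))%E) ->
    {ae mu, forall t : R, 0 < t < N + 1 -> {ae mu, forall x : R, `|x| <= N -> `|w (x, t)| <= Num.max C 0}}.
  move=> hw; apply: ae_imp hC => t ht /ht hCt.
  have /Loo_norm_leP := le_trans (hw t) hCt.
  apply: ae_imp => x; rewrite lee_fin patchE => h xN; move: h.
  by rewrite mem_set; [move=> /le_trans; apply; rewrite le_max lexx|rewrite /I /= in_itv/= -ler_norml].
have b1 := bound ux (Num.max C 0) mx.
have b2 := bound ut (Num.max C 0) mt.
have le3 (x y z : \bar R) : (0 <= x -> 0 <= y -> 0 <= z -> y <= x + y + z /\ z <= x + y + z)%E.
  move=> x0 y0 z0; split; first by rewrite (le_trans (leeDr y x0))// leeDl.
  by rewrite leeDr// adde_ge0.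
have {}b1 := b1 (slice ux (fun t => (le3 _ _ _ (Loo_norm_ge0 _) (Loo_norm_ge0 _) (Loo_norm_ge0 _)).1)).
have {}b2 := b2 (slice ut (fun t => (le3 _ _ _ (Loo_norm_ge0 _) (Loo_norm_ge0 _) (Loo_norm_ge0 _)).2)).
exists (Num.max C 0); first by rewrite le_max lexx orbT.
have k := ae2_forall_nat (P := fun n p => if n is 0 then 0 < p.2 -> `|p.1| <= N -> p.2 <= N -> `|ux p| <= Num.max C 0
  else 0 < p.2 -> `|p.1| <= N -> p.2 <= N -> `|ut p| <= Num.max C 0).
apply: ae2_imp (k (fun n => match n with 0 => b1 | _ => b2 end)) => p e p0 p1 p2.
by split; [exact: (e 0%N)|exact: (e 1%N)].
Qed.

Lemma derive_char_prod (A B A' B' : R -> R) (p : R * R) : smooth A -> smooth B ->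
  (forall x : R, is_derive x 1 A (A' x)) -> (forall x : R, is_derive x 1 B (B' x)) ->
  'D_ex (char_prod A B) p = char_prod A' B p + char_prod A B' p /\
  'D_et (char_prod A B) p = char_prod A B' p - char_prod A' B p.
Proof.
move=> sA sB /derive1_eq[_ EA] /derive1_eq[_ EB].
have dx := is_derive_char_prod p (@ex R) sA sB; have dt := is_derive_char_prod p (@et R) sA sB.
rewrite (@derive_val _ _ _ _ _ _ _ dx) (@derive_val _ _ _ _ _ _ _ dt) EA EB /ex /et /=; split; ring.
Qed.

Lemma strip_integral F (C : R) phi : 0 <= C -> L1_loc_half F -> test_fun half_plane phi ->
  (forall p, 0 <= phi p) ->
  {ae mu2, forall p, 0 < p.2 -> phi p != 0 -> `|F p| <= C} ->
  `|\int[mu2]_(p in half_plane) (F p * phi p)| <= C * \int[mu2]_(p in half_plane) phi p.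
Proof.
move=> C0 lF tphi phi0 FC; have mhp := @measurable_half_plane R.
have iF := L1_loc_test lF tphi.
have b1 : lbounded (fun=> 1 : R) by apply: continuous_lbounded => p; exact: cvg_cst.
have l1 : L1_loc_half (fun=> 1 : R) by exact: (lbounded_L1_loc b1).
have bC : lbounded (fun=> C : R) by apply: continuous_lbounded => p; exact: cvg_cst.
have lC : L1_loc_half (fun=> C : R) by exact: (lbounded_L1_loc bC).
have iphi : mu2.-integrable half_plane (EFin \o phi).
  have := L1_loc_test l1 tphi; apply: eq_integrable => // p _; by rewrite /= mul1r.
have h1 : `|\int[mu2]_(p in half_plane) (F p * phi p)| <= \int[mu2]_(p in half_plane) `|F p * phi p|.
  exact: le_normr_Rintegral.
apply: (le_trans h1); rewrite -RintegralZl//.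
have iCphi : mu2.-integrable half_plane (EFin \o (fun p => C * phi p)) by exact: (L1_loc_test lC tphi).
have iA : mu2.-integrable half_plane (EFin \o (fun p => `|F p * phi p|)) by exact: (integrable_abse iF).
rewrite /Rintegral fine_le//.
- exact: (@integrable_fin_num _ _ _ mu2).
- exact: (@integrable_fin_num _ _ _ mu2).
apply: ae_ge0_le_integral => //.
- by case/integrableP: iA.
- by move=> p _; rewrite lee_fin mulr_ge0.
- by case/integrableP: iCphi.
apply: ae2_imp FC => p h p0; rewrite lee_fin normrM (ger0_norm (phi0 p)).
by have [->|/(h p0) hp] := eqVneq (phi p) 0; [rewrite !mulr0|rewrite ler_wpM2r].
Qed.

(* Testing with [st_x - st_(x + h)] in one characteristic variable and a
   mollifier in the other turns the weak derivative into an increment. *)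
Lemma fold_increment u ux ut (N : R) : continuous (fun q => fold u q.1 q.2) ->
  weak_gradient u ux ut -> strip_bounded ux ut -> exists2 C : R, 0 <= C &
  (forall x h y, 0 <= h -> - N < x -> x + h < y -> y < N ->
    `|fold u (x + h) y - fold u x y| <= C * h) /\
  (forall x h y, 0 <= h -> - N < x -> x < y -> y + h < N ->
    `|fold u x (y + h) - fold u x y| <= C * h).
Proof.
move=> cV [gx gt] bd; have [C C0 hC] := bd N; exists C => //.
pose V q := fold u q.1 q.2; have bV : lbounded V by exact: continuous_lbounded.
have [st [kn [ms anti]]] := @mollified_step_exists R.
have [_ lx hx] := gx; have [_ lt ht] := gt.
(* Testing u_x and u_t with A (x - t) B (x + t) bounds half the sum and half the difference of the
   two characteristic pairings; [two_norms] recovers each with the same constant. *)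
have pair (A A' B B' : R -> R) (a1 a2 b1 b2 : R) : smooth A -> smooth B -> continuous A' -> continuous B' ->
    (forall s : R, is_derive s 1 A (A' s)) -> (forall s : R, is_derive s 1 B (B' s)) ->
    (forall s, 0 <= A s) -> (forall s, 0 <= B s) ->
    (forall s, ~ (a1 <= s <= a2) -> A s = 0 /\ A' s = 0) ->
    (forall s, ~ (b1 <= s <= b2) -> B s = 0 /\ B' s = 0) ->
    - N <= a1 -> a2 < b1 -> b2 <= N ->
    `|\int[mu2]_q (V q * (A' q.1 * B q.2))| <= C * \int[mu2]_q (A q.1 * B q.2) /\
    `|\int[mu2]_q (V q * (A q.1 * B' q.2))| <= C * \int[mu2]_q (A q.1 * B q.2).
  move=> sA sB cA' cB' dA dB A0 B0 Aout Bout Na ab bN.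
  have A1 s : ~ (a1 <= s <= a2) -> A s = 0 by move=> /Aout[].
  have A2 s : ~ (a1 <= s <= a2) -> A' s = 0 by move=> /Aout[].
  have B1 s : ~ (b1 <= s <= b2) -> B s = 0 by move=> /Bout[].
  have B2 s : ~ (b1 <= s <= b2) -> B' s = 0 by move=> /Bout[].
  have cA := smooth_continuous sA; have cB := smooth_continuous sB.
  pose phi := char_prod A B.
  have tphi : test_fun half_plane phi.
    apply: (test_char_prod sA sB A1 B1) => p /andP[_ h1] /andP[h2 _]; rewrite /half_plane /=; linarith.
  have phi0 p : 0 <= phi p by rewrite mulr_ge0.
  have bc1 : lbounded (fun=> 1 : R) by apply: continuous_lbounded => p; exact: cvg_cst.
  have E0 := half_char bc1 cA cB A1 B1 ab.
  have E1 := half_char bV cA' cB A2 B1 ab.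
  have E2 := half_char bV cA cB' A1 B2 ab.
  have Iphi : \int[mu2]_(p in half_plane) phi p = 2^-1 * \int[mu2]_q (A q.1 * B q.2).
    transitivity (\int[mu2]_(p in half_plane) (1 * phi p)); first by apply: eq_Rintegral => p _; rewrite mul1r.
    by rewrite E0; congr (_ * _); apply: eq_Rintegral => q _; rewrite mul1r.
  have uV p : 0 < p.2 -> u p = V (char_coord p).
    by move=> p0; rewrite -(wave_fold u (ltW p0)).
  have iV (D E : R -> R) : continuous D -> continuous E -> (forall s, ~ (a1 <= s <= a2) -> D s = 0) ->
      (forall s, ~ (b1 <= s <= b2) -> E s = 0) ->
      mu2.-integrable half_plane (EFin \o (fun p => V (char_coord p) * char_prod D E p)).
    move=> cD cE D0 E0'; have g := tensor_boxed bV cD cE D0 E0'.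
    apply: (integrableS measurableT) => //; first exact: measurable_half_plane.
    exact: (boxed_integrable (boxed_char g)).
  have i1 := iV _ _ cA' cB A2 B1; have i2 := iV _ _ cA cB' A1 B2.
  have dphi p := derive_char_prod p sA sB dA dB.
  have Ix : \int[mu2]_(p in half_plane) (u p * 'D_ex phi p) =
      2^-1 * \int[mu2]_q (V q * (A' q.1 * B q.2)) + 2^-1 * \int[mu2]_q (V q * (A q.1 * B' q.2)).
    rewrite -E1 -E2 -RintegralD//; last exact: measurable_half_plane.
    by apply: eq_Rintegral => p; rewrite inE => hp; rewrite (dphi p).1 uV// mulrDr.
  have It : \int[mu2]_(p in half_plane) (u p * 'D_et phi p) =
      2^-1 * \int[mu2]_q (V q * (A q.1 * B' q.2)) - 2^-1 * \int[mu2]_q (V q * (A' q.1 * B q.2)).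
    rewrite -E1 -E2 -RintegralB//; last exact: measurable_half_plane.
    by apply: eq_Rintegral => p; rewrite inE => hp; rewrite (dphi p).2 uV// mulrBr.
  have region p : 0 < p.2 -> phi p != 0 -> `|p.1| <= N /\ p.2 <= N.
    move=> p0 /eqP phip.
    have [/andP[h1 h2]] : a1 <= p.1 - p.2 <= a2 by apply: contrapT => /A1 h; apply: phip; rewrite /phi /char_prod h mul0r.
    have [/andP[h3 h4]] : b1 <= p.1 + p.2 <= b2 by apply: contrapT => /B1 h; apply: phip; rewrite /phi /char_prod h mulr0.
    exact: (char_region (conj h1 h2) (conj h3 h4) Na bN p0).
  have bx : `|\int[mu2]_(p in half_plane) (ux p * phi p)| <= C * \int[mu2]_(p in half_plane) phi p.
    apply: strip_integral => //; apply: ae2_imp hC => p h p0 /(region _ p0)[h1 h2].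
    by case: (h p0 h1 h2).
  have bt : `|\int[mu2]_(p in half_plane) (ut p * phi p)| <= C * \int[mu2]_(p in half_plane) phi p.
    apply: strip_integral => //; apply: ae2_imp hC => p h p0 /(region _ p0)[h1 h2].
    by case: (h p0 h1 h2).
  have bx' : `|\int[mu2]_(p in half_plane) (u p * 'D_ex phi p)| <= C * \int[mu2]_(p in half_plane) phi p.
    by rewrite hx// normrN.
  have bt' : `|\int[mu2]_(p in half_plane) (u p * 'D_et phi p)| <= C * \int[mu2]_(p in half_plane) phi p.
    by rewrite ht// normrN.
  move: bx' bt'; rewrite Ix It Iphi.
  move: (\int[mu2]_q (V q * (A' q.1 * B q.2))) (\int[mu2]_q (V q * (A q.1 * B' q.2))).
  move: (\int[mu2]_q (A q.1 * B q.2)) => I X Y; exact: two_norms.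
have bc1 : lbounded (fun=> 1 : R) by apply: continuous_lbounded => p; exact: cvg_cst.
have tens (A B : R -> R) (a1 a2 b1 b2 : R) : continuous A -> continuous B -> 
    (forall s, ~ (a1 <= s <= a2) -> A s = 0) -> (forall s, ~ (b1 <= s <= b2) -> B s = 0) ->
    mu.-integrable setT (EFin \o A) -> mu.-integrable setT (EFin \o B) ->
    \int[mu2]_q (A q.1 * B q.2) = (\int[mu]_a A a) * \int[mu]_b B b.
  move=> cA cB A0 B0 iA iB; apply: tensor_integral => //.
  have := tensor_boxed bc1 cA cB A0 B0; congr boxed; apply/funext => q; exact: mul1r.
have sub G1 G2 : boxed G1 -> boxed G2 -> \int[mu2]_q (G1 q - G2 q) = \int[mu2]_q G1 q - \int[mu2]_q G2 q.
  by move=> /boxed_integrable i1 /boxed_integrable i2; rewrite RintegralB.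
split=> x h y h0 Nx; [move=> xy yN|move=> xy yN]; apply/ler_addgt0Pr => r r0.
- have r3 : 0 < r / 3 by rewrite divr_gt0.
  have [d1 d10 hd1] := continuous_square x y cV r3.
  have [d2 d20 hd2] := continuous_square (x + h) y cV r3.
  have g1 : 0 < y - (x + h) by rewrite subr_gt0.
  have g2 : 0 < N - y by rewrite subr_gt0.
  (* The scale e lies below both radii of continuity and both gaps, so the support stays off the
     diagonal and below N. The tolerance r is shared by two averages and by the excess width of the
     window, C e <= r / 3. *)
  have [e [[e0 e1 e2 e3 e4] e5]] := small_scale d10 d20 g1 g2 r3 C0.
  have m1 := ms e x e0; have m2 := ms e (x + h) e0; have m3 := ms e y e0.
  have xh : x <= x + h by rewrite lerDl.
  have xhe : x <= x + h + e by rewrite -addrA lerDl addr_ge0// ltW.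
  have gap : x + h + e < y by move: e3; rewrite ltrBrDl.
  have yeN : y + e <= N by move: e4; rewrite ltrBrDl => /ltW.
  have [sA cA' dA outA] := step_difference e0 xh m1 m2.
  have A01 s : 0 <= st e x s - st e (x + h) s <= 1.
    rewrite subr_ge0 (anti e x (x + h) s e0 xh)/= lerBlDr.
    have /andP[h1 _] := ms_01 m2 s; have /andP[_ h2] := ms_01 m1 s.
    by rewrite (le_trans h2)// lerDl.
  have A0 s : ~ (x <= s <= x + h + e) -> st e x s - st e (x + h) s = 0 by move=> /outA[].
  have cB := ms_continuous m3; have sB := ms_smooth_kn m3.
  have sB' := smooth_derive sB.
  have outB s : ~ (y <= s <= y + e) -> kn e y s = 0 /\ ((kn e y)^`())%classic s = 0.
    by move=> hs; split; [exact: (ms_out m3)|exact: (derive1_out (ms_out m3))].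
  have [+ _] := pair _ _ _ _ _ _ _ _ sA sB cA' (smooth_continuous sB') dA (fun s => smooth_is_derive s sB)
    (fun s => (andP (A01 s)).1) (ms_ge0 m3) outA outB (ltW Nx) gap yeN.
  have [iA lA] := Rintegral_unit_bump (smooth_continuous sA) xhe A01 A0.
  rewrite (tens _ _ _ _ _ _ (smooth_continuous sA) cB A0 (ms_out m3) iA (ms_integrable m3)).
  rewrite (ms_Rintegral e0 m3) mulr1.
  have -> : \int[mu2]_q (V q * ((kn e x q.1 - kn e (x + h) q.1) * kn e y q.2)) =
      \int[mu2]_q (V q * (kn e x q.1 * kn e y q.2)) - \int[mu2]_q (V q * (kn e (x + h) q.1 * kn e y q.2)).
    rewrite -sub; [|exact: (kernel_product_boxed m1 m3 bV)|exact: (kernel_product_boxed m2 m3 bV)].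
    by apply: eq_Rintegral => q _; ring.
  have k1 := kernel_average e0 e0 m1 m3 bV (hd1 e e0 e1).
  have k2 := kernel_average e0 e0 m2 m3 bV (hd2 e e0 e2).
  have lA' : \int[mu]_a (st e x a - st e (x + h) a) <= h + e.
    by apply: le_trans lA _; rewrite -[_ + h + e]addrA [_ + (h + e)]addrC addrK.
  exact: (three_errors C0 lA' e5 k2 k1).
- have r3 : 0 < r / 3 by rewrite divr_gt0.
  have [d1 d10 hd1] := continuous_square x y cV r3.
  have [d2 d20 hd2] := continuous_square x (y + h) cV r3.
  have g1 : 0 < y - x by rewrite subr_gt0.
  have g2 : 0 < N - (y + h) by rewrite subr_gt0.
  have [e [[e0 e1 e2 e3 e4] e5]] := small_scale d10 d20 g1 g2 r3 C0.
  have m1 := ms e y e0; have m2 := ms e (y + h) e0; have m3 := ms e x e0.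
  have yh : y <= y + h by rewrite lerDl.
  have yhe : y <= y + h + e by rewrite -addrA lerDl addr_ge0// ltW.
  have gap : x + e < y by move: e3; rewrite ltrBrDl.
  have yeN : y + h + e <= N by move: e4; rewrite ltrBrDl => /ltW.
  have [sA cA' dA outA] := step_difference e0 yh m1 m2.
  have A01 s : 0 <= st e y s - st e (y + h) s <= 1.
    rewrite subr_ge0 (anti e y (y + h) s e0 yh)/= lerBlDr.
    have /andP[h1 _] := ms_01 m2 s; have /andP[_ h2] := ms_01 m1 s.
    by rewrite (le_trans h2)// lerDl.
  have A0 s : ~ (y <= s <= y + h + e) -> st e y s - st e (y + h) s = 0 by move=> /outA[].
  have cB := ms_continuous m3; have sB := ms_smooth_kn m3.
  have sB' := smooth_derive sB.
  have outB s : ~ (x <= s <= x + e) -> kn e x s = 0 /\ ((kn e x)^`())%classic s = 0.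
    by move=> hs; split; [exact: (ms_out m3)|exact: (derive1_out (ms_out m3))].
  have [_] := pair _ _ _ _ _ _ _ _ sB sA (smooth_continuous sB') cA' (fun s => smooth_is_derive s sB) dA
    (ms_ge0 m3) (fun s => (andP (A01 s)).1) outB outA (ltW Nx) gap yeN.
  have [iA lA] := Rintegral_unit_bump (smooth_continuous sA) yhe A01 A0.
  rewrite (tens _ _ _ _ _ _ cB (smooth_continuous sA) (ms_out m3) A0 (ms_integrable m3) iA).
  rewrite (ms_Rintegral e0 m3) mul1r.
  have -> : \int[mu2]_q (V q * (kn e x q.1 * (kn e y q.2 - kn e (y + h) q.2))) =
      \int[mu2]_q (V q * (kn e x q.1 * kn e y q.2)) - \int[mu2]_q (V q * (kn e x q.1 * kn e (y + h) q.2)).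
    rewrite -sub; [|exact: (kernel_product_boxed m3 m1 bV)|exact: (kernel_product_boxed m3 m2 bV)].
    by apply: eq_Rintegral => q _; ring.
  have k1 := kernel_average e0 e0 m3 m1 bV (hd1 e e0 e1).
  have k2 := kernel_average e0 e0 m3 m2 bV (hd2 e e0 e2).
  have lA' : \int[mu]_a (st e y a - st e (y + h) a) <= h + e.
    by apply: le_trans lA _; rewrite -[_ + h + e]addrA [_ + (h + e)]addrC addrK.
  exact: (three_errors C0 lA' e5 k2 k1).
Qed.

(** The increments are bounded strictly inside a < b only, hence the bounds on N + 1 and the
    approach of closed positions along 1 / n.+1 by continuity. Points with a > b are handled by
    symmetry, since sorting the two pairs does not increase their distance ([sorted_dist]). *)
Lemma fold_lip2 u ux ut : {within [set p : R * R | 0 <= p.2], continuous u} ->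
  weak_gradient u ux ut -> strip_bounded ux ut -> lip2 (fold u).
Proof.
move=> cu gu bd N; have cV := fold_continuous cu.
have [C C0 [hl hr]] := fold_increment (N + 1) cV gu bd; exists C => //.
have cs (a b : nat -> R) (x y : R) : a @ \oo --> x -> b @ \oo --> y ->
    (fun n => fold u (a n) (b n)) @ \oo --> fold u x y.
  move=> ca cb; exact: (cvg_comp _ _ (cvg_pair ca cb) (cV (x, y))).
have hc (x : R) : (fun=> x) @ \oo --> x by exact: cvg_cst.
have cp (x : R) : (fun n => x + n.+1%:R^-1) @ \oo --> x.
  by rewrite -[X in _ --> X]addr0; apply: cvgD; [exact: cvg_cst|exact: cvg_harmonic].
have cm (x : R) : (fun n => x - n.+1%:R^-1) @ \oo --> x.
  by rewrite -[X in _ --> X]subr0; apply: cvgB; [exact: cvg_cst|exact: cvg_harmonic].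
have small n : (0 < n)%N -> 0 < n.+1%:R^-1 :> R /\ n.+1%:R^-1 < 1 :> R.
  by move=> n0; rewrite invr_gt0 ltr0n invf_lt1// ltr1n.
have l1 a a' b : - N <= a -> a <= a' -> a' <= b -> b <= N -> `|fold u a' b - fold u a b| <= C * (a' - a).
  move=> Na aa ab bN; apply: (cvgr_to_le (cvg_norm (cvgB (cs _ _ _ _ (hc a') (cp b)) (cs _ _ _ _ (hc a) (cp b))))).
  exists 1%N => // n /= /small[k0 k1]; have h0 : 0 <= a' - a by rewrite subr_ge0.
  move: k0 k1; rewrite !fctE; move: (n.+1%:R^-1 : R) => k k0 k1.
  by have := hl a (a' - a) (b + k) h0; rewrite [a + _]addrC subrK; apply; linarith.
have r1 a b b' : - N <= a -> a <= b -> b <= b' -> b' <= N -> `|fold u a b' - fold u a b| <= C * (b' - b).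
  move=> Na ab bb bN; apply: (cvgr_to_le (cvg_norm (cvgB (cs _ _ _ _ (cm a) (hc b')) (cs _ _ _ _ (cm a) (hc b))))).
  exists 1%N => // n /= /small[k0 k1]; have h0 : 0 <= b' - b by rewrite subr_ge0.
  move: k0 k1; rewrite !fctE; move: (n.+1%:R^-1 : R) => k k0 k1.
  by have := hr (a - k) (b' - b) b h0; rewrite [b + _]addrC subrK; apply; linarith.
have l2 a a' b : - N <= a -> - N <= a' -> a <= b -> a' <= b -> b <= N ->
    `|fold u a b - fold u a' b| <= C * `|a - a'|.
  move=> Na Na' ab ab' bN; have [aa|aa] := orP (le_total a a').
    by rewrite distrC [`|a - a'|]distrC [`|a' - a|]ger0_norm ?subr_ge0//; exact: l1.
  by rewrite [`|a - a'|]ger0_norm ?subr_ge0//; exact: l1.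
have r2 a b b' : - N <= a -> a <= b -> a <= b' -> b <= N -> b' <= N ->
    `|fold u a b - fold u a b'| <= C * `|b - b'|.
  move=> Na ab ab' bN bN'; have [bb|bb] := orP (le_total b b').
    by rewrite distrC [`|b - b'|]distrC [`|b' - b|]ger0_norm ?subr_ge0//; exact: r1.
  by rewrite [`|b - b'|]ger0_norm ?subr_ge0//; exact: r1.
have half a a' b b' : - N <= a -> - N <= a' -> a <= b -> a' <= b' -> b <= N -> b' <= N ->
    `|fold u a b - fold u a' b'| <= C * (`|a - a'| + `|b - b'|).
  move=> Na Na' ab ab' bN bN'; rewrite mulrDr; have [aa|aa] := orP (le_total a a').
    have -> : fold u a b - fold u a' b' = (fold u a b - fold u a b') + (fold u a b' - fold u a' b') by ring.
    have ab2 : a <= b' by exact: le_trans ab'.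
    by rewrite [leRHS]addrC (le_trans (ler_normD _ _))// lerD ?r2 ?l2.
  have -> : fold u a b - fold u a' b' = (fold u a b - fold u a' b) + (fold u a' b - fold u a' b') by ring.
  have ab2 : a' <= b by exact: le_trans ab.
  by rewrite (le_trans (ler_normD _ _))// lerD ?r2 ?l2.
move=> a a' b b'; rewrite !(ler_norml _ N) => /andP[? ?] /andP[? ?] /andP[? ?] /andP[? ?].
have [ab|ab] := orP (le_total a b); have [ab'|ab'] := orP (le_total a' b').
- exact: half.
- rewrite (fold_sym u a'); apply: le_trans (half _ _ _ _ _ _ _ _ _ _) _ => //.
  by rewrite ler_wpM2l// sorted_dist.
- rewrite (fold_sym u a b); apply: le_trans (half _ _ _ _ _ _ _ _ _ _) _ => //.
  by rewrite ler_wpM2l// [leRHS]addrC sorted_dist.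
- by rewrite (fold_sym u a b) (fold_sym u a') [X in C * X]addrC half.
Qed.

End WeakSolution.

(** * Rectangle conditions and initial velocity from the distributional equation *)

Lemma norm_window2 (R : realFieldType) (a c e q : R) : a - e - e <= c -> c <= a -> c <= q <= c + e ->
  `|q - a| <= e + e.
Proof. by move=> ? ? /andP[? ?]; rewrite ler_norml; apply/andP; split; linarith. Qed.

Lemma norm_window1 (R : realFieldType) (a c e q : R) : a - e <= c -> c <= a -> c <= q <= c + e ->
  `|q - a| <= e.
Proof. by move=> ? ? /andP[? ?]; rewrite ler_norml; apply/andP; split; linarith. Qed.

Lemma rect_errors (R : realFieldType) (s k I11 I12 I21 I22 l11 l12 l21 l22 : R) : s = 1 \/ s = -1 ->
  `|I11 - l11| <= k -> `|I12 - l12| <= k -> `|I21 - l21| <= k -> `|I22 - l22| <= k ->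
  0 <= s * (2^-1 * (- 4 * (I11 - I12 - I21 + I22))) -> 0 <= s * (l12 + l21 - l11 - l22) + 4 * k.
Proof.
rewrite !ler_norml => -[->|->] /andP[? ?] /andP[? ?] /andP[? ?] /andP[? ?]; linarith.
Qed.

Section WeakToChar.
Context {R : realType}.
Notation mu := (@lebesgue_measure R).
Notation mu2 := (@lebesgue_measure R \x @lebesgue_measure R)%E.
Implicit Types (phi F G u ux ut : R * R -> R) (V : R -> R -> R).

Lemma box_char_prod (A B : R -> R) (p : R * R) : smooth A -> smooth B ->
  box (char_prod A B) p = - 4 * char_prod (A^`())%classic (B^`())%classic p.
Proof.
move=> sA sB; have dA s := smooth_is_derive s sA; have dB s := smooth_is_derive s sB.
have sA' := smooth_derive sA; have sB' := smooth_derive sB.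
have ExE : 'D_ex (char_prod A B) = char_prod (A^`())%classic B + char_prod A (B^`())%classic.
  by apply/funext => q; have [-> _] := derive_char_prod q sA sB dA dB.
have EtE : 'D_et (char_prod A B) = char_prod A (B^`())%classic - char_prod (A^`())%classic B.
  by apply/funext => q; have [_ ->] := derive_char_prod q sA sB dA dB.
have d v D E : smooth D -> smooth E -> derivable (char_prod D E) p v.
  by move=> sD sE; exact: diff_derivable (differentiable_char_prod p sD sE).
rewrite /box ExE EtE (deriveD (d ex _ _ sA' sB) (d ex _ _ sA sB')) (deriveB (d et _ _ sA sB') (d et _ _ sA' sB)).
have dA' s := smooth_is_derive s sA'; have dB' s := smooth_is_derive s sB'.
have [-> ->] := derive_char_prod p sA' sB dA' dB.
have [-> ->] := derive_char_prod p sA sB' dA dB'.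
ring.
Qed.

Lemma boxedZ (k : R) F : boxed F -> boxed (fun q => k * F q).
Proof.
move=> [mF [N N0 [C [FC FN]]]]; split; first exact: measurable_funM.
exists N => //; exists (`|k| * C); split => [p|p kF]; first by rewrite normrM ler_wpM2l.
by apply: FN => F0; apply: kF; rewrite F0 mulr0.
Qed.

Lemma boxedB F G : boxed F -> boxed G -> boxed (fun q => F q - G q).
Proof.
move=> bF bG; have := boxedD bF (boxedZ (-1) bG).
by congr boxed; apply/funext => q; rewrite mulN1r.
Qed.

Lemma RintegralB_boxed F G : boxed F -> boxed G ->
  \int[mu2]_q (F q - G q) = \int[mu2]_q F q - \int[mu2]_q G q.
Proof. by move=> /boxed_integrable iF /boxed_integrable iG; rewrite RintegralB. Qed.

Lemma lip2_square V (N : R) : lip2 V -> exists2 L : R, 0 <= L & forall a b x y : R,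
  `|a| <= N -> `|b| <= N -> `|x| <= N -> `|y| <= N -> `|V x y - V a b| <= L * (`|x - a| + `|y - b|).
Proof.
by move=> lV; have [L L0 VL] := lV N; exists L => // a b x y aN bN xN yN; exact: VL.
Qed.

(** Tested with a product of two windows, box becomes - 4 times a product of differences of kernels,
    that is, - 4 times the alternating sum of averages of V near the four corners. The support in a
    must end at some c < a2, because a2 = b1 is allowed and the test function has to stay in
    positive time. *)
Lemma rect_limit V (s a1 a2 b1 b2 : R) : lip2 V -> s = 1 \/ s = -1 -> a1 < a2 -> a2 <= b1 -> b1 < b2 ->
  (forall (A B : R -> R) (c : R), c < a2 -> smooth A -> smooth B ->
    (forall x, 0 <= A x) -> (forall x, 0 <= B x) ->
    (forall x, ~ (a1 <= x <= c) -> A x = 0) -> (forall x, ~ (b1 <= x <= b2) -> B x = 0) ->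
    0 <= s * \int[mu2]_(p in half_plane) (wave V p * box (char_prod A B) p)) ->
  0 <= s * (V a1 b2 + V a2 b1 - V a1 b1 - V a2 b2).
Proof.
move=> lV s1 a12 ab b12 H; apply/ler_addgt0Pr => r r0.
have [st [kn [ms anti]]] := @mollified_step_exists R.
pose N : R := Num.max (Num.max `|a1| `|a2|) (Num.max `|b1| `|b2|).
have [aN1 aN2 bN1 bN2] : [/\ `|a1| <= N, `|a2| <= N, `|b1| <= N & `|b2| <= N].
  by split; rewrite !le_max lexx ?orbT.
have [L L0 VL] := lip2_square (N + 2) lV.
have da : 0 < (a2 - a1) / 4 by rewrite divr_gt0 ?subr_gt0.
have db : 0 < (b2 - b1) / 2 by rewrite divr_gt0 ?subr_gt0.
(* Each of the four corner averages is off by at most 3 L e. *)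
have L40 : 0 <= 12 * L by rewrite mulr_ge0.
have [e [[e0 ea eb e1 _] eL]] := small_scale da db ltr01 ltr01 r0 L40.
(* The kernel at c2 lives on [a2 - 2 e, a2 - e], still strictly before a2; at b2 no such margin is
   needed. *)
pose c2 := a2 - e - e; pose d2 := b2 - e.
have [y1 y2 y3 y4] : [/\ a1 + e <= c2, c2 <= a2 - e, a2 - e < a2 & b1 + e <= d2].
  exact: corner_windows.
have ac2 : a1 <= c2 by rewrite (le_trans _ y1)// lerDl ltW.
have bd2 : b1 <= d2 by rewrite (le_trans _ y4)// lerDl ltW.
have c2e : c2 + e < a2 by rewrite /c2 subrK.
have d2e : d2 + e = b2 by rewrite /d2 subrK.
have m1 := ms e a1 e0; have m2 := ms e c2 e0; have m3 := ms e b1 e0; have m4 := ms e d2 e0.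
have [sA cA' dA outA] := step_difference e0 ac2 m1 m2.
have [sB cB' dB outB] := step_difference e0 bd2 m3 m4.
have A0 x : 0 <= st e a1 x - st e c2 x by rewrite subr_ge0 anti.
have B0 x : 0 <= st e b1 x - st e d2 x by rewrite subr_ge0 anti.
have outA1 x : ~ (a1 <= x <= c2 + e) -> st e a1 x - st e c2 x = 0 by move=> /outA[].
have outA2 x : ~ (a1 <= x <= c2 + e) -> kn e a1 x - kn e c2 x = 0 by move=> /outA[].
have outB1 x : ~ (b1 <= x <= b2) -> st e b1 x - st e d2 x = 0 by rewrite -d2e => /outB[].
have outB2 x : ~ (b1 <= x <= b2) -> kn e b1 x - kn e d2 x = 0 by rewrite -d2e => /outB[].
have := H _ _ _ c2e sA sB A0 B0 outA1 outB1.
pose W q := V q.1 q.2; have bW : lbounded W := continuous_lbounded (lip2_continuous lV).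
have -> : \int[mu2]_(p in half_plane) (wave V p *
      box (char_prod (fun x => st e a1 x - st e c2 x) (fun x => st e b1 x - st e d2 x)) p) =
    2^-1 * \int[mu2]_q ((- 4 * W q) * ((kn e a1 q.1 - kn e c2 q.1) * (kn e b1 q.2 - kn e d2 q.2))).
  rewrite -(half_char (lboundedZ (-4) bW) cA' cB' outA2 outB2 (lt_le_trans c2e ab)).
  apply: eq_Rintegral => p _; rewrite (box_char_prod _ sA sB).
  have [_ ->] := derive1_eq dA; have [_ ->] := derive1_eq dB.
  by rewrite mulrCA mulrA.
pose G (c d : R) q := W q * (kn e c q.1 * kn e d q.2).
have bG c d : boxed (G c d) by exact: (kernel_product_boxed (ms e c e0) (ms e d e0) bW).
have -> : \int[mu2]_q ((- 4 * W q) * ((kn e a1 q.1 - kn e c2 q.1) * (kn e b1 q.2 - kn e d2 q.2))) =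
    - 4 * (\int[mu2]_q G a1 b1 q - \int[mu2]_q G a1 d2 q - \int[mu2]_q G c2 b1 q + \int[mu2]_q G c2 d2 q).
  have g1 := boxedB (bG a1 b1) (bG a1 d2); have g2 := boxedB (bG c2 b1) (bG c2 d2).
  transitivity (\int[mu2]_q (- 4 * ((G a1 b1 q - G a1 d2 q) - (G c2 b1 q - G c2 d2 q)))).
    by apply: eq_Rintegral => q _; rewrite /G; ring.
  rewrite (RintegralZ_boxed _ (boxedB g1 g2)) (RintegralB_boxed g1 g2).
  rewrite (RintegralB_boxed (bG _ _) (bG _ _)) (RintegralB_boxed (bG _ _) (bG _ _)).
  by move: (Rintegral _ _ _) (Rintegral _ _ _) (Rintegral _ _ _) (Rintegral _ _ _) => X Y Z T; ring.
have ee2 : e + e <= 2 by rewrite -[leRHS]/(1 + 1) lerD// ltW.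
have e2 : e <= 2 by rewrite (le_trans (ltW e1))// ler1n.
have avg (c d a b : R) : a - e - e <= c -> c <= a -> b - e <= d -> d <= b -> `|a| <= N -> `|b| <= N ->
    `|\int[mu2]_q G c d q - V a b| <= L * (e + e + e).
  move=> h1 h2 h3 h4 aN bN; apply: (kernel_average e0 e0 (ms e c e0) (ms e d e0) bW) => q q1 q2.
  have k1 := norm_window2 h1 h2 q1; have k2 := norm_window1 h3 h4 q2.
  have near (x y k : R) : `|x - y| <= k -> k <= 2 -> `|y| <= N -> `|x| <= N + 2.
    by move=> xy k2' yN; rewrite -[x](subrK y) (le_trans (ler_normD _ _))// addrC lerD// (le_trans xy).
  have q1N : `|q.1| <= N + 2 by exact: near k1 ee2 aN.
  have q2N : `|q.2| <= N + 2 by exact: near k2 e2 bN.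
  have up (x : R) : `|x| <= N -> `|x| <= N + 2 by move=> /le_trans; apply; rewrite lerDl.
  apply: le_trans (VL _ _ _ _ (up _ aN) (up _ bN) q1N q2N) _.
  by rewrite ler_wpM2l// lerD.
have [w1 w2] : a1 - e - e <= a1 /\ b1 - e <= b1.
  by rewrite -addrA -opprD !lerBlDr !lerDl addr_ge0// ltW.
have w3 : c2 <= a2 by exact: ltW (le_lt_trans y2 y3).
have w4 : d2 <= b2 by rewrite /d2 lerBlDr lerDl ltW.
have I11 := avg a1 b1 a1 b1 w1 (lexx _) w2 (lexx _) aN1 bN1.
have I12 := avg a1 d2 a1 b2 w1 (lexx _) (lexx _) w4 aN1 bN2.
have I21 := avg c2 b1 a2 b1 (lexx _) w3 w2 (lexx _) aN2 bN1.
have I22 := avg c2 d2 a2 b2 (lexx _) w3 (lexx _) w4 aN2 bN2.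
move=> h; have := rect_errors s1 I11 I12 I21 I22 h.
have -> : 4 * (L * (e + e + e)) = 12 * L * e by ring.
by move=> k; apply: (le_trans k); rewrite lerD2l.
Qed.

Lemma weak_rect V a1 a2 b1 b2 : lip2 V -> obstacle_equation (wave V) ->
  a1 <= a2 -> a2 <= b1 -> b1 <= b2 -> V a1 b1 + V a2 b2 <= V a1 b2 + V a2 b1.
Proof.
move=> lV [_ ob _]; rewrite le_eqVlt => /predU1P[-> _ _|a12 ab]; first by rewrite addrC.
rewrite le_eqVlt => /predU1P[->//|b12].
have := @rect_limit V 1 a1 a2 b1 b2 lV (or_introl erefl) a12 ab b12; rewrite mul1r.
suff H : forall (A B : R -> R) (c : R), c < a2 -> smooth A -> smooth B ->
    (forall x, 0 <= A x) -> (forall x, 0 <= B x) ->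
    (forall x, ~ (a1 <= x <= c) -> A x = 0) -> (forall x, ~ (b1 <= x <= b2) -> B x = 0) ->
    0 <= 1 * \int[mu2]_(p in half_plane) (wave V p * box (char_prod A B) p).
  by move=> /(_ H); linarith.
move=> A B c ca sA sB A0 B0 outA outB; rewrite mul1r; apply: ob.
  apply: (test_char_prod sA sB outA outB) => p /andP[_ h1] /andP[h2 _].
  rewrite /half_plane /=; linarith.
by move=> p; rewrite mulr_ge0.
Qed.

Lemma weak_mod V a1 a2 b1 b2 : lip2 V -> obstacle_equation (wave V) ->
  a1 <= a2 -> a2 <= b1 -> b1 <= b2 ->
  (forall a b, a1 <= a <= a2 -> b1 <= b <= b2 -> 0 < V a b) ->
  V a1 b1 + V a2 b2 = V a1 b2 + V a2 b1.
Proof.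
move=> lV [_ _ ob]; rewrite le_eqVlt => /predU1P[-> _ _ _|a12 ab]; first by rewrite addrC.
rewrite le_eqVlt => /predU1P[->//|b12 pos].
have H (s : R) (A B : R -> R) (c : R) : c < a2 -> smooth A -> smooth B ->
    (forall x, 0 <= A x) -> (forall x, 0 <= B x) ->
    (forall x, ~ (a1 <= x <= c) -> A x = 0) -> (forall x, ~ (b1 <= x <= b2) -> B x = 0) ->
    0 <= s * \int[mu2]_(p in half_plane) (wave V p * box (char_prod A B) p).
  move=> ca sA sB A0 B0 outA outB; rewrite ob ?mulr0//.
  apply: (test_char_prod sA sB outA outB) => p /andP[h0 h1] /andP[h2 h3]; split.
    by rewrite /half_plane /=; linarith.
  by apply: pos; rewrite ?h0 ?h2 ?h3//= (le_trans h1)// ltW.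
have := rect_limit lV (or_introl erefl) a12 ab b12 (H 1).
have := rect_limit lV (or_intror erefl) a12 ab b12 (H (-1)).
linarith.
Qed.

Lemma cvg_natSinv_right : (fun n => n.+1%:R^-1 : R) @ \oo --> 0^'+.
Proof.
move=> A [e /= e0 eA].
have := near_infty_natSinv_lt (PosNum e0); apply: filterS => n /= ne.
by apply: eA => //=; rewrite sub0r normrN ger0_norm.
Qed.

Lemma weak_geo g f (u0 u1 : R -> R) V : loclip g -> loclip f -> lip2 V ->
  (forall x, u0 x = g x - f x) ->
  {ae mu, forall x, g^`()%classic x + f^`()%classic x = - u1 x} ->
  obstacle_equation (wave V) -> initial_conditions u0 u1 (wave V) -> geo g f V.
Proof.
move=> lg lf lV u0E u1E ob [i0 i1].
have diag x : V x x = g x - f x.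
  by have := i0 x; rewrite /wave /= subr0 addr0 u0E.
split => //.
- move=> a b ab; have [h _ _] := ob; have := h (char_inv (a, b)).
  rewrite /wave /char_inv /=.
  have -> : 2^-1 * (a + b) - 2^-1 * (b - a) = a by field.
  have -> : 2^-1 * (a + b) + 2^-1 * (b - a) = b by field.
  by apply; rewrite mulr_ge0// subr_ge0.
- by move=> a1 a2 b1 b2; exact: weak_rect.
- by move=> a1 a2 b1 b2; exact: weak_mod.
have := ae_and i1 (ae_and u1E (ae_and (loclip_derivable lg) (loclip_derivable lf))).
apply: ae_imp => x [ix [ux [dg df]]].
have c1 : (fun n => (wave V (x, n.+1%:R^-1) - wave V (x, 0)) / n.+1%:R^-1) @ \oo --> u1 x.
  exact: (cvg_comp _ _ cvg_natSinv_right ix).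
have -> : (0 : R) = u1 x + g^`()%classic x + f^`()%classic x by rewrite -addrA ux subrr.
apply: cvg_trans (cvgD (cvgD c1 (derive_seql dg)) (derive_seqr df)); apply: near_eq_cvg; apply: nearW => n.
rewrite !fctE /= /wave /= subr0 addr0 diag /exc invrK; ring.
Qed.

Lemma kernel_average1 (h : R -> R) (e c l r : R) st kn : 0 < e -> mollified_step e c st kn ->
  mu.-integrable setT (EFin \o (fun x => kn x * h x)) ->
  (forall x, c <= x <= c + e -> `|h x - l| <= r) -> `|\int[mu]_x (kn x * h x) - l| <= r.
Proof.
move=> e0 ms ih hl; have ik := ms_integrable ms; have k1 := ms_Rintegral e0 ms.
have main (s : R) : (forall x, c <= x <= c + e -> 0 <= s * h x + (r - s * l)) ->
    0 <= s * \int[mu]_x (kn x * h x) + (r - s * l).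
  move=> pos; rewrite -[X in _ + X]mulr1 -k1 -!RintegralZl//.
  have i1 : mu.-integrable setT (EFin \o (fun x => s * (kn x * h x))).
    exact: (integrableZl measurableT s ih).
  have i2 : mu.-integrable setT (EFin \o (fun x => (r - s * l) * kn x)).
    exact: (integrableZl measurableT (r - s * l) ik).
  rewrite -RintegralD//; apply: Rintegral_ge0 => x _.
  have -> : s * (kn x * h x) + (r - s * l) * kn x = (s * h x + (r - s * l)) * kn x by ring.
  have [xc|/negP/(ms_out ms) ->] := boolP (c <= x <= c + e); last by rewrite mulr0.
  by rewrite mulr_ge0 ?pos// (ms_ge0 ms).
have p1 := main 1; have p2 := main (-1); rewrite ler_norml; apply/andP; split.
- have := p1 _; set I := Rintegral _ _ _.
  have k : forall x, c <= x <= c + e -> 0 <= 1 * h x + (r - 1 * l).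
    by move=> x xc; have := hl x xc; rewrite ler_norml => /andP[? ?]; linarith.
  by move=> /(_ k); linarith.
- have := p2 _; set I := Rintegral _ _ _.
  have k : forall x, c <= x <= c + e -> 0 <= -1 * h x + (r - -1 * l).
    by move=> x xc; have := hl x xc; rewrite ler_norml => /andP[? ?]; linarith.
  by move=> /(_ k); linarith.
Qed.

Lemma window_error (k B : R -> R) (b1 b2 p q K : R) : measurable_fun setT k -> measurable_fun setT B ->
  b1 <= p -> p <= q -> q <= b2 -> (forall x, b1 <= x <= b2 -> 0 <= k x <= K) ->
  (forall x, 0 <= B x <= 1) -> (forall x, p <= x <= q -> B x = 1) ->
  `|\int[mu]_(x in `[b1, b2]) (k x * B x) - \int[mu]_(x in `[b1, b2]) k x| <= K * ((p - b1) + (b2 - q)).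
Proof.
move=> mk mB bp pq qb k0K B01 B1.
have K0 : 0 <= K.
  have /andP[h1 h2] := k0K b1 ltac:(rewrite lexx/=; linarith); exact: le_trans h2.
have md : measurable_fun setT (fun x => k x * (1 - B x)) by apply: measurable_funM => //; exact: measurable_funB.
have mkB : measurable_fun setT (fun x => k x * B x) by exact: measurable_funM.
have dK x : b1 <= x <= b2 -> 0 <= k x * (1 - B x) <= K.
  move=> /k0K/andP[h1 h2]; have /andP[h3 h4] := B01 x.
  by rewrite mulr_ge0 ?subr_ge0//= (le_trans _ h2)// ler_piMr//; linarith.
have ik : mu.-integrable `[b1, b2] (EFin \o k).
  by apply: (bounded_integrable_itv (C := K) mk) => x /k0K/andP[h1 h2]; rewrite ger0_norm.
have ikB : mu.-integrable `[b1, b2] (EFin \o (fun x => k x * B x)).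
  apply: (bounded_integrable_itv (C := K) mkB) => x /k0K/andP[h1 h2]; have /andP[h3 h4] := B01 x.
  by rewrite ger0_norm ?mulr_ge0// (le_trans _ h2)// ler_piMr.
have idif (x y : R) : b1 <= x -> y <= b2 -> mu.-integrable `[x, y] (EFin \o (fun x => k x * (1 - B x))).
  move=> bx yb; apply: (bounded_integrable_itv (C := K) md) => z /andP[z1 z2].
  by have /andP[h1 h2] := dK z ltac:(apply/andP; split; linarith); rewrite ger0_norm.
have bnd (x y : R) : b1 <= x -> x <= y -> y <= b2 ->
    0 <= \int[mu]_(z in `[x, y]) (k z * (1 - B z)) <= K * (y - x).
  move=> bx xy yb; apply/andP; split.
    apply: Rintegral_ge0 => z; rewrite /= in_itv/= => /andP[z1 z2].
    by have /andP[] := dK z ltac:(apply/andP; split; linarith).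
  apply: (@le_trans _ _ (\int[mu]_(z in `[x, y]) (cst K z))).
    apply: (ae_le_Rintegral (C := K)) => //.
      move=> z /andP[z1 z2]; have /andP[h1 h2] := dK z ltac:(apply/andP; split; linarith).
      by rewrite !ger0_norm.
    apply: ae_imp (loclip_derivable (loclip_cst 0)) => z _ /andP[z1 z2].
    by have /andP[] := dK z ltac:(apply/andP; split; linarith).
  rewrite Rintegral_cst//= lebesgue_measure_itv/= lte_fin; case: ltP => [_|yx]/=; first by [].
  by rewrite mulr0 mulr_ge0// subr_ge0.
have -> : \int[mu]_(x in `[b1, b2]) (k x * B x) - \int[mu]_(x in `[b1, b2]) k x =
    - \int[mu]_(x in `[b1, b2]) (k x * (1 - B x)).
  apply/eqP; rewrite -opprB eqr_opp -RintegralB//; apply/eqP; apply: eq_Rintegral => x _; ring.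
have pb : p <= b2 by exact: le_trans qb.
rewrite normrN (Rintegral_cat bp pb (idif _ _ (lexx _) (lexx _))) (Rintegral_cat pq qb (idif _ _ bp (lexx _))).
have -> : \int[mu]_(s in `[p, q]) (k s * (1 - B s)) = 0.
  have -> : \int[mu]_(s in `[p, q]) (k s * (1 - B s)) = \int[mu]_(s in `[p, q]) (cst 0 s).
    by apply: eq_Rintegral => z; rewrite inE /= in_itv/= => /B1 ->; rewrite subrr mulr0.
  by rewrite Rintegral_cst// mul0r.
have /andP[h1 h2] := bnd b1 p (lexx _) bp pb; have /andP[h3 h4] := bnd q b2 (le_trans bp pq) qb (lexx _).
by rewrite add0r ger0_norm ?addr_ge0// mulrDr lerD.
Qed.

End WeakToChar.

(** * Energy law on characteristic rectangles *)

Lemma mean_budget (R : realFieldType) (K M1 M2 e : R) : 0 <= K -> 0 <= M1 -> 0 <= M2 -> 0 <= e ->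
  M1 * (e + e) + K * (2 * e) <= (3 * K + 2 * M1 + 2 * M2) * e /\
  M2 * e + K * (3 * e) <= (3 * K + 2 * M1 + 2 * M2) * e.
Proof.
by move=> K0 M10 M20 e0; have := mulr_ge0 K0 e0; have := mulr_ge0 M10 e0; have := mulr_ge0 M20 e0; split; linarith.
Qed.

Lemma increment_budget (R : realFieldType) (M e d a a0 c : R) : 0 <= M -> c <= a -> a <= c + e -> c <= a0 ->
  a0 <= c + d -> e <= d -> M * (a0 - a) <= M * d /\ M * (a - a0) <= M * d.
Proof. by move=> M0 ? ? ? ? ?; split; rewrite ler_wpM2l//; linarith. Qed.

Lemma four_errors (R : realFieldType) (k H1 H2 K1 K2 h1 h2 k1 k2 : R) :
  `|h1 - H1| <= k -> `|h2 - H2| <= k -> `|k1 - K1| <= k -> `|k2 - K2| <= k -> h1 - h2 = k1 - k2 ->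
  `|(H1 - H2) - (K1 - K2)| <= 4 * k.
Proof. rewrite !ler_norml => /andP[? ?] /andP[? ?] /andP[? ?] /andP[? ?] ?; apply/andP; split; linarith. Qed.

Section WeakEnergy.
Context {R : realType}.
Notation mu := (@lebesgue_measure R).
Notation mu2 := (@lebesgue_measure R \x @lebesgue_measure R)%E.
Implicit Types (phi F G u ux ut : R * R -> R) (V : R -> R -> R).

(** Pointwise the slopes need not depend continuously on a, but V a' - V a is monotone by the
    rectangle inequality, so [int2_diff_le] bounds the change of energy by increments of V. This
    continuity is what allows the mollified energy law to be localized on single characteristics. *)
Lemma slices_lipschitz g f V (N : R) : geo g f V -> exists2 M : R, 0 <= M & forall a a' b1 b2 : R,
  - N <= a -> a <= a' -> a' <= b1 -> b1 <= b2 -> b2 <= N ->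
  `|int2 (V a') b1 b2 - int2 (V a) b1 b2| <= M * (a' - a).
Proof.
move=> hV; have lV := geo_lip hV.
have [L L0 VL] := lV N; have [_ [_ hr]] := lbounded_slopes lV; have [C C0 hC] := hr N.
exists (2 * C * (2 * L)) => [|a a' b1 b2 Na aa ab bb bN]; first by rewrite !mulr_ge0.
have Nb x : - N <= x -> x <= N -> `|x| <= N by rewrite ler_norml => -> ->.
have aN := Nb a Na ltac:(linarith); have aN' := Nb a' ltac:(linarith) ltac:(linarith).
have bN1 := Nb b1 ltac:(linarith) ltac:(linarith); have bN2 := Nb b2 ltac:(linarith) bN.
apply: (@le_trans _ _ (2 * C * (-1 * ((V a' b2 - V a b2) - (V a' b1 - V a b1))))).
  apply: (int2_diff_le (lip2_r _ lV) (lip2_r _ lV) bb (or_intror erefl)).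
    move=> s t bs st tb; have := @geo_rect _ _ _ _ hV a a' s t aa ltac:(linarith) st; linarith.
  move=> x /andP[x1 x2]; have xN := Nb x ltac:(linarith) ltac:(linarith).
  by split; [exact: (hC (a', x))|exact: (hC (a, x))].
rewrite -!mulrA !ler_wpM2l//.
have := VL a' a b2 b2 aN' aN bN2 bN2; have := VL a' a b1 b1 aN' aN bN1 bN1.
rewrite !subrr normr0 addr0 (ger0_norm (x := a' - a)) ?subr_ge0// !ler_norml.
by move=> /andP[? ?] /andP[? ?]; linarith.
Qed.

Lemma columns_lipschitz g f V (N : R) : geo g f V -> exists2 M : R, 0 <= M & forall a1 a2 b b' : R,
  - N <= a1 -> a1 <= a2 -> a2 <= b -> b <= b' -> b' <= N ->
  `|int2 (V^~ b') a1 a2 - int2 (V^~ b) a1 a2| <= M * (b' - b).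
Proof.
move=> hV; have lV := geo_lip hV.
have [L L0 VL] := lV N; have [[_ hl] _] := lbounded_slopes lV; have [C C0 hC] := hl N.
exists (2 * C * (2 * L)) => [|a1 a2 b b' Na aa ab bb bN]; first by rewrite !mulr_ge0.
have Nb x : - N <= x -> x <= N -> `|x| <= N by rewrite ler_norml => -> ->.
have aN := Nb a1 Na ltac:(linarith); have aN' := Nb a2 ltac:(linarith) ltac:(linarith).
have bN1 := Nb b ltac:(linarith) ltac:(linarith); have bN2 := Nb b' ltac:(linarith) bN.
apply: (@le_trans _ _ (2 * C * (-1 * ((V a2 b' - V a2 b) - (V a1 b' - V a1 b))))).
  apply: (int2_diff_le (lip2_l _ lV) (lip2_l _ lV) aa (or_intror erefl)).
    move=> s t bs st tb; have := @geo_rect _ _ _ _ hV s t b b' st ltac:(linarith) bb; linarith.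
  move=> x /andP[x1 x2]; have xN := Nb x ltac:(linarith) ltac:(linarith).
  by split; [exact: (hC (x, b'))|exact: (hC (x, b))].
rewrite -!mulrA !ler_wpM2l//.
have := VL a2 a2 b' b aN' aN' bN2 bN1; have := VL a1 a1 b' b aN aN bN2 bN1.
rewrite !subrr normr0 add0r (ger0_norm (x := b' - b)) ?subr_ge0// !ler_norml.
by move=> /andP[? ?] /andP[? ?]; linarith.
Qed.

Lemma energy_pairing V (A B A' B' : R -> R) (a1 a2 b1 b2 : R) : lip2 V ->
  energy_conservation (wave V) -> smooth A -> smooth B ->
  (forall x : R, is_derive x 1 A (A' x)) -> (forall x : R, is_derive x 1 B (B' x)) ->
  (forall s, ~ (a1 <= s <= a2) -> A s = 0) -> (forall s, ~ (b1 <= s <= b2) -> B s = 0) -> a2 < b1 ->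
  \int[mu2]_q (slope_r V q ^+ 2 * (A' q.1 * B q.2)) = \int[mu2]_q (slope_l V q ^+ 2 * (A q.1 * B' q.2)).
Proof.
move=> lV ec sA sB dA dB A0 B0 ab; have gV := wave_gradient lV.
have tphi : test_fun half_plane (char_prod A B).
  by apply: (test_char_prod sA sB A0 B0) => p /andP[_ h1] /andP[h2 _]; rewrite /half_plane /=; linarith.
have := ec _ _ gV _ tphi; rewrite (energy_fluxE lV tphi) => /eqP.
rewrite mulf_eq0 pnatr_eq0/= subr_eq0 => /eqP h.
have [E1 E2] : (forall q, phi_a (char_prod A B) q = A' q.1 * B q.2) /\
    (forall q, phi_b (char_prod A B) q = A q.1 * B' q.2).
  have k (q : R * R) : (char_inv q).1 - (char_inv q).2 = q.1 /\ (char_inv q).1 + (char_inv q).2 = q.2.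
    by split; [exact: (congr1 fst (char_invK q))|exact: (congr1 snd (char_invK q))].
  split=> q; have [ex et] := derive_char_prod (char_inv q) sA sB dA dB; have [k1 k2] := k q.
    by rewrite /phi_a ex et /char_prod k1 k2; field.
  by rewrite /phi_b ex et /char_prod k1 k2; field.
have -> : \int[mu2]_q (slope_r V q ^+ 2 * (A' q.1 * B q.2)) = \int[mu2]_q (slope_r V q ^+ 2 * phi_a (char_prod A B) q).
  by apply: eq_Rintegral => q _; rewrite E1.
by rewrite h; apply: eq_Rintegral => q _; rewrite E2.
Qed.

(** The error r comes from averaging over slices near the one with integral H, the other term from
    the two end pieces on which the window B is not 1. *)
Lemma row_average F (B : R -> R) (e c b1 b2 p q K H r : R) st kn : lbounded F -> 0 < e ->
  mollified_step e c st kn -> continuous B -> (forall s, ~ (b1 <= s <= b2) -> B s = 0) ->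
  b1 <= p -> p <= q -> q <= b2 -> (forall s, 0 <= B s <= 1) -> (forall s, p <= s <= q -> B s = 1) ->
  (forall a b, c <= a <= c + e -> b1 <= b <= b2 -> 0 <= F (a, b) <= K) ->
  (forall a, c <= a <= c + e -> `|\int[mu]_(b in `[b1, b2]) F (a, b) - H| <= r) ->
  `|\int[mu2]_z (F z * (kn z.1 * B z.2)) - H| <= r + K * ((p - b1) + (b2 - q)).
Proof.
move=> bF e0 ms cB B0 bp pq qb B01 B1 FK FH.
have g : boxed (fun z => F z * (kn z.1 * B z.2)).
  exact: (tensor_boxed bF (ms_continuous ms) cB (ms_out ms) B0).
have mB : measurable_fun setT B by exact: continuous_measurable_fun.
have mFa a : measurable_fun setT (fun b => F (a, b)).
  by case: bF => mF _; exact: (measurableT_comp mF (pair1_measurable a)).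
pose h a := \int[mu]_(b in `[b1, b2]) (F (a, b) * B b).
have hE a : \int[mu]_b (F (a, b) * (kn a * B b)) = kn a * h a.
  have [ac|/negP/(ms_out ms) ->] := boolP (c <= a <= c + e); last first.
    rewrite mul0r; transitivity (\int[mu]_b (cst 0 b)).
      by apply: eq_Rintegral => b _; rewrite mul0r mulr0.
    by rewrite Rintegral_cst// mul0r.
  rewrite -RintegralZl//; last first.
    have mFB : measurable_fun setT (fun b => F (a, b) * B b) by exact: measurable_funM.
    apply: (bounded_integrable_itv (C := K) mFB) => b bb.
    have /andP[k0 k1] := FK a b ac bb; have /andP[k2 k3] := B01 b.
    by rewrite ger0_norm ?mulr_ge0// (le_trans _ k1)// ler_piMr.
  rewrite [RHS]Rintegral_mkcond; apply: eq_Rintegral => b _; rewrite patchE; case: ifPn => [_|/negP].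
    by ring.
  by rewrite inE /= in_itv/= => /B0 ->; rewrite !mulr0.
rewrite (boxed_fubini1 g) /=.
have -> : \int[mu]_a \int[mu]_b (F (a, b) * (kn a * B b)) = \int[mu]_a (kn a * h a).
  by apply: eq_Rintegral => a _; rewrite hE.
apply: (kernel_average1 e0 ms) => [|a ac].
  have := boxed_integrable_slice1 g; apply: eq_integrable => // a _; by rewrite /= hE.
have -> : h a - H = (h a - \int[mu]_(b in `[b1, b2]) F (a, b)) + (\int[mu]_(b in `[b1, b2]) F (a, b) - H).
  by ring.
rewrite (le_trans (ler_normD _ _))// addrC lerD ?FH//.
by apply: (window_error (mFa a) mB bp pq qb) => // b; exact: FK.
Qed.

Lemma lbounded_swap F : lbounded F -> lbounded (fun z => F (z.2, z.1)).
Proof.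
move=> [mF bF]; split.
  by apply: (measurableT_comp mF); apply/measurable_fun_pairP; split;
    [exact: measurable_snd|exact: measurable_fst].
by move=> N; have [C C0 hC] := bF N; exists C => // z z1 z2; exact: hC.
Qed.

Lemma boxed_Rintegral_swap F : boxed F -> \int[mu2]_z F (z.2, z.1) = \int[mu2]_z F z.
Proof. by move=> bF; rewrite (boxed_fubini1 (boxed_swap bF)) (boxed_fubini2 bF). Qed.

Lemma column_average F (A : R -> R) (e c a1 a2 p q K H r : R) st kn : lbounded F -> 0 < e ->
  mollified_step e c st kn -> continuous A -> (forall s, ~ (a1 <= s <= a2) -> A s = 0) ->
  a1 <= p -> p <= q -> q <= a2 -> (forall s, 0 <= A s <= 1) -> (forall s, p <= s <= q -> A s = 1) ->
  (forall a b, a1 <= a <= a2 -> c <= b <= c + e -> 0 <= F (a, b) <= K) ->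
  (forall b, c <= b <= c + e -> `|\int[mu]_(a in `[a1, a2]) F (a, b) - H| <= r) ->
  `|\int[mu2]_z (F z * (A z.1 * kn z.2)) - H| <= r + K * ((p - a1) + (a2 - q)).
Proof.
move=> bF e0 ms cA A0 ap pq qa A01 A1 FK FH.
have g := tensor_boxed bF cA (ms_continuous ms) A0 (ms_out ms).
rewrite -(boxed_Rintegral_swap g) /=.
have -> : \int[mu2]_z (F (z.2, z.1) * (A z.2 * kn z.1)) = \int[mu2]_z (F (z.2, z.1) * (kn z.1 * A z.2)).
  by apply: eq_Rintegral => z _; ring.
apply: (row_average (lbounded_swap bF) e0 ms cA A0 ap pq qa A01 A1) => [a b ac ab|a ac].
  exact: FK.
exact: FH.
Qed.

(** Testing with a product of two windows equates differences of averaged energies near opposite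
    sides; the averages converge to the sides by [slices_lipschitz] and [columns_lipschitz]. *)
Lemma energy_rect g f V (a1 a2 b1 b2 : R) : geo g f V -> energy_conservation (wave V) ->
  a1 < a2 -> a2 <= b1 -> b1 < b2 ->
  int2 (V a1) b1 b2 - int2 (V a2) b1 b2 = int2 (V^~ b1) a1 a2 - int2 (V^~ b2) a1 a2.
Proof.
move=> hV ec a12 ab b12; have lV := geo_lip hV.
apply/eqP; rewrite -subr_eq0 -normr_le0; apply/ler_addgt0Pr => r r0; rewrite add0r.
have [st [kn [ms anti]]] := @mollified_step_exists R.
pose N : R := Num.max (Num.max `|a1| `|a2|) (Num.max `|b1| `|b2|).
have [aN1 bN2] : `|a1| <= N /\ `|b2| <= N by split; rewrite !le_max lexx ?orbT.
have Na : - N <= a1 by move: aN1; rewrite ler_norml => /andP[].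
have bN : b2 <= N by move: bN2; rewrite ler_norml => /andP[].
have Nb x : a1 <= x -> x <= b2 -> `|x| <= N by move=> h1 h2; rewrite ler_norml; apply/andP; linarith.
have [M1 M10 H1] := slices_lipschitz N hV; have [M2 M20 H2] := columns_lipschitz N hV.
have [bl br] := lbounded_slopes lV.
have [_ /(_ N)[C1 C10 hC1]] := bl; have [_ /(_ N)[C2 C20 hC2]] := br.
pose K := C1 ^+ 2 + C2 ^+ 2; have K0 : 0 <= K by rewrite addr_ge0 ?sqr_ge0.
have sq (x C : R) : `|x| <= C -> x ^+ 2 <= C ^+ 2.
  move=> xC; rewrite -[x ^+ 2]ger0_norm ?sqr_ge0// normrX lerXn2r ?nnegrE//.
  by rewrite (le_trans _ xC).
have lK a b : a1 <= a -> a <= a2 -> b1 <= b -> b <= b2 -> 0 <= slope_l V (a, b) ^+ 2 <= K.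
  move=> h1 h2 h3 h4; have aN := Nb a h1 (le_trans h2 (le_trans ab (ltW b12)));
  have bNb := Nb b (le_trans (ltW a12) (le_trans ab h3)) h4;
  by rewrite sqr_ge0/= (le_trans (sq _ _ (hC1 (a, b) aN bNb)))// lerDl sqr_ge0.
have rK a b : a1 <= a -> a <= a2 -> b1 <= b -> b <= b2 -> 0 <= slope_r V (a, b) ^+ 2 <= K.
  move=> h1 h2 h3 h4; have aN := Nb a h1 (le_trans h2 (le_trans ab (ltW b12)));
  have bNb := Nb b (le_trans (ltW a12) (le_trans ab h3)) h4;
  by rewrite sqr_ge0/= (le_trans (sq _ _ (hC2 (a, b) aN bNb)))// lerDr sqr_ge0.
have bl2 : lbounded (fun q => slope_l V q ^+ 2) by exact: lboundedM.
have br2 : lbounded (fun q => slope_r V q ^+ 2) by exact: lboundedM.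
(* One side costs at most T e: M1 times 2 e or M2 times e for averaging next to it, and K times 2 e
   or 3 e for the ends of the window. There are four sides. *)
pose T := 3 * K + 2 * M1 + 2 * M2.
have T0 : 0 <= 4 * T by rewrite mulr_ge0// !addr_ge0// mulr_ge0.
have da : 0 < (a2 - a1) / 4 by rewrite divr_gt0 ?subr_gt0.
have db : 0 < (b2 - b1) / 2 by rewrite divr_gt0 ?subr_gt0.
have [e [[e0 ea eb _ _] eT]] := small_scale da db ltr01 ltr01 r0 T0.
pose c2 := a2 - e - e; pose d2 := b2 - e.
have c2e : c2 + e = a2 - e by rewrite /c2 subrK.
have d2e : d2 + e = b2 by rewrite /d2 subrK.
have [q1 q2 q3 q4] : [/\ a1 + e <= c2, c2 <= a2 - e, a2 - e < a2 & b1 + e <= d2].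
  exact: corner_windows.
have ac2 : a1 <= c2 by rewrite (le_trans _ q1)// lerDl ltW.
have bd2 : b1 <= d2 by rewrite (le_trans _ q4)// lerDl ltW.
have d2b : d2 <= b2 by rewrite /d2 lerBlDr lerDl ltW.
have c2a : c2 <= a2 by rewrite (le_trans q2)// ltW.
have m1 := ms e a1 e0; have m2 := ms e c2 e0; have m3 := ms e b1 e0; have m4 := ms e d2 e0.
have [sA cA' dA outA] := step_difference e0 ac2 m1 m2.
have [sB cB' dB outB] := step_difference e0 bd2 m3 m4.
have step01 (c d : R) s : c <= d -> 0 <= st e c s - st e d s <= 1.
  move=> cd; rewrite subr_ge0 anti//= lerBlDr.
  have /andP[h1 _] := ms_01 (ms e d e0) s; have /andP[_ h2] := ms_01 (ms e c e0) s.
  by rewrite (le_trans h2)// lerDl.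
have step1 (c d : R) s : c + e <= s <= d -> st e c s - st e d s = 1.
  by move=> /andP[h1 h2]; rewrite (ms_r (ms e c e0) h1) (ms_l (ms e d e0) h2) subr0.
have outA1 x : ~ (a1 <= x <= c2 + e) -> st e a1 x - st e c2 x = 0 by move=> /outA[].
have outA3 x : ~ (a1 <= x <= a2) -> st e a1 x - st e c2 x = 0.
  by move=> h; apply: outA1 => /andP[h1 h2]; apply: h; rewrite h1 (le_trans h2)// c2e ltW.
have outB1 x : ~ (b1 <= x <= b2) -> st e b1 x - st e d2 x = 0 by rewrite -d2e => /outB[].
have gap : c2 + e < b1 by rewrite c2e (lt_le_trans q3).
have E := energy_pairing lV ec sA sB dA dB outA1 outB1 gap.
have cA := smooth_continuous sA; have cB := smooth_continuous sB.
have split_r : \int[mu2]_q (slope_r V q ^+ 2 * ((kn e a1 q.1 - kn e c2 q.1) * (st e b1 q.2 - st e d2 q.2))) =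
    \int[mu2]_q (slope_r V q ^+ 2 * (kn e a1 q.1 * (st e b1 q.2 - st e d2 q.2))) -
    \int[mu2]_q (slope_r V q ^+ 2 * (kn e c2 q.1 * (st e b1 q.2 - st e d2 q.2))).
  rewrite -RintegralB_boxed; first by apply: eq_Rintegral => q _; ring.
  - exact: (tensor_boxed br2 (ms_continuous m1) cB (ms_out m1) outB1).
  - exact: (tensor_boxed br2 (ms_continuous m2) cB (ms_out m2) outB1).
have split_l : \int[mu2]_q (slope_l V q ^+ 2 * ((st e a1 q.1 - st e c2 q.1) * (kn e b1 q.2 - kn e d2 q.2))) =
    \int[mu2]_q (slope_l V q ^+ 2 * ((st e a1 q.1 - st e c2 q.1) * kn e b1 q.2)) -
    \int[mu2]_q (slope_l V q ^+ 2 * ((st e a1 q.1 - st e c2 q.1) * kn e d2 q.2)).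
  rewrite -RintegralB_boxed; first by apply: eq_Rintegral => q _; ring.
  - exact: (tensor_boxed bl2 cA (ms_continuous m3) outA1 (ms_out m3)).
  - exact: (tensor_boxed bl2 cA (ms_continuous m4) outA1 (ms_out m4)).
rewrite split_r split_l in E.
have row (c a0 : R) : c <= a0 -> a0 <= c + e + e -> a1 <= c -> c + e <= a2 -> a1 <= a0 -> a0 <= a2 ->
    `|\int[mu2]_q (slope_r V q ^+ 2 * (kn e c q.1 * (st e b1 q.2 - st e d2 q.2))) - int2 (V a0) b1 b2| <= T * e.
  move=> ca0 ac ac1 ca a0l a0r.
  have Te : M1 * (e + e) + K * (b1 + e - b1 + (b2 - d2)) <= T * e.
    have -> : b1 + e - b1 + (b2 - d2) = 2 * e by rewrite /d2; ring.
    exact: (mean_budget K0 M10 M20 (ltW e0)).1.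
  apply: le_trans Te.
  apply: (row_average br2 e0 (ms e c e0) cB outB1 _ q4 d2b (fun s => step01 b1 d2 s bd2) (fun s => @step1 b1 d2 s)).
  - by rewrite lerDl ltW.
  - move=> a b /andP[h1 h2] /andP[h3 h4].
    exact: rK (le_trans ac1 h1) (le_trans h2 ca) h3 h4.
  move=> a /andP[h1 h2]; rewrite -[X in `|X - _|]/(int2 (V a) b1 b2).
  have ac' : a0 <= c + (e + e) by rewrite addrA.
  have ee : e <= e + e by rewrite lerDl ltW.
  have [k1 k2] := increment_budget M10 h1 h2 ca0 ac' ee.
  have [aa|aa] := orP (le_total a a0).
    rewrite distrC; apply: le_trans k1.
    exact: H1 (le_trans Na (le_trans ac1 h1)) aa (le_trans a0r ab) (ltW b12) bN.
  apply: le_trans k2.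
  exact: H1 (le_trans Na a0l) aa (le_trans (le_trans h2 ca) ab) (ltW b12) bN.
have column (d b0 : R) : d <= b0 -> b0 <= d + e -> b1 <= d -> d + e <= b2 ->
    `|\int[mu2]_q (slope_l V q ^+ 2 * ((st e a1 q.1 - st e c2 q.1) * kn e d q.2)) - int2 (V^~ b0) a1 a2| <= T * e.
  move=> db0 bd1 bd db2.
  have Te : M2 * e + K * (a1 + e - a1 + (a2 - c2)) <= T * e.
    have -> : a1 + e - a1 + (a2 - c2) = 3 * e by rewrite /c2; ring.
    exact: (mean_budget K0 M10 M20 (ltW e0)).2.
  apply: le_trans Te.
  apply: (column_average bl2 e0 (ms e d e0) cA outA3 _ q1 c2a (fun s => step01 a1 c2 s ac2) (fun s => @step1 a1 c2 s)).
  - by rewrite lerDl ltW.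
  - move=> a b /andP[h1 h2] /andP[h3 h4].
    exact: lK h1 h2 (le_trans bd h3) (le_trans h4 db2).
  move=> b /andP[h1 h2]; rewrite -[X in `|X - _|]/(int2 (V^~ b) a1 a2).
  have [k1 k2] := increment_budget M20 h1 h2 db0 bd1 (lexx e).
  have [bb|bb] := orP (le_total b b0).
    rewrite distrC; apply: le_trans k1.
    exact: H2 Na (ltW a12) (le_trans ab (le_trans bd h1)) bb (le_trans (le_trans bd1 db2) bN).
  apply: le_trans k2.
  exact: H2 Na (ltW a12) (le_trans ab (le_trans bd db0)) bb (le_trans (le_trans h2 db2) bN).
have eT' : 4 * (T * e) <= r by rewrite mulrA.
apply: le_trans eT'; apply: four_errors E.
- apply: row; [by []| |by []| |by []|exact: ltW].
    by rewrite -addrA lerDl addr_ge0// ltW.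
  by rewrite (le_trans q1)// (le_trans q2)// ltW.
- apply: row; [by []| |by []| |exact: ltW|by []]; last by rewrite c2e ltW.
  by rewrite /c2 !subrK.
- apply: column; [by []| |by []|]; first by rewrite lerDl ltW.
  by rewrite (le_trans q4).
- by apply: column; [|rewrite d2e| |rewrite d2e].
Qed.

Lemma weak_charsol g f (u0 u1 : R -> R) u : loclip g -> loclip f -> (forall x, u0 x = g x - f x) ->
  {ae mu, forall x, g^`()%classic x + f^`()%classic x = - u1 x} ->
  conservative_solution u0 u1 u -> charsol g f (fold u).
Proof.
move=> lg lf u0E u1E [es ob ic ec].
have [ux [ut [gu bd]]] := energy_space_strip es; have [cu _] := es.
have lV := fold_lip2 cu gu bd; pose V := fold u.
have uV p : 0 <= p.2 -> u p = wave V p by move=> p0; rewrite wave_fold.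
have obV : obstacle_equation (wave V) by exact: obstacle_equation_ext ob.
have icV : initial_conditions u0 u1 (wave V).
  case: ic => i0 i1; split => [x|]; first by rewrite -uV.
  apply: ae_imp i1 => x; apply: cvg_trans; apply: near_eq_cvg.
  near=> h; have h0 : 0 < h by near: h; exact: nbhs_right_gt.
  by rewrite !uV//= ltW.
have ecV : energy_conservation (wave V).
  move=> vx vt gV; apply: ec; apply: weak_gradient_ext gV => p p0; by rewrite uV// ltW.
have hV : geo g f V by exact: weak_geo icV.
split => // a c b ac cb.
have id0 (h : R -> R) x : int2 h x x = 0 by rewrite /int2 set_itv1 Rintegral_set1.
move: ac; rewrite le_eqVlt => /predU1P[->|ac]; first by rewrite {2}/ene !id0 !add0r.
move: cb; rewrite le_eqVlt => /predU1P[->|cb]; first by rewrite {3}/ene !id0 !addr0.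
(* The rectangle [a, c] x [c, b] has a corner on the diagonal: it is what the triangle over [a, b]
   contains beyond those over [a, c] and [c, b]. *)
have := energy_rect hV ecV ac (lexx c) cb.
rewrite /ene (int2_cat (lip2_l b lV) (ltW ac) (ltW cb)) (int2_cat (lip2_r a lV) (ltW ac) (ltW cb)).
move: (int2 _ _ _) (int2 _ _ _) (int2 _ _ _) (int2 _ _ _) => X1 X2 X3 X4.
by move: (int2 _ _ _) (int2 _ _ _) => X5 X6; linarith.
Unshelve. all: by end_near. Qed.

End WeakEnergy.

(** * Initial data and speed norms *)

Section InitialData.
Context {R : realType}.
Notation mu := (@lebesgue_measure R).

Lemma locally_integrable_itv (k : R -> R) (a b : R) : locally_integrable setT k ->
  mu.-integrable `[a, b] (EFin \o k).
Proof.
move=> [mk _ h]; apply/integrableP; split.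
  by apply/measurable_EFinP; exact: measurable_funTS.
by apply: h => //; exact: segment_compact.
Qed.

Lemma density_continuousE (F k : R -> R) : locally_integrable setT k ->
  (forall a b, a <= b -> F b - F a = \int[mu]_(t in `[a, b]) k t) ->
  {ae mu, forall x, derivable F x 1 /\ F^`()%classic x = k x}.
Proof.
move=> lk FE; have ik a b := locally_integrable_itv a b lk.
have main n : {ae mu, forall x : R, - n.+1%:R < x < n.+1%:R -> derivable F x 1 /\ F^`()%classic x = k x}.
  have lk0 : locally_integrable setT (k \_ `[- n.+1%:R, n.+1%:R]).
    by apply: integrable_locally => //; exact: ik.
  apply: ae_imp (lebesgue_differentiation lk0) => x k0x /andP[Nx xN].
  have cd : forall a b : R, - n.+1%:R <= a -> a <= b -> b <= n.+1%:R ->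
      F b - F a = \int[mu]_(t in `[a, b]) k t by move=> a b _ ab _; exact: FE.
  exact: (density_derivable (ik _ _) cd Nx xN k0x).
apply: ae_imp (ae_forall_nat main) => x h; apply: (h (Num.bound x)).
rewrite -ltr_norml (lt_le_trans (unstable.ltr_norm_bound x))// ler_nat.
by [].
Qed.

Lemma ae_bounded_Rintegral (k : R -> R) (a b C : R) : locally_integrable setT k -> a <= b ->
  {ae mu, forall x, a <= x <= b -> `|k x| <= C} -> `|\int[mu]_(t in `[a, b]) k t| <= C * (b - a).
Proof.
move=> lk ab kC; have ik := locally_integrable_itv a b lk; have [mk _ _] := lk.
have mI : measurable (`[a, b]%classic : set R) by exact: measurable_itv.
have [C0|C0] := ltP C 0.
  have [->|ba] := eqVneq a b; first by rewrite subrr mulr0 set_itv1 Rintegral_set1 normr0.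
  exfalso; have lab : a < b by rewrite lt_neqAle ba.
  have : {ae mu, forall x, `[a, b]%classic x -> False}.
    apply: ae_imp kC => x h; rewrite /= in_itv/= => /h; have := normr_ge0 (k x); linarith.
  move=> [N [mN N0 hN]]; have : (mu `[a, b]%classic <= mu N)%E.
    apply: le_measure; rewrite ?inE// => x xab; apply: hN => /=; exact.
  by rewrite N0 lebesgue_measure_itv/= lte_fin lab -EFinD lee_fin leNgt subr_gt0 lab.
have h1 : `|\int[mu]_(t in `[a, b]) k t| <= \int[mu]_(t in `[a, b]) `|k t|.
  exact: le_normr_Rintegral.
apply: (le_trans h1).
have iA : mu.-integrable `[a, b] (EFin \o (fun x => `|k x|)) by exact: (integrable_abse ik).
have iC : mu.-integrable `[a, b] (EFin \o cst C).
  by apply: (bounded_integrable_itv (C := `|C|)).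
have -> : C * (b - a) = \int[mu]_(x in `[a, b]) (cst C x).
  rewrite Rintegral_cst//= lebesgue_measure_itv/= lte_fin; case: ltP => //= ba.
  by rewrite (le_anti (introT andP (conj ab ba))) subrr.
rewrite /Rintegral fine_le//.
- exact: (@integrable_fin_num _ _ _ mu).
- exact: (@integrable_fin_num _ _ _ mu).
apply: ae_ge0_le_integral => //.
- by case/integrableP: iA.
- by case/integrableP: iC.
Qed.

Lemma density_loclip (F k : R -> R) : locally_integrable setT k ->
  (forall a b, a <= b -> F b - F a = \int[mu]_(t in `[a, b]) k t) ->
  (forall N : R, exists2 C : R, 0 <= C & {ae mu, forall x, `|x| <= N -> `|k x| <= C}) -> loclip F.
Proof.
move=> lk FE kb N; have [C C0 hC] := kb N; exists C => // x y xN yN.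
wlog xy : x y xN yN / x <= y.
  move=> H; have [xy|yx] := orP (le_total x y); first exact: H.
  by rewrite distrC (distrC x); exact: H.
rewrite distrC (distrC x) FE// [`|y - x|]ger0_norm ?subr_ge0//.
apply: ae_bounded_Rintegral => //; apply: ae_imp hC => z h /andP[z1 z2]; apply: h.
move: xN yN; rewrite !ler_norml => /andP[? ?] /andP[? ?]; apply/andP; split; linarith.
Qed.

Lemma Loo_loc_bound (k : R -> R) : Loo_loc k ->
  measurable_fun setT k /\ forall N : R, exists2 C : R, 0 <= C & {ae mu, forall x, `|x| <= N -> `|k x| <= C}.
Proof.
move=> kL; have seg (N : R) : compact (`[- N, N]%classic : set R) by exact: segment_compact.
have mI (N : R) : measurable (`[- N, N]%classic : set R) by exact: measurable_itv.
split.
  have -> : [set: R] = \bigcup_n `[- n%:R, n%:R]%classic.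
    apply/esym/seteqP; split => // x _; exists (Num.bound x) => //=.
    by rewrite in_itv/= -ler_norml ltW// unstable.ltr_norm_bound.
  apply/measurable_fun_bigcup => n; first exact: mI.
  apply/(measurable_restrictT _ (mI _)).
  by have := kL _ (seg n%:R); rewrite /Loo inE => /andP[+ _]; rewrite inE.
move=> N; have := kL _ (seg N); rewrite /Loo inE => /andP[_]; rewrite inE /= /finite_norm => fin.
have hN : (Loo_norm (k \_ `[(- N)%R, N]%classic) < +oo)%E by exact: fin.
have E0 := Loo_norm_ge0 (k \_ `[- N, N]%classic).
have fn : Loo_norm (k \_ `[- N, N]%classic) \is a fin_num by rewrite ge0_fin_numE.
exists (fine (Loo_norm (k \_ `[- N, N]%classic))); first exact: fine_ge0.
have /Loo_norm_leP := lexx (Loo_norm (k \_ `[- N, N]%classic)).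
apply: ae_imp => x; rewrite -[X in (_ <= X)%E](fineK fn) lee_fin patchE => h xN; move: h.
by rewrite mem_set// /= in_itv/= -ler_norml.
Qed.

Lemma bounded_locally_integrable (k : R -> R) : measurable_fun setT k ->
  (forall N : R, exists2 C : R, 0 <= C & {ae mu, forall x, `|x| <= N -> `|k x| <= C}) ->
  locally_integrable setT k.
Proof.
move=> mk kb; split => //; first exact: openT.
move=> K _ cK; have [N N0 KN] := compact_radius cK; have [C C0 hC] := kb N.
have mK : measurable K by exact: compact_measurable.
apply: (@le_lt_trans _ _ (\int[mu]_(x in K) C%:E)%E).
  apply: ae_ge0_le_integral => //.
  - by apply/measurable_EFinP; apply: measurableT_comp => //; exact: measurable_funTS.
  - by apply: ae_imp hC => x h /KN/h; rewrite lee_fin.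
rewrite integral_cst// lte_mul_pinfty//.
by apply: compact_finite_measure.
Qed.

Lemma smooth_test_fun1 (A : R -> R) (a b : R) : smooth A -> (forall s, ~ (a <= s <= b) -> A s = 0) ->
  test_fun1 A.
Proof.
move=> sA A0; split => //; exists `[a, b]%classic; first exact: segment_compact.
by move=> x; rewrite /= in_itv/= => /A0.
Qed.

(** The test functions are differences of mollified steps at a and b: they converge to the indicator
    of ]a, b], and their derivatives average F near a and near b, where it is continuous. *)
Lemma weak_derivative_FTC (F k : R -> R) (a b : R) : continuous F -> weak_derivative F k -> a <= b ->
  F b - F a = \int[mu]_(t in `[a, b]) k t.
Proof.
move=> cF [_ lk wk]; rewrite le_eqVlt => /predU1P[->|ab].
  by rewrite subrr set_itv1 Rintegral_set1.
have [st [kn [ms anti]]] := @mollified_step_exists R.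
have [mk _ _] := lk.
pose e n : R := n.+1%:R^-1; have e0 n : 0 < e n by rewrite invr_gt0.
have e1 n : e n <= 1 by rewrite invf_le1// ler1n.
pose A n s := st (e n) a s - st (e n) b s.
have sd n := step_difference (e0 n) (ltW ab) (ms (e n) a (e0 n)) (ms (e n) b (e0 n)).
have iknF n c : mu.-integrable setT (EFin \o (fun x => kn (e n) c x * F x)).
  have m := ms (e n) c (e0 n); have mI : measurable (`[c, c + e n]%classic : set R) by exact: measurable_itv.
  have -> : EFin \o (fun x => kn (e n) c x * F x) = (EFin \o (fun x => kn (e n) c x * F x)) \_ `[c, c + e n]%classic.
    apply/funext => x; rewrite patchE; case: ifPn => // /negP; rewrite inE /= in_itv/=.
    by move=> /(ms_out m) ->; rewrite mul0r.
  rewrite -(@integrable_mkcond _ _ _ mu _ _ mI).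
  apply: continuous_compact_integrable; first exact: segment_compact.
  by apply: continuous_subspaceT => x; apply: cvgM; [exact: (ms_continuous m)|exact: cF].
have avg c : \int[mu]_x (kn (e n) c x * F x) @[n --> \oo] --> F c.
  apply/cvgrPdist_le => r r0; have /cvgrPdist_le /(_ _ r0) := cF c.
  move=> /nbhs_ballP[d /= d0 hd]; have := near_infty_natSinv_lt (PosNum d0).
  apply: filterS => n /= nd; rewrite distrC.
  apply: (kernel_average1 (e0 n) (ms (e n) c (e0 n)) (iknF n c)) => x /andP[x1 x2].
  rewrite distrC; apply: hd; rewrite /= -ball_normE /= ltr_norml.
  by move: x2; rewrite /e; move: (n.+1%:R^-1 : R) nd => z nd x2; apply/andP; split; linarith.
have lhs n : \int[mu]_x (k x * A n x) = \int[mu]_x (kn (e n) b x * F x) - \int[mu]_x (kn (e n) a x * F x).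
  have [sA cA' dA outA] := sd n.
  have tA : test_fun1 (A n) by apply: (smooth_test_fun1 sA) => s /outA[].
  have := wk _ tA; have [_ ->] := derive1_eq dA => /eqP; rewrite -eqr_oppLR => /eqP <-.
  rewrite -opprB -RintegralB//; congr (- _); apply: eq_Rintegral => x _; ring.
pose D : set R := `[a, b + 1]%classic.
have mD : measurable D by exact: measurable_itv.
have ikD : mu.-integrable D (EFin \o k) by exact: locally_integrable_itv.
have mA n : measurable_fun setT (A n).
  by have [sA _ _ _] := sd n; apply: continuous_measurable_fun; exact: smooth_continuous.
have outD n x : ~ D x -> A n x = 0.
  have [_ _ _ outA] := sd n; move=> Dx; have [] := outA x => //.
  by move=> /andP[x1 x2]; apply: Dx; rewrite /D /= in_itv/= x1/= (le_trans x2)// lerD2l.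
have A01 n x : `|A n x| <= 1.
  rewrite ger0_norm ?subr_ge0 ?anti// ?(ltW ab)// lerBlDr.
  have /andP[h1 _] := ms_01 (ms (e n) b (e0 n)) x; have /andP[_ h2] := ms_01 (ms (e n) a (e0 n)) x.
  by rewrite (le_trans h2)// lerDl.
have stl c x : st (e n) c x @[n --> \oo] --> ((c < x)%R%:R : R).
  apply: cvg_near_cst; have [cx|xc] := ltP c x; last by apply: nearW => n; exact: ms_l (ms _ _ (e0 n)) _ xc.
  have d0 : 0 < x - c by rewrite subr_gt0.
  have := near_infty_natSinv_lt (PosNum d0); apply: filterS => n /= nd.
  by rewrite (ms_r (ms _ _ (e0 n)))// -lerBrDl ltW.
have Al x : A n x @[n --> \oo] --> ((a < x)%R%:R - (b < x)%R%:R : R) by apply: cvgB; exact: stl.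
have iA n : mu.-integrable D (EFin \o (fun x => k x * A n x)).
  apply: le_integrable ikD => //.
    by apply/measurable_EFinP; apply: measurable_funTS; exact: (measurable_funM mk (mA n)).
  by move=> x _; rewrite /= lee_fin normrM ler_piMr.
have lim1 : (\int[mu]_(x in D) (k x * A n x)%:E)%E @[n --> \oo] -->
    (\int[mu]_(x in D) (k x * ((a < x)%R%:R - (b < x)%R%:R))%:E)%E.
  apply: (@dominated_cvg _ _ _ mu D mD _ _ (fun x => `|k x|%:E)) => //.
  - by move=> n; apply/measurable_EFinP; apply: measurable_funTS; exact: (measurable_funM mk (mA n)).
  - move=> x _; apply: cvg_EFin; first exact: nearW.
    by apply: cvgM; [exact: cvg_cst|exact: Al].
  - exact: (integrable_abse ikD).
  - by move=> n x _; rewrite /= lee_fin normrM ler_piMr.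
have limE : (\int[mu]_(x in D) (k x * ((a < x)%R%:R - (b < x)%R%:R))%:E =
    (\int[mu]_(t in `[a, b]) k t)%:E)%E.
  have ikab := locally_integrable_itv a b lk.
  have iko : mu.-integrable `]a, b] (EFin \o k).
    by apply: integrableS ikab => //; apply: subset_itvr; rewrite bnd_simp.
  rewrite -Rintegral_itv_obnd_cbnd//.
  have -> : (\int[mu]_(x in `]a, b]) k x)%:E = (\int[mu]_(x in `]a, b]) (k x)%:E)%E.
    by rewrite /Rintegral fineK//; exact: (@integrable_fin_num _ _ _ mu).
  rewrite integral_mkcond [RHS]integral_mkcond; apply: eq_integral => x _; rewrite !patchE.
  have Dx : (x \in D) = (a <= x <= b + 1) by apply/idP/idP; rewrite inE /D /= in_itv.
  have Ix : (x \in `]a, b]%classic) = (a < x <= b) by apply/idP/idP; rewrite inE /= in_itv.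
  rewrite Dx Ix; have [ax|xa] := ltP a x; have [bx|xb] := ltP b x => /=.
  - by rewrite subrr mulr0; case: ifP.
  - rewrite subr0 mulr1 (ltW ax) ifT//; apply: (le_trans xb); rewrite lerDl; exact: ler01.
  - by exfalso; have := lt_le_trans ab (le_trans (ltW bx) xa); rewrite ltxx.
  - by rewrite subrr mulr0; case: ifP.
have lim2 : \int[mu]_x (k x * A n x) @[n --> \oo] --> \int[mu]_(t in `[a, b]) k t.
  have E n : (\int[mu]_(x in D) (k x * A n x)%:E)%E = (\int[mu]_x (k x * A n x))%:E.
    have -> : \int[mu]_x (k x * A n x) = \int[mu]_(x in D) (k x * A n x).
      rewrite [RHS]Rintegral_mkcond; apply: eq_Rintegral => x _; rewrite patchE.
      by case: ifPn => // /negP; rewrite inE => /outD ->; rewrite mulr0.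
    by rewrite /Rintegral fineK//; exact: (@integrable_fin_num _ _ _ mu D mD _ (iA n)).
  rewrite limE (_ : (fun n => _) = (fun n => (\int[mu]_x (k x * A n x))%:E)) in lim1.
    exact: (fine_cvg lim1).
  by apply/funext => n; exact: E.
have lim3 : \int[mu]_x (k x * A n x) @[n --> \oo] --> F b - F a.
  by under eq_fun do rewrite lhs; apply: cvgB; exact: avg.
exact: (cvg_unique _ lim3 lim2).
Qed.

Lemma Rintegral_degenerate (k : R -> R) (a b : R) : b <= a -> \int[mu]_(t in `[a, b]) k t = 0.
Proof.
rewrite le_eqVlt => /predU1P[->|ba]; first by rewrite set_itv1 Rintegral_set1.
by rewrite set_itv_ge ?Rintegral_set0// bnd_simp -ltNge.
Qed.

Lemma primitive_exists (k : R -> R) : locally_integrable setT k -> exists F : R -> R,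
  forall a b, a <= b -> F b - F a = \int[mu]_(t in `[a, b]) k t.
Proof.
move=> lk; have ik a b := locally_integrable_itv a b lk.
exists (fun x => \int[mu]_(t in `[0, x]) k t - \int[mu]_(t in `[x, 0]) k t) => a b ab.
have [a0|a0] := leP 0 a.
  have b0 := le_trans a0 ab.
  by rewrite (Rintegral_degenerate k a0) (Rintegral_degenerate k b0) (Rintegral_cat a0 ab (ik _ _)); ring.
have [b0|b0] := leP 0 b.
  rewrite (Rintegral_degenerate k (ltW a0)) (Rintegral_degenerate k b0).
  by rewrite (Rintegral_cat (ltW a0) b0 (ik _ _)); ring.
rewrite (Rintegral_degenerate k (ltW a0)) (Rintegral_degenerate k (ltW b0)).
by rewrite (Rintegral_cat ab (ltW b0) (ik a 0)); ring.
Qed.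

(** This is d'Alembert's formula: with U a primitive of u1, take g = (u0 - U) / 2 and f = (- u0 - U)
    / 2. A zero of u0 is a minimum, so u0' = 0 and g' = - u1 / 2 <= 0 at almost every such point. *)
Lemma initial_profiles (u0 u1 : R -> R) : W1oo_loc u0 -> Loo_loc u1 -> (forall x, 0 <= u0 x) ->
  {ae mu, forall x : R, u0 x = 0 -> 0 <= u1 x} ->
  exists g f : R -> R, [/\ loclip g, loclip f, forall x, u0 x = g x - f x,
    {ae mu, forall x, g^`()%classic x + f^`()%classic x = - u1 x} &
    {ae mu, forall x, g x = f x -> derivable g x 1 -> g^`()%classic x <= 0}].
Proof.
move=> [cu0 _ [d wd Ld]] Lu1 u00 u10.
have [md bd] := Loo_loc_bound Ld; have [mu1 bu1] := Loo_loc_bound Lu1.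
have [_ ld _] := wd; have lu1 := bounded_locally_integrable mu1 bu1.
have [U UE] := primitive_exists lu1.
have lU := density_loclip lu1 UE bu1; have dU := density_continuousE lu1 UE.
have u0E a b := @weak_derivative_FTC u0 d a b cu0 wd.
have l0 := density_loclip ld u0E bd.
have lip (s : R) : loclip (fun x => 2^-1 * (s * u0 x - U x)).
  apply: loclipM (loclip_cst 2^-1) _; apply: loclipD; last exact: loclipN.
  exact: loclipM (loclip_cst s) l0.
have der (s x : R) : derivable u0 x 1 -> derivable U x 1 /\ U^`()%classic x = u1 x ->
    (fun x => 2^-1 * (s * u0 x - U x))^`()%classic x = 2^-1 * (s * u0^`()%classic x - u1 x).
  move=> d0 [d1 <-].
  have h0 : is_derive x 1 u0 (u0^`()%classic x) by apply: DeriveDef d0 _; rewrite derive1E.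
  have h1 : is_derive x 1 U (U^`()%classic x) by rewrite derive1E; exact: DeriveDef.
  have h := is_deriveZ 2^-1 (is_deriveB (is_deriveZ s h0) h1).
  rewrite derive1E; exact: (@derive_val _ _ _ _ _ _ _ h).
exists (fun x => 2^-1 * (1 * u0 x - U x)), (fun x => 2^-1 * (-1 * u0 x - U x)); split => //.
- by move=> x; field.
- apply: ae_imp (ae_and dU (loclip_derivable l0)) => x [dUx d0].
  by rewrite !der//; field.
apply: ae_imp (ae_and u10 (ae_and dU (loclip_derivable l0))) => x [u1x [dUx d0]] gf _.
have u0x : u0 x = 0 by move: gf; linarith.
rewrite der// mul1r; have -> : u0^`()%classic x = 0.
  apply/le_anti/andP; split.
    by apply: (derive_le0_l (d := 1)) => // h _ _; rewrite u0x.
  by apply: (derive_ge0_r (d := 1)) => // h _ _; rewrite u0x.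
by rewrite sub0r mulrN oppr_le0 mulr_ge0// u1x.
Qed.

End InitialData.

(** * Supremum norms of the two speeds *)

Section SpeedOfPropagationNorms.
Context {R : realType}.
Notation mu := (@lebesgue_measure R).
Notation mu2 := (@lebesgue_measure R \x @lebesgue_measure R)%E.
Implicit Types (h k : R -> R) (V : R -> R -> R).

Lemma ae_shift (P : R -> Prop) (c : R) : {ae mu, forall x, P x} -> {ae mu, forall x, P (x + c)}.
Proof.
move=> [N [mN N0 PN]].
have mshift : measurable_fun setT (fun x : R => x + c).
  by apply: continuous_measurable_fun => x; apply: cvgD; [exact: cvg_id|exact: cvg_cst].
have mM : measurable ((fun x : R => x + c) @^-1` N) by rewrite -[X in measurable X]setTI; exact: mshift.
exists ((fun x : R => x + c) @^-1` N); split => //; last by move=> x Px; apply: PN.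
have m1 : measurable_fun setT (fun x : R => (\1_N x)%:E : \bar R).
  by apply/measurable_EFinP; exact: measurable_indic.
have := ge0_integral_affine c ltr01 m1 (fun x => ltac:(rewrite lee_fin//)).
rewrite (integral1_indic mN) N0 mule0 => <-; rewrite -(integral1_indic mM).
by apply: eq_integral => x _; rewrite mul1r.
Qed.

Lemma Loo_norm_ae_eq h k : {ae mu, forall x, `|h x| = `|k x|} -> Loo_norm h = Loo_norm k.
Proof.
move=> hk; have le h1 h2 : {ae mu, forall x, `|h1 x| = `|h2 x|} -> (Loo_norm h1 <= Loo_norm h2)%E.
  move=> E; apply/Loo_norm_leP; have /Loo_norm_leP := lexx (Loo_norm h2).
  by move=> /(ae_and E); apply: ae_imp => x [-> ].
by apply/le_anti; rewrite !le//; apply: ae_imp hk.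
Qed.

Lemma Loo_norm_shift h (c : R) : Loo_norm (fun x => h (x + c)) = Loo_norm h.
Proof.
have le (k : R -> R) (d : R) : (Loo_norm (fun x => k (x + d)%R) <= Loo_norm k)%E.
  apply/Loo_norm_leP; have /Loo_norm_leP := lexx (Loo_norm k).
  exact: (ae_shift (P := fun x => (`|k x|%:E <= Loo_norm k)%E)).
apply/le_anti; rewrite le/=; apply: le_trans (le (fun x => h (x + c)) (- c)).
by under [X in (_ <= Loo_norm X)%E]eq_fun do rewrite subrK.
Qed.

Lemma ae2_slices (P : R * R -> Prop) : {ae mu2, forall p, P p} ->
  {ae mu, forall t, {ae mu, forall x, P (x, t)}}.
Proof.
move=> [N [mN /(null_slices mN) N0 PN]]; apply: ae_imp N0 => t Nt.
exists [set x | N (x, t)]; split => //; last by move=> x Px; apply: PN.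
by rewrite -[X in measurable X]setTI; exact: (pair2_measurable t).
Qed.

Lemma null_rows (A : set (R * R)) : measurable A -> (forall a, mu [set b | A (a, b)] = 0%E) ->
  mu2 A = 0%E.
Proof.
move=> mA A0; apply: integral0_eq => a _ /=; rewrite -[RHS](A0 a); congr (mu _).
by apply/seteqP; split => b; rewrite /xsection /= inE.
Qed.

Lemma ae_measurable0 (A : set R) : measurable A -> {ae mu, forall x, ~ A x} -> mu A = 0%E.
Proof.
move=> mA [N [mN N0 hN]]; apply/eqP; rewrite -measure_le0 -N0; apply: le_measure; rewrite ?inE//.
by move=> x Ax; apply: hN => /=; apply.
Qed.

(** The hypotheses give a null exceptional set on each slice, with b fixed for one slope and a fixed
    for the other. Fubini joins the slices because the set where two measurable functions differ is
    measurable. *)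
Lemma slope_squares g f V : lip2 V -> loclip g -> loclip f ->
  (forall b, {ae mu, forall a, a < b -> slope_l V (a, b) ^+ 2 = dq g a ^+ 2}) ->
  (forall a, {ae mu, forall b, a < b -> slope_r V (a, b) ^+ 2 = dq f b ^+ 2}) ->
  {ae mu2, forall q, q.1 < q.2 -> slope_l V q ^+ 2 = dq g q.1 ^+ 2} /\
  {ae mu2, forall q, q.1 < q.2 -> slope_r V q ^+ 2 = dq f q.2 ^+ 2}.
Proof.
move=> lV lg lf hl hr; have [[ml _] [mr _]] := lbounded_slopes lV.
have mset (F G : R * R -> R) : measurable_fun setT F -> measurable_fun setT G ->
    measurable [set q : R * R | q.1 < q.2 /\ F q <> G q].
  move=> mF mG; have mlt (E : R * R -> R) : measurable_fun setT E -> measurable [set q | 0 < E q].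
    move=> mE; rewrite (_ : [set q | 0 < E q] = setT `&` E @^-1` `]0, +oo[%classic).
      by apply: mE => //; exact: measurable_itv.
    by rewrite setTI; apply/seteqP; split => p; rewrite /= in_itv/= andbT.
  rewrite (_ : [set q : R * R | q.1 < q.2 /\ F q <> G q] =
      [set q : R * R | 0 < q.2 - q.1] `&` ([set q | 0 < F q - G q] `|` [set q | 0 < G q - F q])).
    apply: measurableI; first by apply: mlt; apply: measurable_funB; [exact: measurable_snd|exact: measurable_fst].
    by apply: measurableU; apply: mlt; exact: measurable_funB.
  apply/seteqP; split => q /=; rewrite !subr_gt0 => -[q12 FG]; split => //.
    by apply/orP; rewrite orbC -neq_lt; apply/eqP.
  by case: FG => FG E; rewrite E ltxx in FG.
have m1 : measurable_fun setT (fun q : R * R => dq g q.1 ^+ 2).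
  exact: measurableT_comp (measurable_dq2 lg) measurable_fst.
have m2 : measurable_fun setT (fun q : R * R => dq f q.2 ^+ 2).
  exact: measurableT_comp (measurable_dq2 lf) measurable_snd.
have l2 : measurable_fun setT (fun q => slope_l V q ^+ 2) by exact: measurable_funX.
have r2 : measurable_fun setT (fun q => slope_r V q ^+ 2) by exact: measurable_funX.
have ml' := mset _ _ l2 m1; have mr' := mset _ _ r2 m2.
have conv (A : set (R * R)) (P : R * R -> Prop) : measurable A -> mu2 A = 0%E ->
    (forall q, ~ A q -> P q) -> {ae mu2, forall q, P q}.
  by move=> mA A0 h; exists A; split => // q nP; apply: contrapT => /h.
split.
- apply: (conv _ _ ml') => [|q h q12]; last by apply: contrapT => E; apply: h.
  apply/(null_slices ml'); apply: ae_imp (loclip_derivable (loclip_cst 0)) => b _.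
  apply: ae_measurable0; first by rewrite -[X in measurable X]setTI; exact: (pair2_measurable b).
  by apply: ae_imp (hl b) => a h [/= ab]; apply; exact: h.
- apply: (conv _ _ mr') => [|q h q12]; last by apply: contrapT => E; apply: h.
  apply: (null_rows mr') => a.
  apply: ae_measurable0; first by rewrite -[X in measurable X]setTI; exact: (pair1_measurable a).
  by apply: ae_imp (hr a) => b h [/= ab]; apply; exact: h.
Qed.

Lemma wave_speeds g f V (ux ut : R * R -> R) : lip2 V -> loclip g -> loclip f ->
  (forall b, {ae mu, forall a, a < b -> slope_l V (a, b) ^+ 2 = dq g a ^+ 2}) ->
  (forall a, {ae mu, forall b, a < b -> slope_r V (a, b) ^+ 2 = dq f b ^+ 2}) ->
  weak_gradient (wave V) ux ut ->
  {ae mu, forall t, 0 <= t -> {ae mu, forall x,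
    `|ux (x, t) - ut (x, t)| = `|2 * dq g (x - t)| /\ `|ux (x, t) + ut (x, t)| = `|2 * dq f (x + t)|}}.
Proof.
move=> lV lg lf hl hr [hx ht]; have [gx gt] := wave_gradient lV.
have [sl sr] := slope_squares lV lg lf hl hr.
pose P n (p : R * R) := match n with
  | 0 => 0 < p.2 -> ux p = wave_x V p
  | 1 => 0 < p.2 -> ut p = wave_t V p
  | 2 => (char_coord p).1 < (char_coord p).2 -> slope_l V (char_coord p) ^+ 2 = dq g (char_coord p).1 ^+ 2
  | _ => (char_coord p).1 < (char_coord p).2 -> slope_r V (char_coord p) ^+ 2 = dq f (char_coord p).2 ^+ 2
  end.
have all : {ae mu2, forall p, forall n, P n p}.
  apply: ae2_forall_nat => -[|[|[|n]]]; rewrite /P.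
  - exact: weak_partial_unique hx gx.
  - exact: weak_partial_unique ht gt.
  - exact: (ae_char sl).
  - exact: (ae_char sr).
have t0 : {ae mu, forall t : R, t <> 0}.
  by exists [set 0]; split; [exact: measurable_set1|exact: lebesgue_measure_set1|move=> t /= /contrapT].
apply: ae_imp (ae_and t0 (ae2_slices all)) => t [/eqP tn h] tge.
have tp : 0 < t by rewrite lt_neqAle eq_sym tn.
apply: ae_imp h => x h; have := (h 0%N tp, h 1%N tp) => -[-> ->].
have lt : (char_coord (x, t)).1 < (char_coord (x, t)).2 by rewrite /char_coord /=; linarith.
have norm2 (y z : R) : y ^+ 2 = z ^+ 2 -> `|2 * y| = `|2 * z|.
  by move=> /eqP; rewrite eqf_sqr => /orP[/eqP ->//|/eqP ->]; rewrite mulrN normrN.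
rewrite /wave_x /wave_t; split.
- rewrite -(norm2 _ _ (h 2%N lt)); congr (`|_|); ring.
- rewrite -(norm2 _ _ (h 3%N lt)); congr (`|_|); ring.
Qed.

(** The reason is p^2 + q^2 = ((p - q)^2 + (p + q)^2) / 2. *)
Lemma gradient_norm_le (p q : R -> R) (M : \bar R) :
  (Loo_norm (fun x => (p x - q x)%R) <= M)%E -> (Loo_norm (fun x => (p x + q x)%R) <= M)%E ->
  (Loo_norm (fun x => Num.sqrt (p x ^+ 2 + q x ^+ 2)%R) <= M)%E.
Proof.
move=> /Loo_norm_leP h1 /Loo_norm_leP h2; apply/Loo_norm_leP.
apply: ae_imp (ae_and h1 h2) => x []; case: M {h1 h2} => [m| |]; rewrite ?leey ?leNye// !lee_fin => a b.
have m0 : 0 <= m by exact: le_trans (normr_ge0 _) a.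
rewrite ger0_norm ?sqrtr_ge0// -(ger0_norm m0) -sqrtr_sqr ler_wsqrtr//.
have sq (y : R) : `|y| <= m -> y ^+ 2 <= m ^+ 2.
  by move=> ym; rewrite -[y ^+ 2]ger0_norm ?sqr_ge0// normrX lerXn2r ?nnegrE.
have := sq _ a; have := sq _ b; rewrite !expr2; linarith.
Qed.

(** The reason is (p - q)^2 <= 2 (p^2 + q^2), and likewise for p + q. *)
Lemma speeds_le_gradient (p q : R -> R) :
  (Loo_norm (fun x => (p x - q x)%R) <= (Num.sqrt 2)%:E * Loo_norm (fun x => Num.sqrt (p x ^+ 2 + q x ^+ 2)%R))%E /\
  (Loo_norm (fun x => (p x + q x)%R) <= (Num.sqrt 2)%:E * Loo_norm (fun x => Num.sqrt (p x ^+ 2 + q x ^+ 2)%R))%E.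
Proof.
set E := Loo_norm (fun x => Num.sqrt _); have /Loo_norm_leP h := lexx E.
have s2 : 0 < Num.sqrt (2 : R) by rewrite sqrtr_gt0.
have key (y : R) x : `|y| <= Num.sqrt 2 * Num.sqrt (p x ^+ 2 + q x ^+ 2) ->
    (`|Num.sqrt (p x ^+ 2 + q x ^+ 2)|%:E <= E)%E -> (`|y|%:E <= (Num.sqrt 2)%:E * E)%E.
  move=> yx; rewrite ger0_norm ?sqrtr_ge0// => hE.
  apply: (@le_trans _ _ ((Num.sqrt 2)%:E * (Num.sqrt (p x ^+ 2 + q x ^+ 2))%:E)%E).
    by rewrite -EFinM lee_fin.
  by rewrite lee_pmul2l ?lte_fin.
have sq (y a b : R) : y ^+ 2 <= 2 * (a ^+ 2 + b ^+ 2) -> `|y| <= Num.sqrt 2 * Num.sqrt (a ^+ 2 + b ^+ 2).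
  move=> hy; rewrite -sqrtrM// -sqrtr_sqr ler_wsqrtr//.
split; apply/Loo_norm_leP; apply: ae_imp h => x; apply: key; apply: sq.
- have := sqr_ge0 (p x + q x); rewrite !expr2; linarith.
- have := sqr_ge0 (p x - q x); rewrite !expr2; linarith.
Qed.

End SpeedOfPropagationNorms.

Theorem corollary3p2 (R : realType) (u0 u1 : R -> R)
    (u0W : W1oo_loc u0) (u1L : Loo_loc u1)
    (u0_ge0 : forall x, 0 <= u0 x)
    (u1_ge0 : {ae @lebesgue_measure R, forall x : R, u0 x = 0 -> 0 <= u1 x}) :
  exists u : R * R -> R,
    [/\ conservative_solution u0 u1 u,
        forall v : R * R -> R, conservative_solution u0 u1 v ->
          forall p : R * R, 0 <= p.2 -> v p = u p &
        W1oo u0 -> Loo u1 ->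
          forall (du0 : R -> R) (ux ut : R * R -> R),
          weak_derivative u0 du0 -> weak_gradient u ux ut ->
          {ae @lebesgue_measure R, forall t : R, 0 <= t ->
            [/\ Loo_norm (fun x => ux (x, t) - ut (x, t)) =
                Loo_norm (fun x => du0 x - u1 x),
                Loo_norm (fun x => ux (x, t) + ut (x, t)) =
                Loo_norm (fun x => du0 x + u1 x),
                ((1 / Num.sqrt 2)%:E *
                  Loo_norm (fun x => Num.sqrt (du0 x ^+ 2 + u1 x ^+ 2)) <=
                Loo_norm (fun x => Num.sqrt (ux (x, t) ^+ 2 + ut (x, t) ^+ 2)))%E &
                (Loo_norm (fun x => Num.sqrt (ux (x, t) ^+ 2 + ut (x, t) ^+ 2)) <=
                (Num.sqrt 2)%:E *
                  Loo_norm (fun x => Num.sqrt (du0 x ^+ 2 + u1 x ^+ 2)))%E]}].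
Proof.
have [g [f [lg lf u0E u1E ini]]] := initial_profiles u0W u1L u0_ge0 u1_ge0.
have fg x : f x <= g x by rewrite -subr_ge0 -u0E.
pose V := trade_sol g f; have csV : charsol g f V by exact: trade_sol_charsol.
have lV := geo_lip (cs_geo csV).
have hl := trade_slope_l lg lf fg ini; have hr a := trade_slope_r a lg lf fg ini.
exists (wave V); split.
- exact: wave_conservative (cs_geo csV) hl hr u0E u1E.
- move=> v cv p p0; rewrite -(wave_fold v p0).
  have csU : charsol g f (fold v) by exact: weak_charsol cv.
  by apply: charsol_unique csU csV _; lra.
move=> _ _ du0 ux ut wd gV.
have [cu0 _ _] := u0W; have [_ ldu _] := wd.
have ddu := density_continuousE ldu (fun a b => @weak_derivative_FTC _ u0 du0 a b cu0 wd).
(* Here u0' = g' - f' and u1 = - (g' + f'), so the speeds transported along the characteristics are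
   exactly those of the data. *)
have profile : {ae @lebesgue_measure R, forall x,
    2 * dq g x = du0 x - u1 x /\ - (2 * dq f x) = du0 x + u1 x}.
  have := ae_and ddu (ae_and u1E (ae_and (loclip_derivable lg) (loclip_derivable lf))).
  apply: ae_imp => x [[_ ed] [eu [dg df]]]; rewrite !derive_dq//.
  have E : du0 x = g^`()%classic x - f^`()%classic x.
    have [_ <-] := derive1_sub dg df; rewrite -ed; congr (_^`()%classic x).
    by apply/funext => y; rewrite u0E.
  by rewrite E; split; lra.
have eg : Loo_norm (fun x => 2 * dq g x) = Loo_norm (fun x => du0 x - u1 x).
  by apply: Loo_norm_ae_eq; apply: ae_imp profile => x [-> _].
have ef : Loo_norm (fun x => 2 * dq f x) = Loo_norm (fun x => du0 x + u1 x).
  by apply: Loo_norm_ae_eq; apply: ae_imp profile => x [_ <-]; rewrite normrN.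
apply: ae_imp (wave_speeds lV lg lf hl hr gV) => t h t0.
have e1 : Loo_norm (fun x => ux (x, t) - ut (x, t)) = Loo_norm (fun x => du0 x - u1 x).
  rewrite -eg -(Loo_norm_shift (fun x => 2 * dq g x) (- t)).
  by apply: Loo_norm_ae_eq; apply: ae_imp (h t0) => x [].
have e2 : Loo_norm (fun x => ux (x, t) + ut (x, t)) = Loo_norm (fun x => du0 x + u1 x).
  rewrite -ef -(Loo_norm_shift (fun x => 2 * dq f x) t).
  by apply: Loo_norm_ae_eq; apply: ae_imp (h t0) => x [].
have [k1 k2] := speeds_le_gradient du0 u1.
have [k3 k4] := speeds_le_gradient (fun x => ux (x, t)) (fun x => ut (x, t)).
have s2 : 0 < Num.sqrt (2 : R) by rewrite sqrtr_gt0.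
split => //; last by apply: gradient_norm_le; rewrite ?e1 ?e2.
(* The lower bound is the upper bound with time t and time 0 exchanged, the norms of both speeds
   being equal at the two times. *)
have : (Loo_norm (fun x => Num.sqrt (du0 x ^+ 2 + u1 x ^+ 2)) <= (Num.sqrt 2)%:E *
    Loo_norm (fun x => Num.sqrt (ux (x, t) ^+ 2 + ut (x, t) ^+ 2)))%E.
  by apply: gradient_norm_le; rewrite -?e1 -?e2.
rewrite -lee_pdivrMl// div1r; exact.
Qed.
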